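(* Let $M$ be an 8-manifold and consider, for Cayley forms $\Phi$ and 3-forms $C$ on $M$, the action $$S_{\kappa=0}[\Phi,C]=\int_M \Phi\wedge\left(dC-6\,C\wedge_\Phi C\right)+\frac{\lambda}{6}v_\Phi+\text{constr.},\qquad\lambda\in\mathbb{R},$$ where ''constr.'' denotes terms, depending only on $\Phi$ and Lagrange multipliers, that impose that $\Phi$ is a Cayley form. An alternative way of writing the Euler-Lagrange equations resulting from extremisation of $S_{\kappa=0}[\Phi,C]$ with respect to $\Phi$ (with $C$ equal to the torsion 3-form $T$ of $\Phi$, which is the Euler-Lagrange equation for $C$) is to project them on the $\Lambda^4_{1+7+35}$ component of $\Lambda^4$. This gives the set of equations $$\frac14\Phi_b{}^{pqr}\nabla_aT_{pqr}-\frac34\Phi_b{}^{pqr}\nabla_rT_{apq}-\frac32\Phi_b{}^{pqr}T_{ap}{}^{s}T_{qrs}-\frac34\Phi^{pqrs}T_{apq}T_{brs}+\frac12g_{ab}\left(\lambda+\frac38\Phi^{pqrs}T_{pq}{}^{t}T_{rst}\right)=0 .$$ The equations are written in terms of $\nabla$, but they have the same form with $\nabla$ replaced by the partial derivative operator $\partial$. The left-hand side is not automatically symmetric in $ab$, and the antisymmetric part of these equations is non-trivial. The antisymmetric part lies in $\Lambda^2_7$, and so the total number of independent second-order differential equations is $36+7=43$, the dimension of the space of Cayley forms (at a point).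
   Context: A Cayley form ($\mathrm{Spin}(7)$-structure) on an 8-manifold $M$ is a 4-form $\Phi$ which at each point lies in a fixed $\mathrm{GL}(8,\mathbb{R})$-orbit of 4-forms with stabiliser $\mathrm{Spin}(7)$. It determines a Riemannian metric $g$ and an orientation. The conventions are fixed by the identity (all contractions and index raisings with $g$) $$\Phi_{ijkp}\Phi_{abc}{}^{p}= g_{ia}g_{jb}g_{kc}+g_{ib}g_{jc}g_{ka}+g_{ic}g_{ja}g_{kb}-g_{ia}g_{jc}g_{kb}-g_{ic}g_{jb}g_{ka}-g_{ib}g_{ja}g_{kc}$$ $$-g_{ia}\Phi_{jkbc}-g_{ja}\Phi_{kibc}-g_{ka}\Phi_{ijbc}-g_{ib}\Phi_{jkca}-g_{jb}\Phi_{kica}-g_{kb}\Phi_{ijca}-g_{ic}\Phi_{jkab}-g_{jc}\Phi_{kiab}-g_{kc}\Phi_{ijab},$$ and $\Phi$ is self-dual: $\frac1{4!}\epsilon_{ijkl}{}^{abcd}\Phi_{abcd}=\Phi_{ijkl}$, with $\epsilon$ the volume form of $g$. Square brackets denote antisymmetrisation with weight one; indices between vertical bars are excluded from it. $k$-forms have components $\omega=\frac1{k!}\omega_{a_1\dots a_k}dx^{a_1}\wedge\dots\wedge dx^{a_k}$. $C\wedge_\Phi C$ is the 4-form with components $(C\wedge_\Phi C)_{abcd}=C_{[ab|p|}C_{cd]q}g^{pq}$, and $v_\Phi=\frac1{14}\Phi\wedge\Phi$ is the volume form of $g$. $\nabla$ is the Levi-Civita connection of $g$, and the torsion 3-form $T$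 of $\Phi$ is the 3-form with $\nabla_i\Phi_{abcd}=4\,T_{i[a}{}^{p}\Phi_{|p|bcd]}$. $\Lambda^2_7\subset\Lambda^2$ is the eigenspace with eigenvalue $-3$ of $J_2(\beta)_{ij}=\frac12\Phi_{ij}{}^{ab}\beta_{ab}$. The irreducible components $\Lambda^4_1,\Lambda^4_7,\Lambda^4_{35},\Lambda^4_{27}$ of $\Lambda^4$ are the eigenspaces of $J_4(\sigma)_{ijkl}=3\Phi_{[ij}{}^{pq}\sigma_{kl]pq}$ with eigenvalues $-12,-6,0,2$ respectively, and $\Lambda^4_{1+7+35}=\Lambda^4_1\oplus\Lambda^4_7\oplus\Lambda^4_{35}$. Because of the constraint terms, extremisation with respect to $\Phi$ requires the variation of the remaining terms with respect to $\Phi$ to vanish only up to an arbitrary element of $\Lambda^4_{27}$; projecting on $\Lambda^4_{1+7+35}$ removes this arbitrary element.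
   Formalization: The constant λ in the last term of the field equations is corrected to λ/2: varying (λ/6)v_Φ with v_Φ = Φ∧Φ/14 contributes (λ/4)g_ab, and the printed equation fails for Φ = f⁴Φ₀, f = 1/(1+b|x|²), with λ = 112b. *)

(* Defs.v *)
From HB Require Import structures.
From mathcomp Require Import all_boot all_order all_algebra all_fingroup.
From mathcomp Require Import all_classical all_reals all_analysis.

Set Implicit Arguments.
Unset Strict Implicit.
Unset Printing Implicit Defensive.

Import Order.TTheory GRing.Theory Num.Theory.
Import numFieldNormedType.Exports.

Local Open Scope classical_set_scope.
Local Open Scope ring_scope.

(* Tensors on R^8 are given by all their components, without any 1/k! factor:
   a k-form is (1/k!) w_{a_1...a_k} dx^{a_1} /\ ... /\ dx^{a_k}. *)
Notation pt R := 'rV[R]_8.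
Definition T3 (R : Type) := 'I_8 -> 'I_8 -> 'I_8 -> R.
Definition T4 (R : Type) := 'I_8 -> 'I_8 -> 'I_8 -> 'I_8 -> R.

Section Calculus.
Variable R : realType.

(* All iterated directional derivatives up to order k exist and are continuous
   on U; on a finite-dimensional V and for open U this is the class C^k. *)
Fixpoint Ck (V : normedModType R) (k : nat) (U : set V) (f : V -> R) : Prop :=
  (forall x, U x -> {for x, continuous f}) /\
  match k with
  | 0%N => True
  | j.+1 => forall v : V, (forall x, U x -> derivable f x v) /\
                          Ck j U (fun x => 'D_v f x)
  end.

Definition smooth (V : normedModType R) (U : set V) (f : V -> R) : Prop :=
  forall k, Ck k U f.

Definition partial (i : 'I_8) (f : pt R -> R) (x : pt R) : R :=
  'D_(delta_mx 0 i) f x.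

(* Iterated Lebesgue integral over R^n; it is only used for continuous
   functions with compact support. *)
Fixpoint integral_rV (n : nat) : ('rV[R]_n -> R) -> R :=
  match n with
  | 0%N => fun f => f 0
  | m.+1 => fun f =>
      \int[@lebesgue_measure R]_(t in setT)
        integral_rV (fun y : 'rV[R]_m => f (row_mx (t%:M : 'rV[R]_1) y))
  end.

Definition smooth3 (U : set (pt R)) (w : pt R -> T3 R) : Prop :=
  forall a b c, smooth U (fun x => w x a b c).

Definition smooth4 (U : set (pt R)) (w : pt R -> T4 R) : Prop :=
  forall a b c d, smooth U (fun x => w x a b c d).

End Calculus.

Section PointwiseAlgebra.
Variable R : realType.
Implicit Types (g A N : 'M[R]_8) (u v : T4 R) (w : T3 R).

Definition alternating3 w : Prop :=
  forall a b c, w b a c = - w a b c /\ w a c b = - w a b c.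

Definition alternating4 u : Prop :=
  forall a b c d, [/\ u b a c d = - u a b c d,
                      u a c b d = - u a b c d
                    & u a b d c = - u a b c d].

(* u_[abcd], antisymmetrisation with weight one *)
Definition alt4 u : T4 R := fun a b c d =>
  (4`!%:R)^-1 * \sum_(s : 'S_4) (-1) ^+ s *
     (let i k := tnth [tuple a; b; c; d] (s k) in u (i 0) (i 1) (i 2) (i 3)).

(* coefficient of dx^0 /\ ... /\ dx^7 in u /\ v *)
Definition wedge44 u v : R :=
  (4`!%:R * 4`!%:R)^-1 * \sum_(s : 'S_8) (-1) ^+ s *
     (u (s 0) (s 1) (s 2) (s 3) * v (s 4) (s 5) (s 6) (s 7)).

(* components of dx^i /\ dx^j /\ dx^k /\ dx^l *)
Definition dx4 (i j k l : 'I_8) : T4 R := fun a b c d =>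
  4`!%:R * alt4 (fun a' b' c' d' =>
     ([:: a'; b'; c'; d'] == [:: i; j; k; l])%:R) a b c d.

(* The model Cayley form of R^8.  The overall sign is the one for which
   the quadratic identity satisfied by Phi with g = delta reads
   Phi_{ijkp} Phi_{abcp} = delta_ia delta_jb delta_kc + ...
                           - delta_ia Phi_{jkbc} - ...,
   equivalently for which the 7-dimensional eigenspace of J_2 on 2-forms
   (defined below) has eigenvalue -3. It is self-dual for the standard
   orientation. *)
Definition Phi0 : T4 R := fun a b c d =>
  - dx4 0 1 2 3 a b c d - dx4 0 1 4 5 a b c d
  - dx4 0 1 6 7 a b c d - dx4 0 2 4 6 a b c d
  + dx4 0 2 5 7 a b c d + dx4 0 3 4 7 a b c d
  + dx4 0 3 5 6 a b c d + dx4 1 2 4 7 a b c d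
  + dx4 1 2 5 6 a b c d + dx4 1 3 4 6 a b c d
  - dx4 1 3 5 7 a b c d - dx4 2 3 4 5 a b c d
  - dx4 2 3 6 7 a b c d - dx4 4 5 6 7 a b c d.

Definition pull3 A w : T3 R := fun a b c =>
  \sum_p \sum_q \sum_r A p a * A q b * A r c * w p q r.

Definition pull4 A u : T4 R := fun a b c d =>
  \sum_p \sum_q \sum_r \sum_s A p a * A q b * A r c * A s d * u p q r s.

(* the orbit GL(8,R) . Phi0 *)
Definition cayley u : Prop := exists2 A, A \in unitmx & u = pull4 A Phi0.

(* The metric of A^* Phi0 is A^* delta; it does not depend on the choice of A,
   since the stabiliser Spin(7) of Phi0 lies in SO(8). *)
Definition metric u : 'M[R]_8 :=
  xget 0 [set g | exists A, [/\ A \in unitmx, u = pull4 A Phi0 & g = A^T *m A]].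

Definition ginv u : 'M[R]_8 := invmx (metric u).

(* component of v_Phi = Phi /\ Phi / 14 along dx^0 /\ ... /\ dx^7; its sign
   compares the orientation defined by Phi with that of the coordinates *)
Definition vol u : R := wedge44 u u / 14.
Definition orient u : R := Num.sg (vol u).

(* In the next definitions u is a Cayley form, and indices are raised with its
   metric. *)

(* u_{ab}^{pq}, u_b^{pqr} and u^{pqrs} *)
Definition up2 u : T4 R := fun a b p q =>
  \sum_k \sum_l ginv u p k * ginv u q l * u a b k l.
Definition up3 u : T4 R := fun b p q r =>
  \sum_k \sum_l \sum_m ginv u p k * ginv u q l * ginv u r m * u b k l m.
Definition up4 u : T4 R := fun p q r s =>
  \sum_k \sum_l \sum_m \sum_n
     ginv u p k * ginv u q l * ginv u r m * ginv u s n * u k l m n.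

(* w_{ab}^s *)
Definition up_last u w : T3 R := fun a b s => \sum_t w a b t * ginv u t s.

(* (w /\_u w)_{abcd} = w_{[ab|p|} w_{cd]q} g^{pq} *)
Definition wedge_Phi u w : T4 R :=
  alt4 (fun a b c d => \sum_p \sum_q w a b p * w c d q * ginv u p q).

Definition J2 u N : 'M[R]_8 :=
  \matrix_(i, j) (2^-1 * \sum_a \sum_b up2 u i j a b * N a b).

Definition Lambda2_7 u N : Prop := N^T = - N /\ J2 u N = (- 3) *: N.

Definition J4 u v : T4 R := fun i j k l =>
  3 * alt4 (fun i' j' k' l' => \sum_p \sum_q up2 u i' j' p q * v k' l' p q)
        i j k l.

Definition J4_eigen (c : R) u v : Prop :=
  alternating4 v /\ forall i j k l, J4 u v i j k l = c * v i j k l.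

Definition Lambda4_1 := J4_eigen (- 12).
Definition Lambda4_7 := J4_eigen (- 6).
Definition Lambda4_35 := J4_eigen 0.
Definition Lambda4_27 := J4_eigen 2.

Definition Lambda4_1_7_35 u v : Prop :=
  exists v1 v7 v35,
    [/\ Lambda4_1 u v1, Lambda4_7 u v7, Lambda4_35 u v35
      & v = fun a b c d => v1 a b c d + v7 a b c d + v35 a b c d].

(* v' is the component of v along Lambda^4_{1+7+35} in
   Lambda^4 = Lambda^4_{1+7+35} (+) Lambda^4_27 *)
Definition proj_1_7_35 u v v' : Prop :=
  Lambda4_1_7_35 u v' /\
  Lambda4_27 u (fun a b c d => v a b c d - v' a b c d).

(* Left-hand side of the field equations for the Cayley form u, the 3-form w
   and the constant L; dw stands for the derivatives nabla_a w_{pqr}.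
   A term (lam/6) v_Phi in the action enters with L = lam/2: its variation is
   (lam/42) dPhi /\ Phi, that is, it acts as if (lam/42) Phi were added to dC,
   and the derivative terms below are 1/4 Phi_b^{pqr} (dC)_{apqr}, where
   1/4 Phi_b^{pqr} (lam/42) Phi_{apqr} = (lam/4) g_{ab}. *)
Definition field_eq (L : R) u w (dw : 'I_8 -> T3 R) : 'M[R]_8 :=
  \matrix_(a, b)
   (  4^-1 * (\sum_p \sum_q \sum_r up3 u b p q r * dw a p q r)
    - 3 / 4 * (\sum_p \sum_q \sum_r up3 u b p q r * dw r a p q)
    - 3 / 2 * (\sum_p \sum_q \sum_r \sum_s
                  up3 u b p q r * up_last u w a p s * w q r s)
    - 3 / 4 * (\sum_p \sum_q \sum_r \sum_s
                  up4 u p q r s * w a p q * w b r s)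
    + 2^-1 * metric u a b *
        (L + 3 / 8 * \sum_p \sum_q \sum_r \sum_s \sum_t
                        up4 u p q r s * up_last u w p q t * w r s t)).

Definition asym_part N : 'M[R]_8 := 2^-1 *: (N - N^T).

Definition tensor4 u : {ffun 'I_8 * 'I_8 * 'I_8 * 'I_8 -> R^o} :=
  [ffun i => u i.1.1.1 i.1.1.2 i.1.2 i.2].

(* velocities at u of smooth curves of Cayley forms *)
Definition cayley_velocity u v : Prop :=
  exists e : R, exists gam : R -> T4 R,
    [/\ 0 < e, gam 0 = u, (forall t, `|t| < e -> cayley (gam t)),
        (forall a b c d,
           smooth [set t : R^o | `|t| < e] (fun t => gam t a b c d))
      & forall a b c d, 'D_(1 : R^o) (fun t : R^o => gam t a b c d) 0 = v a b c d].

End PointwiseAlgebra.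

Section LocalGeometry.
Variable R : realType.
Implicit Types (U : set (pt R)) (Phi E : pt R -> T4 R) (C T : pt R -> T3 R).

Definition christoffel Phi (x : pt R) (k i j : 'I_8) : R :=
  2^-1 * \sum_l ginv (Phi x) k l *
    (partial i (fun y => metric (Phi y) j l) x
     + partial j (fun y => metric (Phi y) i l) x
     - partial l (fun y => metric (Phi y) i j) x).

Definition nabla3 Phi C (x : pt R) (i : 'I_8) : T3 R := fun a b c =>
  partial i (fun y => C y a b c) x
  - \sum_m (christoffel Phi x m i a * C x m b c
            + christoffel Phi x m i b * C x a m c
            + christoffel Phi x m i c * C x a b m).

Definition nabla_Phi Phi (x : pt R) (i : 'I_8) : T4 R := fun a b c d =>
  partial i (fun y => Phi y a b c d) x
  - \sum_m (christoffel Phi x m i a * Phi x m b c d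
            + christoffel Phi x m i b * Phi x a m c d
            + christoffel Phi x m i c * Phi x a b m d
            + christoffel Phi x m i d * Phi x a b c m).

Definition partial3 C (x : pt R) (i : 'I_8) : T3 R := fun a b c =>
  partial i (fun y => C y a b c) x.

Definition ext_d C (x : pt R) : T4 R := fun a b c d =>
  partial a (fun y => C y b c d) x - partial b (fun y => C y a c d) x
  + partial c (fun y => C y a b d) x - partial d (fun y => C y a b c) x.

Definition form3_on U C : Prop :=
  smooth3 U C /\ forall x, U x -> alternating3 (C x).

Definition form4_on U E : Prop :=
  smooth4 U E /\ forall x, U x -> alternating4 (E x).

Definition cayley_on U Phi : Prop :=
  smooth4 U Phi /\ forall x, U x -> cayley (Phi x).

(* nabla_i Phi_{abcd} = 4 T_{i[a}^p Phi_{|p|bcd]} *)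
Definition torsion_on U Phi T : Prop :=
  form3_on U T /\
  forall x, U x -> forall i a b c d,
    nabla_Phi Phi x i a b c d =
    4 * alt4 (fun a' b' c' d' =>
          \sum_p up_last (Phi x) (T x) i a' p * Phi x p b' c' d') a b c d.

(* component of Phi /\ (dC - 6 C /\_Phi C) + lam/6 v_Phi, with respect to the
   coordinate volume form taken with the orientation of Phi *)
Definition lagrangian (lam : R) Phi C (x : pt R) : R :=
  orient (Phi x) *
  (wedge44 (Phi x) (fun a b c d =>
      ext_d C x a b c d - 6 * wedge_Phi (Phi x) (C x) a b c d)
   + lam / 6 * vol (Phi x)).

(* The action of (Phi', C') minus that of (Phi, C), for fields which agree
   outside the compact set K. *)
Definition action_diff (lam : R) (K : set (pt R)) Phi' C' Phi C : R :=
  integral_rV (fun x : pt R =>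
    \1_K x * (lagrangian lam Phi' C' x - lagrangian lam Phi C x)).

(* Smooth one-parameter families through Phi (resp. C), |t| < e, that are
   constant outside the compact subset K of U.  Restricting to Cayley forms
   implements the constraint terms of the action. *)
Definition Phi_variation U Phi (e : R) (K : set (pt R)) (h : R -> pt R -> T4 R)
    : Prop :=
  [/\ 0 < e /\ (compact K /\ K `<=` U),
      (forall x, h 0 x = Phi x),
      (forall t x, ~ K x -> h t x = Phi x),
      (forall t x, `|t| < e -> U x -> cayley (h t x))
    & forall a b c d,
        smooth [set z : (R^o * pt R)%type | `|z.1| < e /\ U z.2]
               (fun z => h z.1 z.2 a b c d)].

Definition C_variation U C (e : R) (K : set (pt R)) (h : R -> pt R -> T3 R)
    : Prop :=
  [/\ 0 < e /\ (compact K /\ K `<=` U),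
      (forall x, h 0 x = C x),
      (forall t x, ~ K x -> h t x = C x),
      (forall t x, `|t| < e -> U x -> alternating3 (h t x))
    & forall a b c,
        smooth [set z : (R^o * pt R)%type | `|z.1| < e /\ U z.2]
               (fun z => h z.1 z.2 a b c)].

Definition extremal_Phi (lam : R) U Phi C : Prop :=
  forall e K h, Phi_variation U Phi e K h ->
    is_derive (0 : R^o) (1 : R^o)
      (fun t : R^o => action_diff lam K (h t) C Phi C : R^o) 0.

Definition extremal_C (lam : R) U Phi C : Prop :=
  forall e K h, C_variation U C e K h ->
    is_derive (0 : R^o) (1 : R^o)
      (fun t : R^o => action_diff lam K Phi (h t) Phi C : R^o) 0.

(* E is the variation with respect to Phi of the terms of the action other than
   the constraint terms: delta S = int delta Phi /\ E.  These terms are defined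
   on Cayley forms only, so E is determined up to sections of Lambda^4_27. *)
Definition variation_Phi (lam : R) U Phi C E : Prop :=
  form4_on U E /\
  forall e K h, Phi_variation U Phi e K h ->
    is_derive (0 : R^o) (1 : R^o)
      (fun t : R^o => action_diff lam K (h t) C Phi C : R^o)
      (integral_rV (fun x : pt R =>
         \1_K x * (orient (Phi x) * wedge44
           (fun a b c d => 'D_(1 : R^o) (fun t : R^o => h t x a b c d) 0)
           (E x)))).

(* a Cayley form with its torsion on a neighbourhood W of x inside U *)
Definition cayley_germ U (x : pt R) (W : set (pt R)) Phi T : Prop :=
  [/\ open W, W x, W `<=` U, cayley_on W Phi & torsion_on W Phi T].

Definition same_1jet (x : pt R) Phi' Phi : Prop :=
  forall a b c d, Phi' x a b c d = Phi x a b c d /\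
    forall i, partial i (fun y => Phi' y a b c d) x =
              partial i (fun y => Phi y a b c d) x.

(* left-hand side of the field equations at x, with the covariant derivative
   and with the partial derivatives *)
Definition field_eq_nabla (L : R) Phi T (x : pt R) : 'M[R]_8 :=
  field_eq L (Phi x) (T x) (nabla3 Phi T x).

Definition field_eq_partial (L : R) Phi T (x : pt R) : 'M[R]_8 :=
  field_eq L (Phi x) (T x) (partial3 T x).

End LocalGeometry.

(* A smooth 8-manifold: a Hausdorff, second countable space with an atlas.
   The inverse of chart i is unchart i, only meaningful on the image of the
   domain of chart i. *)
Record manifold8 (R : realType) := Manifold8 {
  carrier :> topologicalType;
  carrier_hausdorff : hausdorff_space carrier;
  carrier_second_countable : @second_countable carrier;
  atlas : Type;
  dom : atlas -> set carrier;
  chart : atlas -> carrier -> pt R;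
  unchart : atlas -> pt R -> carrier;
  dom_open : forall i, open (dom i);
  dom_cover : forall p, exists i, dom i p;
  img_open : forall i, open (chart i @` dom i);
  chartK : forall i p, dom i p -> unchart i (chart i p) = p;
  chart_continuous : forall i p, dom i p -> {for p, continuous (chart i)};
  unchart_continuous : forall i x,
    (chart i @` dom i) x -> {for x, continuous (unchart i)};
  transition_smooth : forall i j k,
    smooth [set x | (chart i @` dom i) x /\ dom j (unchart i x)]
           (fun x => chart j (unchart i x) 0 k)
}.

Section ManifoldForms.
Variables (R : realType) (M : manifold8 R).

Definition img (i : atlas M) : set (pt R) := chart i @` dom i.

(* domain, in chart i, of the change of coordinates from chart i to chart j *)
Definition overlap (i j : atlas M) : set (pt R) :=
  [set x | img i x /\ dom j (unchart i x)].

Definition transition (i j : atlas M) (x : pt R) : pt R :=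
  chart j (unchart i x).

Definition transition_jac (i j : atlas M) (x : pt R) : 'M[R]_8 :=
  \matrix_(p, a) partial a (fun y => transition i j y 0 p) x.

Definition form3 (C : atlas M -> pt R -> T3 R) : Prop :=
  (forall i, form3_on (img i) (C i)) /\
  forall i j x, overlap i j x ->
    C i x = pull3 (transition_jac i j x) (C j (transition i j x)).

Definition form4 (E : atlas M -> pt R -> T4 R) : Prop :=
  (forall i, form4_on (img i) (E i)) /\
  forall i j x, overlap i j x ->
    E i x = pull4 (transition_jac i j x) (E j (transition i j x)).

Definition cayley_form (Phi : atlas M -> pt R -> T4 R) : Prop :=
  form4 Phi /\ forall i, cayley_on (img i) (Phi i).

Definition torsion_form (Phi : atlas M -> pt R -> T4 R)
    (T : atlas M -> pt R -> T3 R) : Prop :=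
  form3 T /\ forall i, torsion_on (img i) (Phi i) (T i).

End ManifoldForms.

(* Main.v *)
From HB Require Import structures.
Require Import Defs.
From mathcomp Require Import all_boot all_order all_algebra all_fingroup.
From mathcomp Require Import all_classical all_reals all_analysis.
From mathcomp Require Import ring lra zify.


(* Every pointwise statement is GL(8)-equivariant, so it is proved for the model
   form Phi0 and transported along a frame A with Phi = A^* Phi0.  At Phi0 all of
   them follow from the contraction identity Phi_{ijkp} Phi_{abcp} = ... and from
   the action N |-> N.Phi of matrices on 4-forms: Lambda^4_27 is the kernel of
   E |-> Phi_b^{pqr} E_{apqr}, equivalently the annihilator of all N.Phi for the
   wedge pairing, and N.Phi = 0 exactly when N lies in spin(7), which gives the
   36 + 7 tangent directions and the unique torsion 3-form.

   Variations of Phi have velocities N.Phi, so by the fundamental lemma of the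
   calculus of variations extremality in Phi means that the variation E is
   pointwise in Lambda^4_27.  The derivative of the metric entering C /\_Phi C is
   absorbed into a matrix acting on Phi ([correction]), and contracting the
   resulting 4-form with Phi yields the field equations.  Extremality in C is,
   after integration by parts, the linear equation characterising the torsion.

   For the independence of the equations, replace Phi by (1 + q m)^* Phi, where q
   is half the squared distance of the metric at x.  This keeps the 1-jet at x and
   changes the equations there by an arbitrary element of S^2 + Lambda^2_7 when m
   varies, since the second derivatives of q form the metric. *)

Set Implicit Arguments.
Unset Strict Implicit.
Unset Printing Implicit Defensive.

Import Order.TTheory GRing.Theory Num.Theory.
Import numFieldNormedType.Exports.

Local Open Scope ring_scope.

(** [metric] picks some frame of the form, and a smooth family of Cayley forms is not given with a
    smooth family of frames; so neither the independence of the frame nor the smoothness of the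
    metric is visible. Both come from an explicit formula: wedging two double contractions of the
    form with the form itself, and dividing by the volume, yields the 2 x 2 minors of the metric up
    to a multiple of the form, and positive definiteness lets its entries be extracted from these
    minors with one square root. For the same reason velocities are found by differentiating the
    twofold contraction identity, which involves only the form and its metric, and the torsion is
    given by a formula without frames. Self-duality turns the wedge pairing with the model form into
    a sum over components, so that the pointwise constants come from contractions of two copies of
    it. The integral is evaluated on uniformly continuous functions that vanish outside a box, for
    which linearity, bounds and differentiation under the sign are inductions on the dimension. *)

Notation I8 := 'I_8.

(** * Alternating tensors and the model form *)

Section Perms.

(** Splits a permutation into the image of the first point and a permutation of the others.
    Repeated, it expands sums over ['S_4] and evaluates sums over ['S_8] whose terms depend on four
    values only. *)
Lemma sum_lift_perm (V : nmodType) n (F : 'S_n.+1 -> V) :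
  \sum_s F s = \sum_(i < n.+1) \sum_(s : 'S_n) F (lift_perm ord0 i s).
Proof.
rewrite pair_bigA /=.
rewrite (reindex (fun p : 'I_n.+1 * 'S_n => lift_perm ord0 p.1 p.2)) //.
apply/onW_bij/inj_card_bij.
  move=> [i s] [j t] /= e.
  have := congr1 (fun u : 'S_n.+1 => u ord0) e.
  rewrite !lift_perm_id => eij; subst j.
  congr pair; apply/permP => k.
  have := congr1 (fun u : 'S_n.+1 => u (lift ord0 k)) e.
  by rewrite !lift_perm_lift => /lift_inj.
by rewrite card_prod card_ord !card_Sn factS.
Qed.

End Perms.

Section Alt4.
Variable R : realType.
Implicit Types (u v : T4 R).

(** [F] takes natural numbers, so that the iterated [lift] become [bump] expressions that evaluate
    to the 24 explicit terms. *)
Lemma sum_S4 (F : nat -> nat -> nat -> nat -> R) :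
  \sum_(s : 'S_4) (-1) ^+ s * F (s 0) (s 1) (s 2) (s 3) =
   F 0 1 2 3 - F 0 1 3 2 - F 0 2 1 3 + F 0 2 3 1 + F 0 3 1 2 - F 0 3 2 1
 - F 1 0 2 3 + F 1 0 3 2 + F 1 2 0 3 - F 1 2 3 0 - F 1 3 0 2 + F 1 3 2 0
 + F 2 0 1 3 - F 2 0 3 1 - F 2 1 0 3 + F 2 1 3 0 + F 2 3 0 1 - F 2 3 1 0
 - F 3 0 1 2 + F 3 0 2 1 + F 3 1 0 2 - F 3 1 2 0 - F 3 2 0 1 + F 3 2 1 0.
Proof.
have e1 : (1 : 'I_4) = lift ord0 ord0 by apply: val_inj.
have e2 : (2 : 'I_4) = lift ord0 (lift ord0 ord0) by apply: val_inj.
have e3 : (3 : 'I_4) = lift ord0 (lift ord0 (lift ord0 ord0)) by apply: val_inj.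
have e0 : (0 : 'I_4) = ord0 by apply: val_inj.
rewrite e3 e2 e1 e0.
transitivity (\sum_(i < 4) \sum_(j < 3) \sum_(k < 2) (-1) ^+ (i + j + k) *
  F i (bump i j) (bump i (bump j k)) (bump i (bump j (bump k 0)))).
  rewrite sum_lift_perm; apply: eq_bigr => i _.
  rewrite sum_lift_perm; apply: eq_bigr => j _.
  rewrite sum_lift_perm; apply: eq_bigr => k _.
  rewrite sum_lift_perm big_ord1.
  rewrite (eq_bigr (fun=> (-1) ^+ (i + j + k) *
    F i (bump i j) (bump i (bump j k)) (bump i (bump j (bump k 0))))); last first.
    move=> s _; rewrite !(lift_perm_id, lift_perm_lift) /=.
    rewrite !odd_lift_perm /=.
    congr (_ * _).
    have -> : s = 1%g by apply/permP => -[].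
    rewrite odd_perm1 addbF -[RHS]signr_odd !oddD.
    by case: (odd i); case: (odd j); case: (odd k).
  by rewrite big_const card_Sn /= addr0.
rewrite !big_ord_recl !big_ord0 /= /bump /= !addr0 !add0n.
rewrite !exprS expr0 /=.
ring.
Qed.

Lemma alt4E u a b c d : alt4 u a b c d = 24^-1 *
    (u a b c d - u a b d c - u a c b d + u a c d b + u a d b c - u a d c b
     - u b a c d + u b a d c + u b c a d - u b c d a - u b d a c + u b d c
     a + u c a b d - u c a d b - u c b a d + u c b d a + u c d a b - u c d
     b a - u d a b c + u d a c b + u d b a c - u d b c a - u d c a b + u d
     c b a).
Proof.
rewrite /alt4; congr (_ * _).
under eq_bigr => s _ do rewrite !(tnth_nth a).
exact: (sum_S4 (fun i j k l => u (nth a [:: a; b; c; d] i)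
   (nth a [:: a; b; c; d] j) (nth a [:: a; b; c; d] k)
   (nth a [:: a; b; c; d] l))).
Qed.

(** The 23 nontrivial reorderings in one rewrite rule, anchored at the order [a b c d] chosen by the
    caller. *)
Lemma alternating4_perm u (hu : alternating4 u) a b c d :
  (u a b d c = - u a b c d) * (u a c b d = - u a b c d) * (u a c d b = u a b
   c d) * (u a d b c = u a b c d) * (u a d c b = - u a b c d) * (u b a c d =
   - u a b c d) * (u b a d c = u a b c d) * (u b c a d = u a b c d) * (u b c
   d a = - u a b c d) * (u b d a c = - u a b c d) * (u b d c a = u a b c d) *
   (u c a b d = u a b c d) * (u c a d b = - u a b c d) * (u c b a d = - u a b
   c d) * (u c b d a = u a b c d) * (u c d a b = u a b c d) * (u c d b a = -
   u a b c d) * (u d a b c = - u a b c d) * (u d a c b = u a b c d) * (u d b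
   a c = u a b c d) * (u d b c a = - u a b c d) * (u d c a b = - u a b c d) *
   (u d c b a = u a b c d).
Proof.
have h1 x y z t : u y x z t = - u x y z t by case: (hu x y z t).
have h2 x y z t : u x z y t = - u x y z t by case: (hu x y z t).
have h3 x y z t : u x y t z = - u x y z t by case: (hu x y z t).
have e1 : u a c b d = - u a b c d := h2 a b c d.
have e2 : u b a c d = - u a b c d := h1 a b c d.
have e3 : u a b d c = - u a b c d := h3 a b c d.
have f1 : u c a b d = u a b c d by rewrite h1 e1 opprK.
have f2 : u b c a d = u a b c d by rewrite h2 e2 opprK.
have f3 : u c b a d = - u a b c d by rewrite h1 f2.
have g0 : u a d b c = u a b c d by rewrite h2 e3 opprK.
have g1 : u a c d b = u a b c d by rewrite h3 e1 opprK.
have g2 : u a d c b = - u a b c d by rewrite h2 g1.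
have k1 : u b a d c = u a b c d by rewrite h1 e3 opprK.
have k2 : u b d a c = - u a b c d by rewrite h2 k1.
have k3 : u d b a c = u a b c d by rewrite h1 k2 opprK.
have k4 : u d a b c = - u a b c d by rewrite h1 g0.
have k5 : u b c d a = - u a b c d by rewrite h3 f2.
have k6 : u b d c a = u a b c d by rewrite h2 k5 opprK.
have k7 : u d b c a = - u a b c d by rewrite h1 k6.
have k8 : u c b d a = u a b c d by rewrite h1 k5 opprK.
have k9 : u c d b a = - u a b c d by rewrite h2 k8.
have l1 : u d c b a = u a b c d by rewrite h1 k9 opprK.
have l2 : u c a d b = - u a b c d by rewrite h3 f1.
have l3 : u c d a b = u a b c d by rewrite h2 l2 opprK.
have l4 : u d c a b = - u a b c d by rewrite h1 l3.
have l5 : u d a c b = u a b c d by rewrite h2 l4 opprK.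
by do !split.
Qed.

Lemma alt4_alternating u : alternating4 (alt4 u).
Proof. by move=> a b c d; split; rewrite !alt4E; ring. Qed.

Lemma alt4_id u : alternating4 u -> forall a b c d, alt4 u a b c d = u a b c d.
Proof. by move=> hu a b c d; rewrite alt4E !(alternating4_perm hu a b c d); field. Qed.

Lemma eq_alt4 u v : (forall a b c d, u a b c d = v a b c d) ->
  forall a b c d, alt4 u a b c d = alt4 v a b c d.
Proof. by move=> e a b c d; rewrite !alt4E !e. Qed.

End Alt4.

(** * Integer components of the model form *)

Section ModelForm.

(** Integer components of a coordinate 4-form, indexed by natural numbers, so that identities for
    [Phi0] can be decided by computation. *)
Definition dx_int (I : seq nat) (a b c d : nat) : int :=
   (I == [:: a; b; c; d])%:Z - (I == [:: a; b; d; c])%:Z - (I == [:: a; c; b;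
   d])%:Z + (I == [:: a; c; d; b])%:Z + (I == [:: a; d; b; c])%:Z - (I == [::
   a; d; c; b])%:Z - (I == [:: b; a; c; d])%:Z + (I == [:: b; a; d; c])%:Z +
   (I == [:: b; c; a; d])%:Z - (I == [:: b; c; d; a])%:Z - (I == [:: b; d; a;
   c])%:Z + (I == [:: b; d; c; a])%:Z + (I == [:: c; a; b; d])%:Z - (I == [::
   c; a; d; b])%:Z - (I == [:: c; b; a; d])%:Z + (I == [:: c; b; d; a])%:Z +
   (I == [:: c; d; a; b])%:Z - (I == [:: c; d; b; a])%:Z - (I == [:: d; a; b;
   c])%:Z + (I == [:: d; a; c; b])%:Z + (I == [:: d; b; a; c])%:Z - (I == [::
   d; b; c; a])%:Z - (I == [:: d; c; a; b])%:Z + (I == [:: d; c; b; a])%:Z.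

Definition phi_int (a b c d : nat) : int :=
   - dx_int [:: 0; 1; 2; 3] a b c d - dx_int [:: 0; 1; 4; 5] a b c d - dx_int
   [:: 0; 1; 6; 7] a b c d - dx_int [:: 0; 2; 4; 6] a b c d + dx_int [:: 0;
   2; 5; 7] a b c d + dx_int [:: 0; 3; 4; 7] a b c d + dx_int [:: 0; 3; 5; 6]
   a b c d + dx_int [:: 1; 2; 4; 7] a b c d + dx_int [:: 1; 2; 5; 6] a b c d
   + dx_int [:: 1; 3; 4; 6] a b c d - dx_int [:: 1; 3; 5; 7] a b c d - dx_int
   [:: 2; 3; 4; 5] a b c d - dx_int [:: 2; 3; 6; 7] a b c d - dx_int [:: 4;
   5; 6; 7] a b c d.

Definition triples : seq (nat * nat * nat) :=
  flatten [seq flatten [seq [seq (i, j, k) | k <- iota j.+1 (7 - j)]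
                   | j <- iota i.+1 (7 - i)] | i <- iota 0 8].

Variable R : realType.

Lemma dx4_int (i j k l : I8) (I : seq nat) : [:: val i; val j; val k; val l] = I ->
  forall a b c d : I8, dx4 R i j k l a b c d = (dx_int I a b c d)%:~R.
Proof.
move=> <- a b c d.
have e (x y z t : I8) : ([:: x; y; z; t] == [:: i; j; k; l])%:R =
   (([:: val i; val j; val k; val l] == [:: val x; val y; val z; val t])%:Z)%:~R :> R.
  rewrite -(inj_eq (inj_map val_inj)) /= eq_sym.
  by case: (_ == _).
have e24 : 4`!%:R = 24 :> R by [].
rewrite /dx4 alt4E e24 mulVKf ?pnatr_eq0 // !e /dx_int.
by rewrite !(intrD, mulrNz).
Qed.

Lemma Phi0_int (a b c d : I8) : Phi0 R a b c d = (phi_int a b c d)%:~R.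
Proof.
have intr14 (x0 x1 x2 x3 x4 x5 x6 x7 x8 x9 x10 x11 x12 x13 : int) :
   (- x0 - x1 - x2 - x3 + x4 + x5 + x6 + x7 + x8 + x9 - x10 - x11 - x12 - x13)%:~R =
   - x0%:~R - x1%:~R - x2%:~R - x3%:~R + x4%:~R + x5%:~R + x6%:~R + x7%:~R + x8%:~R + x9%:~R - x10%:~R - x11%:~R - x12%:~R - x13%:~R :> R by rewrite !(intrD, mulrNz).
rewrite /phi_int intr14 /Phi0.
by do 13?congr (_ + _); try congr (- _); apply: dx4_int.
Qed.

End ModelForm.

(** * The contraction identity of the model form *)

Section ContractionCheck.

Definition phi_row (t : nat * nat * nat) : seq int :=
  [seq phi_int t.1.1 t.1.2 t.2 p | p <- iota 0 8].

(** The vectors Phi_{ijkp}, with p running, are tabulated once for increasing i, j, k; the check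
    below compares their 56 x 56 inner products with the right-hand side of the identity. *)
Definition phi_rows : seq (nat * nat * nat * seq int) :=
  Eval vm_compute in [seq (t, phi_row t) | t <- triples].

Definition contraction_rhs (s t : nat * nat * nat) : int :=
  let: (i, j, k) := s in let: (a, b, c) := t in
  let d (x y : nat) : int := if x == y then 1 else 0 in
  let e (x y p q r s : nat) : int := if x == y then phi_int p q r s else 0 in
  d i a * d j b * d k c + d i b * d j c * d k a + d i c * d j a * d k b
  - d i a * d j c * d k b - d i c * d j b * d k a - d i b * d j a * d k c
  - e i a j k b c - e j a k i b c - e k a i j b c
  - e i b j k c a - e j b k i c a - e k b i j c a
  - e i c j k a b - e j c k i a b - e k c i j a b.

Lemma phi_rowsE : phi_rows = [seq (t, phi_row t) | t <- triples].
Proof. by vm_compute. Qed.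

Lemma contraction_check :
  all (fun s => all (fun t =>
    foldr (fun p z => p.1 * p.2 + z) 0 (zip s.2 t.2) == contraction_rhs s.1 t.1)
    phi_rows) phi_rows.
Proof. by vm_compute. Qed.

End ContractionCheck.

Section Contraction.
Variable R : realType.
Implicit Types w : T3 R.

Lemma alternating3_perm w (hw : alternating3 w) a b c :
  (w a c b = - w a b c) * (w b a c = - w a b c) * (w b c a = w a b c) *
  (w c a b = w a b c) * (w c b a = - w a b c).
Proof.
have h1 x y z : w y x z = - w x y z by case: (hw x y z).
have h2 x y z : w x z y = - w x y z by case: (hw x y z).
have e1 : w b c a = w a b c by rewrite h2 h1 opprK.
have e2 : w c a b = w a b c by rewrite h1 h2 opprK.
by do !split => //; rewrite h1 e1.
Qed.

Lemma oppr_fix0 (x : R) : x = - x -> x = 0.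
Proof. by move=> h; lra. Qed.

(** Reduces an identity that alternates in three indices to the 56 increasing triples: a repeated
    index forces zero, and any other triple is sorted by one of the six reorderings. *)
Lemma alternating3_eq0 w : alternating3 w ->
  (forall a b c : I8, (a < b < c)%N -> w a b c = 0) -> forall a b c, w a b c = 0.
Proof.
move=> hw h0 a b c.
have p := alternating3_perm hw a b c.
have z1 : w a c b = 0 \/ w b a c = 0 \/ w b c a = 0 \/ w c a b = 0 \/
    w c b a = 0 \/ w a b c = 0 -> w a b c = 0 by rewrite !p; lra.
have [ab|ba|/val_inj ab] := ltngtP a b; last first.
- by subst; move: (p.1.1.1.2); lra.
- have [bc|cb|/val_inj bc] := ltngtP b c; last first.
  + by subst; move: (p.1.1.1.1); lra.
  + by apply: z1; do 4!right; left; rewrite h0 ?cb.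
  have [ac|ca|/val_inj ac] := ltngtP a c; last first.
  + by subst; move: (p.2); lra.
  + by apply: z1; do 2!right; left; rewrite h0 ?bc.
  by apply: z1; right; left; rewrite h0 ?ba.
have [bc|cb|/val_inj bc] := ltngtP b c; last first.
- by subst; move: (p.1.1.1.1); lra.
- have [ac|ca|/val_inj ac] := ltngtP a c; last first.
  + by subst; move: (p.2); lra.
  + by apply: z1; do 3!right; left; rewrite h0 ?ca.
  by apply: z1; left; rewrite h0 ?ac.
by rewrite h0 ?ab.
Qed.

Lemma Phi0_alternating : alternating4 (Phi0 R).
Proof.
have h i j k l : alternating4 (dx4 R i j k l).
  by move=> a b c d; split; rewrite /dx4;
    case: (alt4_alternating (fun a' b' c' d' =>
      ([:: a'; b'; c'; d'] == [:: i; j; k; l])%:R : R) a b c d) => h1 h2 h3;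
    rewrite ?h1 ?h2 ?h3 mulrN.
have h1 i j k l a b c d : dx4 R i j k l b a c d = - dx4 R i j k l a b c d.
  by case: (h i j k l a b c d).
have h2 i j k l a b c d : dx4 R i j k l a c b d = - dx4 R i j k l a b c d.
  by case: (h i j k l a b c d).
have h3 i j k l a b c d : dx4 R i j k l a b d c = - dx4 R i j k l a b c d.
  by case: (h i j k l a b c d).
move=> a b c d; split; rewrite /Phi0.
- by do 14 rewrite [dx4 _ _ _ _ _ b a c d]h1; rewrite !(opprD, opprK).
- by do 14 rewrite [dx4 _ _ _ _ _ a c b d]h2; rewrite !(opprD, opprK).
- by do 14 rewrite [dx4 _ _ _ _ _ a b d c]h3; rewrite !(opprD, opprK).
Qed.

Lemma mem_triples (i j k : I8) : (i < j < k)%N -> (val i, val j, val k) \in triples.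
Proof.
case/andP=> ij jk; have [i8 [j8 k8]] := (ltn_ord i, (ltn_ord j, ltn_ord k)).
apply/flatten_mapP; exists (val i); first by rewrite mem_iota.
apply/flatten_mapP; exists (val j); first by rewrite mem_iota ij /=; lia.
by apply: (map_f (fun k => (val i, val j, k))); rewrite mem_iota jk /=; lia.
Qed.

Local Notation phi := (Phi0 R).
Local Notation d x y := ((x == y)%:R : R).

(** Both sides alternate in [i j k] and in [a b c], so increasing triples suffice, and there the
    identity is the integer check. *)
Lemma Phi0_contract1 (i j k a b c : I8) :
  \sum_p phi i j k p * phi a b c p =
  d i a * d j b * d k c + d i b * d j c * d k a + d i c * d j a * d k b
  - d i a * d j c * d k b - d i c * d j b * d k a - d i b * d j a * d k c
  - d i a * phi j k b c - d j a * phi k i b c - d k a * phi i j b c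
  - d i b * phi j k c a - d j b * phi k i c a - d k b * phi i j c a
  - d i c * phi j k a b - d j c * phi k i a b - d k c * phi i j a b.
Proof.
pose F i j k a b c := \sum_p phi i j k p * phi a b c p -
  (d i a * d j b * d k c + d i b * d j c * d k a + d i c * d j a * d k b
  - d i a * d j c * d k b - d i c * d j b * d k a - d i b * d j a * d k c
  - d i a * phi j k b c - d j a * phi k i b c - d k a * phi i j b c
  - d i b * phi j k c a - d j b * phi k i c a - d k b * phi i j c a
  - d i c * phi j k a b - d j c * phi k i a b - d k c * phi i j a b).
suff : F i j k a b c = 0 by move/eqP; rewrite subr_eq0 => /eqP.
have ph x y z t := alternating4_perm Phi0_alternating x y z t.
have altl a' b' c' : alternating3 (fun i j k => F i j k a' b' c').
  move=> x y z; split; rewrite /F.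
    rewrite (eq_bigr (fun p => - (phi x y z p * phi a' b' c' p))); last first.
      by move=> p _; rewrite (ph x y z p) mulNr.
    rewrite sumrN (ph y z b' c') (ph z x b' c') (ph x y b' c').
    rewrite (ph y z c' a') (ph z x c' a') (ph x y c' a').
    rewrite (ph y z a' b') (ph z x a' b') (ph x y a' b'); ring.
  rewrite (eq_bigr (fun p => - (phi x y z p * phi a' b' c' p))); last first.
    by move=> p _; rewrite (ph x y z p) mulNr.
  rewrite sumrN (ph y z b' c') (ph z x b' c') (ph x y b' c').
  rewrite (ph y z c' a') (ph z x c' a') (ph x y c' a').
  rewrite (ph y z a' b') (ph z x a' b') (ph x y a' b'); ring.
have altr i' j' k' : alternating3 (F i' j' k').
  move=> x y z; split; rewrite /F.
    rewrite (eq_bigr (fun p => - (phi i' j' k' p * phi x y z p))); last first.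
      by move=> p _; rewrite (ph x y z p) mulrN.
    rewrite sumrN (ph j' k' y z) (ph k' i' y z) (ph i' j' y z).
    rewrite (ph j' k' z x) (ph k' i' z x) (ph i' j' z x).
    rewrite (ph j' k' x y) (ph k' i' x y) (ph i' j' x y); ring.
  rewrite (eq_bigr (fun p => - (phi i' j' k' p * phi x y z p))); last first.
    by move=> p _; rewrite (ph x y z p) mulrN.
  rewrite sumrN (ph j' k' y z) (ph k' i' y z) (ph i' j' y z).
  rewrite (ph j' k' z x) (ph k' i' z x) (ph i' j' z x).
  rewrite (ph j' k' x y) (ph k' i' x y) (ph i' j' x y); ring.
apply: (alternating3_eq0 (altl a b c)) => {}i {}j {}k ijk.
apply: (alternating3_eq0 (altr i j k)) => {}a {}b {}c abc.
have := contraction_check; rewrite phi_rowsE => /allP.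
move=> /(_ _ (map_f (fun t => (t, phi_row t)) (mem_triples ijk))) /allP.
move=> /(_ _ (map_f (fun t => (t, phi_row t)) (mem_triples abc))) /eqP e.
apply/eqP; rewrite subr_eq0; apply/eqP.
have dE (x y : I8) : d x y = ((if (val x == val y) then 1 else 0 : int))%:~R :> R.
  by rewrite -(inj_eq val_inj); case: (_ == _).
have eE (x y p q r s : I8) : d x y * phi p q r s =
  ((if (val x == val y) then phi_int p q r s else 0 : int))%:~R.
  by rewrite Phi0_int -(inj_eq val_inj); case: (_ == _); rewrite ?mul1r ?mul0r.
rewrite !eE !dE.
under eq_bigr => p _ do rewrite !Phi0_int -intrM.
rewrite -(big_morph (intmul (1 : R)) (intrD R) (mulr0z 1)).
rewrite -!(intrM, intrB, intrD); congr (_%:~R).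
by rewrite -[RHS]e !big_ord_recl big_ord0.
Qed.

End Contraction.

Section Sums.
Variable R : realType.
Local Notation d x y := ((x == y)%:R : R).

Definition S2 (f : I8 -> I8 -> R) : R := \sum_p \sum_q f p q.
Definition S3 (f : I8 -> I8 -> I8 -> R) : R := \sum_p \sum_q \sum_r f p q r.

Lemma eq_S2 f g : (forall p q, f p q = g p q) -> S2 f = S2 g.
Proof. by move=> e; apply: eq_bigr => p _; apply: eq_bigr => q _. Qed.

Lemma eq_S3 f g : (forall p q r, f p q r = g p q r) -> S3 f = S3 g.
Proof. by move=> e; apply: eq_bigr => p _; apply: eq_bigr => q _; apply: eq_bigr. Qed.

Lemma S2D f g : S2 (fun p q => f p q + g p q) = S2 f + S2 g.
Proof. by rewrite -big_split; apply: eq_bigr => p _; rewrite -big_split. Qed.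

Lemma S3D f g : S3 (fun p q r => f p q r + g p q r) = S3 f + S3 g.
Proof. by rewrite -big_split; apply: eq_bigr => p _; rewrite -[RHS]S2D. Qed.

Lemma S2N f : S2 (fun p q => - f p q) = - S2 f.
Proof. by rewrite -sumrN; apply: eq_bigr => p _; rewrite sumrN. Qed.

Lemma S3N f : S3 (fun p q r => - f p q r) = - S3 f.
Proof. by rewrite -sumrN; apply: eq_bigr => p _; rewrite -[RHS]S2N. Qed.

Lemma S2Zl x f : S2 (fun p q => x * f p q) = x * S2 f.
Proof. by rewrite mulr_sumr; apply: eq_bigr => p _; rewrite mulr_sumr. Qed.

Lemma S3Zl x f : S3 (fun p q r => x * f p q r) = x * S3 f.
Proof. by rewrite mulr_sumr; apply: eq_bigr => p _; rewrite -[RHS]S2Zl. Qed.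

Lemma S2_swap f : S2 f = S2 (fun p q => f q p).
Proof. exact: exchange_big. Qed.

Lemma S3_swap12 f : S3 f = S3 (fun p q r => f q p r).
Proof. exact: exchange_big. Qed.

Lemma S3_swap23 f : S3 f = S3 (fun p q r => f p r q).
Proof. by apply: eq_bigr => p _; exact: exchange_big. Qed.

Lemma S1_S3 (f : I8 -> I8 -> I8 -> I8 -> R) :
  \sum_i S3 (fun p q r => f i p q r) = S3 (fun p q r => \sum_i f i p q r).
Proof.
rewrite /S3 exchange_big; apply: eq_bigr => p _ /=.
rewrite exchange_big; apply: eq_bigr => q _ /=.
by rewrite exchange_big.
Qed.

Lemma S1_S2 (f : I8 -> I8 -> I8 -> R) :
  \sum_i S2 (fun p q => f i p q) = S2 (fun p q => \sum_i f i p q).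
Proof.
by rewrite /S2 exchange_big; apply: eq_bigr => p _ /=; rewrite exchange_big.
Qed.

Lemma dxx (x : I8) : d x x = 1. Proof. by rewrite eqxx. Qed.

Lemma S1_d i (f : I8 -> R) : \sum_p d i p * f p = f i.
Proof.
rewrite (bigD1 i) //= eqxx mul1r big1 ?addr0 // => p /negPf.
by rewrite eq_sym => ->; rewrite mul0r.
Qed.

Lemma S1_d' i (f : I8 -> R) : \sum_p d p i * f p = f i.
Proof. by rewrite -[RHS]S1_d; apply: eq_bigr => p _; rewrite eq_sym. Qed.

Lemma S2_d1 i f : S2 (fun p q => d i p * f p q) = \sum_q f i q.
Proof. by rewrite -[RHS](S1_d i (fun p => \sum_q f p q)); apply: eq_bigr => p _; rewrite mulr_sumr. Qed.

Lemma S2_d2 i f : S2 (fun p q => d i q * f p q) = \sum_p f p i.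
Proof. by rewrite S2_swap S2_d1. Qed.

Lemma S3_d1 i f : S3 (fun p q r => d i p * f p q r) = S2 (fun q r => f i q r).
Proof.
by rewrite -[RHS](S1_d i (fun p => S2 (f p))); apply: eq_bigr => p _; rewrite -[RHS]S2Zl.
Qed.

Lemma S3_d2 i f : S3 (fun p q r => d i q * f p q r) = S2 (fun p r => f p i r).
Proof. by rewrite S3_swap12 S3_d1. Qed.

Lemma S3_d3 i f : S3 (fun p q r => d i r * f p q r) = S2 (fun p q => f p q i).
Proof. by rewrite S3_swap23 S3_d2. Qed.

End Sums.

(** * Contractions with the model form and its Spin(7) components *)

Section ModelAlgebra.
Variable R : realType.
Local Notation d x y := ((x == y)%:R : R).

Variables (phi : T4 R) (phi_alt : alternating4 phi).
Hypothesis phi_contract1 : forall i j k a b c : I8,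
  \sum_p phi i j k p * phi a b c p =
  d i a * d j b * d k c + d i b * d j c * d k a + d i c * d j a * d k b
  - d i a * d j c * d k b - d i c * d j b * d k a - d i b * d j a * d k c
  - d i a * phi j k b c - d j a * phi k i b c - d k a * phi i j b c
  - d i b * phi j k c a - d j b * phi k i c a - d k b * phi i j c a
  - d i c * phi j k a b - d j c * phi k i a b - d k c * phi i j a b.

Let ph := alternating4_perm phi_alt.

(** The contraction identity read as an operator on 3-tensors: the Kronecker terms produce the six
    reorderings of [F], the other nine terms its contractions with [phi] in two slots. *)
Lemma contract_op (F : T3 R) i j k :
  \sum_q phi i j k q * S3 (fun r s t => phi r s t q * F r s t) =
  F i j k + F k i j + F j k i - F i k j - F k j i - F j i k
  - S2 (fun s t => phi j k s t * F i s t) - S2 (fun s t => phi k i s t * F j s t)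
  - S2 (fun s t => phi i j s t * F k s t)
  - S2 (fun r t => phi j k t r * F r i t) - S2 (fun r t => phi k i t r * F r j t)
  - S2 (fun r t => phi i j t r * F r k t)
  - S2 (fun r s => phi j k r s * F r s i) - S2 (fun r s => phi k i r s * F r s j)
  - S2 (fun r s => phi i j r s * F r s k).
Proof.
under eq_bigr => q _ do rewrite -S3Zl.
rewrite S1_S3.
under eq_S3 => r s t.
  under eq_bigr => q _ do rewrite mulrA.
  rewrite -mulr_suml phi_contract1 !(mulrDl, mulNr) -!mulrA.
  over.
rewrite !(S3D, S3N, S3_d1, S3_d2, S3_d3, S2_d1, S2_d2, S1_d).
by rewrite ?addrA.
Qed.

(** On a 3-form the six reorderings agree up to sign, and the nine contractions fall into three
    groups of three equal ones. *)
Lemma contract_alt (F : T3 R) (hF : alternating3 F) i j k :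
  \sum_q phi i j k q * S3 (fun r s t => phi r s t q * F r s t) =
  6 * F i j k - 3 * (S2 (fun s t => phi j k s t * F i s t)
    + S2 (fun s t => phi k i s t * F j s t) + S2 (fun s t => phi i j s t * F k s t)).
Proof.
have e x y z : S2 (fun r t => phi x y t r * F r z t) =
               S2 (fun s t => phi x y s t * F z s t).
  by rewrite S2_swap; apply: eq_S2 => s t; rewrite !(alternating3_perm hF z s t).
have e' x y z : S2 (fun r s => phi x y r s * F r s z) =
               S2 (fun s t => phi x y s t * F z s t).
  by apply: eq_S2 => s t; rewrite !(alternating3_perm hF z s t).
rewrite contract_op !e !e'.
rewrite !(alternating3_perm hF i j k); ring.
Qed.

Lemma phi_rep a b c : (phi a a b c = 0) * (phi a b a c = 0) * (phi a b c a = 0) *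
  (phi b a a c = 0) * (phi b a c a = 0) * (phi b c a a = 0).
Proof.
have h1 x y z : phi x x y z = 0 by apply: oppr_fix0; case: (phi_alt x x y z).
do !split; first exact: h1.
- by rewrite (ph a a b c) h1 oppr0.
- by rewrite (ph a a b c) h1.
- by rewrite (ph a a b c) h1.
- by rewrite (ph a a b c) h1 oppr0.
- by rewrite (ph a a b c) h1.
Qed.

(** The contraction identity with the third index of each factor set to [p] and summed. The trace of
    the metric contributes 8, the Kronecker terms containing [p] lower it: 8 - 2 = 6 and -8 + 4 =
    -4. *)
Lemma contract2 a b c e :
  S2 (fun p q => phi a b p q * phi c e p q) =
  6 * (d a c * d b e - d a e * d b c) - 4 * phi a b c e.
Proof.
transitivity (\sum_p ((d a c * d b e - d a e * d b c - phi a b c e)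
  + d b p * (d a e * d p c - d a c * d p e - phi p a c e)
  + d a p * (d b c * d p e - d b e * d p c - phi b p c e)
  + d p c * (- phi a b e p) + d p e * (- phi a b p c))).
  apply: eq_bigr => p _; rewrite phi_contract1 !dxx !phi_rep; ring.
rewrite !big_split /= !S1_d !S1_d' !sumr_const card_ord.
rewrite !(ph a b c e); ring.
Qed.

Lemma contract3 a b : S3 (fun p q r => phi a p q r * phi b p q r) = 42 * d a b.
Proof.
transitivity (\sum_p (6 * d a b + d a p * (- 6 * d p b))).
  apply: eq_bigr => p _; rewrite -[LHS]/(S2 _) contract2 !dxx !phi_rep.
  rewrite (eq_sym p b); ring.
by rewrite big_split /= S1_d !sumr_const card_ord; ring.
Qed.

(** The infinitesimal action of gl(8): the derivative at t = 0 of the pullback of [u] by 1 + t N. *)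
Definition dot (N : I8 -> I8 -> R) (u : T4 R) : T4 R := fun a b c e =>
  \sum_p N p a * u p b c e + \sum_p N p b * u a p c e
  + \sum_p N p c * u a b p e + \sum_p N p e * u a b c p.

(** The contraction E |-> Phi_b^{pqr} E_{apqr} in an orthonormal frame. It identifies
    Lambda^4_{1+7+35} with S^2 + Lambda^2_7 and kills Lambda^4_27. *)
Definition mX (E : T4 R) a b : R := S3 (fun p q r => phi b p q r * E a p q r).

(** Twice [J2] in an orthonormal frame: on 2-forms its eigenvalues are -6, on Lambda^2_7, and 2 on
    the complement spin(7). *)
Definition mP (N : I8 -> I8 -> R) a b : R := S2 (fun p q => phi a b p q * N p q).

(** The vector part of a 3-form, its component in the 8-dimensional summand of Lambda^3. *)
Definition mV (T : T3 R) v : R := S3 (fun p q r => phi v p q r * T p q r).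

Lemma mX_cycle E a b : mX E a b = - S3 (fun r s t => phi r s t b * E a r s t).
Proof. by rewrite -S3N; apply: eq_S3 => r s t; rewrite (ph r s t b) mulNr. Qed.

Lemma alternating4_3 (E : T4 R) a : alternating4 E -> alternating3 (E a).
Proof. by move=> h x y z; split; case: (h a x y z). Qed.

Lemma mX_phi (E : T4 R) (hE : alternating4 E) a b c e :
  \sum_p mX E a p * phi p b c e = 6 * E a b c e
   - 3 * (mP (E a b) c e + mP (E a c) e b + mP (E a e) b c).
Proof.
rewrite -(contract_alt (alternating4_3 a hE)); apply: eq_bigr => p _.
by rewrite mX_cycle (ph b c e p) mulrNN mulrC.
Qed.

(** [contract_alt], applied to [E] with its first index frozen, expresses the action of the matrix
    [mX E] on one slot of [phi] by [E] and three [mP] terms; antisymmetrising over the slots gives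
    this. Thus J4 - 2 factors through [mX], which is why its kernel Lambda^4_27 is that of [mX]. *)
Lemma J4_mX (E : T4 R) (hE : alternating4 E) a b c e :
  3 * alt4 (fun i j k l => mP (E k l) i j) a b c e =
  2 * E a b c e - 12^-1 * dot (fun p q => mX E q p) phi a b c e.
Proof.
have y i j k l : (mP (E k l) j i = - mP (E k l) i j) *
  (mP (E l k) i j = - mP (E k l) i j) * (mP (E l k) j i = mP (E k l) i j).
  have y1 x1 x2 x3 x4 : mP (E x3 x4) x2 x1 = - mP (E x3 x4) x1 x2.
    by rewrite -S2N; apply: eq_S2 => p q; rewrite (ph x1 x2 p q) mulNr.
  have y2 x1 x2 x3 x4 : mP (E x4 x3) x1 x2 = - mP (E x3 x4) x1 x2.
    rewrite -S2N; apply: eq_S2 => p q.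
    by rewrite !(alternating4_perm hE x3 x4 p q) mulrN.
  by do !split => //; rewrite y1 y2 opprK.
rewrite alt4E /dot.
have -> : \sum_p mX E b p * phi a p c e = - \sum_p mX E b p * phi p a c e.
  by rewrite -sumrN; apply: eq_bigr => p _; rewrite (ph p a c e) mulrN.
have -> : \sum_p mX E c p * phi a b p e = \sum_p mX E c p * phi p a b e.
  by apply: eq_bigr => p _; rewrite (ph p a b e).
have -> : \sum_p mX E e p * phi a b c p = - \sum_p mX E e p * phi p a b c.
  by rewrite -sumrN; apply: eq_bigr => p _; rewrite (ph p a b c) mulrN.
rewrite !mX_phi // !(alternating4_perm hE a b c e).
rewrite !(y a b c e, y c e a b, y a c b e, y b e a c, y a e b c, y b c a e).
by field.
Qed.

(** The action on the first slot meets the full contraction 42; the other three slots contribute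
    equally through the double contraction 6, -4. Hence 24 = 42 - 3 * 6, 18 = 3 * 6 and 12 = 3 *
    4. *)
Lemma mX_dot N a b :
  mX (dot N phi) a b = 24 * N b a + 18 * (\sum_p N p p) * d a b + 12 * mP N a b.
Proof.
have e2 : S3 (fun p q r => phi b p q r * \sum_s N s p * phi a s q r) =
   6 * d a b * (\sum_p N p p) - 6 * N b a + 4 * mP N a b.
  transitivity (\sum_p \sum_s (N s p * (6 * (d b a * d p s - d b s * d p a)
     - 4 * phi b p a s))).
    apply: eq_bigr => p _.
    rewrite -[LHS]/(S2 _).
    under eq_S2 => q r do rewrite mulr_sumr.
    rewrite -S1_S2; apply: eq_bigr => s _.
    by rewrite -contract2 -S2Zl; apply: eq_S2 => q r; ring.
  transitivity (\sum_p (d a p * (- 6 * N b p) + 6 * d a b * N p p)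
        + S2 (fun p s => 4 * (phi a b s p * N s p))).
    rewrite -big_split; apply: eq_bigr => p _ /=.
    transitivity (\sum_s (d b s * (- 6 * d a p * N s p) + d p s * (6 * d a b * N s p)
       + 4 * (phi a b s p * N s p))).
      by apply: eq_bigr => s _; rewrite (ph a b s p) (eq_sym b a) (eq_sym p a); ring.
    by rewrite !big_split /= !S1_d; ring.
  by rewrite big_split /= S1_d -mulr_sumr S2Zl S2_swap; rewrite /mP; ring.
have e3 : S3 (fun p q r => phi b p q r * \sum_s N s q * phi a p s r) =
  S3 (fun p q r => phi b p q r * \sum_s N s p * phi a s q r).
  rewrite S3_swap12; apply: eq_S3 => p q r.
  rewrite (ph b p q r) mulNr -mulrN; congr (_ * _); rewrite -sumrN.
  by apply: eq_bigr => s _; rewrite (ph a s q r) mulrN opprK.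
have e4 : S3 (fun p q r => phi b p q r * \sum_s N s r * phi a p q s) =
  S3 (fun p q r => phi b p q r * \sum_s N s q * phi a p s r).
  rewrite S3_swap23; apply: eq_S3 => p q r.
  rewrite (ph b p q r) mulNr -mulrN; congr (_ * _); rewrite -sumrN.
  by apply: eq_bigr => s _; rewrite (ph a p s r) mulrN opprK.
have e1 : S3 (fun p q r => phi b p q r * \sum_s N s a * phi s p q r) = 42 * N b a.
  transitivity (\sum_s N s a * (42 * d b s)).
    under eq_S3 => p q r do rewrite mulr_sumr.
    rewrite -S1_S3; apply: eq_bigr => s _.
    by rewrite -contract3 -S3Zl; apply: eq_S3 => p q r; ring.
  by under eq_bigr => s _ do (rewrite mulrC -mulrA mulrCA); rewrite S1_d.
rewrite /mX /dot; under eq_S3 => p q r do rewrite !mulrDr.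
rewrite !S3D e4 e3 e2 e1; ring.
Qed.

(** Since [mP] only sees antisymmetric parts, this places the antisymmetric part of [mX E] in the -6
    eigenspace, that is in Lambda^2_7. It is the source of the corresponding property of the field
    equations. *)
Lemma mP_mX (E : T4 R) (hE : alternating4 E) a b :
  mP (mX E) a b = 3 * (mX E b a - mX E a b).
Proof.
transitivity (\sum_p - (6 * E p a b p - 3 * (mP (E p a) b p + mP (E p b) p a
     + mP (E p p) a b))).
  apply: eq_bigr => p _; rewrite -(contract_alt (alternating4_3 p hE)) -sumrN.
  by apply: eq_bigr => q _; rewrite mX_cycle mulrN.
have e0 x y z : E x x y z = 0 by apply: oppr_fix0; case: (hE x x y z).
transitivity (\sum_p (3 * mP (E b p) a p - 3 * mP (E a p) b p)).
  apply: eq_bigr => p _.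
  have -> : E p a b p = 0 by rewrite (alternating4_perm hE p p a b) e0.
  have -> : mP (E p p) a b = 0.
    by rewrite /mP /S2 big1 // => r _; rewrite big1 // => s _; rewrite e0 mulr0.
  have -> : mP (E p a) b p = - mP (E a p) b p.
    by rewrite -S2N; apply: eq_S2 => r s; rewrite (alternating4_perm hE a p r s) mulrN.
  have -> : mP (E p b) p a = mP (E b p) a p.
    apply: eq_S2 => r s.
    by rewrite (alternating4_perm hE b p r s) (ph a p r s) mulrNN.
  by ring.
by rewrite sumrB -!mulr_sumr mulrBr.
Qed.

(** [contract_alt] once more: for a 3-form the cyclic sum of the [mP] terms is determined by [T] and
    its vector part. *)
Lemma mP_cycle (T : T3 R) (hT : alternating3 T) i a b :
  mP (T i) a b + mP (T a) b i + mP (T b) i a =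
  2 * T i a b + 3^-1 * \sum_v phi i a b v * mV T v.
Proof.
have -> : \sum_v phi i a b v * mV T v =
   - \sum_q phi i a b q * S3 (fun r s t => phi r s t q * T r s t).
  rewrite -sumrN; apply: eq_bigr => q _; rewrite -mulrN; congr (_ * _).
  by rewrite -S3N; apply: eq_S3 => r s t; rewrite (ph r s t q) mulNr.
by rewrite contract_alt // /mP; field.
Qed.

Lemma mV_phi (W : I8 -> R) u :
  mV (fun p q r => \sum_v phi p q r v * W v) u = - 42 * W u.
Proof.
transitivity (\sum_v d u v * (- 42 * W v)); last by rewrite S1_d.
rewrite /mV; under eq_S3 => p q r do rewrite mulr_sumr.
rewrite -S1_S3; apply: eq_bigr => v _.
transitivity (- W v * (42 * d u v)); last by ring.
rewrite -contract3 -S3Zl; apply: eq_S3 => p q r.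
by rewrite (ph v p q r); ring.
Qed.

(** Antisymmetrisation from V (x) Lambda^2_7 to Lambda^3 is injective; both spaces have dimension
    56. A contraction of [D] with two copies of [phi] is 18 D by the eigenvalue equation, while the
    contraction identity and the cyclic condition make it 8 D - 6 D = 2 D. *)
Lemma cyclic_L7_eq0 (D : T3 R) : (forall i a b, D i b a = - D i a b) ->
  (forall i a b, mP (D i) a b = - 6 * D i a b) ->
  (forall i a b, D i a b + D a b i + D b i a = 0) -> forall i a b, D i a b = 0.
Proof.
move=> ha h7 hc.
have h1 i a b : S2 (fun p q => phi a b p q * D p q i) = 3 * D i a b.
  have := h7 i a b.
  have -> : mP (D i) a b = - S2 (fun p q => phi a b p q * D p q i)
     - S2 (fun p q => phi a b p q * D q i p).
    rewrite -!S2N -S2D; apply: eq_S2 => p q.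
    by have := hc i p q; move=> /eqP; rewrite -addrA addr_eq0 => /eqP ->; ring.
  have -> : S2 (fun p q => phi a b p q * D q i p) = S2 (fun p q => phi a b p q * D p q i).
    by rewrite S2_swap; apply: eq_S2 => p q; rewrite (ph a b p q) (ha p q i); ring.
  by lra.
(* The traces of [D] vanish first, since they would otherwise survive in the contraction identity
   below. *)
pose t b := \sum_p D p b p.
have t0 b : t b = 0.
  have : \sum_a S2 (fun p q => phi a b p q * D p q a) = - 3 * t b.
    rewrite mulr_sumr; apply: eq_bigr => a _.
    by rewrite h1 (ha a b a); ring.
  have -> : \sum_a S2 (fun p q => phi a b p q * D p q a) = \sum_p - mP (D p) b p.
    rewrite S1_S2; apply: eq_bigr => p _; rewrite -S2N.
    apply: eq_bigr => q _; apply: eq_bigr => a _.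
    by rewrite (ph a b p q); ring.
  under eq_bigr => p _ do rewrite h7.
  rewrite sumrN -mulr_sumr -/(t b); lra.
have t0' b : \sum_p D p p b = 0.
  transitivity (- t b); last by rewrite t0 oppr0.
  by rewrite -sumrN; apply: eq_bigr => p _; exact: ha.
have {}t0 b : \sum_p D p b p = 0 := t0 b.
move=> i a b.
(* First evaluation: the inner sum is an [mP] contraction, worth -6, and the outer one is [h1],
   worth 3. *)
have hL : \sum_p \sum_q phi a b p q * S3 (fun x r s => phi x r s q * (d i x * D p r s))
   = 18 * D i a b.
  transitivity (6 * (3 * D i a b)); last by ring.
  rewrite -h1 -S2Zl; apply: eq_S2 => p q.
  under eq_S3 => x r s do rewrite mulrCA.
  rewrite S3_d1.
  have -> : S2 (fun r s => phi i r s q * D p r s) = - mP (D p) q i.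
    by rewrite -S2N; apply: eq_S2 => r s; rewrite (ph q i r s) mulNr.
  by rewrite h7; ring.
have hS x y : \sum_p S2 (fun r t => phi x p t r * (d i r * D p y t)) =
    \sum_p \sum_t phi x p t i * D p y t.
  apply: eq_bigr => p _; under eq_S2 => r s do rewrite mulrCA.
  by rewrite S2_d1.
have hA x y : \sum_p \sum_s phi x p s i * D p y s = 3 * D y i x.
  rewrite -h1; apply: eq_S2 => p s.
  by rewrite (ph i x p s) (ha p s y); ring.
(* Second evaluation: the two copies of [phi] share the index [q] and are eliminated by the
   contraction identity. [q1] to [q9] are its nine terms linear in [phi]. *)
have hR : \sum_p \sum_q phi a b p q * S3 (fun x r s => phi x r s q * (d i x * D p r s))
  = 2 * D i a b + 6 * D i a b - 2 * (3 * D a i b) + 2 * (3 * D b i a).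
  under eq_bigr => p _ do rewrite contract_op.
  rewrite -!hA !(sumrB, big_split) /=.
  have e0 x y : \sum_p d i x * D p y p = 0 by rewrite -mulr_sumr t0 mulr0.
  have e0' x y : \sum_p d i x * D p p y = 0 by rewrite -mulr_sumr t0' mulr0.
  have eS x y : S2 (fun s t => phi x y s t * (d i i * D i s t)) = - 6 * D i x y.
    by rewrite -h7; apply: eq_S2 => s r; rewrite dxx mul1r.
  have q1 : \sum_p S2 (fun s r => phi b p s r * (d i a * D p s r)) = 0.
    transitivity (\sum_p d i a * (- 6 * D p b p)).
      by apply: eq_bigr => p _; rewrite -h7 -S2Zl; apply: eq_S2 => *; ring.
    by rewrite -mulr_sumr -mulr_sumr t0 !mulr0.
  have q2 : \sum_p S2 (fun s r => phi p a s r * (d i b * D p s r)) = 0.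
    transitivity (\sum_p d i b * (- 6 * D p p a)).
      by apply: eq_bigr => p _; rewrite -h7 -S2Zl; apply: eq_S2 => *; ring.
    by rewrite -mulr_sumr -mulr_sumr t0' !mulr0.
  have q3 : \sum_p S2 (fun s r => phi a b s r * (d i p * D p s r)) = - 6 * D i a b.
    rewrite -h7 -[RHS](S1_d i (fun p => mP (D p) a b)).
    by apply: eq_bigr => p _; rewrite -S2Zl; apply: eq_S2 => *; ring.
  have q4 : \sum_p S2 (fun r s => phi b p s r * (d i r * D p a s)) =
     \sum_p \sum_s phi b p s i * D p a s by exact: hS.
  have q5 : \sum_p S2 (fun r s => phi p a s r * (d i r * D p b s)) =
     - \sum_p \sum_s phi a p s i * D p b s.
    rewrite -hS -sumrN; apply: eq_bigr => p _; rewrite -S2N.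
    by apply: eq_S2 => r s; rewrite (ph a p s r); ring.
  have q6 : \sum_p S2 (fun r s => phi a b s r * (d i r * D p p s)) = 0.
    rewrite S1_S2 /S2 big1 // => r _; rewrite big1 // => s _.
    by rewrite -!mulr_sumr t0' !mulr0.
  have q7 : \sum_p S2 (fun r s => phi b p r s * (d i r * D p s a)) =
     \sum_p \sum_s phi b p s i * D p a s.
    rewrite -hS; apply: eq_bigr => p _.
    by apply: eq_S2 => r s; rewrite (ph b p s r) (ha p a s); ring.
  have q8 : \sum_p S2 (fun r s => phi p a r s * (d i r * D p s b)) =
     - \sum_p \sum_s phi a p s i * D p b s.
    rewrite -hS -sumrN; apply: eq_bigr => p _; rewrite -S2N.
    by apply: eq_S2 => r s; rewrite (ph a p s r) (ha p b s); ring.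
  have q9 : \sum_p S2 (fun r s => phi a b r s * (d i r * D p s p)) = 0.
    rewrite S1_S2 /S2 big1 // => r _; rewrite big1 // => s _.
    by rewrite -!mulr_sumr t0 !mulr0.
  rewrite q1 q2 q3 q4 q5 q6 q7 q8 q9 !e0 !e0'.
  rewrite !(S1_d i (fun p => D p a b)) !(S1_d i (fun p => D p b a)) (ha i a b).
  by ring.
have := hc i a b; have := hR; rewrite hL (ha a b i); lra.
Qed.

Lemma mP_anti N a b : mP N b a = - mP N a b.
Proof. by rewrite -S2N; apply: eq_S2 => p q; rewrite (ph a b p q) mulNr. Qed.

Lemma mPB (N N' : I8 -> I8 -> R) x a b :
  mP (fun p q => N p q + x * N' p q) a b = mP N a b + x * mP N' a b.
Proof. by rewrite -S2Zl -S2D; apply: eq_S2 => p q; ring. Qed.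

Lemma mP_sym N : (forall a b, N a b = N b a) -> forall a b, mP N a b = 0.
Proof.
move=> h a b; apply: oppr_fix0; rewrite {1}/mP S2_swap -S2N.
by apply: eq_S2 => p q; rewrite (ph a b p q) (h q p) mulNr.
Qed.

Lemma mP_mP N : (forall a b, N b a = - N a b) ->
  forall a b, mP (mP N) a b = 12 * N a b - 4 * mP N a b.
Proof.
move=> hN a b.
transitivity (S2 (fun r s => N r s * S2 (fun p q => phi a b p q * phi r s p q))).
  rewrite /mP; under eq_S2 => p q do rewrite /S2 mulr_sumr.
  rewrite -[LHS]S1_S2; apply: eq_bigr => r _.
  under eq_S2 => p q do rewrite mulr_sumr.
  rewrite -S1_S2; apply: eq_bigr => s _.
  by rewrite -S2Zl; apply: eq_S2 => p q; rewrite (ph r s p q); ring.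
under eq_S2 => r s do rewrite contract2.
transitivity (S2 (fun r s => d a r * (d b s * (6 * N r s))
   - d b r * (d a s * (6 * N r s)) - 4 * (phi a b r s * N r s))).
  by apply: eq_S2 => r s; ring.
by rewrite !(S2D, S2N) !S2_d1 !S1_d S2Zl (hN a b); rewrite /mP; ring.
Qed.

(** [N - mP N / 2] is four times the projection of a 2-form on Lambda^2_7: 1 - x/2 is 4 at x = -6
    and 0 at x = 2, the two roots of x^2 + 4 x - 12 found in [mP_mP]. *)
Lemma mP_pi7 N : (forall a b, N b a = - N a b) ->
  forall a b, mP (fun p q => N p q - 2^-1 * mP N p q) a b =
     - 6 * (N a b - 2^-1 * mP N a b).
Proof.
move=> hN a b; have := mPB N (mP N) (- 2^-1) a b.
rewrite mP_mP // => e.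
transitivity (mP (fun p q => N p q + - 2^-1 * mP N p q) a b).
  by apply: eq_S2 => p q; ring.
by rewrite e; field.
Qed.

(** Sum the hypothesis cyclically: by [mP_cycle] the [mP] terms remove one of the three copies of
    [T] and leave a multiple of its vector part; then divide by 2. *)
Lemma torsion_trace (T : T3 R) (hT : alternating3 T) (B : T3 R) :
  (forall i a b, T i a b - 2^-1 * mP (T i) a b = B i a b) ->
  forall i a b, T i a b = 2^-1 * (B i a b + B a b i + B b i a)
     + 12^-1 * \sum_v phi i a b v * mV T v.
Proof.
move=> hB i a b; have := mP_cycle hT i a b.
have := (hB i a b, hB a b i, hB b i a).
rewrite !(alternating3_perm hT i a b) => -[[<- <-] <-].
set s := \sum_v _; set x := mP _ _ _; set y := mP _ _ _; set z := mP _ _ _; lra.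
Qed.

Lemma mV_D (T T' : T3 R) x v :
  mV (fun p q r => T p q r + x * T' p q r) v = mV T v + x * mV T' v.
Proof. by rewrite -S3Zl -S3D; apply: eq_S3 => p q r; ring. Qed.

(** With B = 0, [torsion_trace] makes [T] a multiple of its own vector part contracted with [phi];
    taking vector parts gives V = -(42/12) V, so V = 0. *)
Lemma torsion_inj (T : T3 R) (hT : alternating3 T) :
  (forall i a b, T i a b - 2^-1 * mP (T i) a b = 0) -> forall i a b, T i a b = 0.
Proof.
move=> /(torsion_trace hT) h.
have hV v : mV T v = 0.
  have : mV T v = 12^-1 * (- 42 * mV T v).
    rewrite -mV_phi -S3Zl; apply: eq_S3 => p q r.
    by rewrite {1}h; ring.
  lra.
move=> i a b; rewrite h big1; first by rewrite mulr0 !addr0 mulr0.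
by move=> v _; rewrite hV mulr0.
Qed.

Lemma mP_cycle_inj (T : T3 R) (hT : alternating3 T) :
  (forall i a b, mP (T i) a b + mP (T a) b i + mP (T b) i a = 0) ->
  forall i a b, T i a b = 0.
Proof.
move=> h.
have h' i a b : T i a b = - 6^-1 * \sum_v phi i a b v * mV T v.
  by have := mP_cycle hT i a b; rewrite h; set s := \sum_v _; lra.
have hV v : mV T v = 0.
  have : mV T v = - 6^-1 * (- 42 * mV T v).
    rewrite -mV_phi -S3Zl; apply: eq_S3 => p q r.
    by rewrite {1}h'; ring.
  lra.
move=> i a b; rewrite h' big1; first by rewrite mulr0.
by move=> v _; rewrite hV mulr0.
Qed.

(** The formula of [torsion_trace] solved for the unknown vector part: it must be a third of that of
    [B], because 3/2 - 42/36 = 1/3, whence 36 = 12 * 3. *)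
Definition torsion_of (B : T3 R) : T3 R := fun i a b =>
  2^-1 * (B i a b + B a b i + B b i a)
  + 36^-1 * \sum_v phi i a b v * mV B v.

Lemma torsion_of_alternating (B : T3 R) : (forall i a b, B i b a = - B i a b) ->
  alternating3 (torsion_of B).
Proof.
move=> hB x y z; split; rewrite /torsion_of.
  have -> : \sum_v phi y x z v * mV B v = - \sum_v phi x y z v * mV B v.
    by rewrite -sumrN; apply: eq_bigr => v _; rewrite (ph x y z v) mulNr.
  by rewrite (hB y x z) (hB x y z) (hB z x y); ring.
have -> : \sum_v phi x z y v * mV B v = - \sum_v phi x y z v * mV B v.
  by rewrite -sumrN; apply: eq_bigr => v _; rewrite (ph x y z v) mulNr.
by rewrite (hB y x z) (hB x y z) (hB z x y); ring.
Qed.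

(** The defect of the equation takes values in Lambda^2_7 and, by the choice of the coefficients,
    has zero cyclic sum; so [cyclic_L7_eq0] applies to it. *)
Lemma torsion_ofP (B : T3 R) : (forall i a b, B i b a = - B i a b) ->
  (forall i a b, mP (B i) a b = - 6 * B i a b) ->
  forall i a b, torsion_of B i a b - 2^-1 * mP (torsion_of B i) a b = B i a b.
Proof.
move=> hB h7 i a b; have hT := torsion_of_alternating hB.
set T := torsion_of B in hT *.
have hV v : mV T v = 3^-1 * mV B v.
  have e1 : mV T v = mV (fun p q r => 2^-1 * (B p q r + B q r p + B r p q)) v
        + 36^-1 * (- 42 * mV B v).
    by rewrite -mV_phi -mV_D.
  have e2 : mV (fun p q r => 2^-1 * (B p q r + B q r p + B r p q)) v =
     3 / 2 * mV B v.
    have c1 : mV (fun p q r => B q r p) v = mV B v.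
      rewrite /mV S3_swap12 S3_swap23; apply: eq_S3 => p q r.
      by rewrite (ph v p q r).
    have c2 : mV (fun p q r => B r p q) v = mV B v.
      rewrite /mV S3_swap23 S3_swap12; apply: eq_S3 => p q r.
      by rewrite (ph v p q r).
    transitivity (2^-1 * (mV B v + mV (fun p q r => B q r p) v
                        + mV (fun p q r => B r p q) v)).
      by rewrite -!S3D -S3Zl; apply: eq_S3 => p q r; ring.
    by rewrite c1 c2; field.
  by rewrite e1 e2; field.
pose D i a b := T i a b - 2^-1 * mP (T i) a b - B i a b.
suff : D i a b = 0 by move/eqP; rewrite subr_eq0 => /eqP.
have hTa x y z : T x z y = - T x y z by case: (hT x y z).
apply: cyclic_L7_eq0 => {i a b} i a b.
- by rewrite /D hTa (hB i a b) mP_anti; ring.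
- transitivity (mP (fun p q => T i p q - 2^-1 * mP (T i) p q) a b - mP (B i) a b).
    by rewrite -S2N -S2D; apply: eq_S2 => p q; rewrite /D; ring.
  by rewrite mP_pi7 // h7 /D; ring.
- have := mP_cycle hT i a b.
  have -> : \sum_v phi i a b v * mV T v = 3^-1 * \sum_v phi i a b v * mV B v.
    by rewrite mulr_sumr; apply: eq_bigr => v _; rewrite hV; ring.
  have := erefl (T i a b); rewrite {1}/T /torsion_of /D !(alternating3_perm hT i a b).
  set s := \sum_v _; set x := mP _ _ _; set y := mP _ _ _; set z := mP _ _ _.
  set t := T i a b; lra.
Qed.

Definition S4 (f : I8 -> I8 -> I8 -> I8 -> R) : R := \sum_p S3 (f p).

Lemma eq_S4 f g : (forall p q r s, f p q r s = g p q r s) -> S4 f = S4 g.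
Proof. by move=> e; apply: eq_bigr => p _; apply: eq_S3. Qed.

Lemma S4D f g : S4 (fun p q r s => f p q r s + g p q r s) = S4 f + S4 g.
Proof. by rewrite -big_split; apply: eq_bigr => p _; rewrite -[RHS]S3D. Qed.

Lemma S4Zl x f : S4 (fun p q r s => x * f p q r s) = x * S4 f.
Proof. by rewrite mulr_sumr; apply: eq_bigr => p _; rewrite -[RHS]S3Zl. Qed.

Lemma S4N f : S4 (fun p q r s => - f p q r s) = - S4 f.
Proof. by rewrite -sumrN; apply: eq_bigr => p _; rewrite -[RHS]S3N. Qed.

Lemma S4_swap12 f : S4 f = S4 (fun p q r s => f q p r s).
Proof. exact: exchange_big. Qed.

Lemma S4_swap23 f : S4 f = S4 (fun p q r s => f p r q s).
Proof. by apply: eq_bigr => p _; exact: exchange_big. Qed.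

Lemma S4_swap34 f : S4 f = S4 (fun p q r s => f p q s r).
Proof. by apply: eq_bigr => p _; exact: S3_swap23. Qed.

(** By antisymmetry the four slots contribute equally to the inner product. *)
Lemma dot_ip N (u : T4 R) (E : T4 R) : alternating4 u -> alternating4 E ->
  S4 (fun a b c e => dot N u a b c e * E a b c e) =
  4 * S2 (fun p a => N p a * S3 (fun b c e => u p b c e * E a b c e)).
Proof.
move=> hu hE.
pose Z := S4 (fun a b c e => (\sum_p N p a * u p b c e) * E a b c e).
have -> : S2 (fun p a => N p a * S3 (fun b c e => u p b c e * E a b c e)) = Z.
  rewrite S2_swap; apply: eq_bigr => a _.
  under eq_S3 => b c e do rewrite mulr_suml.
  rewrite -S1_S3; apply: eq_bigr => p _.
  by rewrite -S3Zl; apply: eq_S3 => *; ring.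
rewrite /dot; under eq_S4 => a b c e do rewrite !mulrDl.
rewrite !S4D -/Z.
have -> : S4 (fun a b c e => (\sum_p N p b * u a p c e) * E a b c e) = Z.
  rewrite S4_swap12; apply: eq_S4 => a b c e.
  rewrite (alternating4_perm hE a b c e) mulrN -mulNr -sumrN; congr (_ * _).
  by apply: eq_bigr => p _; rewrite (alternating4_perm hu p b c e) mulrN opprK.
have -> : S4 (fun a b c e => (\sum_p N p c * u a b p e) * E a b c e) = Z.
  rewrite S4_swap23 S4_swap12; apply: eq_S4 => a b c e.
  rewrite (alternating4_perm hE a b c e); congr (_ * _).
  by apply: eq_bigr => p _; rewrite (alternating4_perm hu p b c e).
have -> : S4 (fun a b c e => (\sum_p N p e * u a b c p) * E a b c e) = Z.
  rewrite S4_swap34 S4_swap23 S4_swap12; apply: eq_S4 => a b c e.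
  rewrite (alternating4_perm hE a b c e) mulrN -mulNr -sumrN; congr (_ * _).
  by apply: eq_bigr => p _; rewrite (alternating4_perm hu p b c e) mulrN opprK.
by ring.
Qed.

Lemma S4_sqr_eq0 (u : T4 R) : S4 (fun a b c e => u a b c e * u a b c e) = 0 ->
  forall a b c e, u a b c e = 0.
Proof.
move=> h a b c e.
have p4 x y z t : 0 <= u x y z t * u x y z t by rewrite -expr2 sqr_ge0.
have p3 x y z : 0 <= \sum_t u x y z t * u x y z t by apply: sumr_ge0 => *.
have p2 x y : 0 <= \sum_z \sum_t u x y z t * u x y z t by apply: sumr_ge0 => *.
have p1 x : 0 <= \sum_y \sum_z \sum_t u x y z t * u x y z t by apply: sumr_ge0 => *.
have sum0 (F : I8 -> R) : (forall i, 0 <= F i) -> \sum_i F i = 0 -> forall i, F i = 0.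
  by move=> hp hF i; exact: (psumr_eq0P (fun i _ => hp i) hF).
have /eqP := sum0 _ (p4 a b c) (sum0 _ (p3 a b) (sum0 _ (p2 a) (sum0 _ p1 h a) b) c) e.
by rewrite mulf_eq0 orbb => /eqP.
Qed.

Lemma dot_alternating N (u : T4 R) : alternating4 u -> alternating4 (dot N u).
Proof.
move=> hu x y z t.
have e (f g : I8 -> R) : (forall p, f p = - g p) -> \sum_p f p = - \sum_p g p.
  by move=> h; rewrite -sumrN; apply: eq_bigr.
split; rewrite /dot.
- rewrite (e (fun p => N p y * u p x z t) (fun p => N p y * u x p z t)); last first.
    by move=> p; rewrite (alternating4_perm hu x p z t) mulrN.
  rewrite (e (fun p => N p x * u y p z t) (fun p => N p x * u p y z t)); last first.
    by move=> p; rewrite (alternating4_perm hu p y z t) mulrN.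
  rewrite (e (fun p => N p z * u y x p t) (fun p => N p z * u x y p t)); last first.
    by move=> p; rewrite (alternating4_perm hu x y p t) mulrN.
  rewrite (e (fun p => N p t * u y x z p) (fun p => N p t * u x y z p)); last first.
    by move=> p; rewrite (alternating4_perm hu x y z p) mulrN.
  by ring.
- rewrite (e (fun p => N p x * u p z y t) (fun p => N p x * u p y z t)); last first.
    by move=> p; rewrite (alternating4_perm hu p y z t) mulrN.
  rewrite (e (fun p => N p z * u x p y t) (fun p => N p z * u x y p t)); last first.
    by move=> p; rewrite (alternating4_perm hu x y p t) mulrN.
  rewrite (e (fun p => N p y * u x z p t) (fun p => N p y * u x p z t)); last first.
    by move=> p; rewrite (alternating4_perm hu x p z t) mulrN.
  rewrite (e (fun p => N p t * u x z y p) (fun p => N p t * u x y z p)); last first.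
    by move=> p; rewrite (alternating4_perm hu x y z p) mulrN.
  by ring.
- rewrite (e (fun p => N p x * u p y t z) (fun p => N p x * u p y z t)); last first.
    by move=> p; rewrite (alternating4_perm hu p y z t) mulrN.
  rewrite (e (fun p => N p y * u x p t z) (fun p => N p y * u x p z t)); last first.
    by move=> p; rewrite (alternating4_perm hu x p z t) mulrN.
  rewrite (e (fun p => N p t * u x y p z) (fun p => N p t * u x y z p)); last first.
    by move=> p; rewrite (alternating4_perm hu x y z p) mulrN.
  rewrite (e (fun p => N p z * u x y t p) (fun p => N p z * u x y p t)); last first.
    by move=> p; rewrite (alternating4_perm hu x y p t) mulrN.
  by ring.
Qed.

(** The squared norm of N.phi is a linear combination of the entries of [mX (N.phi)], by
    [dot_ip]. *)
Lemma dot_mX0 N : (forall a b, mX (dot N phi) a b = 0) ->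
  forall a b c e, dot N phi a b c e = 0.
Proof.
move=> h; apply: S4_sqr_eq0; rewrite dot_ip //; last exact: dot_alternating.
rewrite /S2 big1 ?mulr0 // => p _; rewrite big1 // => a _.
by have := h a p; rewrite /mX => ->; rewrite mulr0.
Qed.

Lemma dotB N N' x (u : T4 R) a b c e :
  dot (fun p q => N p q + x * N' p q) u a b c e = dot N u a b c e + x * dot N' u a b c e.
Proof.
rewrite /dot !mulrDr !mulr_sumr.
have h M M' (f : I8 -> R) : \sum_p (M p + x * M' p) * f p =
    \sum_p M p * f p + \sum_p x * (M' p * f p).
  by rewrite -big_split; apply: eq_bigr => p _ /=; ring.
by rewrite !h; ring.
Qed.

Lemma mX_dot_anti N : (forall a b, N b a = - N a b) ->
  forall a b, mX (dot N phi) a b = - 24 * (N a b - 2^-1 * mP N a b).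
Proof.
move=> hN a b; rewrite mX_dot (hN a b) big1; first by field.
by move=> p _; apply: oppr_fix0; exact: hN.
Qed.

(** Among antisymmetric matrices the stabiliser of [phi] is spin(7), the complement of Lambda^2_7;
    so the action only depends on the Lambda^2_7 part. *)
Lemma dot_anti_eq N N' : (forall a b, N b a = - N a b) ->
  (forall a b, N' b a = - N' a b) ->
  (forall a b c e, dot N phi a b c e = dot N' phi a b c e) <->
  (forall a b, N a b - 2^-1 * mP N a b = N' a b - 2^-1 * mP N' a b).
Proof.
move=> hN hN'; split=> h.
  move=> a b; apply: (@mulfI _ (- 24)); first by rewrite oppr_eq0 pnatr_eq0.
  rewrite -!mX_dot_anti //; apply: eq_S3 => p q r.
  by rewrite h.
have hM a b : N b a + -1 * N' b a = - (N a b + -1 * N' a b).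
  by rewrite (hN a b) (hN' a b); ring.
move=> a b c e; apply/eqP; rewrite -subr_eq0; apply/eqP.
transitivity (dot (fun p q => N p q + -1 * N' p q) phi a b c e).
  by rewrite dotB; ring.
apply: dot_mX0 => {a b c e} a b; rewrite mX_dot_anti // mPB; have := h a b; lra.
Qed.

(** By [mX_dot], N |-> mX (N.phi) multiplies traceless symmetric matrices by 24, multiples of the
    identity by 24 + 18 * 8 = 168, and Lambda^2_7 by -24 - 72 = -96. The coefficients invert these
    three factors. *)
Definition inv_mX (X : I8 -> I8 -> R) : I8 -> I8 -> R := fun a b =>
  48^-1 * (X a b + X b a) - 224^-1 * (\sum_p X p p) * d a b
  - 192^-1 * (X a b - X b a).

Lemma mX_inv (X : I8 -> I8 -> R) :
  (forall a b, mP X a b = 3 * (X b a - X a b)) ->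
  forall a b, mX (dot (inv_mX X) phi) a b = X a b.
Proof.
move=> hX a b; rewrite mX_dot.
set tr := \sum_p X p p.
have -> : \sum_p inv_mX X p p = 168^-1 * tr.
  transitivity (\sum_p (24^-1 * X p p - 224^-1 * tr)).
    by apply: eq_bigr => p _; rewrite /inv_mX -/tr dxx; field.
  by rewrite sumrB -mulr_sumr sumr_const card_ord -/tr; field.
have -> : mP (inv_mX X) a b = 96^-1 * (- (3 * (X b a - X a b))).
  have hs : mP (fun p q => 48^-1 * (X p q + X q p) - 224^-1 * tr * d p q) a b = 0.
    by apply: mP_sym => p q; rewrite (eq_sym p q); ring.
  have ht : mP (fun p q => X q p) a b = - mP X a b.
    by rewrite /mP S2_swap -S2N; apply: eq_S2 => p q; rewrite (ph a b p q) mulNr.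
  transitivity (mP (fun p q => 48^-1 * (X p q + X q p) - 224^-1 * tr * d p q) a b
    + - 192^-1 * (mP X a b - mP (fun p q => X q p) a b)).
    by rewrite -S2N -S2D -S2Zl -S2D; apply: eq_S2 => p q; rewrite /inv_mX -/tr; ring.
  by rewrite hs ht hX; field.
by rewrite /inv_mX -/tr (eq_sym b a); field.
Qed.

(** One direction is [J4_mX]. Conversely J4 E = 2 E says that the transpose of [mX E] annihilates
    [phi]; applying [mX] to that relation gives a linear system for X = mX E with only the zero
    solution. *)
Lemma mX_eq0P (E : T4 R) (hE : alternating4 E) :
  (forall a b, mX E a b = 0) <->
  (forall a b c e, 3 * alt4 (fun i j k l => mP (E k l) i j) a b c e = 2 * E a b c e).
Proof.
split=> h.
  have z (f : I8 -> R) q : \sum_p mX E q p * f p = 0.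
    by rewrite big1 // => p _; rewrite h mul0r.
  by move=> a b c e; rewrite J4_mX // /dot !z; ring.
have h0 a b c e : dot (fun p q => mX E q p) phi a b c e = 0.
  by have := h a b c e; rewrite J4_mX //; lra.
have hX a b : mX (dot (fun p q => mX E q p) phi) a b = 0.
  by rewrite /mX /S3 big1 // => p _; rewrite big1 // => q _; rewrite big1 // => r _;
     rewrite h0 mulr0.
have ht : mP (fun p q => mX E q p) =2 fun a b => - mP (mX E) a b.
  by move=> a b; rewrite /mP S2_swap -S2N; apply: eq_S2 => p q; rewrite (ph a b p q) mulNr.
(* 60 = 24 + 36: [mP X] is replaced by 3 (X^T - X). The trace is removed next, then the system for X
   and X^T has determinant 60^2 - 36^2. *)
have hY a b : 60 * mX E a b - 36 * mX E b a + 18 * (\sum_p mX E p p) * d a b = 0.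
  have := hX a b; rewrite mX_dot ht mP_mX //; lra.
have tr0 : \sum_p mX E p p = 0.
  have : \sum_p (24 * mX E p p + 18 * (\sum_q mX E q q)) = 0.
    by apply: big1 => p _; have := hY p p; rewrite dxx; lra.
  by rewrite big_split /= -mulr_sumr sumr_const card_ord; lra.
move=> a b; have := hY a b; have := hY b a; rewrite tr0; lra.
Qed.

End ModelAlgebra.

(** * Signs of index tuples, self-duality and the wedge pairing *)

Section WedgeModel.
Variable R : realType.
Local Notation phi := (Phi0 R).

Definition sg2 (a b : nat) : int := if (a < b)%N then 1 else if (b < a)%N then -1 else 0.

(** The Levi-Civita symbol as a product of the signs of all pairs: it alternates, vanishes on
    repetitions and can be computed without enumerating ['S_8]. *)
Definition tuple_sign (a b c d e f g h : nat) : int :=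
  sg2 a b * sg2 a c * sg2 a d * sg2 a e * sg2 a f * sg2 a g * sg2 a h * sg2 b
  c * sg2 b d * sg2 b e * sg2 b f * sg2 b g * sg2 b h * sg2 c d * sg2 c e *
  sg2 c f * sg2 c g * sg2 c h * sg2 d e * sg2 d f * sg2 d g * sg2 d h * sg2 e
  f * sg2 e g * sg2 e h * sg2 f g * sg2 f h * sg2 g h.

Lemma sg2C a b : sg2 b a = - sg2 a b.
Proof. by rewrite /sg2; case: ltngtP; rewrite ?opprK ?oppr0. Qed.

Lemma tuple_sign_swap a b c d e f g h :
  (tuple_sign b a c d e f g h = - tuple_sign a b c d e f g h) *
  (tuple_sign a c b d e f g h = - tuple_sign a b c d e f g h) *
  (tuple_sign a b d c e f g h = - tuple_sign a b c d e f g h) *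
  (tuple_sign a b c d f e g h = - tuple_sign a b c d e f g h) *
  (tuple_sign a b c d e g f h = - tuple_sign a b c d e f g h) *
  (tuple_sign a b c d e f h g = - tuple_sign a b c d e f g h).
Proof.
by do !split; rewrite /tuple_sign; [rewrite (sg2C a b)|rewrite (sg2C b c)|
  rewrite (sg2C c d)|rewrite (sg2C e f)|rewrite (sg2C f g)|rewrite (sg2C g h)]; ring.
Qed.

(** Permuting the nodes 0, ..., 7 of a Vandermonde matrix multiplies its determinant by the sign of
    the permutation, and the product formula reads that sign off from the pairs. *)
Lemma sign_permE (s : 'S_8) : (-1) ^+ s = tuple_sign (s 0) (s 1) (s 2) (s 3)
   (s 4) (s 5) (s 6) (s 7).
Proof.
pose a : 'rV[int]_8 := \row_i (i : nat)%:Z.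
have hs : \det (Vandermonde 8 (\row_i a 0 (s i))) = (-1) ^+ s * \det (Vandermonde 8 a).
  have -> : Vandermonde 8 (\row_i a 0 (s i)) = col_perm s (Vandermonde 8 a).
    by apply/matrixP => i j; rewrite !mxE.
  by rewrite col_permE det_mulmx det_perm odd_permV mulrC.
move: hs; rewrite !det_Vandermonde => /(congr1 (@sgz int)).
rewrite sgzM.
have -> : sgz (\prod_(i < 8) \prod_(j < 8 | (i < j)%N) (a 0 j - a 0 i)) = 1.
  apply: gtr0_sgz; apply: prodr_gt0 => i _; apply: prodr_gt0 => j ij.
  by rewrite !mxE subr_gt0 ltz_nat.
rewrite mulr1 => h.
transitivity (sgz ((-1) ^+ s : int)); first by case: (odd_perm s).
rewrite -h (big_morph (@sgz int) (@sgzM _) (erefl _)).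
under eq_bigr => i _ do rewrite (big_morph (@sgz int) (@sgzM _) (erefl _)).
have e i j : sgz ((\row_i0 a 0 (s i0)) 0 j - (\row_i0 a 0 (s i0)) 0 i) = sg2 (s i) (s j).
  rewrite !mxE /sg2; case: ltngtP => [h1|h1|->].
  - by rewrite gtr0_sgz // subr_gt0 ltz_nat.
  - by rewrite ltr0_sgz // subr_lt0 ltz_nat.
  - by rewrite subrr sgz0.
under eq_bigr => i _ do under eq_bigr => j _ do rewrite e.
under eq_bigr => i _ do rewrite big_mkcond.
rewrite !big_ord_recl !big_ord0 /= !mulr1 ?mul1r.
rewrite /tuple_sign.
have o1 : (1 : I8) = lift ord0 ord0 by apply: val_inj.
have o2 : (2 : I8) = lift ord0 (lift ord0 ord0) by apply: val_inj.
have o3 : (3 : I8) = lift ord0 (lift ord0 (lift ord0 ord0)) by apply: val_inj.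
have o4 : (4 : I8) = lift ord0 (lift ord0 (lift ord0 (lift ord0 ord0))) by apply: val_inj.
have o5 : (5 : I8) = lift ord0 (lift ord0 (lift ord0 (lift ord0 (lift ord0 ord0)))).
  by apply: val_inj.
have o6 : (6 : I8) =
    lift ord0 (lift ord0 (lift ord0 (lift ord0 (lift ord0 (lift ord0 ord0))))).
  by apply: val_inj.
have o7 : (7 : I8) =
    lift ord0 (lift ord0 (lift ord0 (lift ord0 (lift ord0 (lift ord0 (lift ord0 ord0)))))).
  by apply: val_inj.
have o0 : (0 : I8) = ord0 by apply: val_inj.
rewrite o7 o6 o5 o4 o3 o2 o1 o0 !mulrA; reflexivity.
Qed.

Lemma alternating4_eq0 (u : T4 R) : alternating4 u ->
  (forall a b c e : I8, (a < b < c)%N -> (c < e)%N -> u a b c e = 0) ->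
  forall a b c e, u a b c e = 0.
Proof.
move=> hu h0 a; apply: (alternating3_eq0 (alternating4_3 a hu)) => b c e /andP[bc ce].
have p := alternating4_perm hu a b c e.
have r := phi_rep hu.
have [ab|ba|/val_inj ab] := ltngtP a b; last by rewrite ab r.
  by rewrite h0 ?ab.
have [ac|ca|/val_inj ac] := ltngtP a c; last by rewrite ac r.
  by have := h0 b a c e; rewrite ba ac ce p => /(_ isT isT); lra.
have [ae|ea|/val_inj ae] := ltngtP a e; last by rewrite ae r.
  by have := h0 b c a e; rewrite bc ca ae p => /(_ isT isT); lra.
by have := h0 b c e a; rewrite bc ce ea p => /(_ isT isT); lra.
Qed.

Definition quads : seq (seq nat) :=
  flatten [seq flatten [seq flatten [seq [seq [:: i; j; k; l] | l <- iota k.+1 (7 - k)]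
     | k <- iota j.+1 (7 - j)] | j <- iota i.+1 (7 - i)] | i <- iota 0 8].

Lemma mem_quads (i j k l : I8) : (i < j < k)%N -> (k < l)%N ->
  [:: val i; val j; val k; val l] \in quads.
Proof.
case/andP=> ij jk kl; have [i8 [j8 [k8 l8]]] := (ltn_ord i, (ltn_ord j, (ltn_ord k, ltn_ord l))).
apply/flatten_mapP; exists (val i); first by rewrite mem_iota.
apply/flatten_mapP; exists (val j); first by rewrite mem_iota ij /=; lia.
apply/flatten_mapP; exists (val k); first by rewrite mem_iota jk /=; lia.
by apply: (map_f (fun l => [:: val i; val j; val k; l])); rewrite mem_iota kl /=; lia.
Qed.

Definition self_dual_test (q r : seq nat) : bool :=
  if q is [:: a; b; c; d] then if r is [:: e; f; g; h] then
   let t := tuple_sign a b c d e f g h in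
   (t == 0) || ((t * t == 1) && (phi_int a b c d == t * phi_int e f g h))
  else true else true.

Lemma self_dual_check : all (fun q => all (self_dual_test q) quads) quads.
Proof. by lazy. Qed.

Definition tsign (a b c d e f g h : I8) : R := (tuple_sign a b c d e f g h)%:~R.

Lemma tsign_swap a b c d e f g h :
  (tsign b a c d e f g h = - tsign a b c d e f g h) *
  (tsign a c b d e f g h = - tsign a b c d e f g h) *
  (tsign a b d c e f g h = - tsign a b c d e f g h) *
  (tsign a b c d f e g h = - tsign a b c d e f g h) *
  (tsign a b c d e g f h = - tsign a b c d e f g h) *
  (tsign a b c d e f h g = - tsign a b c d e f g h).
Proof. by do !split; rewrite /tsign -mulrNz; congr (_%:~R); rewrite (tuple_sign_swap a b c d e f g h). Qed.

Lemma tsign_sorted (a b c d e f g h : I8) : (a < b < c)%N -> (c < d)%N ->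
  (e < f < g)%N -> (g < h)%N -> tsign a b c d e f g h = 0 \/
  tsign a b c d e f g h * tsign a b c d e f g h = 1 /\
  phi a b c d = tsign a b c d e f g h * phi e f g h.
Proof.
move=> abc cd efg gh; rewrite !Phi0_int /tsign.
have := allP (allP self_dual_check _ (mem_quads abc cd)) _ (mem_quads efg gh).
rewrite /self_dual_test; case/orP => [/eqP ->|/andP[/eqP s1 /eqP s2]]; first by left; rewrite mulr0z.
by right; rewrite s2 -!intrM s1.
Qed.

Lemma signR_permE (s : 'S_8) : (-1) ^+ s = tsign (s 0) (s 1) (s 2) (s 3)
   (s 4) (s 5) (s 6) (s 7).
Proof. by rewrite /tsign -sign_permE; case: (odd_perm s). Qed.

Opaque Phi0 tsign.

(** Self-duality for arbitrary 8-tuples: the square on the right is 1 on permutations and 0 on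
    tuples with a repetition. *)
Lemma self_dual_tuple (a b c d e f g h : I8) : tsign a b c d e f g h * phi e f g h =
  tsign a b c d e f g h * tsign a b c d e f g h * phi a b c d.
Proof.
have ph := alternating4_perm (Phi0_alternating R).
suff H : forall a b c d : I8, tsign a b c d e f g h * phi e f g h
    - tsign a b c d e f g h * tsign a b c d e f g h * phi a b c d = 0.
  by apply/eqP; rewrite -subr_eq0; apply/eqP; exact: H.
apply: alternating4_eq0 => [x y z w|{}a {}b {}c {}d abc cd].
  by split; rewrite (tsign_swap x y z w) (ph x y z w); ring.
(* The difference is symmetric, not alternating, in [e f g h]. A further factor [tsign] makes it
   alternate, and nothing is lost since the difference vanishes where this factor does. *)
suff H : forall e f g h : I8, tsign a b c d e f g h * (tsign a b c d e f g h * phi e f g h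
     - tsign a b c d e f g h * tsign a b c d e f g h * phi a b c d) = 0.
  have /eqP := H e f g h; rewrite mulf_eq0 => /orP[/eqP ->|/eqP //].
  by rewrite !mul0r subr0.
apply: alternating4_eq0 => [x y z w|{}e {}f {}g {}h efg gh].
  by split; rewrite (tsign_swap _ _ _ _ x y z w) (ph x y z w); ring.
case: (tsign_sorted abc cd efg gh) => [->|[s1 s2]]; first by rewrite mul0r.
by rewrite -s2 s1 mul1r subrr mulr0.
Qed.

Lemma self_dual_perm (s : 'S_8) :
  (-1) ^+ s * phi (s 4) (s 5) (s 6) (s 7) = phi (s 0) (s 1) (s 2) (s 3).
Proof.
have := self_dual_tuple (s 0) (s 1) (s 2) (s 3) (s 4) (s 5) (s 6) (s 7).
by rewrite -signR_permE => ->; rewrite -expr2 sqrr_sign mul1r.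
Qed.

Lemma sum_lift n (k : 'I_n.+1) (H : 'I_n.+1 -> R) : H k = 0 ->
  \sum_(l < n) H (lift k l) = \sum_l H l.
Proof. by move=> h; rewrite (bigD1_ord k) //= h add0r. Qed.

(** Each quadruple of distinct values is taken by 4! permutations, and quadruples with a repetition
    may be added because [G] vanishes on them. *)
Lemma sum_S8_4 (G : T4 R) : (forall a b c e, (a == b) || (a == c) || (a == e) ||
    (b == c) || (b == e) || (c == e) -> G a b c e = 0) ->
  \sum_(s : 'S_8) G (s 0) (s 1) (s 2) (s 3) = 24 * S4 G.
Proof.
move=> hG.
have o1 : (1 : I8) = lift ord0 ord0 by apply: val_inj.
have o2 : (2 : I8) = lift ord0 (lift ord0 ord0) by apply: val_inj.
have o3 : (3 : I8) = lift ord0 (lift ord0 (lift ord0 ord0)) by apply: val_inj.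
have o0 : (0 : I8) = ord0 by apply: val_inj.
rewrite o3 o2 o1 o0 sum_lift_perm mulr_sumr; apply: eq_bigr => i _.
rewrite /S3 mulr_sumr -(sum_lift (k := i)); last first.
  by rewrite big1 ?mulr0 // => k _; rewrite big1 // => l _; rewrite hG // eqxx.
rewrite sum_lift_perm; apply: eq_bigr => j _.
rewrite mulr_sumr -(sum_lift (k := i)); last first.
  by rewrite big1 ?mulr0 // => l _; rewrite hG // eqxx ?orbT.
rewrite -(sum_lift (k := j)); last first.
  by rewrite big1 ?mulr0 // => l _; rewrite hG // eqxx ?orbT.
rewrite sum_lift_perm; apply: eq_bigr => k _.
rewrite mulr_sumr -(sum_lift (k := i)); last by rewrite hG ?mulr0 // eqxx ?orbT.
rewrite -(sum_lift (k := j)); last by rewrite hG ?mulr0 // eqxx ?orbT.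
rewrite -(sum_lift (k := k)); last by rewrite hG ?mulr0 // eqxx ?orbT.
rewrite sum_lift_perm; apply: eq_bigr => l _.
transitivity (\sum_(s : 'S_4) G i (lift i j) (lift i (lift j k)) (lift i (lift j (lift k l)))).
  by apply: eq_bigr => s _; rewrite !(lift_perm_id, lift_perm_lift).
by rewrite sumr_const card_Sn mulr_natl.
Qed.

(** Self-duality absorbs the signs, so that wedging with the model form is the component inner
    product; 24 / (24 * 24) is the factor left. *)
Lemma wedge44_phi (u : T4 R) :
  wedge44 u phi = 24^-1 * S4 (fun a b c e => u a b c e * phi a b c e).
Proof.
rewrite /wedge44.
have -> : \sum_(s : 'S_8) (-1) ^+ s * (u (s 0) (s 1) (s 2) (s 3) *
   phi (s 4) (s 5) (s 6) (s 7)) = \sum_(s : 'S_8) u (s 0) (s 1) (s 2) (s 3) *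
   phi (s 0) (s 1) (s 2) (s 3).
  by apply: eq_bigr => s _; rewrite mulrCA self_dual_perm.
rewrite (sum_S8_4 (G := fun a b c e => u a b c e * phi a b c e)); last first.
  have r := phi_rep (Phi0_alternating R).
  move=> a b c e; do 5!(case/orP; last by move=> /eqP ->; rewrite r mulr0).
  by move=> /eqP ->; rewrite r mulr0.
have -> : 4`!%:R = 24 :> R by [].
by field.
Qed.

(** Exchanging the two blocks of four indices is a product of four transpositions, hence even. *)
Lemma wedge44C (u v : T4 R) : wedge44 u v = wedge44 v u.
Proof.
rewrite /wedge44; congr (_ * _).
pose t : 'S_8 := (tperm (0 : I8)%R (4 : I8)%R * tperm (1 : I8)%R (5 : I8)%R
  * tperm (2 : I8)%R (6 : I8)%R * tperm (3 : I8)%R (7 : I8)%R)%g.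
rewrite (reindex_inj (mulgI t)) /=; apply: eq_bigr => s _.
have -> : (t * s)%g = s :> bool by rewrite odd_permM /t !odd_permM !odd_tperm.
have e k l : t k = l -> (t * s)%g k = s l by rewrite permM => ->.
have te (k l : I8) : (t k == l) = ((tperm (3 : I8) 7 (tperm (2 : I8) 6
   (tperm (1 : I8) 5 (tperm (0 : I8) 4 k)))) == l) by rewrite /t !permM.
rewrite (e 0 4) ?(e 1 5) ?(e 2 6) ?(e 3 7) ?(e 4 0) ?(e 5 1) ?(e 6 2) ?(e 7 3);
  try by apply/eqP; rewrite te !permE.
by congr (_ * _); rewrite mulrC.
Qed.

(** The derivative of the determinant in disguise: a diagonal entry of [N] leaves the alternating
    sum unchanged, whereas an off-diagonal one repeats a value, and composing with the transposition
    of [p] and [q] cancels the sum. *)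
Lemma sum_sign_derivation (N : I8 -> I8 -> R) (F : (I8 -> I8) -> R) :
  \sum_(s : 'S_8) (-1) ^+ s * (\sum_k \sum_p N p (s k) *
      F (fun j => if j == k then p else s j)) =
  (\sum_p N p p) * \sum_(s : 'S_8) (-1) ^+ s * F s.
Proof.
pose U (s : 'S_8) q p := F (fun j => if s j == q then p else s j).
transitivity (\sum_q \sum_p N p q * \sum_(s : 'S_8) (-1) ^+ s * U s q p).
  transitivity (\sum_(s : 'S_8) \sum_q \sum_p N p q * ((-1) ^+ s * U s q p)).
    apply: eq_bigr => s _; rewrite mulr_sumr [RHS](reindex_inj (@perm_inj _ s)) /=.
    apply: eq_bigr => k _; rewrite mulr_sumr; apply: eq_bigr => p _.
    rewrite mulrCA; congr (_ * (_ * _)); rewrite /U; congr F.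
    by apply: boolp.funext => j; rewrite (inj_eq (@perm_inj _ s)).
  rewrite exchange_big; apply: eq_bigr => q _ /=.
  by rewrite exchange_big; apply: eq_bigr => p _ /=; rewrite mulr_sumr.
rewrite mulr_suml; apply: eq_bigr => q _.
rewrite (bigD1 q) //= [X in _ + X]big1 ?addr0 => [|p pq].
  congr (_ * _); apply: eq_bigr => s _; congr (_ * _); rewrite /U; congr F.
  by apply: boolp.funext => j; case: eqP.
suff -> : \sum_(s : 'S_8) (-1) ^+ s * U s q p = 0 by rewrite mulr0.
apply: oppr_fix0; rewrite {1}(reindex_inj (mulIg (tperm p q))) /= -sumrN.
apply: eq_bigr => s _; rewrite odd_permM odd_tperm pq addbT signrN mulNr.
congr (- (_ * _)); rewrite /U; congr F; apply: boolp.funext => j; rewrite permM.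
case: tpermP => [->|->|/eqP h1 /eqP h2].
- by rewrite eqxx (negPf pq).
- by rewrite (negPf pq) eqxx.
- by rewrite (negPf h2).
Qed.

Lemma sum_I8 (V : nmodType) (K : I8 -> V) :
  \sum_k K k = K 0 + K 1 + K 2 + K 3 + K 4 + K 5 + K 6 + K 7.
Proof.
rewrite !big_ord_recl big_ord0 addr0 !addrA.
by do 7?[congr (_ + _)]; congr K; apply: val_inj.
Qed.

(** The Leibniz rule, together with the fact that [N] acts on 8-forms by its trace. *)
Lemma wedge44_dot (N : I8 -> I8 -> R) (u v : T4 R) :
  wedge44 (dot N u) v + wedge44 u (dot N v) = (\sum_p N p p) * wedge44 u v.
Proof.
rewrite /wedge44 -mulrDr -big_split /= [RHS]mulrCA; congr (_ * _).
pose F (f : I8 -> I8) := u (f 0) (f 1) (f 2) (f 3) * v (f 4) (f 5) (f 6) (f 7).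
rewrite -(sum_sign_derivation N F); apply: eq_bigr => s _.
rewrite -mulrDr; congr (_ * _).
rewrite [RHS]sum_I8 /dot /F /=.
have e (x : I8) (G : I8 -> R) y : (\sum_p N p x * G p) * y = \sum_p N p x * (G p * y).
  by rewrite mulr_suml; apply: eq_bigr => p _; rewrite mulrA.
have e' (x : I8) (G : I8 -> R) y : y * (\sum_p N p x * G p) = \sum_p N p x * (y * G p).
  by rewrite mulr_sumr; apply: eq_bigr => p _; rewrite mulrCA.
by rewrite !mulrDl !mulrDr !e !e' -!addrA.
Qed.

End WedgeModel.

(** * Frames *)

Section Pullback.
Variable R : realType.
Implicit Types (A B C D N : 'M[R]_8) (u v : T4 R).

Lemma S1_S4 (f : I8 -> I8 -> I8 -> I8 -> I8 -> R) :
  \sum_i S4 (f i) = S4 (fun p q r s => \sum_i f i p q r s).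
Proof. by rewrite /S4 exchange_big; apply: eq_bigr => p _; rewrite -S1_S3. Qed.

Lemma S4_sum (I : finType) (F : I -> T4 R) :
  S4 (fun p q r w => \sum_s F s p q r w) = \sum_s S4 (F s).
Proof.
rewrite /S4 /S3 [RHS]exchange_big; apply: eq_bigr => p _ /=.
rewrite [RHS]exchange_big; apply: eq_bigr => q _ /=.
rewrite [RHS]exchange_big; apply: eq_bigr => r _ /=.
by rewrite exchange_big.
Qed.

Lemma S3_S4 (f : I8 -> I8 -> I8 -> I8 -> I8 -> I8 -> I8 -> R) :
  S3 (fun a b c => S4 (f a b c)) = S4 (fun p q r s => S3 (fun a b c => f a b c p q r s)).
Proof.
rewrite /S3 -S1_S4; apply: eq_bigr => a _.
rewrite -S1_S4; apply: eq_bigr => b _.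
exact: S1_S4.
Qed.

Lemma S4_S4 (f : I8 -> I8 -> I8 -> I8 -> I8 -> I8 -> I8 -> I8 -> R) :
  S4 (fun a b c d => S4 (f a b c d)) = S4 (fun p q r s => S4 (fun a b c d => f a b c d p q r s)).
Proof. by rewrite [RHS]/S4 -S1_S4; apply: eq_bigr => a _; rewrite S3_S4. Qed.

Lemma S4_prod (f g h k : I8 -> R) : S4 (fun p q r s => f p * g q * h r * k s) =
  (\sum_p f p) * (\sum_p g p) * (\sum_p h p) * (\sum_p k p).
Proof.
rewrite /S4 /S3 -!mulrA mulr_suml; apply: eq_bigr => p _.
rewrite mulr_suml mulr_sumr; apply: eq_bigr => q _.
rewrite mulr_suml !mulr_sumr; apply: eq_bigr => r _.
by rewrite !mulr_sumr; apply: eq_bigr => s _; rewrite !mulrA.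
Qed.

Lemma S4_mul (f g : I8 -> I8 -> I8 -> I8 -> R) :
  S4 f * S4 g = S4 (fun p q r s => S4 (fun x y z t => f p q r s * g x y z t)).
Proof.
by rewrite mulrC -S4Zl; apply: eq_S4 => p q r s; rewrite mulrC -S4Zl.
Qed.

(** A separate matrix for each slot covers pullbacks, raised indices and the terms of [dot] with a
    single composition rule. *)
Definition slots A B C D u : T4 R := fun a b c e =>
  S4 (fun p q r s => A p a * B q b * C r c * D s e * u p q r s).

Lemma pull4_slots A u : pull4 A u = slots A A A A u.
Proof. by []. Qed.

Lemma slots_comp A B C D A' B' C' D' u a b c e :
  slots A B C D (slots A' B' C' D' u) a b c e =
  slots (A' *m A) (B' *m B) (C' *m C) (D' *m D) u a b c e.
Proof.
rewrite /slots; under eq_S4 => p q r s do rewrite -S4Zl.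
rewrite S4_S4; apply: eq_S4 => x y z t.
rewrite !mxE -S4_prod mulrC -S4Zl; apply: eq_S4 => p q r s; ring.
Qed.

Lemma slots1 u a b c e : slots 1%:M 1%:M 1%:M 1%:M u a b c e = u a b c e.
Proof.
have d (i j : I8) : (1%:M : 'M[R]_8) i j = (j == i)%:R by rewrite mxE eq_sym.
rewrite /slots /S4 -[RHS](S1_d a (fun p => u p b c e)); apply: eq_bigr => p _.
rewrite -[u p b c e](S1_d b (fun q => u p q c e)) mulr_sumr; apply: eq_bigr => q _.
rewrite -[u p q c e](S1_d c (fun r => u p q r e)) !mulr_sumr; apply: eq_bigr => r _.
rewrite -[u p q r e](S1_d e (fun s => u p q r s)) !mulr_sumr; apply: eq_bigr => s _.
by rewrite !d; ring.
Qed.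

Lemma eq_slots A B C D u v : (forall a b c e, u a b c e = v a b c e) ->
  forall a b c e, slots A B C D u a b c e = slots A B C D v a b c e.
Proof. by move=> h a b c e; apply: eq_S4 => *; rewrite h. Qed.

Lemma T4_ext u v : (forall a b c e, u a b c e = v a b c e) -> u = v.
Proof.
by move=> h; apply: boolp.funext => a; apply: boolp.funext => b;
   apply: boolp.funext => c; apply: boolp.funext => e.
Qed.

Lemma pull4_comp A B u : pull4 A (pull4 B u) = pull4 (B *m A) u.
Proof. by apply: T4_ext => a b c e; exact: slots_comp. Qed.

Lemma pull4_1 u : pull4 1%:M u = u.
Proof. by apply: T4_ext => a b c e; exact: slots1. Qed.

Lemma dot_slots N u a b c e : dot N u a b c e =
  slots N 1%:M 1%:M 1%:M u a b c e + slots 1%:M N 1%:M 1%:M u a b c e +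
  slots 1%:M 1%:M N 1%:M u a b c e + slots 1%:M 1%:M 1%:M N u a b c e.
Proof.
have d (i j : I8) : (1%:M : 'M[R]_8) i j = (j == i)%:R by rewrite mxE eq_sym.
have h1 (F : T4 R) x y z : S4 (fun p q r s => F p q r s * (x == q)%:R * (y == r)%:R * (z == s)%:R)
   = \sum_p F p x y z.
  apply: eq_bigr => p _.
  rewrite -[RHS](S1_d x (fun q => F p q y z)); apply: eq_bigr => q _.
  rewrite -[F p q y z](S1_d y (fun r => F p q r z)) !mulr_sumr; apply: eq_bigr => r _.
  rewrite -[F p q r z](S1_d z (fun s => F p q r s)) !mulr_sumr; apply: eq_bigr => s _.
  by ring.
rewrite /dot; do !congr (_ + _); rewrite /slots.
- by rewrite -(h1 (fun p q r s => N p a * u p q r s)); apply: eq_S4 => *; rewrite !d; ring.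
- rewrite S4_swap12 -(h1 (fun p q r s => N p b * u q p r s)); apply: eq_S4 => *.
  by rewrite !d; ring.
- rewrite S4_swap23 S4_swap12 -(h1 (fun p q r s => N p c * u q r p s)); apply: eq_S4 => *.
  by rewrite !d; ring.
- rewrite S4_swap34 S4_swap23 S4_swap12 -(h1 (fun p q r s => N p e * u q r s p)).
  by apply: eq_S4 => *; rewrite !d; ring.
Qed.

Lemma slots_lin A B C D u v x a b c e :
  slots A B C D (fun a b c e => u a b c e + x * v a b c e) a b c e =
  slots A B C D u a b c e + x * slots A B C D v a b c e.
Proof. by rewrite /slots -S4Zl -S4D; apply: eq_S4 => *; ring. Qed.

Lemma pull4_dot A N N' u : N *m A = A *m N' -> pull4 A (dot N u) = dot N' (pull4 A u).
Proof.
move=> h; apply: T4_ext => a b c e.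
rewrite [RHS]dot_slots pull4_slots (eq_slots A A A A (dot_slots N u)).
have sD w w' : slots A A A A (fun a b c e => w a b c e + w' a b c e) a b c e =
   slots A A A A w a b c e + slots A A A A w' a b c e.
  by rewrite /slots -S4D; apply: eq_S4 => *; ring.
by rewrite !sD !pull4_slots !slots_comp !mul1mx !mulmx1 h.
Qed.

Lemma prod_I8 (K : I8 -> R) :
  \prod_k K k = K 0 * K 1 * K 2 * K 3 * K 4 * K 5 * K 6 * K 7.
Proof.
rewrite !big_ord_recl big_ord0 mulr1 !mulrA.
by do 7?[congr (_ * _)]; congr K; apply: val_inj.
Qed.

Lemma wedge44_pull A u v : wedge44 (pull4 A u) (pull4 A v) = \det A * wedge44 u v.
Proof.
rewrite /wedge44 [RHS]mulrCA; congr (_ * _).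
pose t (p q r s x y z w : I8) := [tuple p; q; r; s; x; y; z; w].
pose E (l : 8.-tuple I8) : 'M[R]_8 := \matrix_(k, j) (j == tnth l k)%:R.
have EA l : E l *m A = \matrix_(k, j) A (tnth l k) j.
  apply/matrixP => k j; rewrite !mxE -[RHS](S1_d' (tnth l k) (fun p => A p j)).
  by apply: eq_bigr => p _; rewrite mxE.
have sdet (M : 'M[R]_8) : \det M = \sum_(s : 'S_8) (-1) ^+ s * (M 0 (s 0) * M 1 (s 1)
   * M 2 (s 2) * M 3 (s 3) * M 4 (s 4) * M 5 (s 5) * M 6 (s 6) * M 7 (s 7)).
  by apply: eq_bigr => s _; rewrite prod_I8.
have ar (a b c d e f g h x y : R) : a * b * c * d * x * (e * f * g * h * y) =
   a * b * c * d * e * f * g * h * (x * y) by ring.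
(* Each side becomes a sum over 8-tuples of indices, weighted by the determinant of the selected
   rows of [B]. The cases [B = A] and [B = 1] differ by the factor det A, as the determinant is
   multiplicative. *)
have gen (B : 'M[R]_8) : \sum_(s : 'S_8) (-1) ^+ s *
     (S4 (fun p q r w => B p (s 0) * B q (s 1) * B r (s 2) * B w (s 3) * u p q r w) *
      S4 (fun p q r w => B p (s 4) * B q (s 5) * B r (s 6) * B w (s 7) * v p q r w)) =
   S4 (fun p q r w => S4 (fun x y z k => \det (\matrix_(i, j) B (tnth (t p q r w x y z k) i) j)
       * (u p q r w * v x y z k))).
  rewrite [RHS]/S4.
  transitivity (S4 (fun p q r w => S4 (fun x y z k => \sum_(s : 'S_8)
     (-1) ^+ s * (B p (s 0) * B q (s 1) * B r (s 2) * B w (s 3) * B x (s 4) * B y (s 5)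
       * B z (s 6) * B k (s 7) * (u p q r w * v x y z k))))); last first.
    apply: eq_S4 => p q r w; apply: eq_S4 => x y z k.
    rewrite sdet mulr_suml; apply: eq_bigr => s _.
    by rewrite !mxE /t !(tnth_nth p) /= !mulrA.
  under [RHS]eq_S4 => p q r w do rewrite S4_sum.
  rewrite S4_sum; apply: eq_bigr => s _.
  rewrite S4_mul -S4Zl; apply: eq_S4 => p q r w; rewrite -S4Zl.
  by apply: eq_S4 => x y z k; congr (_ * _); exact: ar.
rewrite gen.
have -> : \sum_(s : 'S_8) (-1) ^+ s * (u (s 0) (s 1) (s 2) (s 3) * v (s 4) (s 5) (s 6) (s 7))
  = \sum_(s : 'S_8) (-1) ^+ s * (pull4 1%:M u (s 0) (s 1) (s 2) (s 3)
      * pull4 1%:M v (s 4) (s 5) (s 6) (s 7)) by rewrite !pull4_1.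
rewrite gen -S4Zl; apply: eq_S4 => p q r w; rewrite -S4Zl; apply: eq_S4 => x y z k.
rewrite [RHS]mulrA; congr (_ * _).
rewrite -EA det_mulmx mulrC; congr (_ * _).
by congr (\det _); apply/matrixP => i j; rewrite !mxE eq_sym.
Qed.

End Pullback.

(** * A positive definite matrix recovered from its two-by-two minors *)

Section MetricFromMinors.
Variable R : realType.
Local Notation d x y := ((x == y)%:R : R).
Implicit Types (g : I8 -> I8 -> R) (G : T4 R).

Definition minor2 g : T4 R := fun a b c e => g a c * g b e - g a e * g b c.

Definition third (a b : I8) : I8 := odflt 0 [pick c | (c != a) && (c != b)].

Lemma thirdP a b : (third a b != a) && (third a b != b).
Proof.
rewrite /third; case: pickP => [c //|h].
have : {subset enum I8 <= [:: a; b]}.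
  by move=> c _; rewrite !inE; have := h c; case: (c == a) => //=; case: (c == b).
by move/(uniq_leq_size (enum_uniq _)); rewrite size_enum_ord.
Qed.

(* For a triple of indices, the Gram matrix of the three bivectors is the second
   compound of a 3x3 block D of g, with determinant (det D)^2, and
   its minors give det D times the entries of D. *)
Definition minor_det G (a b c : I8) : R :=
  G a b a b * (G a c a c * G b c b c - G a c b c * G a c b c)
  - G a b a c * (G a b a c * G b c b c - G a c b c * G a b b c)
  + G a b b c * (G a b a c * G a c b c - G a c a c * G a b b c).

Definition minor_num G (a b c : I8) : R :=
  if a == b then G a (third a a) a (third a a) * G a c a c
       - G a (third a a) a c * G a (third a a) a c
  else G a b a b * G b c a c - G b c a b * G a b a c.

Definition minor_entry G (a b : I8) : R :=
  let b' := if a == b then third a a else b in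
  minor_num G a b (third a b') / Num.sqrt (minor_det G a b' (third a b')).

Lemma quadratic3 g (x y z : R) a b c :
  S2 (fun p q => (x * d a p + y * d b p + z * d c p) *
                 (x * d a q + y * d b q + z * d c q) * g p q) =
  x * x * g a a + y * y * g b b + z * z * g c c + x * y * (g a b + g b a)
  + x * z * (g a c + g c a) + y * z * (g b c + g c b).
Proof.
transitivity (S2 (fun p q => d a p * (d a q * (x * x * g p q)) + d a p * (d b q * (x * y * g p q))
  + d a p * (d c q * (x * z * g p q)) + d b p * (d a q * (y * x * g p q))
  + d b p * (d b q * (y * y * g p q)) + d b p * (d c q * (y * z * g p q))
  + d c p * (d a q * (z * x * g p q)) + d c p * (d b q * (z * y * g p q))
  + d c p * (d c q * (z * z * g p q)))); first by apply: eq_S2 => p q; ring.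
by rewrite !S2D !S2_d1 !S1_d; ring.
Qed.

Variable g : I8 -> I8 -> R.
Hypothesis g_sym : forall a b, g a b = g b a.
Hypothesis g_pos : forall x : I8 -> R, (exists p, x p != 0) ->
  0 < S2 (fun p q => x p * x q * g p q).

Let det3 a b c := g a a * (g b b * g c c - g b c * g b c)
  - g a b * (g a b * g c c - g b c * g a c) + g a c * (g a b * g b c - g b b * g a c).

Lemma diag_pos a : 0 < g a a.
Proof.
have -> : g a a = S2 (fun p q => (1 * d a p + 0 * d a p + 0 * d a p) *
    (1 * d a q + 0 * d a q + 0 * d a q) * g p q) by rewrite quadratic3; ring.
apply: (g_pos (x := fun p => _)); exists a; rewrite dxx !mul0r !addr0 mul1r.
exact: oner_neq0.
Qed.

Lemma minor2_pos a b : a != b -> 0 < g a a * g b b - g a b * g a b.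
Proof.
move=> ab; rewrite -(pmulr_rgt0 _ (diag_pos a)).
have -> : g a a * (g a a * g b b - g a b * g a b) = S2 (fun p q =>
   (- g a b * d a p + g a a * d b p + 0 * d b p) *
   (- g a b * d a q + g a a * d b q + 0 * d b q) * g p q).
  by rewrite quadratic3 (g_sym b a); ring.
apply: (g_pos (x := fun p => _)); exists b.
rewrite dxx (negPf ab) mulr0 add0r mulr1 mul0r addr0.
by rewrite gt_eqF // diag_pos.
Qed.

Lemma det3_pos a b c : a != b -> c != a -> c != b -> 0 < det3 a b c.
Proof.
move=> ab ca cb.
(* [x], [y], [z] form the last column of the adjugate of the block, on which the quadratic form
   takes the value z det. *)
pose x := g a b * g b c - g b b * g a c.
pose y := g a b * g a c - g a a * g b c.
pose z := g a a * g b b - g a b * g a b.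
have z0 : 0 < z by exact: minor2_pos.
rewrite -(pmulr_rgt0 _ z0).
have -> : z * det3 a b c = S2 (fun p q => (x * d a p + y * d b p + z * d c p) *
    (x * d a q + y * d b q + z * d c q) * g p q).
  by rewrite quadratic3 (g_sym b a) (g_sym c a) (g_sym c b) /x /y /z /det3; ring.
apply: (g_pos (x := fun p => _)); exists c.
rewrite dxx !(eq_sym _ c) (negPf ca) (negPf cb) !mulr0 !add0r mulr1.
by rewrite gt_eqF.
Qed.

Lemma minor_detE a b c : minor_det (minor2 g) a b c = det3 a b c ^+ 2.
Proof.
rewrite /minor_det /minor2 /det3 (g_sym b a) (g_sym c a) (g_sym c b); ring.
Qed.

Lemma minor_entryE a b : g a b = minor_entry (minor2 g) a b.
Proof.
rewrite /minor_entry minor_detE sqrtr_sqr /minor_num.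
case: eqVneq => [<-|ab].
  have /andP[ba _] := thirdP a a; set b' := third a a in ba *.
  have /andP[ca cb] := thirdP a b'; set c := third a b' in ca cb *.
  have ab : a != b' by rewrite eq_sym; exact: ba.
  have hd := det3_pos ab ca cb.
  rewrite gtr0_norm //; apply: (canRL (mulfK _)); first by rewrite gt_eqF.
  by rewrite /det3 /minor2 (g_sym b' a) (g_sym c a) ?(g_sym c b'); ring.
have /andP[ca cb] := thirdP a b; set c := third a b in ca cb *.
have hd := det3_pos ab ca cb.
rewrite gtr0_norm //; apply: (canRL (mulfK _)); first by rewrite gt_eqF.
by rewrite /det3 /minor2 (g_sym b a) (g_sym c a) ?(g_sym c b); ring.
Qed.

Lemma minor_det_gt0 a b : 0 < minor_det (minor2 g) a (if a == b then third a a else b)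
   (third a (if a == b then third a a else b)).
Proof.
rewrite minor_detE exprn_even_gt0 //=.
have [_|ab] := eqVneq a b; last first.
  by have /andP[ca cb] := thirdP a b; rewrite gt_eqF // det3_pos.
have /andP[ba _] := thirdP a a; have /andP[ca cb] := thirdP a (third a a).
by rewrite gt_eqF // det3_pos // eq_sym.
Qed.

End MetricFromMinors.

Section Frames.
Variable R : realType.
Local Notation d x y := ((x == y)%:R : R).
Implicit Types (A B C D P Q N : 'M[R]_8) (u v : T4 R) (w : T3 R).

Definition sw12 u : T4 R := fun a b c e => u b a c e.
Definition sw23 u : T4 R := fun a b c e => u a c b e.
Definition sw34 u : T4 R := fun a b c e => u a b e c.

Definition sw_word (l : seq nat) u : T4 R :=
  foldr (fun k v => nth sw34 [:: sw12; sw23] k v) u l.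

(* reduced words of the 24 elements of the symmetric group *)
Definition S4_words : seq (seq nat) := [::
   [::]; [:: 2]; [:: 1]; [:: 1; 2]; [:: 2; 1]; [:: 1; 2; 1]; [:: 0]; [:: 0;
   2]; [:: 0; 1]; [:: 0; 1; 2]; [:: 0; 2; 1]; [:: 0; 1; 2; 1]; [:: 1; 0]; [::
   1; 0; 2]; [:: 0; 1; 0]; [:: 0; 1; 0; 2]; [:: 1; 0; 2; 1]; [:: 0; 1; 0; 2;
   1]; [:: 2; 1; 0]; [:: 1; 2; 1; 0]; [:: 0; 2; 1; 0]; [:: 0; 1; 2; 1; 0];
   [:: 1; 0; 2; 1; 0]; [:: 0; 1; 0; 2; 1; 0]].

Lemma alt4_words u a b c e : alt4 u a b c e =
  24^-1 * \sum_(l <- S4_words) (-1) ^+ size l * sw_word l u a b c e.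
Proof.
rewrite alt4E; congr (_ * _); rewrite /S4_words unlock /= /sw12 /sw23 /sw34.
by rewrite !(expr0, exprS) !(mulN1r, mul1r, mulr1, mulrN1, opprK) addr0 -!addrA.
Qed.

Lemma pull4_sw A u :
  (pull4 A (sw12 u) = sw12 (pull4 A u)) * (pull4 A (sw23 u) = sw23 (pull4 A u)) *
  (pull4 A (sw34 u) = sw34 (pull4 A u)).
Proof.
do !split; apply: T4_ext => a b c e.
- by rewrite /sw12 !pull4_slots /slots S4_swap12; apply: eq_S4 => *; ring.
- by rewrite /sw23 !pull4_slots /slots S4_swap23; apply: eq_S4 => *; ring.
- by rewrite /sw34 !pull4_slots /slots S4_swap34; apply: eq_S4 => *; ring.
Qed.

(** Pullback by the same matrix in all slots commutes with the adjacent swaps, and [alt4] is a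
    signed sum of words in them. *)
Lemma pull4_alt4 A u : pull4 A (alt4 u) = alt4 (pull4 A u).
Proof.
apply: T4_ext => a b c e.
have hw l v : pull4 A (sw_word l v) = sw_word l (pull4 A v).
  elim: l => [//|k l IH]; rewrite [sw_word _ _]/= [in RHS]/= -IH.
  have [[h1 h2] h3] := pull4_sw A (sw_word l v).
  by case: k => [|[|k]]; [exact: h1|exact: h2|case: k => [|k]; exact: h3].
rewrite alt4_words; under eq_bigr => l _ do rewrite -hw.
rewrite -[LHS]/(S4 _).
under [LHS]eq_S4 => p q r s do rewrite alt4_words mulrCA mulr_sumr.
rewrite S4Zl; congr (_ * _); elim: S4_words => [|l ls IH].
  rewrite big_nil /S4 big1 // => p _; rewrite /S3 big1 // => q _.
  by rewrite big1 // => r _; rewrite big1 // => t _; rewrite big_nil.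
rewrite big_cons -IH -S4Zl -S4D; apply: eq_S4 => *; rewrite big_cons; ring.
Qed.

(** Used with P = B^T and Q = A, where A is a frame and B its inverse: contracting a raised with a
    lowered index is then a contraction of frame components. *)
Lemma contract_P1 P Q (f h : I8 -> R) : P *m Q^T = 1%:M ->
  \sum_p (\sum_k P k p * f k) * (\sum_l Q l p * h l) = \sum_k f k * h k.
Proof.
move=> PQ; transitivity (\sum_k \sum_l (f k * h l) * ((P *m Q^T) k l)).
  transitivity (\sum_p \sum_k \sum_l f k * h l * (P k p * Q l p)).
    apply: eq_bigr => p _; rewrite mulr_suml; apply: eq_bigr => k _.
    by rewrite mulr_sumr; apply: eq_bigr => l _; ring.
  rewrite exchange_big; apply: eq_bigr => k _ /=; rewrite exchange_big.
  by apply: eq_bigr => l _; rewrite mxE mulr_sumr; apply: eq_bigr => p _; rewrite mxE.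
apply: eq_bigr => k _; rewrite -[RHS](S1_d k (fun l => f k * h l)).
by apply: eq_bigr => l _; rewrite PQ mxE mulrC.
Qed.

Lemma contract_P2 P Q (f h : I8 -> I8 -> R) : P *m Q^T = 1%:M ->
  S2 (fun p q => S2 (fun k l => P k p * P l q * f k l) * S2 (fun k l => Q k p * Q l q * h k l))
  = S2 (fun k l => f k l * h k l).
Proof.
move=> PQ.
transitivity (S2 (fun q k => (\sum_l P l q * f k l) * (\sum_l Q l q * h k l))); last first.
  by rewrite S2_swap; apply: eq_bigr => k _; exact: contract_P1.
rewrite S2_swap; apply: eq_bigr => q _; rewrite -[RHS](contract_P1
  (fun k => \sum_l P l q * f k l) (fun k => \sum_l Q l q * h k l) PQ).
apply: eq_bigr => p _; congr (_ * _); apply: eq_bigr => k _; rewrite mulr_sumr;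
  by apply: eq_bigr => l _; rewrite mulrA.
Qed.

Lemma contract_P3 P Q (f h : T3 R) : P *m Q^T = 1%:M ->
  S3 (fun p q r => S3 (fun k l m => P k p * P l q * P m r * f k l m)
                 * S3 (fun k l m => Q k p * Q l q * Q m r * h k l m))
  = S3 (fun k l m => f k l m * h k l m).
Proof.
move=> PQ.
transitivity (S3 (fun p k l => (\sum_m P m p * f k l m) * (\sum_m Q m p * h k l m))); last first.
  rewrite /S3 S1_S2; apply: eq_bigr => k _; apply: eq_bigr => l _; exact: contract_P1.
rewrite S3_swap23 S3_swap12; apply: eq_bigr => r _; rewrite -[RHS](contract_P2
  (fun k l => \sum_m P m r * f k l m) (fun k l => \sum_m Q m r * h k l m) PQ).
apply: eq_S2 => p q; congr (_ * _); apply: eq_S2 => k l; rewrite mulr_sumr;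
  by apply: eq_bigr => m _; rewrite mulrA.
Qed.

Lemma slots_S2 A B C D u a b c e : slots A B C D u a b c e =
  S2 (fun p q => A p a * B q b * S2 (fun r s => C r c * D s e * u p q r s)).
Proof.
apply: eq_bigr => p _; apply: eq_bigr => q _; rewrite -S2Zl.
by apply: eq_S2 => r s; rewrite !mulrA.
Qed.

Lemma slots_S3 A B C D u a b c e : slots A B C D u a b c e =
  \sum_p A p a * S3 (fun q r s => B q b * C r c * D s e * u p q r s).
Proof. by apply: eq_bigr => p _; rewrite -S3Zl; apply: eq_S3 => *; rewrite !mulrA. Qed.

Lemma slots11 C D u a b c e :
  slots 1%:M 1%:M C D u a b c e = S2 (fun r s => C r c * D s e * u a b r s).
Proof.
have dd (i j : I8) : (1%:M : 'M[R]_8) i j = d j i by rewrite mxE eq_sym.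
rewrite slots_S2; under eq_S2 => p q do rewrite !dd -mulrA.
by rewrite S2_d1 S1_d.
Qed.

Lemma slots111 B C D u a b c e :
  slots 1%:M B C D u a b c e = S3 (fun q r s => B q b * C r c * D s e * u a q r s).
Proof.
have dd (i j : I8) : (1%:M : 'M[R]_8) i j = d j i by rewrite mxE eq_sym.
by rewrite slots_S3; under eq_bigr => p _ do rewrite !dd; rewrite S1_d.
Qed.

Lemma slots_contract2 A1 A2 A3 A4 P Q u v i j k l : P *m Q^T = 1%:M ->
  S2 (fun p q => slots A1 A2 P P u i j p q * slots A3 A4 Q Q v k l p q) =
  slots A1 A2 A3 A4 (fun i j k l => S2 (fun p q => u i j p q * v k l p q)) i j k l.
Proof.
move=> PQ; rewrite slots_S2.
have S22 (f : T4 R) : S2 (fun a b => S2 (f a b)) = S2 (fun c e => S2 (fun a b => f a b c e)).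
  by rewrite [LHS]/S2; under eq_bigr => a _ do rewrite S1_S2; rewrite S1_S2.
pose U a b p q := S2 (fun r s => P r p * P s q * u a b r s).
pose V c e p q := S2 (fun r s => Q r p * Q s q * v c e r s).
transitivity (S2 (fun p q => S2 (fun a b => A1 a i * A2 b j *
    S2 (fun c e => A3 c k * A4 e l * (U a b p q * V c e p q))))).
  apply: eq_S2 => p q; rewrite !slots_S2 mulrC -S2Zl; apply: eq_S2 => a b.
  rewrite mulrCA; congr (_ * _); rewrite mulrC -S2Zl; apply: eq_S2 => c e.
  exact: mulrCA.
rewrite S22; apply: eq_S2 => a b; rewrite S2Zl; congr (_ * _).
rewrite S22; apply: eq_S2 => c e; rewrite S2Zl; congr (_ * _).
exact: (contract_P2 (fun p q => u a b p q) (fun p q => v c e p q) PQ).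
Qed.

Lemma slots_contract3 A1 A2 P Q u v i j : P *m Q^T = 1%:M ->
  S3 (fun p q r => slots A1 P P P u i p q r * slots A2 Q Q Q v j p q r) =
  S2 (fun i' j' => A1 i' i * A2 j' j * S3 (fun p q r => u i' p q r * v j' p q r)).
Proof.
move=> PQ; under eq_S3 => p q r do rewrite !slots_S3 mulr_suml.
rewrite -S1_S3; apply: eq_bigr => a _.
under eq_S3 => p q r do rewrite mulr_sumr.
rewrite -S1_S3; apply: eq_bigr => b _.
by rewrite -(contract_P3 (u a) (v b) PQ) -S3Zl; apply: eq_S3 => p q r; ring.
Qed.

End Frames.

(** * The metric determined by a Cayley form *)

Section CayleyFrames.
Variable R : realType.
Local Notation d x y := ((x == y)%:R : R).
Local Notation phi := (Phi0 R).
Implicit Types (A B N M : 'M[R]_8) (u v E : T4 R) (w : T3 R).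

Let phi_alt := Phi0_alternating R.
Let phi_Q := @Phi0_contract1 R.
Let ph := alternating4_perm phi_alt.

(** (i_a i_b Phi) /\ (i_c i_e Phi) /\ Phi up to normalisation, the analogue for pairs of bivectors
    of the formula by which a G_2-form determines its metric. It is cubic in the form and involves
    no frame. *)
Definition bivectors u : T4 R := fun a b c e =>
  wedge44 (fun i j k l => u a b i j * u c e k l) u.

Lemma bivectors_phi a b c e :
  bivectors phi a b c e = - (d a c * d b e - d a e * d b c) + 7 / 6 * phi a b c e.
Proof.
rewrite /bivectors wedge44_phi.
have -> : S4 (fun i j k l => phi a b i j * phi c e k l * phi i j k l) =
   S2 (fun k l => phi c e k l * S2 (fun i j => phi a b i j * phi k l i j)).
  transitivity (S2 (fun i j => S2 (fun k l => phi a b i j * phi c e k l * phi i j k l))) => //.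
  transitivity (S2 (fun k l => S2 (fun i j => phi a b i j * phi c e k l * phi i j k l))).
    by rewrite [LHS]/S2; under eq_bigr => i _ do rewrite S1_S2; rewrite S1_S2.
  apply: eq_S2 => k l; rewrite -S2Zl; apply: eq_S2 => i j.
  by rewrite (ph i j k l); ring.
under eq_S2 => k l do rewrite (contract2 phi_alt phi_Q).
transitivity (24^-1 * S2 (fun k l => d a k * (d b l * (6 * phi c e k l))
   - d b k * (d a l * (6 * phi c e k l)) - 4 * (phi c e k l * phi a b k l))).
  by congr (_ * _); apply: eq_S2 => k l; ring.
rewrite !(S2D, S2N) !S2_d1 !S1_d S2Zl (contract2 phi_alt phi_Q).
by rewrite !(ph a b c e) !(eq_sym _ a) !(eq_sym _ b); field.
Qed.

Lemma wedge44_sum_l (F : I8 -> I8 -> I8 -> I8 -> T4 R) (k : T4 R) v :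
  wedge44 (fun a b c e => S4 (fun p q r s => k p q r s * F p q r s a b c e)) v =
  S4 (fun p q r s => k p q r s * wedge44 (F p q r s) v).
Proof.
rewrite /wedge44.
under [RHS]eq_S4 => p q r s do rewrite mulrCA mulr_sumr.
rewrite S4Zl; congr (_ * _); rewrite S4_sum; apply: eq_bigr => t _.
rewrite mulrC -!mulrA mulrC -S4Zl; apply: eq_S4 => p q r s.
have ar (x y z k' : R) : x * y * (z * k') = z * (y * (k' * x)) by ring.
exact: ar.
Qed.

Lemma S2_mul (f g : I8 -> I8 -> R) :
  S2 f * S2 g = S4 (fun p q r s => f p q * g r s).
Proof.
rewrite mulrC -S2Zl; apply: eq_bigr => p _; apply: eq_bigr => q _.
by rewrite mulrC -S2Zl.
Qed.

Lemma bivectors_pull A u : bivectors (pull4 A u) = fun a b c e =>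
  \det A * pull4 A (bivectors u) a b c e.
Proof.
apply: T4_ext => a b c e; rewrite /bivectors.
have -> : (fun i j k l => pull4 A u a b i j * pull4 A u c e k l) = fun i j k l =>
   S4 (fun p q r s => A p a * A q b * A r c * A s e *
     pull4 A (fun i j k l => u p q i j * u r s k l) i j k l).
  apply: T4_ext => i j k l; rewrite !pull4_slots !slots_S2 S2_mul.
  apply: eq_S4 => p q r s; rewrite pull4_slots slots_S2.
  transitivity (A p a * A q b * A r c * A s e *
    (S2 (fun r s => A r i * A s j * u p q r s) * S2 (fun r0 s0 => A r0 k * A s0 l * u r s r0 s0))).
    by ring.
  congr (_ * _); rewrite S2_mul; apply: eq_bigr => x _; apply: eq_bigr => y _.
  by rewrite -S2Zl; apply: eq_S2 => z t; ring.
rewrite wedge44_sum_l -[in RHS]S4Zl; apply: eq_S4 => p q r s.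
by rewrite wedge44_pull; ring.
Qed.

Lemma phi_unitvol : vol phi = 1.
Proof.
rewrite /vol wedge44_phi.
have -> : S4 (fun a b c e => phi a b c e * phi a b c e) = 336.
  transitivity (\sum_(a : I8) (42 : R)).
    by apply: eq_bigr => a _; rewrite (contract3 phi_alt phi_Q) dxx mulr1.
  by rewrite sumr_const card_ord; ring.
by field.
Qed.

Lemma vol_pull A u : vol (pull4 A u) = \det A * vol u.
Proof. by rewrite /vol wedge44_pull -mulrA. Qed.

(** Dividing by the volume removes the density weight det A of [bivectors]; the term 7/6 cancels the
    multiple of the form found in [bivectors_phi]. What remains are the 2 x 2 minors of the
    metric. *)
Definition cayley_minors u : T4 R := fun a b c e =>
  7 / 6 * u a b c e - bivectors u a b c e / vol u.

Lemma cayley_minorsE A : A \in unitmx ->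
  forall a b c e, cayley_minors (pull4 A phi) a b c e = minor2 (A^T *m A) a b c e.
Proof.
rewrite unitmxE unitfE => dA a b c e.
rewrite /cayley_minors bivectors_pull vol_pull phi_unitvol mulr1.
rewrite (mulrAC (\det A)) divff // mul1r.
rewrite (_ : bivectors phi = fun a b c e =>
    - (d a c * d b e - d a e * d b c) + 7 / 6 * phi a b c e); last first.
  by apply: T4_ext => *; exact: bivectors_phi.
have h : S4 (fun p q r s => A p a * A q b * A r c * A s e * (d p r * d q s)) =
     (A^T *m A) a c * (A^T *m A) b e.
  transitivity (S2 (fun p q => (A p a * A p c) * (A q b * A q e))).
    apply: eq_S2 => p q.
    transitivity (S2 (fun r s => d p r * (d q s * (A p a * A q b * A r c * A s e)))).
      by apply: eq_S2 => *; ring.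
    by rewrite S2_d1 S1_d; ring.
  rewrite !mxE mulr_suml; apply: eq_bigr => p _.
  by rewrite mulr_sumr; apply: eq_bigr => q _; rewrite !mxE.
have h' : S4 (fun p q r s => A p a * A q b * A r c * A s e * (d p s * d q r)) =
     (A^T *m A) a e * (A^T *m A) b c.
  transitivity (S2 (fun p q => (A p a * A p e) * (A q b * A q c))).
    apply: eq_S2 => p q.
    transitivity (S2 (fun r s => d q r * (d p s * (A p a * A q b * A r c * A s e)))).
      by apply: eq_S2 => *; ring.
    by rewrite S2_d1 S1_d; ring.
  rewrite !mxE mulr_suml; apply: eq_bigr => p _.
  by rewrite mulr_sumr; apply: eq_bigr => q _; rewrite !mxE.
rewrite /minor2 -h -h' !pull4_slots /slots -S4Zl -!S4N -!S4D.
by apply: eq_S4 => *; ring.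
Qed.

Lemma gram_sym A a b : (A^T *m A) a b = (A^T *m A) b a.
Proof. by rewrite !mxE; apply: eq_bigr => p _; rewrite !mxE mulrC. Qed.

Lemma gram_pos A : A \in unitmx -> forall x : I8 -> R, (exists p, x p != 0) ->
  0 < S2 (fun p q => x p * x q * (A^T *m A) p q).
Proof.
move=> Au x [p0 xp0].
have -> : S2 (fun p q => x p * x q * (A^T *m A) p q) = \sum_k (\sum_p A k p * x p) ^+ 2.
  transitivity (\sum_k S2 (fun p q => (A k p * x p) * (A k q * x q))).
    rewrite S1_S2; apply: eq_S2 => p q; rewrite !mxE mulr_sumr.
    by apply: eq_bigr => k _; rewrite !mxE; ring.
  apply: eq_bigr => k _; rewrite expr2 mulr_suml; apply: eq_bigr => p _.
  by rewrite mulr_sumr.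
rewrite lt_neqAle; apply/andP; split; last by apply: sumr_ge0 => k _; rewrite sqr_ge0.
apply: contraNneq xp0 => /esym h.
have h0 k : \sum_p A k p * x p = 0.
  have /eqP := psumr_eq0P (fun i (_ : true) => sqr_ge0 (\sum_p A i p * x p)) h (i := k) isT.
  by rewrite sqrf_eq0 => /eqP.
have Ax : A *m \col_p x p = 0.
  apply/matrixP => k j; rewrite !mxE -[RHS](h0 k); apply: eq_bigr => p _.
  by rewrite !mxE.
have := congr1 (mulmx (invmx A)) Ax; rewrite mulmxA mulVmx // mul1mx mulmx0.
by move/matrixP/(_ p0 0); rewrite !mxE => ->.
Qed.

Lemma gram_entry A : A \in unitmx -> forall a b,
  (A^T *m A) a b = minor_entry (cayley_minors (pull4 A phi)) a b.
Proof.
move=> Au a b; rewrite (minor_entryE (gram_sym A) (gram_pos Au)).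
by congr (minor_entry _ a b); apply: T4_ext => *; rewrite cayley_minorsE.
Qed.

(** The Gram matrix of any frame is a function of the form by [gram_entry], so the choice made in
    [metric] has only one possible value. *)
Lemma metric_pull A : A \in unitmx -> metric (pull4 A phi) = A^T *m A.
Proof.
move=> Au; rewrite /metric; case: xgetP => [g -> [C [Cu e ->]]|/(_ (A^T *m A))].
  by apply/matrixP => a b; rewrite !gram_entry // e.
by case; exists A.
Qed.

Lemma cayley_metric u : cayley u -> forall a b, metric u a b = minor_entry (cayley_minors u) a b.
Proof. by case=> A Au -> a b; rewrite metric_pull // gram_entry. Qed.

Lemma cayley_minor_det u : cayley u -> forall a b, 0 < minor_det (cayley_minors u) a
   (if a == b then third a a else b) (third a (if a == b then third a a else b)).
Proof.
case=> A Au -> a b.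
rewrite (_ : cayley_minors _ = minor2 (A^T *m A)); last first.
  by apply: T4_ext => *; rewrite cayley_minorsE.
exact: (minor_det_gt0 (gram_sym A) (gram_pos Au)).
Qed.

Lemma ginv_pull A : A \in unitmx -> ginv (pull4 A phi) = invmx A *m (invmx A)^T.
Proof.
move=> Au; rewrite /ginv metric_pull //.
have uAA : A^T *m A \in unitmx by rewrite unitmx_mul unitmx_tr Au.
apply: (can_inj (mulKmx uAA)); rewrite mulmxV //.
by rewrite -mulmxA (mulmxA A) mulmxV // mul1mx -trmx_mul mulVmx // trmx1.
Qed.

End CayleyFrames.

(** * The components of 2-forms and 4-forms in a frame *)

Section FrameForms.
Variable R : realType.
Local Notation d x y := ((x == y)%:R : R).
Local Notation phi := (Phi0 R).
Implicit Types (N M : 'M[R]_8) (u v E : T4 R) (w : T3 R).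

Let phi_alt := Phi0_alternating R.
Let phi_Q := @Phi0_contract1 R.
Let ph := alternating4_perm phi_alt.

Definition mat (f : I8 -> I8 -> R) : 'M[R]_8 := \matrix_(i, j) f i j.

Lemma mat_conj (A : 'M[R]_8) (f : I8 -> I8 -> R) a b :
  (A^T *m mat f *m A) a b = S2 (fun i j => A i a * A j b * f i j).
Proof.
rewrite /S2 exchange_big !mxE; apply: eq_bigr => j _ /=.
rewrite !mxE mulr_suml; apply: eq_bigr => i _.
by rewrite !mxE; ring.
Qed.

Lemma matE (M : 'M[R]_8) : mat M = M.
Proof. by apply/matrixP => i j; rewrite mxE. Qed.

Lemma mx_conj (A M : 'M[R]_8) a b :
  (A^T *m M *m A) a b = S2 (fun i j => A i a * A j b * M i j).
Proof. by rewrite -{1}(matE M) mat_conj. Qed.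

Lemma alternating4_neg u : alternating4 u <->
  (sw12 u = fun a b c e => - u a b c e) /\ (sw23 u = fun a b c e => - u a b c e)
  /\ (sw34 u = fun a b c e => - u a b c e).
Proof.
split=> [h|[h1 [h2 h3]] a b c e].
  by do !split; apply: T4_ext => a b c e; case: (h a b c e).
by split; [rewrite -[LHS]/(sw12 u a b c e) h1|rewrite -[LHS]/(sw23 u a b c e) h2
  |rewrite -[LHS]/(sw34 u a b c e) h3].
Qed.

Lemma pull4_alternating (A : 'M[R]_8) u : alternating4 u -> alternating4 (pull4 A u).
Proof.
case/alternating4_neg => h1 [h2 h3]; apply/alternating4_neg.
have pN : pull4 A (fun a b c e => - u a b c e) = fun a b c e => - pull4 A u a b c e.
  by apply: T4_ext => a b c e; rewrite !pull4_slots /slots -S4N; apply: eq_S4 => *; ring.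
have [[p1 p2] p3] := pull4_sw A u.
by rewrite -p1 -p2 -p3 h1 h2 h3 pN.
Qed.

Lemma up2_slots u (G := (ginv u)^T) : up2 u = slots 1%:M 1%:M G G u.
Proof.
apply: T4_ext => a b p q; rewrite slots11.
by apply: eq_S2 => k l; rewrite !mxE.
Qed.

Lemma up3_slots u (G := (ginv u)^T) : up3 u = slots 1%:M G G G u.
Proof.
apply: T4_ext => a p q r; rewrite slots111.
by apply: eq_S3 => k l m; rewrite !mxE.
Qed.

Lemma up4_slots u (G := (ginv u)^T) : up4 u = slots G G G G u.
Proof.
by apply: T4_ext => p q r s; apply: eq_S4 => k l m n; rewrite !mxE.
Qed.

Definition J4_phi v : T4 R := fun a b c e => 3 * alt4 (fun i j k l => mP phi (v k l) i j) a b c e.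

(** [J4_mX] on forms N.phi. The factors k = 168, 96, 24 of the identity, Lambda^2_7 and the
    traceless symmetric matrices give the eigenvalues -12, -6 and 0. *)
Lemma J4_dot k (N : I8 -> I8 -> R) :
  (forall a b, mX phi (dot N phi) a b = k * N b a) ->
  forall a b c e, J4_phi (dot N phi) a b c e = (2 - k / 12) * dot N phi a b c e.
Proof.
move=> h a b c e; rewrite /J4_phi (J4_mX phi_alt phi_Q); last exact: dot_alternating.
have -> : dot (fun p q => mX phi (dot N phi) q p) phi a b c e = k * dot N phi a b c e.
  rewrite /dot !mulrDr !mulr_sumr; do !congr (_ + _); apply: eq_bigr => p _;
  by rewrite h mulrA.
by field.
Qed.

(** The Leibniz rule moves [N] from [phi] to [E] at the cost of a trace, and self-duality evaluates
    both remaining wedges by [mX E]. *)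
Lemma wedge44_dot_phi (N : I8 -> I8 -> R) E : alternating4 E ->
  wedge44 (dot N phi) E = 24^-1 * ((\sum_p N p p) * (\sum_p mX phi E p p)
     - 4 * S2 (fun p a => N p a * mX phi E p a)).
Proof.
move=> hE.
have h0 : wedge44 phi E = 24^-1 * \sum_p mX phi E p p.
  rewrite wedge44C wedge44_phi; congr (_ * _); apply: eq_bigr => p _.
  by apply: eq_S3 => *; rewrite mulrC.
have h1 : wedge44 phi (dot N E) = 24^-1 * (4 * S2 (fun p a => N p a * mX phi E p a)).
  rewrite wedge44C wedge44_phi (dot_ip N hE phi_alt); do 2!congr (_ * _).
  by apply: eq_S2 => p a; congr (_ * _); apply: eq_S3 => *; rewrite mulrC.
have := wedge44_dot N phi E; rewrite h0 h1 => /(canRL (addrK _)) ->.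
by rewrite mulrBr [in RHS]mulrCA.
Qed.

Variable A : 'M[R]_8.
Hypothesis Au : A \in unitmx.
Let B := invmx A.
Let u := pull4 A phi.

Let AG : A *m (ginv u)^T = B^T.
Proof. by rewrite ginv_pull // trmx_mul trmxK mulmxA mulmxV // mul1mx. Qed.

Let BA : B^T *m A^T = 1%:M.
Proof. by rewrite -trmx_mul mulmxV // trmx1. Qed.

Lemma u_alternating : alternating4 u.
Proof. exact: pull4_alternating. Qed.

Lemma up2_frame : up2 u = slots A A B^T B^T phi.
Proof.
rewrite up2_slots; apply: T4_ext => a b p q.
by rewrite slots_comp !mulmx1 AG.
Qed.

Lemma up3_frame : up3 u = slots A B^T B^T B^T phi.
Proof.
rewrite up3_slots; apply: T4_ext => a b p q.
by rewrite slots_comp !mulmx1 AG.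
Qed.

Lemma up4_frame : up4 u = slots B^T B^T B^T B^T phi.
Proof.
rewrite up4_slots; apply: T4_ext => a b p q.
by rewrite slots_comp AG.
Qed.

Lemma pull4K v : pull4 A (pull4 B v) = v.
Proof. by rewrite pull4_comp mulVmx // pull4_1. Qed.

Lemma pull4VK v : pull4 B (pull4 A v) = v.
Proof. by rewrite pull4_comp mulmxV // pull4_1. Qed.

Lemma pull4_eq0 v : (forall a b c e, pull4 A v a b c e = 0) -> forall a b c e, v a b c e = 0.
Proof.
move=> h a b c e; rewrite -(pull4VK v) (_ : pull4 A v = fun _ _ _ _ => 0); last exact: T4_ext.
by rewrite pull4_slots /slots /S4 big1 // => *; rewrite /S3 big1 // => *;
   rewrite big1 // => *; rewrite big1 // => *; rewrite mulr0.
Qed.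

Lemma J2_frame M : J2 u (A^T *m M *m A) = A^T *m (2^-1 *: mat (mP phi M)) *m A.
Proof.
apply/matrixP => i j; rewrite -scalemxAr -scalemxAl mxE [RHS]mxE mat_conj.
rewrite -[X in _ * X = _]/(S2 _); congr (_ * _).
under eq_S2 => a b do rewrite mx_conj.
have := @slots_contract2 R A A 1%:M 1%:M B^T A phi (fun i j k l => M k l) i j i j BA.
rewrite -up2_frame => e.
transitivity (S2 (fun p q => up2 u i j p q * slots 1%:M 1%:M A A (fun _ _ k l => M k l) i j p q)).
  by apply: eq_S2 => p q; rewrite slots11.
rewrite e slots_S2; apply: eq_S2 => p q; congr (_ * _).
have -> : S2 (fun r s => (1%:M : 'M[R]_8) r i * (1%:M : 'M[R]_8) s j *
     S2 (fun p0 q0 => phi p q p0 q0 * M p0 q0)) = mP phi M p q.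
  have dd (x y : I8) : (1%:M : 'M[R]_8) x y = d y x by rewrite mxE eq_sym.
  by under eq_S2 => r s do rewrite !dd -mulrA; rewrite S2_d1 S1_d.
by [].
Qed.

Lemma J4_frame v : J4 u (pull4 A v) =
  pull4 A (fun a b c e => 3 * alt4 (fun i j k l => mP phi (v k l) i j) a b c e).
Proof.
have -> : pull4 A (fun a b c e => 3 * alt4 (fun i j k l => mP phi (v k l) i j) a b c e) =
  fun a b c e => 3 * pull4 A (alt4 (fun i j k l => mP phi (v k l) i j)) a b c e.
  by apply: T4_ext => a b c e; rewrite !pull4_slots /slots -S4Zl; apply: eq_S4 => *; ring.
rewrite pull4_alt4; apply: T4_ext => a b c e; rewrite /J4; congr (_ * _).
apply: eq_alt4 => i j k l.
rewrite -[LHS]/(S2 _) up2_frame pull4_slots slots_contract2 //.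
Qed.

Definition con_up3 u E : 'M[R]_8 := mat (fun a b => S3 (fun p q r => up3 u b p q r * E a p q r)).

Lemma con_up3_frame v : con_up3 u (pull4 A v) = A^T *m mat (mX phi v) *m A.
Proof.
apply/matrixP => a b; rewrite mat_conj mxE up3_frame pull4_slots slots_contract3 //.
by rewrite S2_swap; apply: eq_S2 => i j; congr (_ * _); exact: mulrC.
Qed.

Lemma J4_eigen_frame k v : alternating4 v ->
  J4_eigen k u (pull4 A v) <-> forall a b c e, J4_phi v a b c e = k * v a b c e.
Proof.
move=> hv.
have kE : (fun a b c e => k * pull4 A v a b c e) = pull4 A (fun a b c e => k * v a b c e).
  by apply: T4_ext => a b c e; rewrite !pull4_slots /slots -S4Zl; apply: eq_S4 => *; ring.
split=> [[_ h] a b c e|h]; last first.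
  split=> [|a b c e]; first exact: pull4_alternating.
  rewrite J4_frame (_ : (fun a b c e => 3 * _) = fun a b c e => k * v a b c e); last first.
    by apply: T4_ext.
  by rewrite -kE.
have e1 : pull4 A (J4_phi v) = pull4 A (fun a b c e => k * v a b c e).
  by rewrite -J4_frame -kE; apply: T4_ext.
by rewrite -(pull4VK (J4_phi v)) e1 pull4VK.
Qed.

Lemma conj_eq0 (f : I8 -> I8 -> R) : A^T *m mat f *m A = 0 <-> forall a b, f a b = 0.
Proof.
split=> h.
  have := congr1 (fun M => B^T *m M *m B) h; rewrite mulmx0 mul0mx.
  rewrite !mulmxA BA mul1mx -mulmxA mulmxV // mulmx1 => hf a b.
  by have := congr1 (fun M : 'M[R]_8 => M a b) hf; rewrite !mxE.
rewrite (_ : mat f = 0) ?mulmx0 ?mul0mx //.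
by apply/matrixP => a b; rewrite !mxE.
Qed.

Lemma Lambda4_27P E : alternating4 E -> Lambda4_27 u E <-> con_up3 u E = 0.
Proof.
move=> hE; rewrite -{1 2}(pull4K E) con_up3_frame conj_eq0.
have hE' : alternating4 (pull4 B E) by exact: pull4_alternating.
rewrite /Lambda4_27 J4_eigen_frame //.
exact: iff_sym (mX_eq0P phi_alt phi_Q hE').
Qed.

Lemma dot_frame (N : 'M[R]_8) : dot N u = pull4 A (dot (A *m N *m B) phi).
Proof. by symmetry; apply: pull4_dot; rewrite -!mulmxA mulVmx // mulmx1. Qed.

Lemma dot_frameV (f : I8 -> I8 -> R) : pull4 A (dot f phi) = dot (B *m mat f *m A) u.
Proof.
rewrite dot_frame; congr (pull4 A); apply: T4_ext => a b c e.
have -> : A *m (B *m mat f *m A) *m B = mat f.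
  by rewrite !mulmxA mulmxV // mul1mx -mulmxA mulmxV // mulmx1.
by rewrite /dot; do !congr (_ + _); apply: eq_bigr => p _; rewrite mxE.
Qed.

Lemma mP_tr (f : I8 -> I8 -> R) a b : mP phi (fun p q => f q p) a b = - mP phi f a b.
Proof. by rewrite /mP S2_swap -S2N; apply: eq_S2 => p q; rewrite (ph a b p q) mulNr. Qed.

(** The hypothesis says that the antisymmetric part of [f] lies in Lambda^2_7. The identity,
    antisymmetric and traceless symmetric parts [f1], [f7], [f35] land in the three eigenspaces by
    [J4_dot]. *)
Lemma dot_Lambda4_1_7_35 (f : I8 -> I8 -> R) :
  (forall a b, mP phi f a b = 3 * (f b a - f a b)) -> Lambda4_1_7_35 u (pull4 A (dot f phi)).
Proof.
move=> hf; set tr := \sum_p f p p.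
pose f1 (a b : I8) := 8^-1 * tr * d a b.
pose f7 a b := 2^-1 * (f a b - f b a).
pose f35 a b := 2^-1 * (f a b + f b a) + -1 * f1 a b.
have alt g : alternating4 (dot g phi) by exact: dot_alternating.
have s1 a b : f1 b a = f1 a b by rewrite /f1 eq_sym.
have tr1 : \sum_p f1 p p = tr.
  transitivity (\sum_(p < 8) 8^-1 * tr).
    by apply: eq_bigr => p _; rewrite /f1 dxx mulr1.
  by rewrite sumr_const card_ord; field.
have tr7 : \sum_p f7 p p = 0 by apply: big1 => p _; rewrite /f7 subrr mulr0.
have tr35 : \sum_p f35 p p = 0.
  transitivity (\sum_p f p p - \sum_p f1 p p); last by rewrite tr1 subrr.
  by rewrite -sumrB; apply: eq_bigr => p _; rewrite /f35; field.
have P1 a b : mP phi f1 a b = 0 by exact: mP_sym.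
have P35 a b : mP phi f35 a b = 0.
  by apply: mP_sym => // x y; rewrite /f35 (s1 x y); ring.
have P7 a b : mP phi f7 a b = - 6 * f7 a b.
  have -> : mP phi f7 a b = 2^-1 * (mP phi f a b - mP phi (fun p q => f q p) a b).
    by rewrite -S2N -S2D -S2Zl; apply: eq_S2 => p q; rewrite /f7; ring.
  by rewrite (mP_tr f) hf /f7; field.
exists (pull4 A (dot f1 phi)), (pull4 A (dot f7 phi)), (pull4 A (dot f35 phi)); split.
- apply/J4_eigen_frame => // a b c e; rewrite (J4_dot (k := 168)); first by field.
  by move=> x y; rewrite (mX_dot phi_alt phi_Q) tr1 P1 /f1 (eq_sym y x); field.
- apply/J4_eigen_frame => // a b c e; rewrite (J4_dot (k := 96)); first by field.
  by move=> x y; rewrite (mX_dot phi_alt phi_Q) tr7 P7 /f7; field.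
- apply/J4_eigen_frame => // a b c e; rewrite (J4_dot (k := 24)); first by field.
  by move=> x y; rewrite (mX_dot phi_alt phi_Q) tr35 P35; ring.
apply: T4_ext => a b c e; rewrite !pull4_slots /slots -!S4D; apply: eq_S4 => p q r s.
rewrite -!mulrDr; congr (_ * _).
have -> : dot f1 phi p q r s + dot f7 phi p q r s + dot f35 phi p q r s =
  dot (fun a b => (f1 a b + 1 * f7 a b) + 1 * f35 a b) phi p q r s.
  by rewrite !dotB; ring.
rewrite /dot; do !congr (_ + _); apply: eq_bigr => x _; congr (_ * _);
  by rewrite /f35 /f7; field.
Qed.

(** In the frame this is [mP_mX]: the eigenvalue -6 of [mP] is the eigenvalue -3 of [J2]. *)
Lemma asym_Lambda2_7 E : alternating4 E -> Lambda2_7 u (asym_part (con_up3 u E)).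
Proof.
move=> hE; have hE' : alternating4 (pull4 B E) by exact: pull4_alternating.
pose X := mX phi (pull4 B E).
have -> : asym_part (con_up3 u E) = A^T *m mat (fun a b => 2^-1 * (X a b - X b a)) *m A.
  rewrite /asym_part -(pull4K E) con_up3_frame !trmx_mul trmxK mulmxA.
  rewrite -mulmxBl -mulmxBr scalemxAl scalemxAr; congr (_ *m _ *m _).
  by apply/matrixP => a b; rewrite !mxE.
split.
  rewrite !trmx_mul trmxK mulmxA -mulNmx -mulmxN; congr (_ *m _ *m _).
  by apply/matrixP => a b; rewrite !mxE; ring.
rewrite J2_frame scalemxAl scalemxAr; congr (_ *m _ *m _).
apply/matrixP => a b; rewrite !mxE.
have -> : mP phi (mat (fun a b => 2^-1 * (X a b - X b a))) a b =
    2^-1 * (mP phi X a b - mP phi (fun p q => X q p) a b).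
  by rewrite -S2N -S2D -S2Zl; apply: eq_S2 => p q; rewrite mxE; ring.
have hX : mP phi X a b = 3 * (X b a - X a b) by exact: mP_mX.
by rewrite (mP_tr X) hX; field.
Qed.

Lemma wedge44_dot_frame (N : 'M[R]_8) v : alternating4 v ->
  wedge44 (dot N u) (pull4 A v) = vol u * (24^-1 * (\tr N * (\sum_p mX phi v p p)
     - 4 * S2 (fun p a => (A *m N *m B) p a * mX phi v p a))).
Proof.
move=> hv; rewrite dot_frame wedge44_pull wedge44_dot_phi // vol_pull phi_unitvol mulr1.
by congr (_ * (_ * (_ * _ - _))); rewrite -[LHS]/(\tr _) mxtrace_mulC mulmxA mulVmx // mul1mx.
Qed.

(** The witness N.phi has N = [inv_mX (mX E)], so that it has the same contraction [mX] as [E], and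
    their difference lies in the kernel Lambda^4_27. *)
Lemma proj_1_7_35_exists E : alternating4 E -> exists E', proj_1_7_35 u E E'.
Proof.
move=> hE; have hE' : alternating4 (pull4 B E) by exact: pull4_alternating.
pose X := mX phi (pull4 B E).
have hX a b : mP phi X a b = 3 * (X b a - X a b) by exact: mP_mX.
exists (pull4 A (dot (inv_mX X) phi)); split.
  apply: dot_Lambda4_1_7_35 => a b.
  have e : inv_mX X = fun a b => (48^-1 * (X a b + X b a) - 224^-1 * (\sum_p X p p) * d a b)
     + - 192^-1 * (X a b - X b a).
    by apply: boolp.funext => x; apply: boolp.funext => y; rewrite /inv_mX; ring.
  have -> : mP phi (inv_mX X) a b = - 192^-1 * (mP phi X a b - mP phi (fun p q => X q p) a b).
    rewrite e mPB mP_sym // => [|x y]; last by rewrite (eq_sym x y); ring.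
    by rewrite add0r; congr (_ * _); rewrite -S2N -S2D; apply: eq_S2 => *; ring.
  by rewrite (mP_tr X) hX /inv_mX (eq_sym b a); field.
have -> : (fun a b c e => E a b c e - pull4 A (dot (inv_mX X) phi) a b c e) =
   pull4 A (fun a b c e => pull4 B E a b c e - dot (inv_mX X) phi a b c e).
  apply: T4_ext => a b c e; rewrite -{1}(pull4K E) !pull4_slots /slots -S4N -S4D.
  by apply: eq_S4 => *; ring.
have halt : alternating4 (fun a b c e => pull4 B E a b c e - dot (inv_mX X) phi a b c e).
  have h2 := dot_alternating (inv_mX X) phi_alt.
  move=> x y z t; case: (hE' x y z t) => e1 e2 e3; case: (h2 x y z t) => f1 f2 f3.
  by split; rewrite ?e1 ?e2 ?e3 ?f1 ?f2 ?f3; ring.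
apply/J4_eigen_frame => //; apply/(mX_eq0P phi_alt phi_Q halt) => a b.
transitivity (X a b - mX phi (dot (inv_mX X) phi) a b); last first.
  by rewrite (mX_inv phi_alt phi_Q hX) subrr.
by rewrite -S3N -S3D; apply: eq_S3 => *; ring.
Qed.

(** For an eigenvalue k other than 2, [J4_mX] can be solved for the form itself, which is thereby
    N.phi with N a multiple of the transpose of its [mX]. *)
Lemma L1_7_35_dot v : Lambda4_1_7_35 u v -> exists f, v = pull4 A (dot f phi).
Proof.
case=> v1 [v7 [v35 [h1 h7 h35 ->]]].
have aux (k : R) (w : T4 R) : k != 2 -> J4_eigen k u w -> exists f, w = pull4 A (dot f phi).
  move=> k2 hw; have [halt _] := hw; rewrite -(pull4K w) in hw *.
  have hB := pull4_alternating B halt.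
  move/(J4_eigen_frame k hB) : hw => hw.
  have k2' : 2 - k != 0 by rewrite subr_eq0 eq_sym.
  exists (fun a b => ((2 - k) * 12)^-1 * mX phi (pull4 B w) b a).
  congr (pull4 A); apply: T4_ext => a b c e.
  have -> : dot (fun a b => ((2 - k) * 12)^-1 * mX phi (pull4 B w) b a) phi a b c e =
    ((2 - k) * 12)^-1 * dot (fun a b => mX phi (pull4 B w) b a) phi a b c e.
    rewrite /dot !mulrDr !mulr_sumr; do !congr (_ + _); apply: eq_bigr => p _;
    by rewrite mulrA.
  have := hw a b c e; rewrite /J4_phi (J4_mX phi_alt phi_Q hB).
  set D := dot _ _ _ _ _ _; set x := pull4 B w a b c e => hh.
  have -> : D = 12 * (2 - k) * x by lra.
  by field.
have [|f1 ->] := aux (- 12) v1 _ h1; first by apply/eqP; lra.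
have [|f7 ->] := aux (- 6) v7 _ h7; first by apply/eqP; lra.
have [|f35 ->] := aux 0 v35 _ h35; first by apply/eqP; lra.
exists (fun a b => (f1 a b + 1 * f7 a b) + 1 * f35 a b).
apply: T4_ext => a b c e; rewrite !pull4_slots /slots -!S4D; apply: eq_S4 => p q r s.
by rewrite !dotB; ring.
Qed.

(** A form N.phi annihilated by [mX] has zero norm by [dot_mX0]; hence the projection is unique. *)
Lemma L1_7_35_27 v : Lambda4_1_7_35 u v -> Lambda4_27 u v -> forall a b c e, v a b c e = 0.
Proof.
move=> /L1_7_35_dot [f ->] /Lambda4_27P.
have halt : alternating4 (pull4 A (dot f phi)) by apply: pull4_alternating; exact: dot_alternating.
move=> /(_ halt); rewrite con_up3_frame conj_eq0 => h.
have h0 := dot_mX0 phi_alt h.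
move=> a b c e; rewrite pull4_slots /slots /S4 big1 // => *; rewrite /S3 big1 // => *.
by rewrite big1 // => *; rewrite big1 // => *; rewrite h0 mulr0.
Qed.

End FrameForms.

(** * The field equations in a frame *)

Section FieldEquation.
Variable R : realType.
Local Notation d x y := ((x == y)%:R : R).
Local Notation phi := (Phi0 R).
Implicit Types (N M G H : 'M[R]_8) (u v E : T4 R) (w : T3 R).

Let phi_alt := Phi0_alternating R.
Let phi_Q := @Phi0_contract1 R.
Let ph := alternating4_perm phi_alt.

Definition mS (f : T4 R) w a b : R := S4 (fun p q r s => f p q r s * w a p q * w b r s).

(** The antisymmetrisation is left out because a wedge with a 4-form performs it anyway. The matrix
    [H] replaces the inverse metric, so that the derivative of the latter can be inserted. *)
Definition wedge_with2 H w h : T4 R := fun a b c e => S2 (fun p q => w a b p * h c e q * H p q).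
Definition wedge_with H w : T4 R := fun a b c e => S2 (fun p q => w a b p * w c e q * H p q).

Lemma contract_P4 P Q u v : P *m Q^T = 1%:M ->
  S4 (fun p q r s => slots P P P P u p q r s * slots Q Q Q Q v p q r s) =
  S4 (fun p q r s => u p q r s * v p q r s).
Proof.
move=> PQ.
have e (X : 'M[R]_8) (y : T4 R) p q r s : slots X X X X y p q r s =
    S3 (fun k l m => X k q * X l r * X m s * \sum_x X x p * y x k l m).
  rewrite slots_S3; under eq_bigr => x _ do rewrite -S3Zl.
  rewrite S1_S3; apply: eq_S3 => k l m; rewrite mulr_sumr.
  by apply: eq_bigr => x _; ring.
transitivity (\sum_p S3 (fun k l m => (\sum_x P x p * u x k l m) * (\sum_x Q x p * v x k l m))).
  apply: eq_bigr => p _; rewrite -[RHS](contract_P3 (fun k l m => \sum_x P x p * u x k l m)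
     (fun k l m => \sum_x Q x p * v x k l m) PQ).
  by apply: eq_S3 => q r s; rewrite !e.
rewrite S1_S3 /S4 [RHS]S1_S3; apply: eq_S3 => k l m.
exact: (contract_P1 (fun x => u x k l m) (fun x => v x k l m) PQ).
Qed.

Lemma S2_S2 (f : T4 R) : S2 (fun a b => S2 (f a b)) = S2 (fun c e => S2 (fun a b => f a b c e)).
Proof. by rewrite [LHS]/S2; under eq_bigr => a _ do rewrite S1_S2; rewrite S1_S2. Qed.

Lemma S2_S4 (f : I8 -> I8 -> T4 R) :
  S2 (fun a b => S4 (f a b)) = S4 (fun p q r s => S2 (fun a b => f a b p q r s)).
Proof.
rewrite /S2; under eq_bigr => a _ do rewrite S1_S4.
by rewrite S1_S4.
Qed.

Lemma pull3_S3 (X : 'M[R]_8) w a b c :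
  pull3 X w a b c = S3 (fun p q r => X p a * X q b * X r c * w p q r).
Proof. by []. Qed.

Lemma pull3_slots (X : 'M[R]_8) w a b c e :
  slots X X X 1%:M (fun a b c _ => w a b c) a b c e = pull3 X w a b c.
Proof.
have dd (i j : I8) : (1%:M : 'M[R]_8) i j = d j i by rewrite mxE eq_sym.
rewrite pull3_S3; apply: eq_bigr => p _; apply: eq_bigr => q _; apply: eq_bigr => r _.
rewrite -[RHS](S1_d e (fun _ => X p a * X q b * X r c * w p q r)).
by apply: eq_bigr => s _; rewrite dd; ring.
Qed.

Lemma T3_ext w w' : (forall a b c, w a b c = w' a b c) -> w = w'.
Proof.
by move=> h; apply: boolp.funext => a; apply: boolp.funext => b; apply: boolp.funext => c.
Qed.

Lemma pull3_comp (X Y : 'M[R]_8) w : pull3 X (pull3 Y w) = pull3 (Y *m X) w.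
Proof.
apply: T3_ext => a b c; rewrite -(pull3_slots X _ a b c 0) -(pull3_slots (Y *m X) _ a b c 0).
rewrite -[1%:M in RHS](mulmx1 1%:M) -slots_comp; apply: eq_slots => *.
by rewrite pull3_slots.
Qed.

Lemma pull3_1 w : pull3 1%:M w = w.
Proof. by apply: T3_ext => a b c; rewrite -(pull3_slots _ _ a b c 0) slots1. Qed.

Lemma pull3_alternating (X : 'M[R]_8) w : alternating3 w -> alternating3 (pull3 X w).
Proof.
move=> hw a b c; split; rewrite !pull3_S3.
  rewrite S3_swap12 -S3N; apply: eq_S3 => p q r.
  by rewrite (alternating3_perm hw p q r); ring.
rewrite S3_swap23 -S3N; apply: eq_S3 => p q r.
by rewrite (alternating3_perm hw p q r); ring.
Qed.

Section Frame.
Variable A : 'M[R]_8.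
Hypothesis Au : A \in unitmx.
Let B := invmx A.
Let u := pull4 A phi.
Variable w0 : T3 R.
Let w := pull3 A w0.

Lemma mS_frame : mat (mS (up4 u) w) = A^T *m mat (mS phi w0) *m A.
Proof.
apply/matrixP => a b; rewrite mat_conj mxE.
have BA : B^T *m A^T = 1%:M by rewrite -trmx_mul mulmxV // trmx1.
pose W a k l := \sum_a' A a' a * w0 a' k l.
have wE x p q : w x p q = S2 (fun k l => A k p * A l q * W x k l).
  rewrite /w pull3_S3 [LHS]S1_S2; apply: eq_S2 => k l; rewrite /W mulr_sumr.
  by apply: eq_bigr => *; ring.
have wwE p q r s : w a p q * w b r s = slots A A A A (fun k l m n => W a k l * W b m n) p q r s.
  by rewrite !wE S2_mul; apply: eq_S4 => *; ring.
rewrite /mS up4_frame //; under eq_S4 => p q r s do rewrite -mulrA wwE.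
rewrite contract_P4 //.
transitivity (S4 (fun p q r s => S2 (fun i j => A i a * A j b *
   (phi p q r s * w0 i p q * w0 j r s)))).
  apply: eq_S4 => p q r s; rewrite /W mulr_suml mulr_sumr; apply: eq_bigr => i _.
  by rewrite !mulr_sumr; apply: eq_bigr => j _; ring.
by rewrite -S2_S4; apply: eq_S2 => i j; rewrite S4Zl.
Qed.

Lemma wedge_with2_frame H h0 :
  wedge_with2 H w (pull3 A h0) = pull4 A (wedge_with2 (A *m H *m A^T) w0 h0).
Proof.
pose V (v : T3 R) a b x := S2 (fun k l => A k a * A l b * v k l x).
have wE (v : T3 R) a b x : pull3 A v a b x = \sum_p A p x * V v a b p.
  rewrite pull3_S3 S3_swap23 S3_swap12 [LHS]/S3; apply: eq_bigr => p _.
  by rewrite -S2Zl; apply: eq_S2 => k l; ring.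
apply: T4_ext => a b c e; rewrite /wedge_with2 pull4_slots.
transitivity (S2 (fun p q => V w0 a b p * V h0 c e q * (A *m H *m A^T) p q)).
  have -> : S2 (fun p q => w a b p * pull3 A h0 c e q * H p q) = S2 (fun i j => S2 (fun p q =>
      V w0 a b i * V h0 c e j * (A i p * A j q * H p q))).
    rewrite S2_S2; apply: eq_S2 => p q; rewrite /w !wE mulr_suml mulr_suml; apply: eq_bigr => i _.
    by rewrite mulr_sumr mulr_suml; apply: eq_bigr => j _; ring.
  apply: eq_S2 => i j; rewrite S2Zl; congr (_ * _).
  rewrite !mxE /S2 exchange_big; apply: eq_bigr => q _ /=; rewrite !mxE mulr_suml.
  by apply: eq_bigr => p _; ring.
rewrite /slots; under [RHS]eq_S4 => i j k l do rewrite -S2Zl.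
rewrite -S2_S4; apply: eq_S2 => p q; rewrite mulrC /V S2_mul -S4Zl.
by apply: eq_S4 => *; ring.
Qed.

Lemma wedge_with_frame H :
  wedge_with H w = pull4 A (wedge_with (A *m H *m A^T) w0).
Proof. exact: wedge_with2_frame. Qed.

End Frame.

Section UpAntisymmetry.
Variables (u : T4 R) (hu : alternating4 u).

Lemma up3_anti a p q r : (up3 u a q p r = - up3 u a p q r) * (up3 u a p r q = - up3 u a p q r)
  * (up3 u a q r p = up3 u a p q r).
Proof.
have h1 x y z : up3 u a y x z = - up3 u a x y z.
  rewrite -[LHS]/(S3 _) -[X in - X]/(S3 _) S3_swap12 -S3N; apply: eq_S3 => k l m.
  by rewrite (alternating4_perm hu a k l m); ring.
have h2 x y z : up3 u a x z y = - up3 u a x y z.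
  rewrite -[LHS]/(S3 _) -[X in - X]/(S3 _) S3_swap23 -S3N; apply: eq_S3 => k l m.
  by rewrite (alternating4_perm hu a k l m); ring.
by do !split => //; rewrite h2 h1 opprK.
Qed.

End UpAntisymmetry.

Definition dform (dw : I8 -> T3 R) : T4 R := fun a b c e =>
  dw a b c e - dw b a c e + dw c a b e - dw e a b c.

Definition trS u w : R := \tr (ginv u *m mat (mS (up4 u) w)).

(** The matrix whose action on Phi represents the dependence of C /\_Phi C on the metric. -1/8 is
    fixed by [wedge44_correction], and 1/56 makes the trace terms in that pairing cancel. *)
Definition correction u w : 'M[R]_8 :=
  (- 8^-1) *: (ginv u *m mat (mS (up4 u) w)) + (56^-1 * trS u w)%:M.

(** The 4-form that gets wedged with the variation of Phi, [X] standing for dC. The field equations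
    are a quarter of its contraction with Phi. *)
Definition field_form (L : R) u w (X : T4 R) : T4 R := fun a b c e =>
  X a b c e - 6 * wedge_Phi u w a b c e + dot (correction u w) u a b c e + L / 21 * u a b c e.

Lemma ginv_sym_of u : cayley u -> forall p q, ginv u p q = ginv u q p.
Proof.
case=> A Au -> p q; rewrite ginv_pull //.
have -> : invmx A *m (invmx A)^T = (invmx A *m (invmx A)^T)^T by rewrite trmx_mul trmxK.
by rewrite mxE trmx_mul trmxK.
Qed.

Lemma wedge_with_sym H w : (forall p q, H p q = H q p) -> alternating3 w ->
  forall y, y = wedge_with H w -> forall a b c e,
  (y b a c e = - y a b c e) * (y a b e c = - y a b c e) * (y b a e c = y a b c e) *
  (y c e a b = y a b c e) * (y e c a b = - y a b c e) * (y c e b a = - y a b c e) *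
  (y e c b a = y a b c e).
Proof.
move=> hH hw y yE.
have h1 x z t s : y z x t s = - y x z t s.
  by rewrite yE -S2N; apply: eq_S2 => p q; rewrite (alternating3_perm hw x z p); ring.
have h2 x z t s : y x z s t = - y x z t s.
  by rewrite yE -S2N; apply: eq_S2 => p q; rewrite (alternating3_perm hw t s q); ring.
have h3 x z t s : y t s x z = y x z t s.
  by rewrite yE /wedge_with S2_swap; apply: eq_S2 => p q; rewrite (hH q p); ring.
move=> a b c e; do !split => //.
- by rewrite h1 h2 opprK.
- by rewrite h3 h2.
- by rewrite h3 h1.
- by rewrite h3 h1 h2 opprK.
Qed.

(** The symmetries of the unantisymmetrised product reduce the 24 terms of [alt4] to three, which
    become equal when contracted with the alternating [up3]. *)
Lemma con_wedge_Phi u w : cayley u -> alternating4 u -> alternating3 w -> forall a b,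
  S3 (fun p q r => up3 u b p q r * wedge_Phi u w a p q r) =
  S3 (fun p q r => up3 u b p q r * wedge_with (ginv u) w a p q r).
Proof.
move=> hc hu hw a b; set Y := wedge_with (ginv u) w.
have y := wedge_with_sym (ginv_sym_of hc) hw (erefl Y).
have e1 : S3 (fun p q r => up3 u b p q r * Y a q p r) = - S3 (fun p q r => up3 u b p q r * Y a p q r).
  rewrite S3_swap12 -S3N; apply: eq_S3 => p q r.
  by rewrite (up3_anti hu b p q r) mulNr.
have e2 : S3 (fun p q r => up3 u b p q r * Y a r p q) = S3 (fun p q r => up3 u b p q r * Y a p q r).
  rewrite S3_swap23 S3_swap12; apply: eq_S3 => p q r.
  by rewrite (up3_anti hu b p q r).
transitivity (3^-1 * (S3 (fun p q r => up3 u b p q r * Y a p q r)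
   - S3 (fun p q r => up3 u b p q r * Y a q p r) + S3 (fun p q r => up3 u b p q r * Y a r p q))).
  rewrite -S3N -!S3D -S3Zl; apply: eq_S3 => p q r.
  rewrite /wedge_Phi -[alt4 _ _ _ _ _]/(alt4 Y a p q r) alt4E.
  by rewrite !(y a p q r, y a q p r, y a r p q); field.
by rewrite e1 e2; field.
Qed.

Lemma contract_dform (f : T3 R) (hf : alternating3 f) dw a :
  S3 (fun p q r => f p q r * dform dw a p q r) =
  S3 (fun p q r => f p q r * dw a p q r) - 3 * S3 (fun p q r => f p q r * dw r a p q).
Proof.
have e1 : S3 (fun p q r => f p q r * dw p a q r) = S3 (fun p q r => f p q r * dw r a p q).
  rewrite S3_swap12 S3_swap23; apply: eq_S3 => p q r.
  by rewrite (alternating3_perm hf p q r).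
have e2 : S3 (fun p q r => f p q r * dw q a p r) = - S3 (fun p q r => f p q r * dw r a p q).
  rewrite S3_swap23 -S3N; apply: eq_S3 => p q r.
  by rewrite (alternating3_perm hf p q r) mulNr.
transitivity (S3 (fun p q r => f p q r * dw a p q r)
  - S3 (fun p q r => f p q r * dw p a q r)
  + S3 (fun p q r => f p q r * dw q a p r)
  - S3 (fun p q r => f p q r * dw r a p q)).
  by rewrite -!S3N -!S3D; apply: eq_S3 => p q r; rewrite /dform; ring.
by rewrite e1 e2; ring.
Qed.

Lemma con_dform u (hu : alternating4 u) dw a b :
  S3 (fun p q r => up3 u b p q r * dform dw a p q r) =
  S3 (fun p q r => up3 u b p q r * dw a p q r) - 3 * S3 (fun p q r => up3 u b p q r * dw r a p q).
Proof. by apply: contract_dform => x y z; split; rewrite (up3_anti hu b x y z). Qed.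

Section Frame2.
Variable A : 'M[R]_8.
Hypothesis Au : A \in unitmx.
Let B := invmx A.
Let u := pull4 A phi.
Variable w0 : T3 R.
Hypothesis hw0 : alternating3 w0.
Let w := pull3 A w0.
Let S0 := mS phi w0.

Let hcu : cayley u. Proof. by exists A. Qed.

Lemma mS_sym (f : T4 R) a b : alternating4 f -> mS f w0 a b = mS f w0 b a.
Proof.
move=> hf; rewrite /mS S4_swap23 S4_swap12 S4_swap34 S4_swap23; apply: eq_S4 => p q r s.
by rewrite (alternating4_perm hf p q r s); ring.
Qed.

Lemma trS_frame : trS u w = \sum_t S0 t t.
Proof.
rewrite /trS mS_frame // ginv_pull // mxtrace_mulC !mulmxA.
rewrite -[_ *m A *m _]mulmxA mulmxV // mulmx1 mxtrace_mulC mulmxA -trmx_mul mulmxV //.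
rewrite trmx1 mul1mx.
by apply: eq_bigr => t _; rewrite mxE.
Qed.

Let M0 := fun a b => - 8^-1 * S0 a b + 56^-1 * (\sum_t S0 t t) * d a b.

Lemma correction_frame : dot (correction u w) u = pull4 A (dot M0 phi).
Proof.
rewrite dot_frame //; congr (pull4 A).
have -> : A *m correction u w *m B = mat M0.
  rewrite /correction trS_frame mS_frame // ginv_pull //.
  rewrite mulmxDr mulmxDl -scalemxAr -scalemxAl scalar_mxC -(mulmxA _ A) mulmxV // mulmx1.
  rewrite !mulmxA mulmxV // mul1mx -trmx_mul mulmxV // trmx1 mul1mx -mulmxA mulmxV // mulmx1.
  apply/matrixP => a b; rewrite !mxE /M0; congr (_ * _ + _).
  by rewrite mulr_natr.
by apply: T4_ext => *; rewrite /dot; do !congr (_ + _); apply: eq_bigr => *; rewrite mxE.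
Qed.

Lemma mX_correction a b : mX phi (dot M0 phi) a b = - 3 * S0 a b + 3 / 4 * (\sum_t S0 t t) * d a b.
Proof.
rewrite (mX_dot phi_alt phi_Q); set tr := \sum_t S0 t t.
have sS x y : S0 x y = S0 y x by exact: mS_sym.
have -> : \sum_p M0 p p = 56^-1 * tr.
  transitivity (\sum_p (- 8^-1 * S0 p p + 56^-1 * tr)).
    by apply: eq_bigr => p _; rewrite /M0 dxx mulr1.
  by rewrite big_split /= -mulr_sumr sumr_const card_ord -/tr; field.
rewrite mP_sym // => [|x y]; last by rewrite /M0 sS (eq_sym x y).
by rewrite /M0 -/tr (sS b a) (eq_sym b a); field.
Qed.

Lemma mX_phi_phi a b : mX phi phi a b = 42 * d a b.
Proof. by rewrite /mX (contract3 phi_alt phi_Q) eq_sym. Qed.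

Lemma con_up3D v v' x : con_up3 u (fun a b c e => v a b c e + x * v' a b c e) =
  con_up3 u v + x *: con_up3 u v'.
Proof.
apply/matrixP => a b; rewrite !mxE -S3Zl -S3D; apply: eq_S3 => *; ring.
Qed.

(** The coefficients match after division by 4: -6 gives -3/2, the correction contributes -3 S + 3/4
    tr S g, and L/21 times the contraction 42 g of Phi with itself gives L/2. *)
Lemma field_eqE L dw :
  field_eq L u w dw = 4^-1 *: con_up3 u (field_form L u w (dform dw)).
Proof.
have hu : alternating4 u by exact: u_alternating.
have hw : alternating3 w by exact: pull3_alternating.
have -> : field_form L u w (dform dw) = fun a b c e => (dform dw a b c e + -6 * wedge_Phi u w a b c e
   + 1 * dot (correction u w) u a b c e) + L / 21 * u a b c e.
  by apply: T4_ext => *; rewrite /field_form; ring.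
rewrite !con_up3D correction_frame con_up3_frame //.
have -> : con_up3 u u = 42 *: metric u.
  rewrite {2}/u con_up3_frame // metric_pull // -[in RHS](mulmx1 A^T) scalemxAl scalemxAr.
  congr (_ *m _ *m _); apply/matrixP => a b; rewrite !mxE mX_phi_phi.
  by rewrite mulr_natr.
have -> : mat (mX phi (dot M0 phi)) = (- 3) *: mat S0 + (3 / 4 * trS u w) *: 1%:M.
  by apply/matrixP => a b; rewrite !mxE mX_correction trS_frame.
rewrite mulmxDr mulmxDl -!scalemxAr -!scalemxAl mulmx1 -mS_frame // -metric_pull //.
apply/matrixP => a b; rewrite !mxE.
rewrite -[\sum_p \sum_q \sum_r up3 _ _ _ _ _ * dw a _ _ _]/(S3 _).
rewrite -[\sum_p \sum_q \sum_r up3 _ _ _ _ _ * dw _ a _ _]/(S3 _).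
rewrite con_dform // con_wedge_Phi //.
have -> : \sum_p \sum_q \sum_r \sum_s up3 u b p q r * up_last u w a p s * w q r s =
   S3 (fun p q r => up3 u b p q r * wedge_with (ginv u) w a p q r).
  apply: eq_S3 => p q r; rewrite /wedge_with S2_swap /S2 mulr_sumr; apply: eq_bigr => s _.
  rewrite -mulrA; congr (_ * _); rewrite /up_last mulr_suml; apply: eq_bigr => t _; ring.
have -> : \sum_p \sum_q \sum_r \sum_s up4 u p q r s * w a p q * w b r s = mS (up4 u) w a b by [].
have -> : \sum_p \sum_q \sum_r \sum_s \sum_t up4 u p q r s * up_last u w p q t * w r s t = trS u w.
  transitivity (S4 (fun p q r s => S2 (fun t t' => ginv u t t' * (up4 u p q r s * w t' p q * w t r s)))).
    apply: eq_S4 => p q r s; apply: eq_bigr => t _; rewrite /up_last mulr_sumr mulr_suml.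
    apply: eq_bigr => t' _; rewrite (alternating3_perm hw t' p q) (alternating3_perm hw t r s).
    by rewrite (ginv_sym_of hcu t t'); ring.
  rewrite -S2_S4 /trS; apply: eq_bigr => t _; rewrite !mxE; apply: eq_bigr => t' _.
  by rewrite S4Zl mxE.
by field.
Qed.

End Frame2.

End FieldEquation.

(** * The variation of the metric and the torsion equation as wedge pairings *)

Section WedgeForms.
Variable R : realType.
Local Notation d x y := ((x == y)%:R : R).
Local Notation phi := (Phi0 R).
Implicit Types (u v E : T4 R) (w : T3 R).

Lemma wedge44_linr u v E (x : R) :
  wedge44 u (fun a b c e => v a b c e + x * E a b c e) = wedge44 u v + x * wedge44 u E.
Proof.
rewrite /wedge44 [x * _]mulrCA -mulrDr [x * _]mulr_sumr -big_split /=; congr (_ * _).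
by apply: eq_bigr => s _; rewrite mulrDr mulrDr !(mulrCA x).
Qed.

Lemma wedge44_linl u v E (x : R) :
  wedge44 (fun a b c e => v a b c e + x * E a b c e) u = wedge44 v u + x * wedge44 E u.
Proof. by rewrite !(wedge44C _ u) wedge44_linr. Qed.

Lemma wedge44_sumr (I : finType) u (k : I -> R) (F : I -> T4 R) :
  wedge44 u (fun a b c e => \sum_i k i * F i a b c e) = \sum_i k i * wedge44 u (F i).
Proof.
transitivity (\sum_i (4`!%:R * 4`!%:R)^-1 * (k i * \sum_(s : 'S_8) (-1) ^+ s *
   (u (s 0) (s 1) (s 2) (s 3) * F i (s 4) (s 5) (s 6) (s 7)))).
  rewrite -mulr_sumr; congr (_ * _).
  transitivity (\sum_i \sum_(s : 'S_8) k i * ((-1) ^+ s *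
     (u (s 0) (s 1) (s 2) (s 3) * F i (s 4) (s 5) (s 6) (s 7)))).
    rewrite exchange_big; apply: eq_bigr => s _; rewrite !mulr_sumr.
    by apply: eq_bigr => i _; rewrite !(mulrCA (k i)).
  by apply: eq_bigr => i _; rewrite mulr_sumr.
by apply: eq_bigr => i _; rewrite mulrCA.
Qed.

Lemma wedge44_tperm (i j : I8) (F F' : I8 -> I8 -> I8 -> I8 -> I8 -> I8 -> I8 -> I8 -> R) : i != j ->
  (forall s : 'S_8, let t := (tperm i j * s)%g in
    F' (s 0) (s 1) (s 2) (s 3) (s 4) (s 5) (s 6) (s 7) =
    F (t 0) (t 1) (t 2) (t 3) (t 4) (t 5) (t 6) (t 7)) ->
  \sum_(s : 'S_8) (-1) ^+ s * F' (s 0) (s 1) (s 2) (s 3) (s 4) (s 5) (s 6) (s 7) =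
  - \sum_(s : 'S_8) (-1) ^+ s * F (s 0) (s 1) (s 2) (s 3) (s 4) (s 5) (s 6) (s 7).
Proof.
move=> ij h; rewrite [in RHS](reindex_inj (mulgI (tperm i j))) /= -sumrN.
by apply: eq_bigr => s _; rewrite h odd_mul_tperm ij signr_addb mulN1r mulNr opprK.
Qed.

Lemma wedge44_sw u v : (wedge44 u (sw12 v) = - wedge44 u v) *
  (wedge44 u (sw23 v) = - wedge44 u v) * (wedge44 u (sw34 v) = - wedge44 u v).
Proof.
have h i j (w : T4 R) : i != j -> (forall s : 'S_8, let t := (tperm i j * s)%g in
     u (s 0) (s 1) (s 2) (s 3) * w (s 4) (s 5) (s 6) (s 7) =
     u (t 0) (t 1) (t 2) (t 3) * v (t 4) (t 5) (t 6) (t 7)) ->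
   wedge44 u w = - wedge44 u v.
  move=> ij hs; rewrite /wedge44 -mulrN; congr (_ * _).
  exact: (@wedge44_tperm i j (fun a b c e f g k l => u a b c e * v f g k l)
    (fun a b c e f g k l => u a b c e * w f g k l)).
split; first split.
- by apply: (h 4 5) => // s t; rewrite /t !permM tpermL tpermR !tpermD.
- by apply: (h 5 6) => // s t; rewrite /t !permM tpermL tpermR !tpermD.
- by apply: (h 6 7) => // s t; rewrite /t !permM tpermL tpermR !tpermD.
Qed.

(** Each adjacent swap changes the sign of the wedge, so the 24 signed words of [alt4] contribute
    equally. *)
Lemma wedge44_alt4 u v : wedge44 u (alt4 v) = wedge44 u v.
Proof.
have hw l : wedge44 u (sw_word l v) = (-1) ^+ size l * wedge44 u v.
  elim: l => [|k l IH]; first by rewrite mul1r.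
  rewrite /= exprS mulN1r mulNr -IH.
  by case: k => [|[|k]] /=; rewrite ?nth_nil wedge44_sw.
have -> : alt4 v = fun a b c e => \sum_(i < 24) (24^-1 * (-1) ^+ size (nth [::] S4_words i)) *
    sw_word (nth [::] S4_words i) v a b c e.
  apply: T4_ext => a b c e; rewrite alt4_words (big_nth [::]) big_mkord mulr_sumr.
  by apply: eq_bigr => i _; rewrite mulrA.
rewrite wedge44_sumr.
transitivity (\sum_(i < 24) 24^-1 * wedge44 u v).
  apply: eq_bigr => i _; rewrite hw mulrA -[_ * _ * (-1) ^+ _]mulrA -expr2 sqrr_sign; ring.
by rewrite -mulr_suml sumr_const card_ord -[_ *+ 24]mulr_natl divff ?mul1r // pnatr_eq0.
Qed.

Lemma wedge44_dform u dw : wedge44 u (dform dw) = 4 * wedge44 u dw.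
Proof.
have -> : dform dw = fun a b c e => (dw a b c e + -1 * sw12 dw a b c e)
   + (1 * sw23 (sw12 dw) a b c e + -1 * sw34 (sw23 (sw12 dw)) a b c e).
  by apply: T4_ext => a b c e; rewrite /dform /sw12 /sw23 /sw34; ring.
have e X Y : wedge44 u (fun a b c e => X a b c e + Y a b c e) = wedge44 u X + wedge44 u Y.
  by rewrite -[wedge44 u Y]mul1r -wedge44_linr; congr wedge44; apply: T4_ext => *; ring.
have e2 X x : wedge44 u (fun a b c e => x * X a b c e) = x * wedge44 u X.
  rewrite /wedge44 [RHS]mulrCA [x * _]mulr_sumr; congr (_ * _).
  by apply: eq_bigr => s _; rewrite !(mulrCA x).
have h12 X : wedge44 u (sw12 X) = - wedge44 u X by rewrite wedge44_sw.
have h23 X : wedge44 u (sw23 X) = - wedge44 u X by rewrite wedge44_sw.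
have h34 X : wedge44 u (sw34 X) = - wedge44 u X by rewrite wedge44_sw.
rewrite (e (fun a b c e => dw a b c e + -1 * sw12 dw a b c e)) wedge44_linr.
rewrite (e (fun a b c e => 1 * sw23 (sw12 dw) a b c e)).
rewrite (e2 (sw23 (sw12 dw))) (e2 (sw34 (sw23 (sw12 dw)))) h12 h34 h23 h12.
set z := wedge44 u _; ring.
Qed.

Section Frame.
Variable A : 'M[R]_8.
Hypothesis Au : A \in unitmx.
Let B := invmx A.
Let u := pull4 A phi.

Lemma wedge44_u_frame v :
  wedge44 u (pull4 A v) = vol u * (24^-1 * S4 (fun a b c e => v a b c e * phi a b c e)).
Proof.
by rewrite wedge44_pull vol_pull phi_unitvol mulr1 wedge44C wedge44_phi.
Qed.

Lemma frame_mxE (N : 'M[R]_8) : A *m (N *m ginv u + ginv u *m N^T) *m A^T =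
  A *m N *m B + (A *m N *m B)^T.
Proof.
rewrite ginv_pull // -/B mulmxDr mulmxDl !trmx_mul !mulmxA; congr (_ + _).
  by rewrite -!mulmxA -trmx_mul mulmxV // trmx1 mulmx1.
by rewrite mulmxV // mul1mx.
Qed.

Lemma tr_frame (N : 'M[R]_8) : \tr (A *m N *m B) = \tr N.
Proof. by rewrite -mulmxA mxtrace_mulC -mulmxA mulVmx // mulmx1. Qed.

Lemma up_last_frame (w0 : T3 R) i a p : up_last u (pull3 A w0) i a p =
  \sum_j A j i * (B *m mat (fun p a => w0 j a p) *m A) p a.
Proof.
rewrite /up_last ginv_pull // -/B.
transitivity (S2 (fun j x => S2 (fun y t => A j i * A x a * w0 j x y * (A y t * (B *m B^T) t p)))).
  transitivity (\sum_t S2 (fun j x => \sum_y A j i * A x a * w0 j x y * (A y t * (B *m B^T) t p))).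
    apply: eq_bigr => t _; rewrite mulr_suml; apply: eq_bigr => j _; rewrite mulr_suml.
    by apply: eq_bigr => x _; rewrite mulr_suml; apply: eq_bigr => y _; ring.
  rewrite S1_S2; apply: eq_S2 => j x; rewrite /S2 exchange_big; apply: eq_bigr => y _.
  by apply: eq_bigr => t _.
apply: eq_bigr => j _; rewrite [(B *m _ *m A) p a]mxE mulr_sumr; apply: eq_bigr => x _ /=.
transitivity (\sum_y A j i * A x a * w0 j x y * B p y).
  apply: eq_bigr => y _; rewrite /= -mulr_sumr; congr (_ * _).
  have -> : \sum_t A y t * (B *m B^T) t p = (A *m (B *m B^T)) y p by rewrite mxE.
  by rewrite mulmxA mulmxV // mul1mx mxE.
rewrite mxE mulr_suml mulr_sumr; apply: eq_bigr => y _; rewrite mxE; ring.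
Qed.

Variable w0 : T3 R.
Hypothesis hw0 : alternating3 w0.
Let w := pull3 A w0.

(** Along N.Phi the inverse metric changes by -(N g^-1 + g^-1 N^T). In the frame both sides equal
    vol / 2 times the inner product of [N] with the symmetric matrix [mS]; on the right the traces
    cancel as 3 - 4 * 3/4 = 0. *)
Lemma wedge44_correction (N : 'M[R]_8) :
  6 * wedge44 u (alt4 (wedge_with (N *m ginv u + ginv u *m N^T) w)) =
  wedge44 (dot N u) (dot (correction u w) u).
Proof.
rewrite wedge44_alt4 wedge_with_frame // frame_mxE correction_frame // wedge44_u_frame.
set n := A *m N *m B.
rewrite wedge44_dot_frame -/n //; last exact/dot_alternating/Phi0_alternating.
rewrite mulrCA; congr (_ * _).
set M0 : I8 -> I8 -> R := fun a b => _ + _ * d a b; set tr := \sum_t mS phi w0 t t.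
have eX a b : mX phi (dot M0 phi) a b = - 3 * mS phi w0 a b + 3 / 4 * tr * d a b.
  exact: mX_correction.
have -> : \sum_p mX phi (dot M0 phi) p p = 3 * tr.
  under eq_bigr do rewrite eX dxx mulr1.
  by rewrite big_split /= -mulr_sumr -/tr sumr_const card_ord; field.
have -> : S2 (fun p a => n p a * mX phi (dot M0 phi) p a) =
   - 3 * S2 (fun p a => n p a * mS phi w0 p a) + 3 / 4 * tr * \tr N.
  under eq_S2 => p a do rewrite eX mulrDr.
  rewrite S2D -(tr_frame N) -/n /mxtrace; congr (_ + _).
    by rewrite -(@S2Zl R (- 3)); apply: eq_S2 => p a; ring.
  rewrite [RHS]mulr_sumr; apply: eq_bigr => p _.
  under eq_bigr => a _ do rewrite mulrCA [n p a * _]mulrC.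
  by rewrite -mulr_sumr S1_d.
have -> : S4 (fun a b c e => wedge_with (n + n^T) w0 a b c e * phi a b c e) =
   2 * S2 (fun p q => n p q * mS phi w0 p q).
  transitivity (S2 (fun p q => (n + n^T) p q * mS phi w0 p q)).
    transitivity (S4 (fun a b c e => S2 (fun p q => (n + n^T) p q * (phi a b c e * w0 p a b * w0 q c e)))).
      apply: eq_S4 => a b c e; rewrite /wedge_with mulrC -S2Zl; apply: eq_S2 => p q.
      by rewrite (alternating3_perm hw0 p a b) (alternating3_perm hw0 q c e); ring.
    by rewrite -S2_S4; apply: eq_S2 => p q; rewrite /mS -S4Zl.
  under eq_S2 => p q do rewrite [(n + n^T) p q]mxE [n^T p q]mxE mulrDl.
  rewrite S2D [X in _ + X]S2_swap mulr2n mulrDl !mul1r; congr (_ + _).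
  by apply: eq_S2 => p q; congr (_ * _); apply: mS_sym => //; exact: Phi0_alternating.
by field.
Qed.

(** Lambda^4_27 is the annihilator of the tangent directions N.Phi, so a variation of the action can
    be tested on these directions alone. *)
Lemma wedge44_dot_eq0 E : alternating4 E ->
  (forall N : 'M[R]_8, wedge44 (dot N u) E = 0) <-> con_up3 u E = 0.
Proof.
move=> hE; have hv : alternating4 (pull4 B E) by exact: pull4_alternating.
have eE : E = pull4 A (pull4 B E) by rewrite pull4K.
rewrite eE; set v := pull4 B E in hv eE *; rewrite con_up3_frame // conj_eq0 //.
have v0 : vol u != 0.
  by rewrite vol_pull phi_unitvol mulr1 -unitfE -unitmxE.
split=> [h|h N]; last first.
  have e1 : \sum_p mX phi v p p = 0 by apply: big1 => p _.
  have e2 : S2 (fun p a => (A *m N *m B) p a * mX phi v p a) = 0.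
    by apply: big1 => p _; apply: big1 => a _; rewrite h mulr0.
  by rewrite (wedge44_dot_frame Au _ hv) e1 e2; set y := vol u; ring.
have hn (n : 'M[R]_8) : \tr n * (\sum_p mX phi v p p) - 4 * S2 (fun p a => n p a * mX phi v p a) = 0.
  have := h (B *m n *m A); rewrite (wedge44_dot_frame Au _ hv).
  have -> : A *m (B *m n *m A) *m B = n.
    by rewrite !mulmxA mulmxV // mul1mx -mulmxA mulmxV // mulmx1.
  rewrite -(tr_frame (B *m n *m A)).
  have -> : A *m (B *m n *m A) *m B = n.
    by rewrite !mulmxA mulmxV // mul1mx -mulmxA mulmxV // mulmx1.
  move/eqP; rewrite mulf_eq0 => /orP[h0|]; first by move: v0; rewrite h0.
  by rewrite mulf_eq0 invr_eq0 pnatr_eq0 /= => /eqP.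
(* N = 1 gives (8 - 4) times the trace. *)
have t0 : \sum_p mX phi v p p = 0.
  have := hn 1%:M; rewrite mxtrace1.
  have -> : S2 (fun p a => (1%:M : 'M[R]_8) p a * mX phi v p a) = \sum_p mX phi v p p.
    by apply: eq_bigr => p _; under eq_bigr do rewrite mxE; rewrite S1_d.
  set t := \sum_p _; lra.
(* With the trace gone, N = mX itself turns the pairing into a sum of squares. *)
have := hn (mat (mX phi v)); rewrite t0 mulr0 sub0r => /eqP.
rewrite oppr_eq0 mulf_eq0 pnatr_eq0 /= => /eqP h2 a b.
have pos x y : 0 <= mat (mX phi v) x y * mX phi v x y by rewrite mxE -expr2 sqr_ge0.
have hr : \sum_q mat (mX phi v) a q * mX phi v a q = 0.
  by apply: (psumr_eq0P _ h2) => // x _; exact: sumr_ge0.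
have := psumr_eq0P (fun y _ => pos a y) hr (i := b) isT.
by rewrite mxE => /eqP; rewrite mulf_eq0 orbb => /eqP.
Qed.

End Frame.

Local Notation phi_alt := (Phi0_alternating R).
Local Notation phi_Q := (@Phi0_contract1 R).

(** A quarter of the sum over i of D_i /\ dx^i /\ h; with the derivatives of Phi for D_i this is
    dPhi /\ h up to that factor and a sign. *)
Definition dwedge (D : I8 -> T4 R) (h : T3 R) : R :=
  \sum_i wedge44 (D i) (fun a b c e => d i a * h b c e).

Definition wedge_pair u w h : R := wedge44 u (wedge_with2 (ginv u) w h).

(** The matrix of T_{ia}^p acting on Phi, so that the torsion equation reads nabla_i Phi =
    (torsion_mx i).Phi. Its indices are transposed with respect to those of [T]. *)
Definition torsion_mx u w (i : I8) : 'M[R]_8 := mat (fun p a => up_last u w i a p).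

(** The bilinear form on 3-forms to which both terms of the variation in C reduce; it is symmetric
    and nondegenerate. *)
Definition pair3 (T h : T3 R) : R := S3 (fun i a p => T i a p * mP phi (h p) i a).

Lemma dform_alternating (dw : I8 -> T3 R) : (forall i, alternating3 (dw i)) -> alternating4 (dform dw).
Proof.
move=> h a b c e; rewrite /dform; split.
- by rewrite (alternating3_perm (h c) a b e) (alternating3_perm (h e) a b c); ring.
- by rewrite (alternating3_perm (h a) b c e) (alternating3_perm (h e) a b c); ring.
- by rewrite (alternating3_perm (h a) b c e) (alternating3_perm (h b) a c e); ring.
Qed.

Lemma dwedge_term (n : I8 -> I8 -> R) h i : (forall a b, n b a = - n a b) -> alternating3 h ->
  wedge44 (dot n phi) (fun a b c e => d i a * h b c e) =
  8^-1 * S2 (fun p a => n p a * S2 (fun x y => phi a x y i * h p x y))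
  - 24^-1 * \sum_a n i a * mV phi h a.
Proof.
move=> hn hh; pose dw (j : I8) : T3 R := fun b c e => d i j * h b c e.
have hdw j : alternating3 (dw j).
  by move=> a b c; split; rewrite /dw (alternating3_perm hh a b c); ring.
have -> : wedge44 (dot n phi) (fun a b c e => d i a * h b c e) = 4^-1 * wedge44 (dot n phi) (dform dw).
  by rewrite wedge44_dform mulrA mulVf ?mul1r ?pnatr_eq0.
rewrite wedge44_dot_phi; last exact: dform_alternating.
have -> : \sum_p n p p = 0 by apply: big1 => p _; exact/oppr_fix0/hn.
have eX p a : mX phi (dform dw) p a = d i p * mV phi h a - 3 * S2 (fun x y => phi a x y i * h p x y).
  rewrite /mX contract_dform; last exact: (alternating4_3 a phi_alt).
  congr (_ - _ * _); first by rewrite /mV -S3Zl; apply: eq_S3 => x y z; rewrite /dw; ring.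
  transitivity (S3 (fun x y z => d i z * (phi a x y z * h p x y))).
    by apply: eq_S3 => x y z; rewrite /dw; ring.
  by rewrite S3_d3.
under eq_S2 => p a do rewrite eX mulrBr.
rewrite S2D S2N; have -> : S2 (fun p a => n p a * (d i p * mV phi h a)) = \sum_a n i a * mV phi h a.
  by rewrite -(@S2_d1 R i (fun p a => n p a * mV phi h a)); apply: eq_S2 => p a; ring.
have -> : S2 (fun p a => n p a * (3 * S2 (fun x y => phi a x y i * h p x y))) =
   3 * S2 (fun p a => n p a * S2 (fun x y => phi a x y i * h p x y)).
  by rewrite -S2Zl; apply: eq_S2 => p a; ring.
by set X := S2 _; set Y := \sum_a _; field.
Qed.

(** The vector part of [h] in [dwedge_term] is multiplied by T_{iai} = 0, so only the symmetric
    pairing remains. *)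
Lemma dwedge_torsion (T h : T3 R) : alternating3 T -> alternating3 h ->
  \sum_i wedge44 (dot (fun p a => T i a p) phi) (fun a b c e => d i a * h b c e) =
  - 8^-1 * pair3 T h.
Proof.
move=> hT hh; rewrite -[pair3 T h]/(\sum_i S2 (fun a p => T i a p * mP phi (h p) i a)) mulr_sumr.
apply: eq_bigr => i _; rewrite dwedge_term //; last first.
  by move=> a b; rewrite (alternating3_perm hT i a b) opprK.
rewrite [X in _ - _ * X]big1 ?mulr0 ?subr0 => [|a _]; last first.
  have e : T i a i = - T i a i := (alternating3_perm hT i a i).2.
  by rewrite (oppr_fix0 e) mul0r.
rewrite mulNr -mulrN -S2N S2_swap; congr (_ * _); apply: eq_S2 => a p.
rewrite -mulrN; congr (_ * _); rewrite /mP -S2N; apply: eq_S2 => x y.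
by rewrite (alternating4_perm phi_alt i a x y) mulNr.
Qed.

Lemma pair3_cycle (D h : T3 R) : alternating3 D -> alternating3 h ->
  pair3 D h = S3 (fun p x y => h p x y * mP phi (D p) x y).
Proof.
move=> hD hh; transitivity (S3 (fun p i a => D p i a * mP phi (h p) i a)).
  rewrite /pair3 S3_swap23 S3_swap12; apply: eq_S3 => p i a.
  by rewrite (alternating3_perm hD p i a).
apply: eq_bigr => p _; transitivity (S2 (fun i a => S2 (fun x y => phi i a x y * (D p i a * h p x y)))).
  by apply: eq_S2 => i a; rewrite /mP -S2Zl; apply: eq_S2 => x y; ring.
rewrite S2_S2; apply: eq_S2 => x y; rewrite /mP -S2Zl; apply: eq_S2 => i a.
by rewrite (alternating4_perm phi_alt i a x y); ring.
Qed.

(** Test with h = K, the cyclic sum of the [mP] terms of [D]: three times the pairing is the squared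
    norm of K, and K = 0 forces D = 0 by [mP_cycle_inj]. *)
Lemma pair3_eq0 (D : T3 R) : alternating3 D ->
  (forall h, alternating3 h -> pair3 D h = 0) -> forall a b c, D a b c = 0.
Proof.
move=> hD hp; pose K : T3 R := fun i a b => mP phi (D i) a b + mP phi (D a) b i + mP phi (D b) i a.
have hK : alternating3 K.
  move=> a b c; rewrite /K (mP_anti phi_alt _ b c) (mP_anti phi_alt _ a b) (mP_anti phi_alt _ c a).
  rewrite ?(mP_anti phi_alt (D a) c b) ?(mP_anti phi_alt (D b) c a) ?(mP_anti phi_alt (D c) b a).
  rewrite (mP_anti phi_alt (D b) a c) (mP_anti phi_alt (D a) b c); split; ring.
have K0 : S3 (fun p x y => K p x y * K p x y) = 0.
  have e : S3 (fun p x y => K p x y * mP phi (D p) x y) = 0 by rewrite -pair3_cycle // hp.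
  have e1 : S3 (fun p x y => K p x y * mP phi (D x) y p) = 0.
    rewrite S3_swap12 S3_swap23 -[RHS]e; apply: eq_S3 => p x y.
    by rewrite (alternating3_perm hK p x y).
  have e2 : S3 (fun p x y => K p x y * mP phi (D y) p x) = 0.
    rewrite S3_swap23 S3_swap12 -[RHS]e; apply: eq_S3 => p x y.
    by rewrite (alternating3_perm hK p x y).
  have -> : S3 (fun p x y => K p x y * K p x y) = S3 (fun p x y => K p x y * mP phi (D p) x y)
    + S3 (fun p x y => K p x y * mP phi (D x) y p) + S3 (fun p x y => K p x y * mP phi (D y) p x).
    by rewrite -!S3D; apply: eq_S3 => p x y; rewrite /K; ring.
  by rewrite e e1 e2 !addr0.
apply: (mP_cycle_inj phi_alt phi_Q hD) => a b c; rewrite -/(K a b c).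
have K1 : S4 (fun _ p x y => K p x y * K p x y) = 0 by apply: big1 => ? _; exact: K0.
exact: (S4_sqr_eq0 K1 a).
Qed.

Lemma pair3B T T' h : pair3 (fun a b c => T a b c - T' a b c) h = pair3 T h - pair3 T' h.
Proof. by rewrite /pair3 -S3N -S3D; apply: eq_S3 => i a p; ring. Qed.

Section TorsionPoint.
Variable A : 'M[R]_8.
Hypothesis Au : A \in unitmx.
Let B := invmx A.
Let u := pull4 A phi.

Lemma dot_sum (I : finType) (k : I -> R) (F : I -> I8 -> I8 -> R) v a b c e :
  dot (fun p q => \sum_i k i * F i p q) v a b c e = \sum_i k i * dot (F i) v a b c e.
Proof.
have h (G : I8 -> R) y : \sum_p (\sum_i k i * F i p y) * G p = \sum_i k i * \sum_p F i p y * G p.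
  under eq_bigr => p _ do rewrite mulr_suml.
  rewrite exchange_big; apply: eq_bigr => i _; rewrite mulr_sumr.
  by apply: eq_bigr => p _; rewrite mulrA.
by rewrite /dot !h -!big_split; apply: eq_bigr => i _ /=; rewrite -!mulrDr.
Qed.

Lemma pull4_sum (I : finType) (k : I -> R) (F : I -> T4 R) a b c e :
  pull4 A (fun a b c e => \sum_i k i * F i a b c e) a b c e = \sum_i k i * pull4 A (F i) a b c e.
Proof.
rewrite !pull4_slots /slots.
under [RHS]eq_bigr => i _ do rewrite pull4_slots /slots -S4Zl.
rewrite -S4_sum; apply: eq_S4 => p q r s; rewrite mulr_sumr.
by apply: eq_bigr => i _; ring.
Qed.

Lemma dot_torsion_mx w0 i : dot (torsion_mx u (pull3 A w0) i) u =
  fun a b c e => \sum_j A j i * pull4 A (dot (fun p a => w0 j a p) phi) a b c e.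
Proof.
apply: T4_ext => a b c e.
have -> : dot (torsion_mx u (pull3 A w0) i) u a b c e =
    dot (fun p q => \sum_j A j i * (B *m mat (fun p a => w0 j a p) *m A) p q) u a b c e.
  by congr dot; apply: boolp.funext => p; apply: boolp.funext => q; rewrite mxE up_last_frame.
by rewrite dot_sum; apply: eq_bigr => j _; rewrite dot_frameV.
Qed.

Lemma dwedge_frame (D : I8 -> T4 R) h0 :
  dwedge (fun i a b c e => \sum_j A j i * pull4 A (D j) a b c e) (pull3 A h0) =
  vol u * \sum_j wedge44 (D j) (fun a b c e => d j a * h0 b c e).
Proof.
transitivity (\sum_j wedge44 (pull4 A (D j)) (fun a b c e => \sum_i A j i * (d i a * pull3 A h0 b c e))).
  under [RHS]eq_bigr => j _ do rewrite wedge44_sumr.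
  rewrite exchange_big; apply: eq_bigr => i _ /=.
  by rewrite wedge44C wedge44_sumr; apply: eq_bigr => j _; rewrite wedge44C.
rewrite mulr_sumr; apply: eq_bigr => j _.
rewrite vol_pull phi_unitvol mulr1 -wedge44_pull; congr wedge44.
apply: T4_ext => a b c e; transitivity (A j a * pull3 A h0 b c e).
  transitivity (\sum_i d i a * (A j i * pull3 A h0 b c e)).
    by apply: eq_bigr => i _; ring.
  by rewrite S1_d'.
rewrite pull4_slots slots_S3 pull3_S3.
transitivity (\sum_p d j p * (A p a * S3 (fun q r s => A q b * A r c * A s e * h0 q r s))).
  by rewrite S1_d.
apply: eq_bigr => p _; rewrite mulrCA; congr (_ * _); rewrite -S3Zl; apply: eq_S3 => q r s; ring.
Qed.

Lemma wedge_pair_frame w0 h0 (hh : alternating3 h0) : wedge_pair u (pull3 A w0) (pull3 A h0) =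
  vol u * (24^-1 * pair3 w0 h0).
Proof.
rewrite /wedge_pair wedge_with2_frame ginv_pull // -/B.
have -> : A *m (B *m B^T) *m A^T = 1%:M.
  by rewrite mulmxA mulmxV // mul1mx -trmx_mul mulmxV // trmx1.
rewrite wedge44_u_frame //; congr (_ * (_ * _)).
transitivity (S2 (fun a b => S2 (fun c e => \sum_p phi a b c e * (w0 a b p * h0 c e p)))).
  apply: eq_S2 => a b; apply: eq_S2 => c e; rewrite mulrC -mulr_sumr; congr (_ * _).
  apply: eq_bigr => p _; under eq_bigr => q _ do rewrite mxE mulrC.
  by rewrite S1_d.
apply: eq_S2 => a b; rewrite -S1_S2; apply: eq_bigr => p _.
by rewrite /mP -S2Zl; apply: eq_S2 => c e; rewrite (alternating3_perm hh p c e); ring.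
Qed.

Lemma frame_sum_inj (D D' : I8 -> T4 R) :
  (forall i, (fun a b c e => \sum_k A k i * pull4 A (D k) a b c e) =
     (fun a b c e => \sum_k A k i * pull4 A (D' k) a b c e) :> T4 R) -> forall j, D j = D' j.
Proof.
move=> h j.
have hB (F : I8 -> T4 R) : pull4 B (fun a b c e => \sum_i B i j * (\sum_k A k i * pull4 A (F k) a b c e)) = F j.
  rewrite -[RHS](pull4VK Au) -/B; congr pull4; apply: T4_ext => x y z t.
  under eq_bigr => i _ do rewrite mulr_sumr.
  rewrite exchange_big /=; transitivity (\sum_k d k j * pull4 A (F k) x y z t); last by rewrite S1_d'.
  apply: eq_bigr => k _; transitivity ((A *m B) k j * pull4 A (F k) x y z t).
    by rewrite [(A *m B) k j]mxE mulr_suml; apply: eq_bigr => i _; ring.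
  by rewrite mulmxV // [1%:M k j]mxE.
rewrite -(hB D) -[RHS]hB; congr pull4; apply: T4_ext => x y z t; apply: eq_bigr => i _.
by congr (_ * _); exact: (f_equal (fun f : T4 R => f x y z t) (h i)).
Qed.

Lemma torsion_unique (w w' : T3 R) : alternating3 w -> alternating3 w' ->
  (forall i, dot (torsion_mx u w i) u = dot (torsion_mx u w' i) u) -> w = w'.
Proof.
move=> hw hw' h; pose v := pull3 B w; pose v' := pull3 B w'.
have hv : alternating3 v by exact: pull3_alternating.
have hv' : alternating3 v' by exact: pull3_alternating.
have wE : w = pull3 A v by rewrite pull3_comp mulVmx // pull3_1.
have wE' : w' = pull3 A v' by rewrite pull3_comp mulVmx // pull3_1.
have e := frame_sum_inj (D := fun j => dot (fun p a => v j a p) phi)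
   (D' := fun j => dot (fun p a => v' j a p) phi).
have {}e j : dot (fun p a => v j a p) phi = dot (fun p a => v' j a p) phi.
  by apply: e => i; rewrite -!dot_torsion_mx -wE -wE' h.
have hD : alternating3 (fun a b c => v a b c - v' a b c).
  by move=> x y z; split; rewrite (alternating3_perm hv x y z) (alternating3_perm hv' x y z); ring.
rewrite wE wE'; congr pull3; apply: T3_ext => a b c; apply/eqP; rewrite -subr_eq0; apply/eqP.
apply: (torsion_inj phi_alt phi_Q hD) => {a b c} i a b.
have -> : mP phi (fun a b => v i a b - v' i a b) a b = mP phi (v i) a b - mP phi (v' i) a b.
  by rewrite -[X in _ - X]mul1r -mulNr -mPB; apply: eq_S2 => x y; ring.
have h1 (z : T3 R) (hz : alternating3 z) p q : (fun p a => z i a p) q p = - (fun p a => z i a p) p q.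
  exact: (alternating3_perm hz i q p).1.1.1.1.
have := (dot_anti_eq phi_alt phi_Q (h1 v hv) (h1 v' hv')).1.
move=> /(_ (fun x y z t => f_equal (fun f : T4 R => f x y z t) (e i)) b a).
have h2 (z : T3 R) : mP phi (fun p a => z i a p) b a = mP phi (z i) a b.
  by rewrite mP_tr (mP_anti phi_alt) opprK.
by rewrite !h2 => ?; lra.
Qed.

Variables (N : I8 -> 'M[R]_8) (w : T3 R).
Hypothesis Nanti : forall i, (metric u *m N i)^T = - (metric u *m N i).
Hypothesis hw : alternating3 w.
(** Frame components of the family [N i], the label i included; they are antisymmetric because the
    [N i] are so for the metric. *)
Let n j : 'M[R]_8 := \sum_i B i j *: (A *m N i *m B).
Let w0 := pull3 B w.
Let wE : w = pull3 A w0.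
Proof. by rewrite /w0 pull3_comp mulVmx // pull3_1. Qed.

Lemma frame_dot i : dot (N i) u = fun a b c e => \sum_j A j i * pull4 A (dot (n j) phi) a b c e.
Proof.
rewrite dot_frame // -/B; apply: T4_ext => a b c e; rewrite -pull4_sum; congr pull4.
apply: T4_ext => x y z t; rewrite -dot_sum; congr dot.
apply: boolp.funext => p; apply: boolp.funext => q.
transitivity (\sum_j A j i * \sum_k B k j * (A *m N k *m B) p q); last first.
  by apply: eq_bigr => j _; rewrite /n summxE; congr (_ * _); apply: eq_bigr => k _; rewrite [RHS]mxE.
under eq_bigr => j _ do rewrite mulr_sumr.
rewrite exchange_big /=; transitivity (\sum_k d k i * (A *m N k *m B) p q); first by rewrite S1_d'.
apply: eq_bigr => k _; transitivity ((B *m A) k i * (A *m N k *m B) p q).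
  by rewrite mulVmx // [1%:M k i]mxE.
by rewrite [(B *m A) k i]mxE mulr_suml; apply: eq_bigr => j _; ring.
Qed.

Lemma frame_anti j a b : n j b a = - n j a b.
Proof.
have h i : (A *m N i *m B)^T = - (A *m N i *m B).
  have -> : A *m N i *m B = B^T *m (metric u *m N i) *m B.
    rewrite metric_pull // !mulmxA; congr (_ *m _ *m _).
    by rewrite -trmx_mul mulmxV // trmx1 mul1mx.
  by rewrite trmx_mul [(B^T *m _)^T]trmx_mul trmxK Nanti mulNmx mulmxN mulmxA.
rewrite /n !summxE -sumrN; apply: eq_bigr => i _.
rewrite [LHS]mxE [X in - X]mxE -mulrN; congr (_ * _).
by move/matrixP: (h i) => /(_ a b); rewrite [LHS]mxE [RHS]mxE.
Qed.

Lemma anti_pi7_eq j (T0 : T3 R) : alternating3 T0 ->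
  (dot (n j) phi = dot (fun p a => T0 j a p) phi) <->
  (forall a b, T0 j a b - 2^-1 * mP phi (T0 j) a b = n j b a - 2^-1 * mP phi (n j) b a).
Proof.
move=> hT; have h1 a b : T0 j a b = - T0 j b a.
  by exact: (alternating3_perm hT j b a).1.1.1.1.
have e := dot_anti_eq phi_alt phi_Q (@frame_anti j) (N' := fun p a => T0 j a p) (fun a b => h1 a b).
have h2 a b : mP phi (fun p a => T0 j a p) b a = mP phi (T0 j) a b.
  by rewrite mP_tr (mP_anti phi_alt) opprK.
split=> h.
  by move=> a b; move/(_ b a): (e.1 (fun x y z t => f_equal (fun f : T4 R => f x y z t) h)) => ->; rewrite h2.
by apply: T4_ext; apply: e.2 => a b; rewrite h2 h.
Qed.

Lemma frame_dot_eq (w1 : T3 R) : alternating3 w1 ->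
  (forall i, dot (N i) u = dot (torsion_mx u w1 i) u) <->
  (forall j, dot (n j) phi = dot (fun p a => pull3 B w1 j a p) phi).
Proof.
move=> hw1; have e i : dot (torsion_mx u w1 i) u =
    fun a b c e => \sum_j A j i * pull4 A (dot (fun p a => pull3 B w1 j a p) phi) a b c e.
  rewrite -dot_torsion_mx; congr (dot (torsion_mx u _ i) u).
  by rewrite pull3_comp mulVmx // pull3_1.
split=> [h|h i]; last by rewrite frame_dot e; apply: T4_ext => x y z t; under eq_bigr do rewrite h.
apply: (frame_sum_inj (D := fun j => dot (n j) phi)
   (D' := fun j => dot (fun p a => pull3 B w1 j a p) phi)) => i.
by rewrite -e -frame_dot.
Qed.

(** Modulo spin(7) only the Lambda^2_7 parts of the matrices act on Phi, and [torsion_of] produces a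
    3-form with these parts. *)
Lemma torsion_point_exists : exists T0, alternating3 T0 /\
  (forall i, dot (N i) u = dot (torsion_mx u (pull3 A T0) i) u) /\
  (forall j a b, T0 j a b - 2^-1 * mP phi (T0 j) a b = n j b a - 2^-1 * mP phi (n j) b a).
Proof.
pose b0 : T3 R := fun j a b => n j b a - 2^-1 * mP phi (n j) b a.
have hb i a b : b0 i b a = - b0 i a b.
  by rewrite /b0 frame_anti (mP_anti phi_alt _ b a); ring.
have hb7 i a b : mP phi (b0 i) a b = - 6 * b0 i a b.
  rewrite /b0 -[mP phi _ a b]opprK -mP_tr.
  by rewrite (mP_pi7 phi_alt phi_Q (@frame_anti i) a b) frame_anti (mP_anti phi_alt _ a b); ring.
have hT := torsion_of_alternating phi_alt hb.
exists (torsion_of phi b0).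
have hE j a b : torsion_of phi b0 j a b - 2^-1 * mP phi (torsion_of phi b0 j) a b = b0 j a b.
  exact: (torsion_ofP phi_alt phi_Q hb hb7).
split=> //; split=> //; apply/frame_dot_eq; first exact: pull3_alternating.
by move=> j; rewrite pull3_comp mulmxV // pull3_1; apply/(anti_pi7_eq j hT) => a b; exact: hE.
Qed.

(** Compare [w] with the 3-form T0 that does satisfy the torsion equation. The linear functional on
    the right is vol / 2 times [pair3] of T0 - w with [h], and this pairing is nondegenerate. *)
Lemma torsion_pointP : (forall i, dot (N i) u = dot (torsion_mx u w i) u) <->
  (forall h, alternating3 h ->
     - 4 * dwedge (fun i => dot (N i) u) h - 12 * wedge_pair u w h = 0).
Proof.
have [T0 [hT [hdot hpi]]] := torsion_point_exists.
have hw0 : alternating3 w0 by exact: pull3_alternating.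
have v0 : vol u != 0 by rewrite vol_pull phi_unitvol mulr1 -unitfE -unitmxE.
have key h : alternating3 h -> - 4 * dwedge (fun i => dot (N i) u) h - 12 * wedge_pair u w h =
    vol u / 2 * pair3 (fun a b c => T0 a b c - w0 a b c) (pull3 B h).
  move=> hh; have hh0 : alternating3 (pull3 B h) by exact: pull3_alternating.
  have -> : (fun i => dot (N i) u) = fun i => dot (torsion_mx u (pull3 A T0) i) u.
    by apply: boolp.funext.
  have hE : h = pull3 A (pull3 B h) by rewrite pull3_comp mulVmx // pull3_1.
  rewrite pair3B {1 2}hE wE wedge_pair_frame //.
  have -> : (fun i => dot (torsion_mx u (pull3 A T0) i) u) = fun i a b c e =>
     \sum_j A j i * pull4 A (dot (fun p a => T0 j a p) phi) a b c e.
    by apply: boolp.funext => i; exact: dot_torsion_mx.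
  rewrite dwedge_frame dwedge_torsion //.
  by set x := vol u; set y := pair3 T0 _; set z := pair3 w0 _; field.
split=> [h h' hh|h].
  rewrite key //; suff e : forall a b c, T0 a b c - w0 a b c = 0.
    have -> : pair3 (fun a b c => T0 a b c - w0 a b c) (pull3 B h') = 0.
      by apply: big1 => a _; apply: big1 => b _; apply: big1 => c _; rewrite e mul0r.
    by rewrite mulr0.
  move/(frame_dot_eq hw): h; rewrite -/w0 => h.
  have hD : alternating3 (fun a b c => T0 a b c - w0 a b c).
    by move=> a b c; split; rewrite (alternating3_perm hT a b c) (alternating3_perm hw0 a b c); ring.
  apply: (torsion_inj phi_alt phi_Q hD) => i a b.
  have -> : mP phi (fun a b => T0 i a b - w0 i a b) a b = mP phi (T0 i) a b - mP phi (w0 i) a b.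
    by rewrite -[X in _ - X]mul1r -mulNr -mPB; apply: eq_S2 => x y; ring.
  by have := (anti_pi7_eq i hw0).1 (h i) a b; have := hpi i a b; move=> <-; lra.
have e a b c : T0 a b c = w0 a b c.
  have hD : alternating3 (fun a b c => T0 a b c - w0 a b c).
    by move=> x y z; split; rewrite (alternating3_perm hT x y z) (alternating3_perm hw0 x y z); ring.
  apply/eqP; rewrite -subr_eq0; apply/eqP.
  apply: (pair3_eq0 hD) => h0 hh0.
  have := h (pull3 A h0) (pull3_alternating A hh0); rewrite key; last exact: pull3_alternating.
  rewrite pull3_comp mulmxV // pull3_1 => /eqP; rewrite mulf_eq0 => /orP[|/eqP //].
  by rewrite mulf_eq0 (negPf v0) invr_eq0 pnatr_eq0.
by move=> i; rewrite hdot wE; congr (dot (torsion_mx u (pull3 A _) i) u); exact: T3_ext.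
Qed.

End TorsionPoint.
End WedgeForms.

(** * Velocities of Cayley forms at the model *)

Section ModelVelocity.
Variable R : realType.
Local Notation d x y := ((x == y)%:R : R).
Local Notation phi := (Phi0 R).
Local Notation phi_alt := (Phi0_alternating R).
Local Notation phi_Q := (@Phi0_contract1 R).

Lemma alt4D (u v : T4 R) a b c e :
  alt4 (fun a b c e => u a b c e + v a b c e) a b c e = alt4 u a b c e + alt4 v a b c e.
Proof. by rewrite !alt4E; ring. Qed.

Lemma alt4Z x (u : T4 R) a b c e :
  alt4 (fun a b c e => x * u a b c e) a b c e = x * alt4 u a b c e.
Proof. by rewrite !alt4E; ring. Qed.

Lemma alt4_sym13 (f g : I8 -> I8 -> R) : (forall x y, f x y = f y x) ->
  forall a b c e, alt4 (fun a b c e => f a c * g b e - f a e * g b c) a b c e = 0.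
Proof.
move=> hf a b c e; rewrite alt4E (hf b a) (hf c a) (hf e a) (hf c b) (hf e b) (hf e c); ring.
Qed.

Lemma alt4_mP (E : T4 R) a b c e : alternating4 E ->
  alt4 (fun a b c e => mP phi (E a b) c e) a b c e = alt4 (fun a b c e => mP phi (E c e) a b) a b c e.
Proof. by move=> hE; rewrite !alt4E; ring. Qed.

Lemma phi_sym0 (h : I8 -> I8 -> R) : (forall x y, h x y = h y x) ->
  (forall a b, S2 (fun p k => h p k * phi a p b k) = 0) *
  (forall a b, S2 (fun p k => h p k * phi a p k b) = 0) *
  (forall a b, S2 (fun p k => h p k * phi p a b k) = 0) *
  (forall a b, S2 (fun p k => h p k * phi p a k b) = 0).
Proof.
move=> hs; have h1 a b : S2 (fun p k => h p k * phi a p b k) = 0.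
  apply: oppr_fix0; rewrite {1}S2_swap -S2N; apply: eq_S2 => p k.
  by rewrite (hs k p) (alternating4_perm phi_alt a p b k) mulrN.
split; first split; first split => // a b.
- by rewrite -(oppr0) -(h1 a b) -S2N; apply: eq_S2 => p k; rewrite (alternating4_perm phi_alt a p b k) mulrN.
- by move=> a b; rewrite -(oppr0) -(h1 a b) -S2N; apply: eq_S2 => p k; rewrite (alternating4_perm phi_alt a p b k) mulrN.
- by move=> a b; rewrite -(h1 a b); apply: eq_S2 => p k; rewrite (alternating4_perm phi_alt a p b k).
Qed.

(** Inserting a symmetric matrix into the double contraction. The terms in which it meets two
    indices of the same [phi] vanish; of the rest, those linear in [phi] assemble to the action of
    [h]. *)
Lemma contract_metric (h : I8 -> I8 -> R) : (forall x y, h x y = h y x) -> forall a b c e,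
  S2 (fun p k => h p k * \sum_q phi a b p q * phi c e k q) =
  dot h phi a b c e - (\sum_p h p p) * phi a b c e
  + (\sum_p h p p) * (d a c * d b e - d a e * d b c)
  + (d a e * h b c + d b c * h a e - d a c * h b e - d b e * h a c).
Proof.
move=> hs a b c e; set t := \sum_p h p p.
have e0 p k : h p k * \sum_q phi a b p q * phi c e k q =
  (d p k * h p k) * (d a c * d b e - d a e * d b c - phi a b c e)
  + d b k * (d c p * (h p k * d a e)) + d a k * (d e p * (h p k * d b c))
  - d b k * (d e p * (h p k * d a c)) - d a k * (d c p * (h p k * d b e))
  - d a c * (h p k * phi b p e k) - d b c * (h p k * phi p a e k) - d c p * (h p k * phi a b e k)
  - d a e * (h p k * phi b p k c) - d b e * (h p k * phi p a k c) - d e p * (h p k * phi a b k c)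
  - d a k * (h p k * phi b p c e) - d b k * (h p k * phi p a c e).
  rewrite phi_Q (eq_sym c p) (eq_sym e p); set z := h p k.
  by move: (phi a b c e) (phi b p e k) (phi p a e k) (phi a b e k) (phi b p k c) (phi p a k c)
     (phi a b k c) (phi b p c e) (phi p a c e) => *; ring.
rewrite (eq_S2 e0) !(S2D, S2N) !S2Zl.
have hd2 i j (f : I8 -> I8 -> R) : S2 (fun p q => d i q * (d j p * f p q)) = f j i.
  by rewrite S2_d2 S1_d.
have ht y : S2 (fun p q => d p q * h p q * y) = t * y.
  rewrite /t mulr_suml; apply: eq_bigr => p _; under eq_bigr => q _ do rewrite -mulrA.
  by rewrite S1_d.
rewrite ht (hd2 b c (fun p q => h p q * d a e)) (hd2 a e (fun p q => h p q * d b c)).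
rewrite (hd2 b e (fun p q => h p q * d a c)) (hd2 a c (fun p q => h p q * d b e)).
have [[[s1 s2] s3] s4] := phi_sym0 hs.
rewrite s1 s3 s2 s4 (S2_d1 c (fun p q => h p q * phi a b e q)) (S2_d1 e (fun p q => h p q * phi a b q c)).
rewrite (S2_d2 a (fun p q => h p q * phi b p c e)) (S2_d2 b (fun p q => h p q * phi p a c e)).
have -> : dot h phi a b c e = - (\sum_q h c q * phi a b e q) - (\sum_q h e q * phi a b q c)
   - (\sum_p h p a * phi b p c e) - (\sum_p h p b * phi p a c e).
  have q1 : \sum_p h p a * phi p b c e = - \sum_p h p a * phi b p c e.
    by rewrite -sumrN; apply: eq_bigr => p _; rewrite (alternating4_perm phi_alt p b c e) mulrN opprK.
  have q2 : \sum_p h p b * phi a p c e = - \sum_p h p b * phi p a c e.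
    by rewrite -sumrN; apply: eq_bigr => p _; rewrite (alternating4_perm phi_alt p a c e) mulrN.
  have q3 : \sum_p h p c * phi a b p e = - \sum_p h c p * phi a b e p.
    by rewrite -sumrN; apply: eq_bigr => p _; rewrite (alternating4_perm phi_alt a b e p) mulrN (hs c p).
  have q4 : \sum_p h p e * phi a b c p = - \sum_p h e p * phi a b p c.
    by rewrite -sumrN; apply: eq_bigr => p _; rewrite (alternating4_perm phi_alt a b p c) mulrN (hs e p).
  by rewrite /dot q1 q2 q3 q4; set x := \sum_p _; set y := \sum_p _; set z := \sum_p _; set w := \sum_p _; ring.
rewrite (hs c b) (hs e b) (hs e a) (hs c a); move: (\sum_q h c q * _) (\sum_q h e q * _).
move: (\sum_p h p a * _) (\sum_p h p b * _) (phi a b c e) => *; ring.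
Qed.

(** The last hypothesis is the double contraction identity differentiated at the model, with E and h
    the derivatives of the form and of its metric. Antisymmetrised over the four indices it
    determines E through [mX E], which exhibits E as N.phi; feeding this back into [mX] identifies
    the symmetric part of N. *)
Lemma model_velocity (E : T4 R) (h : I8 -> I8 -> R) : alternating4 E ->
  (forall x y, h x y = h y x) ->
  (forall a b c e, mP phi (E a b) c e + mP phi (E c e) a b
     - 2 * S2 (fun p k => h p k * \sum_q phi a b p q * phi c e k q) =
     6 * (h a c * d b e + d a c * h b e - h a e * d b c - d a e * h b c) - 4 * E a b c e) ->
  exists2 N : I8 -> I8 -> R, E = dot N phi & forall a b, N a b + N b a = h a b.
Proof.
move=> hE hs H; set t := \sum_p h p p.
pose XE p q := mX phi E q p.
(* The Kronecker terms disappear under antisymmetrisation, and [J4_mX] eliminates the two [mP]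
   terms. The identity matrix acts as 4, which accounts for the trace coefficient in [N] below. *)
have H2 a b c e : 16 / 3 * E a b c e = 18^-1 * dot XE phi a b c e + 2 * dot h phi a b c e - 2 * t * phi a b c e.
  have e1 x y z w : mP phi (E x y) z w + mP phi (E z w) x y =
    2 * dot h phi x y z w + (- 2 * t * phi x y z w) + (- 4 * E x y z w)
    + (2 * t * (d x z * d y w - d x w * d y z) + 4 * (h x z * d y w - h x w * d y z)
    + 4 * (d x z * h y w - d x w * h y z)).
    by have := H x y z w; rewrite contract_metric // -/t; lra.
  have := J4_mX phi_alt phi_Q hE a b c e.
  have : alt4 (fun x y z w => mP phi (E x y) z w + mP phi (E z w) x y) a b c e =
     2 * dot h phi a b c e - 2 * t * phi a b c e - 4 * E a b c e.
    rewrite (eq_alt4 e1) !alt4D !alt4Z alt4_sym13; last by move=> *; rewrite eq_sym.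
    rewrite alt4_sym13 // alt4_sym13; last by move=> *; rewrite eq_sym.
    rewrite !(alt4_id hE) (alt4_id phi_alt) alt4_id; last exact: dot_alternating phi_alt.
    ring.
  rewrite alt4D alt4_mP // -/XE; set A4 := alt4 _ a b c e; lra.
pose N a b := 3 / 16 * (18^-1 * XE a b + 2 * h a b - 2^-1 * t * d a b).
have d1 a b c e : dot (fun x y => d x y) phi a b c e = 4 * phi a b c e.
  have k (f : I8 -> R) x : \sum_p d p x * f p = f x by rewrite S1_d'.
  by rewrite /dot !k; ring.
have EN : E = dot N phi.
  apply: T4_ext => a b c e.
  have -> : N = (fun p q => (3 / 16 * 18^-1 * XE p q + 3 / 8 * h p q) + (- 3 / 32 * t) * d p q).
    by apply: boolp.funext => x; apply: boolp.funext => y; rewrite /N; field.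
  rewrite dotB d1.
  have -> : (fun p q => 3 / 16 * 18^-1 * XE p q + 3 / 8 * h p q) = (fun p q => (0 + 3 / 16 * 18^-1 * XE p q) + 3 / 8 * h p q).
    by apply: boolp.funext => x; apply: boolp.funext => y; rewrite add0r.
  rewrite dotB dotB; have -> : dot (fun=> fun=> 0) phi a b c e = 0.
    by rewrite /dot !big1 ?addr0 // => *; rewrite mul0r.
  have := H2 a b c e; lra.
exists N => // a b.
have eX x y : XE x y = 24 * N x y + 18 * (\sum_p N p p) * d x y + 12 * mP phi N y x.
  by rewrite /XE {1}EN (mX_dot phi_alt phi_Q) (eq_sym y x).
set T := \sum_p N p p in eX.
(* The trace of N is found first, as the unknown T enters [eX]; the factor 168 is 24 + 18 * 8. *)
have tT : T = 2^-1 * t.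
  have : T = 3 / 16 * (18^-1 * (168 * T) + 2 * t - 4 * t).
    have eT : \sum_p XE p p = 168 * T.
      have aux (f : I8 -> R) : \sum_p (24 * f p + 18 * T * 1 + 12 * mP phi N p p) =
          24 * (\sum_p f p) + 144 * T.
        rewrite !big_split /= -!mulr_sumr sumr_const card_ord.
        rewrite [X in _ + _ * X]big1 => [|p _]; last exact: (oppr_fix0 (mP_anti phi_alt N p p)).
        by set y := \sum_p _; set z := T; ring.
      under eq_bigr => p _ do rewrite eX dxx.
      by rewrite (aux (fun p => N p p)) -/T; set z := T; ring.
    rewrite -eT {1}/T -mulr_sumr; congr (_ * _).
    rewrite big_split big_split /= -!mulr_sumr -/t sumrN -mulr_sumr.
    under [X in _ - _ * X]eq_bigr => p _ do rewrite dxx.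
    by rewrite sumr_const card_ord; field.
  lra.
have : N a b + N b a = 3 / 16 * (18^-1 * (XE a b + XE b a) + 4 * h a b - t * d a b).
  by rewrite /N (hs b a) (eq_sym b a); field.
rewrite !eX tT (eq_sym b a) (mP_anti phi_alt N a b); lra.
Qed.
End ModelVelocity.

(** * Second-order deformations at the model *)

Section JetModel.
Variable R : realType.
Local Notation d x y := ((x == y)%:R : R).
Local Notation phi := (Phi0 R).
Local Notation phi_alt := (Phi0_alternating R).
Local Notation phi_Q := (@Phi0_contract1 R).

Lemma mV_mP (f : T3 R) v : (forall i a b, f i b a = - f i a b) ->
  S3 (fun p q r => phi v p q r * mP phi (f p) q r) = 12 * (\sum_p f p v p) - 4 * mV phi f v.
Proof.
move=> hf.
transitivity (\sum_p S2 (fun s t => (6 * (d v s * d p t - d v t * d p s) - 4 * phi v p s t) * f p s t)).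
  apply: eq_bigr => p _; transitivity (S2 (fun q r => S2 (fun s t => phi v p q r * phi s t q r * f p s t))).
    apply: eq_S2 => q r; rewrite /mP -S2Zl; apply: eq_S2 => s t.
    by rewrite (alternating4_perm phi_alt s t q r) mulrA.
  rewrite S2_S2; apply: eq_S2 => s t; rewrite -(contract2 phi_alt phi_Q) mulrC -S2Zl.
  by apply: eq_S2 => q r; rewrite mulrC.
transitivity (\sum_p (12 * f p v p - 4 * S2 (fun s t => phi v p s t * f p s t))); last first.
  by rewrite big_split /= sumrN -!mulr_sumr.
apply: eq_bigr => p _.
transitivity (S2 (fun s t => d v s * (6 * (d p t * f p s t))) - S2 (fun s t => d v t * (6 * (d p s * f p s t)))
   - 4 * S2 (fun s t => phi v p s t * f p s t)).
  by rewrite -S2Zl -!S2N -!S2D; apply: eq_S2 => s t; ring.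
rewrite S2_d1 S2_d2 -!mulr_sumr !S1_d (hf p v p); set y := S2 _; ring.
Qed.

(** Take the vector part of the equation between the Lambda^2_7 projections: by [mV_mP] it is 3
    times the vector part minus 6 times the trace, and a 3-form has no trace. *)
Lemma mV_torsion (T n : T3 R) : alternating3 T -> (forall i a b, n i b a = - n i a b) ->
  (forall i a b, T i a b - 2^-1 * mP phi (T i) a b = n i a b - 2^-1 * mP phi (n i) a b) ->
  forall v, mV phi T v = mV phi n v - 2 * \sum_p n p v p.
Proof.
move=> hT hn h v.
have e (f : T3 R) : (forall i a b, f i b a = - f i a b) ->
    mV phi (fun i a b => f i a b + - 2^-1 * mP phi (f i) a b) v = 3 * mV phi f v - 6 * \sum_p f p v p.
  by move=> hf; rewrite mV_D /mV mV_mP // -/(mV phi f v); set y := \sum_p _; field.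
have hT1 i a b : T i b a = - T i a b by exact: (alternating3_perm hT i a b).1.1.1.1.
have e1 := e T hT1; have e2 := e n hn.
have e3 : mV phi (fun i a b => T i a b + - 2^-1 * mP phi (T i) a b) v =
   mV phi (fun i a b => n i a b + - 2^-1 * mP phi (n i) a b) v.
  by apply: eq_S3 => p q r; rewrite !mulNr h.
have e4 : \sum_p T p v p = 0.
  by apply: big1 => p _; exact: (oppr_fix0 (alternating3_perm hT p v p).2).
move: e3; rewrite e1 e2 e4; lra.
Qed.

Variables (al s : I8 -> I8 -> R).
Hypothesis al_anti : forall a b, al b a = - al a b.
Hypothesis al7 : forall a b, mP phi al a b = - 6 * al a b.
Hypothesis s_sym : forall a b, s b a = s a b.
(** For the deformation by q (s/2 + al), where q has Hessian delta, this is the second derivative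
    d_ji (s/2 + al) minus the j-derivative of the Christoffel symbols. The symmetric terms d_ji s/2
    cancel. The indices [a k] are transposed as in [torsion_mx]. *)
Definition jet_mx j : T3 R := fun i a k =>
  d j i * al k a - 2^-1 * (d j a * s i k - d j k * s i a).

Lemma jet_mx_anti j i a b : jet_mx j i b a = - jet_mx j i a b.
Proof. by rewrite /jet_mx (al_anti a b); ring. Qed.

Lemma mP_jet j i a b : mP phi (jet_mx j i) a b = 6 * d j i * al a b - \sum_k phi a b j k * s i k.
Proof.
rewrite -[mP _ _ a b]/(S2 _).
transitivity (S2 (fun x k => - d j i * (phi a b x k * al x k))
   - 2^-1 * S2 (fun x k => d j x * (phi a b x k * s i k))
   + 2^-1 * S2 (fun x k => d j k * (phi a b x k * s i x))).
  rewrite -!S2Zl -S2N -!S2D; apply: eq_S2 => x k; rewrite /jet_mx (al_anti x k).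
  by move: (phi a b x k) => y; ring.
rewrite S2Zl -/(mP phi al a b) al7 S2_d1 S2_d2.
have -> : \sum_p phi a b p j * s i p = - \sum_q phi a b j q * s i q.
  by rewrite -sumrN; apply: eq_bigr => k _; rewrite (alternating4_perm phi_alt a b j k) mulNr.
by set y := \sum_q _; field.
Qed.

Let t := \sum_p s p p.

Lemma mV_jet j v : mV phi (jet_mx j) v - 2 * (\sum_p jet_mx j p v p) = - 8 * al j v + d j v * t - s j v.
Proof.
have -> : mV phi (jet_mx j) v = 6 * al v j.
  transitivity (S3 (fun i a k => d j i * (phi v i a k * al k a))
     - 2^-1 * S3 (fun i a k => d j a * (phi v i a k * s i k))
     + 2^-1 * S3 (fun i a k => d j k * (phi v i a k * s i a))).
    rewrite -!S3Zl -S3N -!S3D; apply: eq_S3 => i a k; rewrite /jet_mx.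
    by move: (phi v i a k) => y; ring.
  rewrite S3_d1 S3_d2 S3_d3.
  have -> : S2 (fun a k => phi v j a k * al k a) = 6 * al v j.
    rewrite -[RHS]opprK -mulNr -al7 -S2N; apply: eq_S2 => a k.
    by rewrite (al_anti a k) mulrN.
  have h0 (f : I8 -> I8 -> R) : (forall x y, f y x = - f x y) -> S2 (fun x y => f x y * s x y) = 0.
    move=> hf; apply: oppr_fix0; rewrite {1}S2_swap -S2N; apply: eq_S2 => x y.
    by rewrite s_sym hf mulNr.
  rewrite (h0 (fun x y => phi v x j y)) ?(h0 (fun x y => phi v x y j)) ?mulr0 ?subr0 ?addr0 //.
    by move=> x y; rewrite (alternating4_perm phi_alt v x y j).
  by move=> x y; rewrite (alternating4_perm phi_alt v x j y).
have -> : \sum_p jet_mx j p v p = al j v - 2^-1 * (d j v * t - s j v).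
  transitivity ((\sum_p d j p * al p v) - 2^-1 * (d j v * t - \sum_p d j p * s p v)).
    rewrite /t !mulr_sumr -sumrN -big_split /= mulr_sumr -sumrN -big_split /=.
    by apply: eq_bigr => p _; rewrite /jet_mx; ring.
  by rewrite !S1_d.
by rewrite (al_anti j v); field.
Qed.

Variable tau : I8 -> T3 R.
Hypothesis tau_alt : forall j, alternating3 (tau j).
Hypothesis tau_pi7 : forall j i a b, tau j i a b - 2^-1 * mP phi (tau j i) a b =
  jet_mx j i a b - 2^-1 * mP phi (jet_mx j i) a b.
Let B j i a b := jet_mx j i a b - 2^-1 * mP phi (jet_mx j i) a b.

Lemma mV_tau j v : mV phi (tau j) v = - 8 * al j v + d j v * t - s j v.
Proof. by rewrite -mV_jet; apply: mV_torsion => // i a b; exact: jet_mx_anti. Qed.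

Lemma sum_B1 a b : \sum_r B r a b r = 4 * al a b + 7 / 2 * s a b.
Proof.
transitivity (\sum_r (d a r * al r b - 2^-1 * (d b r * s a r - s a b)
   - 2^-1 * (6 * (d a r * al b r)))).
  apply: eq_bigr => r _; rewrite /B mP_jet /jet_mx dxx (eq_sym r a) (eq_sym r b).
  rewrite (_ : \sum_k _ = 0); first by ring.
  by apply: big1 => k _; rewrite (phi_rep phi_alt) mul0r.
rewrite big_split /= big_split /= !sumrN -!mulr_sumr S1_d big_split /= sumrN S1_d S1_d.
by rewrite sumr_const card_ord (al_anti a b); field.
Qed.

Lemma sum_B2 a b : \sum_r B r r a b = - 32 * al a b.
Proof.
transitivity (\sum_r (al b a - 2^-1 * (d a r * s r b - d b r * s r a)
   - 3 * al a b + 2^-1 * \sum_k phi a b r k * s r k)).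
  apply: eq_bigr => r _; rewrite /B mP_jet /jet_mx dxx (eq_sym r a) (eq_sym r b).
  by set y := \sum_k _; field.
rewrite !big_split /= !sumrN -!mulr_sumr big_split /= sumrN !S1_d.
have -> : \sum_r \sum_k phi a b r k * s r k = 0 by apply: (mP_sym phi_alt) => x y; rewrite s_sym.
by rewrite !sumr_const card_ord (s_sym a b) (al_anti a b); ring.
Qed.

(** The traces of [B] over its two kinds of slot, with the vector part from [mV_tau], determine this
    trace of the torsion; the symmetric matrix [s] drops out. *)
Lemma sum_tau a b : \sum_r tau r a b r = - 8 * al a b.
Proof.
have e r : tau r a b r = 2^-1 * (B r a b r + B r b r a + B r r a b) + 12^-1 * \sum_v phi a b r v * mV phi (tau r) v.
  exact: (torsion_trace phi_alt phi_Q (tau_alt r) (tau_pi7 r)).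
have aux (f g h k : I8 -> R) : \sum_r (2^-1 * (f r + g r + h r) + 12^-1 * k r) =
    2^-1 * (\sum_r f r + \sum_r g r + \sum_r h r) + 12^-1 * \sum_r k r.
  by rewrite big_split /= -!mulr_sumr !big_split.
under eq_bigr => r _ do rewrite e.
rewrite (aux (fun r => B r a b r)) sum_B1 sum_B2.
have -> : \sum_r B r b r a = 4 * al a b - 7 / 2 * s a b.
  transitivity (- \sum_r B r b a r); last by rewrite sum_B1 (al_anti a b) (s_sym a b); ring.
  rewrite -sumrN; apply: eq_bigr => r _; rewrite /B jet_mx_anti (mP_anti phi_alt _ a r).
  by ring.
have -> : \sum_r \sum_v phi a b r v * mV phi (tau r) v = 48 * al a b.
  have -> : 48 * al a b = - 8 * mP phi al a b by rewrite al7; ring.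
  transitivity (S2 (fun r v => - 8 * (phi a b r v * al r v) + phi a b r v * (d r v * t - s r v))).
    by apply: eq_S2 => r v; rewrite mV_tau; ring.
  rewrite S2D S2Zl; have -> : S2 (fun r v => phi a b r v * (d r v * t - s r v)) = 0.
    by apply: (mP_sym phi_alt) => r v; rewrite s_sym (eq_sym r v).
  by rewrite addr0.
by field.
Qed.

(** The change of Phi_b^{pqr} (dT)_{apqr} under the deformation. The factors 64 on Lambda^2_7, 20 on
    traceless symmetric matrices and 28 = 20 + 8 on the identity are nonzero, so every element of
    S^2 + Lambda^2_7 occurs. *)
Lemma jet_model a b : mX phi (dform tau) a b = 64 * al a b + 20 * s a b + t * d a b.
Proof.
rewrite /mX contract_dform; last exact: (alternating4_3 b phi_alt).
rewrite -[S3 (fun p q r => phi b p q r * tau a p q r)]/(mV phi (tau a) b) mV_tau.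
have -> : S3 (fun p q r => phi b p q r * tau r a p q) = - 24 * al a b - 7 * s a b.
  transitivity (\sum_r mP phi (tau r a) b r).
    rewrite S3_swap23 S3_swap12; apply: eq_S3 => r p q.
    by rewrite (alternating4_perm phi_alt b r p q).
  transitivity (\sum_r 2 * (tau r a b r - B r a b r)).
    by apply: eq_bigr => r _; have := tau_pi7 r a b r; rewrite -/(B r a b r); lra.
  have aux (f g : I8 -> R) : \sum_r 2 * (f r - g r) = 2 * (\sum_r f r - \sum_r g r).
    by rewrite -mulr_sumr big_split /= sumrN.
  by rewrite (aux (fun r => tau r a b r)) sum_tau sum_B1; field.
by field.
Qed.
End JetModel.

(** * Dimensions of S^2, Lambda^2_7 and the tangent space *)

Section Dimensions.
Variable R : realType.
Local Notation d x y := ((x == y)%:R : R).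
Local Notation phi := (Phi0 R).
Local Notation phi_alt := (Phi0_alternating R).
Local Notation phi_Q := (@Phi0_contract1 R).

(** An element of Lambda^2_7 is determined by one row, hence by 7 numbers. Contracting the
    eigenvalue equation for that row with phi_{abzk} gives -6 X = 8 (...) + 2 X, which is solved for
    [n]. *)
Lemma pi7_coord (n : I8 -> I8 -> R) z : (forall a b, n b a = - n a b) ->
  (forall a b, mP phi n a b = - 6 * n a b) ->
  forall a b, n a b = \sum_k n z k * (d a z * d b k - d b z * d a k - phi a b z k).
Proof.
move=> hn h7 a b; pose X := \sum_k phi a b z k * n z k.
have e6 : - 6 * X = 8 * n a b + 8 * d b z * n z a - 8 * d a z * n z b + 2 * X.
  transitivity (S2 (fun c e => (\sum_k phi a b z k * phi c e z k) * n c e)).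
    transitivity (\sum_k S2 (fun c e => phi a b z k * (phi z k c e * n c e))).
      by rewrite mulr_sumr; apply: eq_bigr => k _; rewrite mulrCA -h7 -S2Zl.
    rewrite S1_S2; apply: eq_S2 => c e; rewrite mulr_suml; apply: eq_bigr => k _.
    by rewrite (alternating4_perm phi_alt z k c e) mulrA.
  transitivity (S2 (fun c e => d a c * (d b e * n c e)) - S2 (fun c e => d a e * (d b c * n c e))
    + S2 (fun c e => d z c * (d a e * (d b z * n c e))) - S2 (fun c e => d z c * (d b e * (d a z * n c e)))
    + S2 (fun c e => d z e * (d b c * (d a z * n c e))) - S2 (fun c e => d z e * (d a c * (d b z * n c e)))
    - S2 (fun c e => d z c * (phi a b e z * n c e)) - S2 (fun c e => d z e * (phi a b z c * n c e))
    - d a z * S2 (fun c e => phi b z c e * n c e) - d b z * S2 (fun c e => phi z a c e * n c e)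
    - S2 (fun c e => phi a b c e * n c e)).
    rewrite -!S2Zl -!S2N -!S2D; apply: eq_S2 => c e; rewrite phi_Q dxx !(phi_rep phi_alt).
    by move: (phi a b e z) (phi a b z c) (phi b z c e) (phi z a c e) (phi a b c e) => *; ring.
  rewrite !S2_d1 !S2_d2 !S1_d -!/(mP phi n _ _) !h7.
  have -> : \sum_q phi a b q z * n z q = - X.
    by rewrite -sumrN; apply: eq_bigr => k _; rewrite (alternating4_perm phi_alt a b z k) mulNr.
  have -> : \sum_p phi a b z p * n p z = - X.
    by rewrite -sumrN; apply: eq_bigr => k _; rewrite (hn z k) mulrN.
  rewrite (hn a b) (hn z a) (hn z b); set y := X; ring.
have -> : \sum_k n z k * (d a z * d b k - d b z * d a k - phi a b z k) =
   d a z * n z b - d b z * n z a - X.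
  transitivity (d a z * (\sum_k d b k * n z k) - d b z * (\sum_k d a k * n z k) - X).
    rewrite !mulr_sumr -!sumrN -!big_split /=; apply: eq_bigr => k _; ring.
  by rewrite !S1_d.
by move: e6; move: (n a b) (n z a) (n z b) X ((a == z)%:R : R) ((b == z)%:R : R) => *; lra.
Qed.

(** F is four times the Lambda^2_7 projection of the elementary 2-form on [z] and [k]. *)
Lemma pi7_basis z k : let F a b := d a z * d b k - d b z * d a k - phi a b z k in
  (forall a b, F b a = - F a b) /\ (forall a b, mP phi F a b = - 6 * F a b).
Proof.
move=> F; have hF a b : F b a = - F a b.
  by rewrite /F (alternating4_perm phi_alt a b z k); ring.
pose e a b := d a z * d b k - d b z * d a k.
have he a b : e b a = - e a b by rewrite /e; ring.
have Fe a b : F a b = e a b - 2^-1 * mP phi e a b.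
  congr (_ - _); transitivity (2^-1 * (S2 (fun p q => d z p * (d k q * phi a b p q))
     - S2 (fun p q => d z q * (d k p * phi a b p q)))).
    by rewrite S2_d1 S2_d2 !S1_d (alternating4_perm phi_alt a b z k); field.
  by rewrite -S2N -S2D; congr (_ * _); apply: eq_S2 => p q; rewrite /e (eq_sym p z) (eq_sym q z) (eq_sym p k) (eq_sym q k); ring.
split=> // a b; have -> : F = (fun a b => e a b - 2^-1 * mP phi e a b).
  by apply: boolp.funext => x; apply: boolp.funext => y.
exact: (mP_pi7 phi_alt phi_Q (N := e) he).
Qed.

Lemma dot_pi7 (al : I8 -> I8 -> R) : (forall a b, al b a = - al a b) ->
  let be a b := 4^-1 * (al a b - 2^-1 * mP phi al a b) in
  [/\ (forall a b, be b a = - be a b), (forall a b, mP phi be a b = - 6 * be a b)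
    & dot be phi = dot al phi].
Proof.
move=> hal be; have hbe a b : be b a = - be a b.
  by rewrite /be hal (mP_anti phi_alt _ b a); ring.
have h7 a b : mP phi be a b = - 6 * be a b.
  rewrite /be mulrCA -(mP_pi7 phi_alt phi_Q hal) /mP -S2Zl; apply: eq_S2 => p q; ring.
split=> //; apply: T4_ext; apply/(dot_anti_eq phi_alt phi_Q hbe hal) => a b.
by rewrite h7 /be; field.
Qed.

(** Apply [mX]: the antisymmetric part is multiplied by -96, and the symmetric part by 24 plus 18
    times its trace. *)
Lemma dot_sym7_eq0 (s al : I8 -> I8 -> R) : (forall a b, s b a = s a b) ->
  (forall a b, al b a = - al a b) -> (forall a b, mP phi al a b = - 6 * al a b) ->
  dot (fun a b => s a b + al a b) phi = (fun _ _ _ _ => 0) ->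
  forall a b, s a b = 0 /\ al a b = 0.
Proof.
move=> hs hal h7 h0; set N := fun a b => s a b + al a b.
have t0 : \sum_p al p p = 0 by apply: big1 => p _; exact/oppr_fix0/hal.
have eX a b : 24 * (s a b - al a b) + 18 * (\sum_p s p p) * d a b - 72 * al a b = 0.
  have : mX phi (dot N phi) a b = 0.
    by rewrite h0 /mX; apply: big1 => p _; apply: big1 => q _; apply: big1 => r _; rewrite mulr0.
  rewrite (mX_dot phi_alt phi_Q) /N big_split /= t0 addr0.
  have -> : mP phi (fun a b => s a b + al a b) a b = - 6 * al a b.
    rewrite -h7 -[RHS]add0r -{1}(mP_sym phi_alt (fun a b => hs b a) a b) -[mP phi al a b]mul1r -mPB.
    by apply: eq_S2 => p q; rewrite mul1r.
  by rewrite (hs a b) (hal a b) => hz; lra.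
have al0 a b : al a b = 0.
  by have := eX a b; have := eX b a; rewrite (hs a b) (hal a b) (eq_sym b a); lra.
have s0 a b : s a b = - (3 / 4) * (\sum_p s p p) * d a b by have := eX a b; rewrite al0; lra.
have ts : \sum_p s p p = 0.
  have : \sum_p s p p = - 6 * \sum_p s p p.
    rewrite {1}(eq_bigr (fun=> - (3 / 4) * (\sum_p s p p))) => [|p _]; last by rewrite s0 dxx mulr1.
    by rewrite sumr_const card_ord; field.
  by lra.
by move=> a b; rewrite s0 ts mulr0 mul0r.
Qed.

Lemma limg_inj_dim (U V : vectType R) (f : {linear U -> V}) :
  (forall x, f x = 0 -> x = 0) -> \dim (linfun f @: fullv)%VS = \dim (@fullv R U).
Proof.
move=> h; apply: limg_dim_eq; rewrite capfv; apply/eqP; rewrite -subv0; apply/subvP => x.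
by rewrite memv_ker lfunE /= => /eqP /h ->; rewrite mem0v.
Qed.

Definition tr_sym (N : 'M[R]_8) : 'M[R]_8 := N + N^T.
Lemma tr_sym_linear : linear tr_sym.
Proof. by move=> x N N'; rewrite /tr_sym linearP scalerDr addrACA. Qed.
HB.instance Definition _ := GRing.isLinear.Build R 'M[R]_8 'M[R]_8 *:%R tr_sym tr_sym_linear.

(** Changing the sign on and below the diagonal turns antisymmetric matrices into symmetric ones
    with zero diagonal, bijectively. *)
Definition low_sign (N : 'M[R]_8) : 'M[R]_8 := \matrix_(i, j) (if (i < j)%N then N i j else - N i j).
Lemma low_sign_linear : linear low_sign.
Proof. by move=> x N N'; apply/matrixP => i j; rewrite !mxE; case: ifP => _; ring. Qed.
HB.instance Definition _ := GRing.isLinear.Build R 'M[R]_8 'M[R]_8 *:%R low_sign low_sign_linear.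

Definition symm_space : {vspace 'M[R]_8} := limg (linfun tr_sym).

Lemma mem_symm N : N \in symm_space <-> N^T = N.
Proof.
split=> [/memv_imgP[M _ ->]|h].
  by rewrite lfunE /= /tr_sym linearD /= trmxK addrC.
apply/memv_imgP; exists (2^-1 *: N); rewrite ?memvf // lfunE /= /tr_sym linearZ /= h.
by rewrite -scalerDl -[LHS]scale1r; congr (_ *: _); field.
Qed.

Lemma mem_anti N : N \in lker (linfun tr_sym) <-> N^T = - N.
Proof.
rewrite memv_ker lfunE /= /tr_sym addrC addr_eq0; split=> [/eqP //|->]; exact: eqxx.
Qed.

Lemma low_sign_inj N : low_sign N = 0 -> N = 0.
Proof.
move=> h; apply/matrixP => i j; move/matrixP: h => /(_ i j); rewrite !mxE.
by case: ifP => // _ /eqP; rewrite oppr_eq0 => /eqP.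
Qed.

(** Let k be the dimension of the antisymmetric matrices. Rank-nullity for N |-> N + N^T gives dim
    S^2 + k = 64, and splitting off the diagonal gives dim S^2 = k + 8. *)
Lemma dim_symm : \dim symm_space = 36%N.
Proof.
pose K := lker (linfun tr_sym); pose S0 := (linfun low_sign @: K)%VS.
pose D := limg (linfun (@diag_mx R 8)).
have dS0 : \dim S0 = \dim K.
  apply: limg_dim_eq; apply/eqP; rewrite -subv0; apply/subvP => x /memv_capP[_].
  by rewrite memv_ker lfunE /= => /eqP /low_sign_inj ->; rewrite mem0v.
have dD : \dim D = 8%N.
  rewrite limg_inj_dim ?dimvf ?dim_matrix // => x h; apply/rowP => i.
  by move/matrixP: h => /(_ i i); rewrite !mxE eqxx mulr1n.
have S0P N : N \in S0 -> N^T = N /\ forall i, N i i = 0.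
  move=> /memv_imgP[M /mem_anti hM ->]; rewrite lfunE /=.
  have e i j : M j i = - M i j by move/matrixP: hM => /(_ i j); rewrite !mxE.
  split=> [|i]; last by rewrite mxE ltnn (oppr_fix0 (e i i)) oppr0.
  apply/matrixP => i j; rewrite !mxE e; case: (ltngtP i j) => // [|/val_inj ->]; rewrite ?opprK //.
have capSD : (S0 :&: D = 0)%VS.
  apply/eqP; rewrite -subv0; apply/subvP => x /memv_capP[/S0P[_ h0] /memv_imgP[v _ xv]].
  rewrite memv0 xv lfunE /=; apply/eqP/matrixP => i j; rewrite !mxE; case: (eqVneq i j) => [_|_]; last by rewrite mulr0n.
  by move: (h0 i); rewrite xv lfunE /= mxE eqxx.
have symE : symm_space = (S0 + D)%VS.
  apply/eqP; rewrite eqEsubv; apply/andP; split; apply/subvP => N.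
    move=> /mem_symm hN; have e i j : N j i = N i j by move/matrixP: hN => /(_ i j); rewrite mxE.
    apply/memv_addP; exists (\matrix_(i, j) (if i == j then 0 else N i j)).
      apply/memv_imgP; exists (\matrix_(i, j) (if i == j then 0 else if (i < j)%N then N i j else - N i j)).
        apply/mem_anti/matrixP => i j; rewrite !mxE eq_sym e.
        by case: (eqVneq i j) => [|hij]; rewrite ?oppr0 //; case: ltngtP (hij) => // [|/val_inj ->];
          rewrite ?opprK ?eqxx.
      by rewrite lfunE /=; apply/matrixP => i j; rewrite !mxE; case: (eqVneq i j) => _; case: (i < j)%N; rewrite ?oppr0 ?opprK.
    exists (diag_mx (\row_i N i i)); first by apply/memv_imgP; exists (\row_i N i i); rewrite ?memvf ?lfunE.
    by apply/matrixP => i j; rewrite !mxE; case: eqP => [->|_]; rewrite ?addr0 ?add0r.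
  move=> /memv_addP[M /S0P[hM _] [M' /memv_imgP[v _ ->] ->]]; apply/mem_symm.
  by rewrite linearD /= hM lfunE /= tr_diag_mx.
have := limg_ker_dim (linfun tr_sym) fullv; rewrite capfv -/symm_space -/K dimvf dim_matrix.
have : \dim symm_space = (\dim K + 8)%N.
  by rewrite symE dimv_disjoint_sum // dS0 dD.
move: (\dim K) => x -> h; have {}h : (x + (x + 8) = 64)%N := h.
lia.
Qed.

Section FrameDimensions.
Variable A : 'M[R]_8.
Hypothesis Au : A \in unitmx.
Let B := invmx A.
Let u := pull4 A phi.

Definition pi7_vec (k : I8) : I8 -> I8 -> R := fun a b => d a 0 * d b k - d b 0 * d a k - phi a b 0 k.

Definition pi7_map (c : 'rV[R]_7) : 'M[R]_8 :=
  A^T *m mat (fun a b => \sum_k c 0 k * pi7_vec (lift ord0 k) a b) *m A.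
Lemma pi7_map_linear : linear pi7_map.
Proof.
move=> x c c'; rewrite /pi7_map scalemxAl scalemxAr -mulmxDl -mulmxDr; congr (_ *m _ *m _).
apply/matrixP => a b; rewrite !mxE mulr_sumr -big_split /=.
by apply: eq_bigr => k _; rewrite !mxE; ring.
Qed.
HB.instance Definition _ := GRing.isLinear.Build R 'rV[R]_7 'M[R]_8 *:%R pi7_map pi7_map_linear.

Definition pi7_space : {vspace 'M[R]_8} := limg (linfun pi7_map).

Lemma conjK (N : 'M[R]_8) : A^T *m (B^T *m N *m B) *m A = N.
Proof. by rewrite !mulmxA -trmx_mul mulVmx // trmx1 mul1mx -mulmxA mulVmx // mulmx1. Qed.

Lemma conjVK (N : 'M[R]_8) : B^T *m (A^T *m N *m A) *m B = N.
Proof. by rewrite !mulmxA -trmx_mul mulmxV // trmx1 mul1mx -mulmxA mulmxV // mulmx1. Qed.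

Lemma conj_tr (n : 'M[R]_8) : (A^T *m n *m A)^T = A^T *m n^T *m A.
Proof. by rewrite !trmx_mul trmxK mulmxA. Qed.

Lemma conj_inj (n n' : 'M[R]_8) : A^T *m n *m A = A^T *m n' *m A <-> n = n'.
Proof. by split=> [h|-> //]; rewrite -(conjVK n) h conjVK. Qed.

Lemma Lambda2_7_frame (n : 'M[R]_8) : Lambda2_7 u (A^T *m n *m A) <->
  (forall a b, n b a = - n a b) /\ (forall a b, mP phi n a b = - 6 * n a b).
Proof.
rewrite /Lambda2_7 J2_frame // conj_tr -mulNmx -mulmxN conj_inj scalemxAl scalemxAr conj_inj.
split=> [[h1 h2]|[h1 h2]]; split.
- by move=> a b; move/matrixP: h1 => /(_ a b); rewrite !mxE.
- by move=> a b; move/matrixP: h2 => /(_ a b); rewrite !mxE; lra.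
- by apply/matrixP => a b; rewrite !mxE h1.
- by apply/matrixP => a b; rewrite !mxE h2; field.
Qed.

Lemma mem_pi7 N : N \in pi7_space <-> Lambda2_7 u N.
Proof.
split=> [/memv_imgP[c _ ->]|].
  rewrite lfunE /= /pi7_map; apply/Lambda2_7_frame; set n := fun a b : I8 => _.
  have hk (k : 'I_7) : (forall a b, pi7_vec (lift ord0 k) b a = - pi7_vec (lift ord0 k) a b) /\
      (forall a b, mP phi (pi7_vec (lift ord0 k)) a b = - 6 * pi7_vec (lift ord0 k) a b).
    exact: (pi7_basis 0 (lift ord0 k)).
  split=> a b; first by rewrite !mxE -sumrN; apply: eq_bigr => k _; rewrite (hk k).1 mulrN.
  transitivity (\sum_k c 0 k * mP phi (pi7_vec (lift ord0 k)) a b); last first.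
    by rewrite mxE mulr_sumr; apply: eq_bigr => k _; rewrite (hk k).2; ring.
  rewrite /mP /S2; under eq_bigr => p _ do (under eq_bigr => q _ do rewrite mxE mulr_sumr; rewrite exchange_big).
  rewrite exchange_big /=; apply: eq_bigr => k _; rewrite -S2Zl; apply: eq_S2 => p q; ring.
rewrite -(conjK N); set n := B^T *m N *m B => /Lambda2_7_frame [h1 h2].
apply/memv_imgP; exists (\row_k n 0 (lift ord0 k)); rewrite ?memvf // lfunE /= /pi7_map.
congr (_ *m _ *m _); apply/matrixP => a b; rewrite [RHS]mxE (pi7_coord 0 h1 h2 a b).
rewrite big_ord_recl (oppr_fix0 (h1 0 0)) mul0r add0r.
by apply: eq_bigr => k _; rewrite [X in _ = X * _]mxE.
Qed.

Lemma dim_pi7 : \dim pi7_space = 7%N.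
Proof.
rewrite limg_inj_dim ?dimvf ?dim_matrix // => c; rewrite /pi7_map.
have -> : 0 = A^T *m 0 *m A :> 'M[R]_8 by rewrite mulmx0 mul0mx.
move/conj_inj/matrixP => h; apply/rowP => j; have := h 0 (lift ord0 j); rewrite !mxE => <-.
transitivity (\sum_k d j k * c 0 k); first by
  rewrite (bigD1 j) //= eqxx mul1r big1 ?addr0 // => k kj; rewrite eq_sym (negPf kj) mul0r.
apply: eq_bigr => k _; rewrite /pi7_vec (phi_rep phi_alt) dxx (inj_eq (@lift_inj _ _)).
have -> : (lift ord0 j == 0 :> I8) = false by rewrite eq_sym (negPf (neq_lift _ _)).
by rewrite mul0r !subr0 mul1r mulrC.
Qed.

Lemma capv_symm_pi7 : (symm_space :&: pi7_space = 0)%VS.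
Proof.
apply/eqP; rewrite -subv0; apply/subvP => N /memv_capP[/mem_symm h1 /mem_pi7[h2 _]].
rewrite memv0; apply/eqP/matrixP => i j; move/matrixP: h2 => /(_ i j); rewrite h1 mxE => h.
by rewrite (oppr_fix0 h) mxE.
Qed.

Lemma dim_symm_pi7 : \dim (symm_space + pi7_space) = (36 + 7)%N.
Proof.
by rewrite dimv_disjoint_sum ?capv_symm_pi7 // dim_symm dim_pi7.
Qed.

Definition vel_map (N : 'M[R]_8) : {ffun I8 * I8 * I8 * I8 -> R^o} := tensor4 (dot (ginv u *m N) u).
Lemma vel_map_linear : linear vel_map.
Proof.
move=> x N N'; apply/ffunP => i; rewrite !ffunE.
have -> : dot (ginv u *m (x *: N + N')) u = dot (fun p q => (ginv u *m N') p q + x * (ginv u *m N) p q) u.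
  congr dot; apply: boolp.funext => p; apply: boolp.funext => q.
  by rewrite mulmxDr -scalemxAr !mxE addrC.
by rewrite dotB addrC.
Qed.
HB.instance Definition _ := GRing.isLinear.Build R 'M[R]_8 {ffun I8 * I8 * I8 * I8 -> R^o} *:%R vel_map vel_map_linear.

Lemma vel_frame (n : 'M[R]_8) : dot (ginv u *m (A^T *m n *m A)) u = pull4 A (dot n phi).
Proof.
rewrite dot_frameV //; congr (dot (fun_of_matrix _) u); rewrite matE ginv_pull // -/B.
by rewrite !mulmxA -[B *m B^T *m A^T]mulmxA -trmx_mul mulmxV // trmx1 mulmx1.
Qed.

(** The action N |-> N.Phi is injective on S^2 + Lambda^2_7 and already has full image there,
    because the antisymmetric part of a matrix may be replaced by its Lambda^2_7 component. *)
Lemma dim_velocities : exists V : {vspace {ffun I8 * I8 * I8 * I8 -> R^o}},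
  \dim V = (36 + 7)%N /\ forall v, v \in V <-> exists N : 'M[R]_8, v = tensor4 (dot N u).
Proof.
exists (linfun vel_map @: (symm_space + pi7_space))%VS; split.
  rewrite limg_dim_eq ?dim_symm_pi7 //; apply/eqP; rewrite -subv0; apply/subvP => N /memv_capP[].
  move=> /memv_addP[S /mem_symm hS [L /mem_pi7 hL ->]].
  rewrite -(conjK L) in hL *; rewrite -(conjK S) in hS *.
  move: hS hL; set s := B^T *m S *m B; set l := B^T *m L *m B.
  rewrite conj_tr conj_inj => hs /Lambda2_7_frame[h1 h2].
  rewrite memv_ker lfunE /= /vel_map -mulmxDl -mulmxDr vel_frame => /eqP /ffunP h.
  have h0 : dot (s + l) phi = (fun _ _ _ _ => 0).
    apply: T4_ext; apply: (pull4_eq0 Au) => a b c e.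
    by have := h (a, b, c, e); rewrite !ffunE.
  have h3 := dot_sym7_eq0 (s := s) (al := l) _ h1 h2.
  have {}h3 : forall a b, s a b = 0 /\ l a b = 0.
    apply: h3 => [a b|]; first by move/matrixP: hs => /(_ a b); rewrite mxE.
    by rewrite -h0; congr dot; apply: boolp.funext => a; apply: boolp.funext => b; rewrite [RHS]mxE.
  rewrite memv0; apply/eqP; have -> : s + l = 0.
    by apply/matrixP => a b; rewrite [LHS]mxE (h3 a b).1 (h3 a b).2 addr0 [RHS]mxE.
  by rewrite mulmx0 mul0mx.
move=> v; split=> [/memv_imgP[N _ ->]|[N ->]].
  by rewrite lfunE /= /vel_map; exists (ginv u *m N).
pose n := A *m N *m B; pose al a b := 2^-1 * (n a b - n b a).
have hal a b : al b a = - al a b by rewrite /al; ring.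
have [hb h7 hdot] := dot_pi7 hal; set be := (fun a b => 4^-1 * _) in hb h7 hdot.
pose s : 'M[R]_8 := \matrix_(a, b) (2^-1 * (n a b + n b a)).
apply/memv_imgP; exists (A^T *m (s + mat be) *m A).
  rewrite mulmxDr mulmxDl; apply/memv_addP; exists (A^T *m s *m A).
    by apply/mem_symm; rewrite conj_tr; congr (_ *m _ *m _); apply/matrixP => a b; rewrite !mxE addrC.
  exists (A^T *m mat be *m A) => //; apply/mem_pi7/Lambda2_7_frame; split=> a b.
    by rewrite [mat be b a]mxE [mat be a b]mxE; exact: hb.
  transitivity (mP phi be a b); first by apply: eq_S2 => p q; rewrite mxE.
  by rewrite [mat be a b]mxE; exact: h7.
rewrite lfunE /= /vel_map vel_frame dot_frame // -/n; congr tensor4; congr pull4.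
apply: T4_ext => a b c e.
have -> : dot (s + mat be) phi a b c e = dot (fun p q => s p q + 1 * be p q) phi a b c e.
  by congr dot; apply: boolp.funext => p; apply: boolp.funext => q; rewrite [LHS]mxE [mat be p q]mxE mul1r.
have -> : dot n phi a b c e = dot (fun p q => s p q + 1 * al p q) phi a b c e.
  by congr dot; apply: boolp.funext => p; apply: boolp.funext => q; rewrite [s p q]mxE /al; field.
by rewrite !dotB hdot.
Qed.

End FrameDimensions.
End Dimensions.

Local Open Scope classical_set_scope.

Lemma is_derive_invX (R : realType) n (y : R) : y != 0 ->
  is_derive (y : R^o) (1 : R^o) (fun z : R^o => z^-1 ^+ n : R^o) (- n%:R * y^-1 ^+ n.+1).
Proof.
move=> y0; have hV : is_derive (y : R^o) (1 : R^o) (fun z : R^o => z^-1 : R^o) (- y ^- 2).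
  have hid := is_derive_id (y : R^o) (1 : R^o).
  apply: DeriveDef; first exact: (@derivableV _ _ id).
  by rewrite (@deriveV _ _ id) // derive_val [LHS]mulr1.
have h := is_deriveX n hV; rewrite exprfctE in h.
apply: (is_derive_eq h); case: n h => [|n] _; first by rewrite !mul0r oppr0 mul0r scale0r.
change (n.+1%:R * y^-1 ^+ n * - (y ^- 2) = - n.+1%:R * y^-1 ^+ n.+2).
by rewrite -exprVn !exprS expr0 mulr1; move: (n.+1%:R) (y^-1 ^+ n) (y^-1) => *; ring.
Qed.

(** * Smooth functions and iterated integrals *)

Section SmoothCalculus.
Variables (R : realType) (V : normedModType R).
Implicit Types (U : set V) (f g : V -> R) (x v : V) (k n : nat).

Lemma is_derive_line f x v (l : R) :
  is_derive x v f l <-> is_derive (0 : R^o) (1 : R^o) (fun h : R^o => f (h *: v + x) : R^o) l.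
Proof.
have e : (fun h : R => h^-1 *: (((f : V -> R^o) \o shift x) (h *: v) - f x)) =
    (fun h : R => h^-1 *: (((fun h : R^o => f (h *: v + x) : R^o) \o shift 0) (h *: (1 : R^o)) - f (0 *: v + x))).
  by apply: funext => h /=; rewrite addr0 scale0r add0r [h%:A]mulr1.
by split=> -[h1 h2]; apply: DeriveDef; move: h1 h2; rewrite /derivable /derive /= e.
Qed.

Lemma is_derive_comp1 (G : R -> R) f x v (b l : R) :
  is_derive (f x) 1 G b -> is_derive x v f l -> is_derive x v (fun y => G (f y)) (b * l).
Proof.
move=> hG /is_derive_line hf; apply/is_derive_line.
apply: (@is_derive1_comp _ G (fun h : R^o => f (h *: v + x))) => //.
by rewrite scale0r add0r.
Qed.

Lemma near_open U x (P : V -> Prop) : open U -> U x -> (forall y, U y -> P y) -> \forall y \near x, P y.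
Proof. by move=> oU Ux h; near=> y; apply: h; near: y; exact: open_nbhs_nbhs. Unshelve. all: by end_near. Qed.

Lemma continuous_near_eq f g x : (\forall y \near x, f y = g y) ->
  {for x, continuous f} -> {for x, continuous g}.
Proof.
move=> hn hc; have e : f x = g x by exact: (nbhs_singleton hn).
change (g @ x --> g x); rewrite -e; apply: cvg_trans hc.
exact: near_eq_cvg hn.
Qed.

Lemma Ck_eq k U f g : open U -> (forall x, U x -> f x = g x) -> Ck k U f -> Ck k U g.
Proof.
move=> oU; elim: k f g => [|k IH] f g fg /= [hc hd]; have hn x : U x -> \forall y \near x, f y = g y.
- by move=> Ux; exact: near_open Ux fg.
- by split=> // x Ux; apply: continuous_near_eq (hc x Ux); exact: hn.
- by move=> Ux; exact: near_open Ux fg.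
split=> [x Ux|v]; first by apply: continuous_near_eq (hc x Ux); exact: hn.
have [h1 h2] := hd v; split=> [x Ux|]; first exact: (near_eq_derivable (hn x Ux) (h1 x Ux)).
by apply: IH h2 => x Ux; apply: near_eq_derive; exact: hn.
Qed.

Lemma Ck_pred k U f : Ck k.+1 U f -> Ck k U f.
Proof.
elim: k f => [|k IH] f [hc hd]; split=> // v.
by have [h1 h2] := hd v; split=> //; exact: IH.
Qed.

Lemma Ck_sub k U U' f : U' `<=` U -> Ck k U f -> Ck k U' f.
Proof.
move=> s; elim: k f => [|k IH] f /= [hc hd]; first by split=> // x /s /hc.
split=> [x /s /hc //|v].
by have [h1 h2] := hd v; split=> [x /s /h1 //|]; exact: IH.
Qed.

Lemma Ck_cst k U (c : R) : Ck k U (fun=> c).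
Proof.
elim: k c => [|k IH] c /=; (split; first by move=> x _; exact: cvg_cst) => // v.
split=> [x _|]; first exact: derivable_cst.
have -> : (fun x => 'D_v (fun=> c) x) = (fun=> 0) :> (V -> R) by apply: funext => x; exact: derive_cst.
exact: IH.
Qed.

Lemma Ck_add k U f g : open U -> Ck k U f -> Ck k U g -> Ck k U (fun x => f x + g x).
Proof.
move=> oU; elim: k f g => [|k IH] f g /= [hf hf'] [hg hg'].
  by split=> // x Ux; apply: continuousD; [exact: hf|exact: hg].
split=> [x Ux|v]; first by apply: continuousD; [exact: hf|exact: hg].
have [f1 f2] := hf' v; have [g1 g2] := hg' v.
split=> [x Ux|]; first by apply: derivableD; [exact: f1|exact: g1].
apply: (Ck_eq oU _ (IH _ _ f2 g2)) => x Ux.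
by rewrite (deriveD (f1 x Ux) (g1 x Ux)).
Qed.

Lemma Ck_mul k U f g : open U -> Ck k U f -> Ck k U g -> Ck k U (fun x => f x * g x).
Proof.
move=> oU; elim: k f g => [|k IH] f g.
  move=> [hf _] [hg _]; split=> // x Ux; apply: continuousM; [exact: hf|exact: hg].
move=> hf0 hg0; have [hf hf'] := hf0; have [hg hg'] := hg0.
split=> [x Ux|v]; first by apply: continuousM; [exact: hf|exact: hg].
have [f1 f2] := hf' v; have [g1 g2] := hg' v.
split=> [x Ux|]; first by apply: derivableM; [exact: f1|exact: g1].
apply: (Ck_eq oU _ (Ck_add oU (IH _ _ (Ck_pred hf0) g2) (IH _ _ (Ck_pred hg0) f2))) => x Ux.
by rewrite (deriveM (f1 x Ux) (g1 x Ux)).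
Qed.

(** Closes smoothness under a sequence of functions whose derivatives are combinations of the next
    two members, by induction on the order for all members at once. It serves for y^-n, sqrt(y) y^-n
    and y^-n exp(-1/y). *)
Lemma Ck_family (J : set R) (G : nat -> R -> R) (c1 c2 : nat -> R) U f k :
  open U -> (forall x, U x -> J (f x)) ->
  (forall n y, J y -> is_derive y 1 (G n) (c1 n * G n.+1 y + c2 n * G n.+2 y)) ->
  Ck k U f -> forall n, Ck k U (fun x => G n (f x)).
Proof.
move=> oU hJ hG; elim: k => [|k IH] hf n.
  split=> // x Ux; have [hc _] := hf.
  apply: (@continuous_comp _ _ _ f (G n)); first exact: hc.
  by apply/differentiable_continuous/derivable1_diffP; have [] := hG n _ (hJ x Ux).
have [hc hd] := hf; split=> [x Ux|v].
  apply: (@continuous_comp _ _ _ f (G n)); first exact: hc.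
  by apply/differentiable_continuous/derivable1_diffP; have [] := hG n _ (hJ x Ux).
have [f1 f2] := hd v.
have hD x : U x -> is_derive x v (fun y => G n (f y))
    ((c1 n * G n.+1 (f x) + c2 n * G n.+2 (f x)) * 'D_v f x).
  by move=> Ux; apply: is_derive_comp1; [exact/hG/hJ|exact/derivableP/f1].
split=> [x Ux|]; first by have [] := hD x Ux.
have hk := IH (Ck_pred hf).
apply: (Ck_eq oU (f := fun x => (c1 n * G n.+1 (f x) + c2 n * G n.+2 (f x)) * 'D_v f x)).
  by move=> x Ux; have [_ ->] := hD x Ux.
by apply: Ck_mul => //; apply: Ck_add => //; apply: Ck_mul => //; exact: Ck_cst.
Qed.

Lemma smooth_eq U f g : open U -> (forall x, U x -> f x = g x) -> smooth U f -> smooth U g.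
Proof. by move=> oU fg hf k; exact: (Ck_eq oU fg (hf k)). Qed.

Lemma smooth_sub U U' f : U' `<=` U -> smooth U f -> smooth U' f.
Proof. by move=> s hf k; exact: Ck_sub (hf k). Qed.

Lemma smooth_cst U (c : R) : smooth U (fun=> c).
Proof. by move=> k; exact: Ck_cst. Qed.

Lemma smoothD U f g : open U -> smooth U f -> smooth U g -> smooth U (fun x => f x + g x).
Proof. by move=> oU hf hg k; exact: Ck_add. Qed.

Lemma smoothM U f g : open U -> smooth U f -> smooth U g -> smooth U (fun x => f x * g x).
Proof. by move=> oU hf hg k; exact: Ck_mul. Qed.

Lemma smoothN U f : open U -> smooth U f -> smooth U (fun x => - f x).
Proof.
move=> oU hf; apply: (smooth_eq oU (f := fun x => -1 * f x)); first by move=> x _; rewrite mulN1r.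
by apply: smoothM => //; exact: smooth_cst.
Qed.

Lemma smoothB U f g : open U -> smooth U f -> smooth U g -> smooth U (fun x => f x - g x).
Proof. by move=> oU hf hg; apply: smoothD => //; exact: smoothN. Qed.

Lemma smooth_sum (I : Type) (r : seq I) (P : pred I) U (F : I -> V -> R) : open U ->
  (forall i, smooth U (F i)) -> smooth U (fun x => \sum_(i <- r | P i) F i x).
Proof.
move=> oU hF; elim: r => [|i r IH].
  by apply: (smooth_eq oU _ (@smooth_cst U 0)) => x _; rewrite big_nil.
case hP : (P i); last by apply: (smooth_eq oU _ IH) => x _; rewrite big_cons hP.
by apply: (smooth_eq oU _ (smoothD oU (hF i) IH)) => x _; rewrite big_cons hP.
Qed.

Lemma smooth_continuous U f x : smooth U f -> U x -> {for x, continuous f}.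
Proof. by move=> hf Ux; have [h _] := hf 0%N; exact: h. Qed.

Lemma smooth_derivable U f x v : smooth U f -> U x -> derivable f x v.
Proof. by move=> hf Ux; have [_ h] := hf 1%N; exact: (h v).1. Qed.

Lemma smooth_is_derive U f x v : smooth U f -> U x -> is_derive x v f ('D_v f x).
Proof. by move=> hf Ux; exact/derivableP/(smooth_derivable hf Ux). Qed.

Lemma smooth_derive U f v : smooth U f -> smooth U (fun x => 'D_v f x).
Proof. by move=> hf k; have [_ h] := hf k.+1; exact: (h v).2. Qed.

Lemma smoothV U f : open U -> (forall x, U x -> f x != 0) -> smooth U f -> smooth U (fun x => (f x)^-1).
Proof.
move=> oU f0 hf k.
apply: (@Ck_family [set y | y != 0] (fun n y => y^-1 ^+ n.+1) (fun n => - n.+1%:R) (fun=> 0) U f k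
  oU f0 _ (hf k) 0%N) => n y /= y0.
by apply: (is_derive_eq (is_derive_invX n.+1 y0)); rewrite mul0r addr0.
Qed.

Lemma smooth_sqrt U f : open U -> (forall x, U x -> 0 < f x) -> smooth U f ->
  smooth U (fun x => Num.sqrt (f x)).
Proof.
move=> oU f0 hf k.
pose G n (y : R) := Num.sqrt y * y^-1 ^+ n.
have hG := @Ck_family [set y | 0 < y] G (fun n => 2^-1 - n%:R) (fun=> 0) U f k oU f0.
have {}hG n : Ck k U (fun x => G n (f x)).
  apply: hG (hf k) n => n y /= y0.
  have y1 : y != 0 by rewrite gt_eqF.
  have hm := is_deriveM (is_derive1_sqrt y0) (is_derive_invX n y1).
  apply: (is_derive_eq hm).
  rewrite mul0r addr0 /G /= -[LHS]/(Num.sqrt y * _ + y^-1 ^+ n * _).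
  have s0 : Num.sqrt y != 0 by rewrite sqrtr_eq0 -ltNge.
  have ye : y = Num.sqrt y ^+ 2 by rewrite sqr_sqrtr // ltW.
  have yi : y^-1 = (Num.sqrt y)^-1 * (Num.sqrt y)^-1 by rewrite {1}ye expr2 invfM.
  rewrite exprS; move: (y^-1 ^+ n) => z; rewrite yi; move: (Num.sqrt y) s0 (n%:R) => r r0 N.
  by field.
by apply: (Ck_eq oU _ (hG 0%N)) => x Ux; rewrite /G expr0 mulr1.
Qed.

End SmoothCalculus.

Section SmoothAffine.
Variables (R : realType) (V W : normedModType R).

(** For an affine map the difference quotients of the composite are literally those of [f] in the
    direction [l v], so no general chain rule is involved. *)
Lemma Ck_affine (g l : V -> W) (f : W -> R) (U : set V) (U' : set W) k :
  continuous g -> (forall h v x, g (h *: v + x) = h *: l v + g x) ->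
  (forall x, U x -> U' (g x)) -> Ck k U' f -> Ck k U (fun x => f (g x)).
Proof.
move=> cg gl gU; elim: k f => [|k IH] f [hc hd].
  by split=> // x Ux; apply: continuous_comp; [exact: cg|exact/hc/gU].
have eD v x : (fun h => h^-1 *: ((((fun x => f (g x)) : V -> R^o) \o shift x) (h *: v) - f (g x))) =
    (fun h : R => h^-1 *: (((f : W -> R^o) \o shift (g x)) (h *: l v) - f (g x))).
  by apply: funext => h /=; rewrite gl.
split=> [x Ux|v]; first by apply: continuous_comp; [exact: cg|exact/hc/gU].
have [h1 h2] := hd (l v); split=> [x Ux|].
  by have := h1 _ (gU _ Ux); rewrite /derivable -eD.
have -> : (fun x => 'D_v (fun x => f (g x)) x) = (fun x => 'D_(l v) f (g x)).
  by apply: funext => x; rewrite /derive -eD.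
exact: (IH _ h2).
Qed.

Lemma smooth_affine (g l : V -> W) (f : W -> R) (U : set V) (U' : set W) :
  continuous g -> (forall h v x, g (h *: v + x) = h *: l v + g x) ->
  (forall x, U x -> U' (g x)) -> smooth U' f -> smooth U (fun x => f (g x)).
Proof. by move=> cg gl gU hf k; exact: Ck_affine (hf k). Qed.

Lemma derive_affine (g l : V -> W) (f : W -> R) v x :
  (forall h v x, g (h *: v + x) = h *: l v + g x) ->
  'D_v (fun x => f (g x)) x = 'D_(l v) f (g x).
Proof.
move=> gl; have eD : (fun h => h^-1 *: ((((fun x => f (g x)) : V -> R^o) \o shift x) (h *: v) - f (g x))) =
    (fun h : R => h^-1 *: (((f : W -> R^o) \o shift (g x)) (h *: l v) - f (g x))).
  by apply: funext => h /=; rewrite gl.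
by rewrite /derive -eD.
Qed.

End SmoothAffine.

(** * The flat function *)

Section SmoothFlat.
Variable R : realType.

Definition flat (n : nat) (y : R) : R := if 0 < y then y^-1 ^+ n * expR (- y^-1) else 0.

(** From exp x >= x^(n+2) / (n+2)! at x = 1/y. A quadratic bound makes the derivative at 0
    vanish. *)
Lemma flat_bound n (y : R) : 0 < y -> flat n y <= n.+2`!%:R * y ^+ 2.
Proof.
move=> y0; rewrite /flat y0 expRN; have h := @expR_ge1Dxn _ y^-1 n.+1 _.
have {}h : y^-1 ^+ n.+2 / n.+2`!%:R <= expR y^-1.
  by apply: le_trans (h _); rewrite ?lerDr ?invr_ge0 ?(ltW y0) // lerDr.
have E0 : 0 < expR y^-1 by exact: expR_gt0.
rewrite ler_pdivrMr // mulrAC; move: h; rewrite ler_pdivrMr ?ltr0n ?fact_gt0 // => h.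
have -> : y^-1 ^+ n = y^-1 ^+ n.+2 * y ^+ 2.
  by rewrite -addn2 exprD -mulrA -exprMn mulVf ?gt_eqF // expr1n mulr1.
by rewrite ler_wpM2r ?exprn_ge0 ?(ltW y0) // mulrC.
Qed.

Lemma is_derive_flat n (y : R) :
  is_derive (y : R^o) (1 : R^o) (flat n : R^o -> R^o) (- n%:R * flat n.+1 y + 1 * flat n.+2 y).
Proof.
have [y0|y0|<-] := ltgtP 0 y.
- have y1 : y != 0 by rewrite gt_eqF.
  have hN : is_derive (y : R^o) (1 : R^o) (fun z : R^o => - z^-1 : R^o) (y^-1 ^+ 2).
    have := is_deriveN (is_derive_invX 1 y1); rewrite mulN1r opprK.
    by rewrite (_ : - _ = (fun z : R^o => - z^-1 : R^o)) //; apply: funext => z; rewrite /= expr1.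
  have hE := @is_derive1_comp R expR (fun z : R => - z^-1) y _ _ (is_derive_expR (- y^-1)) hN.
  have hP := is_deriveM (is_derive_invX n y1) hE.
  apply: (near_eq_is_derive (f := (fun z : R^o => z^-1 ^+ n : R^o) * (expR \o (fun z : R^o => - z^-1)))).
    near=> z; have z0 : 0 < z by near: z; exact: lt_nbhsr.
    by rewrite /flat z0.
  apply: (is_derive_eq hP); rewrite /flat y0 /= -[LHS]/(_ * _ + _ * _) !exprS.
  by set z := y^-1 ^+ n; ring.
- apply: (near_eq_is_derive (f := cst 0)); last first.
    by apply: (is_derive_eq (is_derive_cst _ _ _)); rewrite /flat !ltNge (ltW y0) /= !mulr0 addr0.
  near=> z; have z0 : z < 0 by near: z; exact: lt_nbhsl.
  by rewrite /flat ltNge (ltW z0).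
have f0 k : flat k 0 = 0 by rewrite /flat ltxx.
rewrite !f0 !mulr0 addr0.
have hc : (fun h : R => h^-1 *: (((flat n : R^o -> R^o) \o shift (0 : R^o)) (h *: (1 : R^o)) - flat n 0)) @ (0 : R)^' --> (0 : R^o).
  rewrite f0; apply/cvgr0Pnorm_le => e e0.
  pose F : R := n.+2`!%:R; have F0 : 0 < F by rewrite ltr0n fact_gt0.
  near=> h; have h0 : h != 0 by near: h; exact: nbhs_dnbhs_neq.
  rewrite /= addr0 subr0 [h *: 1]mulr1 normrZ normfV.
  have hh : `|h| <= e / F by near: h; apply: dnbhs0_le; rewrite divr_gt0.
  have fb : `|flat n h| <= F * h ^+ 2.
    have [hp|hn] := ltP 0 h; last by rewrite /flat ltNge hn /= normr0 mulr_ge0 ?sqr_ge0 // ltW.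
    by rewrite ger0_norm ?flat_bound // /flat hp mulr_ge0 ?expR_ge0 // exprn_ge0 // invr_ge0 ltW.
  rewrite ler_pdivrMl ?normr_gt0 //; apply: (le_trans fb).
  rewrite -real_normK ?num_real // expr2 mulrCA ler_wpM2l //.
  by rewrite mulrC -ler_pdivlMr.
apply: DeriveDef; first by apply/cvg_ex; exists 0.
exact: cvg_lim hc.
Unshelve. all: by end_near.
Qed.

End SmoothFlat.

(** * Integrals of functions with bounded support *)

Section Integral1.
Variable R : realType.
Notation mu := (@lebesgue_measure R).
Implicit Types (f g : R -> R) (B M c : R).
Definition int1 g : R := \int[mu]_(t in setT) g t.

Definition vanish1 B g := forall t, B < `|t| -> g t = 0.

Lemma int1_itv B g : vanish1 B g -> int1 g = \int[mu]_(t in `[- B, B]) g t.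
Proof.
move=> h; rewrite [RHS]Rintegral_mkcond /int1; congr (Rintegral _ _ _).
apply: funext => t; rewrite patchE; case: ifPn => // /negP ht.
by apply: h; rewrite ltNge; apply/negP; rewrite ler_norml => hB; apply: ht; rewrite inE /= in_itv.
Qed.

Lemma int1_integrable (a b : R) g : continuous (g : R^o -> R^o) -> mu.-integrable `[a, b] (EFin \o g).
Proof.
move=> cg; apply: continuous_compact_integrable; first exact: segment_compact.
exact: continuous_subspaceT.
Qed.

Lemma int1_linear B f g c : continuous (f : R^o -> R^o) -> continuous (g : R^o -> R^o) ->
  vanish1 B f -> vanish1 B g -> int1 (fun t => f t + c * g t) = int1 f + c * int1 g.
Proof.
move=> cf cg hf hg; rewrite (int1_itv hf) (int1_itv hg) (int1_itv (B := B)); last first.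
  by move=> t ht; rewrite hf // hg // mulr0 addr0.
rewrite RintegralD ?RintegralZl //; try exact: int1_integrable.
apply: int1_integrable => t; apply: cvgM; [exact: cvg_cst|exact: cg].
Qed.

Lemma int1_cst (a b c : R) : a <= b -> \int[mu]_(t in `[a, b]) c = c * (b - a).
Proof.
move=> ab; rewrite Rintegral_cst //= lebesgue_measure_itv /= lte_fin; case: ltP => //= h.
by rewrite (le_anti (introT andP (conj ab h))) subrr.
Qed.

Lemma int1_bound B M g : 0 <= B -> continuous (g : R^o -> R^o) -> vanish1 B g ->
  (forall t, `|g t| <= M) -> `|int1 g| <= M * (2 * B).
Proof.
move=> B0 cg hg hM; rewrite (int1_itv hg).
apply: (le_trans (le_normr_Rintegral _ (int1_integrable _ _ cg))) => //.
have -> : 2 * B = B - - B by ring.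
rewrite -int1_cst; last by lra.
apply: le_Rintegral => //; apply: int1_integrable => t; last exact: cvg_cst.
by apply: (@continuous_comp _ _ _ g Num.norm); [exact: cg|exact: norm_continuous].
Qed.

Lemma int1_ge0 g : (forall t, 0 <= g t) -> 0 <= int1 g.
Proof. by move=> h; apply: Rintegral_ge0. Qed.

Lemma int1_gt0 B g t0 : continuous (g : R^o -> R^o) -> vanish1 B g ->
  (forall t, 0 <= g t) -> 0 < g t0 -> 0 < int1 g.
Proof.
move=> cg hg g0 gt0.
have /cvgrPdist_lt /(_ _ (divr_gt0 gt0 (ltr0Sn _ 1))) := cg t0.
rewrite -nbhs_nearE => /nbhs_ballP[e /= e0 he].
pose d := e / 2; have d0 : 0 < d by rewrite divr_gt0.
pose B' := `|B| + `|t0| + d.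
have hg' : vanish1 B' g.
  move=> t ht; apply: hg; apply: le_lt_trans ht; rewrite /B'.
  by apply: (le_trans (ler_norm B)); rewrite -addrA lerDl addr_ge0 // ltW.
rewrite (int1_itv hg').
have sub : `[t0 - d, t0 + d] `<=` `[- B', B'].
  move=> t /=; rewrite !in_itv /= => /andP[h1 h2]; rewrite /B'.
  have := ler_norm t0; have := ler_norm (- t0); rewrite normrN => ? ?.
  have := normr_ge0 B; by move=> ?; apply/andP; split; lra.
apply: (@lt_le_trans _ _ (\int[mu]_(t in `[t0 - d, t0 + d]) g t)); last first.
  rewrite /Rintegral fine_le //; try by apply: integrable_fin_num => //; exact: int1_integrable.
  apply: ge0_subset_integral => //; last by move=> t _; rewrite lee_fin.
  by have /integrableP[] := int1_integrable (- B') B' cg.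
apply: (@lt_le_trans _ _ (\int[mu]_(t in `[t0 - d, t0 + d]) (g t0 / 2))).
  by rewrite int1_cst; [rewrite !mulr_gt0 //; lra|lra].
apply: le_Rintegral => //; try exact: int1_integrable.
  by apply: int1_integrable => t; exact: cvg_cst.
move=> t /=; rewrite in_itv /= => /andP[h1 h2].
have : ball t0 e t by rewrite /ball /= ltr_norml; apply/andP; rewrite /d in h1 h2; split; lra.
by move=> /he /=; rewrite ltr_norml => /andP[]; lra.
Qed.

Lemma int1_derive B g dg : 0 <= B -> continuous (dg : R^o -> R^o) -> vanish1 B g -> vanish1 B dg ->
  (forall t, is_derive (t : R^o) (1 : R^o) (g : R^o -> R^o) (dg t)) -> int1 dg = 0.
Proof.
(* [vanish1] gives zeros strictly outside [-B, B] only, so the fundamental theorem is applied on a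
   larger interval. *)
move=> B0 cdg hg hdg hd; pose B' := B + 1.
have hdg' : vanish1 B' dg by move=> t ht; apply: hdg; rewrite /B' in ht; lra.
have cg (t : R) : {for t, continuous (g : R^o -> R^o)}.
  by apply/differentiable_continuous/derivable1_diffP; have [] := hd t.
rewrite (int1_itv hdg') /Rintegral (@continuous_FTC2 _ dg g (- B') B').
- have hB : B < `|B'| by rewrite ger0_norm /B'; lra.
  by rewrite (hg B' hB) hg ?normrN // subee.
- by rewrite /B'; lra.
- exact: continuous_subspaceT.
- split.
  + by move=> t _; have [] := hd t.
  + by apply: cvg_at_right_filter; exact: cg.
  + by apply: cvg_at_left_filter; exact: cg.
by move=> t _; rewrite derive1E; have [_ ->] := hd t.
Qed.

End Integral1.

Section IntegralRV.
Variable R : realType.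
Implicit Types (n : nat) (B M c e : R).

Definition vanish n B (f : 'rV[R]_n -> R) := forall x : 'rV[R]_n, (exists i, B < `|x 0 i|) -> f x = 0.
Definition ucont n (f : 'rV[R]_n -> R) := forall e, 0 < e -> exists2 d, 0 < d &
  forall x y : 'rV[R]_n, (forall i, `|x 0 i - y 0 i| < d) -> `|f x - f y| < e.
(** Uniform continuity, unlike continuity, makes the integral over slices depend continuously on the
    first coordinate without further argument. *)
Definition UC n B f := @ucont n f /\ @vanish n B f.

Definition slice n (f : 'rV[R]_n.+1 -> R) (t : R) (y : 'rV[R]_n) : R := f (row_mx (t%:M : 'rV[R]_1) y).

Lemma row_mxE n (t : R) (y : 'rV[R]_n) : ((row_mx (t%:M : 'rV[R]_1) y : 'rV_n.+1) 0 0 = t) *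
  (forall i, (row_mx (t%:M : 'rV[R]_1) y : 'rV_n.+1) 0 (lift ord0 i) = y 0 i).
Proof.
split=> [|i]; rewrite mxE; case: splitP => j /= e //.
- by rewrite (ord1 j) mxE eqxx mulr1n.
- by move: (ltn_ord j); rewrite -e.
by congr (y 0 _); apply: val_inj; move: e => /= [].
Qed.

Lemma ord_lift n (i : 'I_n.+1) : i = 0 \/ exists j : 'I_n, i = lift ord0 j.
Proof. by case: (unliftP ord0 i) => [j ->|->]; [right; exists j|left; apply: val_inj]. Qed.

Lemma UC_slice n B (f : 'rV[R]_n.+1 -> R) t : UC B f -> UC B (slice f t).
Proof.
move=> [uf vf]; split=> [e e0|y [i hi]].
  have [d d0 h] := uf e e0; exists d => // x y hxy; apply: h => i.
  by have [->|[j ->]] := ord_lift i; rewrite !row_mxE ?subrr ?normr0.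
by apply: vf; exists (lift ord0 i); rewrite row_mxE.
Qed.

Lemma slice_close n B (f : 'rV[R]_n.+1 -> R) e : UC B f -> 0 < e -> exists2 d, 0 < d &
  forall s t y, `|s - t| < d -> `|slice f s y - slice f t y| < e.
Proof.
move=> [uf _] e0; have [d d0 h] := uf e e0; exists d => // s t y st; apply: h => i.
by have [->|[j ->]] := ord_lift i; rewrite !row_mxE ?subrr ?normr0.
Qed.

Lemma UC_linear n B f g c : @UC n B f -> @UC n B g -> UC B (fun x => f x + c * g x).
Proof.
move=> [uf vf] [ug vg]; split=> [e e0|x hx]; last by rewrite vf // vg // mulr0 addr0.
have c0 : 0 < `|c| + 1 by rewrite ltr_wpDl.
have [d1 d10 h1] := uf (e / 2) (divr_gt0 e0 (ltr0Sn _ 1)).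
have [d2 d20 h2] := ug (e / 2 / (`|c| + 1)) (divr_gt0 (divr_gt0 e0 (ltr0Sn _ 1)) c0).
exists (Num.min d1 d2); first by rewrite lt_min d10 d20.
move=> x y hxy.
have a1 : `|f x - f y| < e / 2 by apply: h1 => i; apply: lt_le_trans (hxy i) _; rewrite ge_min lexx.
have a2 : `|g x - g y| < e / 2 / (`|c| + 1).
  by apply: h2 => i; apply: lt_le_trans (hxy i) _; rewrite ge_min lexx orbT.
have -> : f x + c * g x - (f y + c * g y) = (f x - f y) + c * (g x - g y) by ring.
apply: (le_lt_trans (ler_normD _ _)); rewrite normrM.
have : `|c| * `|g x - g y| <= (`|c| + 1) * `|g x - g y| by rewrite ler_wpM2r // lerDl.
have : (`|c| + 1) * `|g x - g y| < e / 2 by rewrite mulrC -ltr_pdivlMr.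
lra.
Qed.

Lemma UC_continuous1 (G : R -> R) :
  (forall e, 0 < e -> exists2 d, 0 < d & forall s t, `|s - t| < d -> `|G s - G t| <= e) ->
  continuous (G : R^o -> R^o).
Proof.
move=> h t; apply/cvgrPdist_le => e e0; have [d d0 hd] := h e e0.
by apply/nbhs_ballP; exists d => //= s; exact: hd.
Qed.

Lemma integral_rV_basic n B : 0 <= B ->
  (forall f g c, @UC n B f -> UC B g -> integral_rV (fun x => f x + c * g x) =
     integral_rV f + c * integral_rV g) /\
  (forall f M, @UC n B f -> (forall x, `|f x| <= M) -> `|integral_rV f| <= M * (2 * B) ^+ n).
Proof.
move=> B0; elim: n => [|n [IL IB]].
  by split=> [f g c _ _ //|f M _ h]; rewrite expr0 mulr1; exact: h.
have hI0 f : @UC n.+1 B f -> vanish1 B (fun t => integral_rV (slice f t)).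
  move=> hf t ht; have := IB (slice f t) 0 (UC_slice t hf); rewrite mul0r => h.
  apply/eqP; rewrite -normr_le0; apply: h => y.
  by have [_ hv] := hf; rewrite /slice hv ?normr0 //; exists 0; rewrite row_mxE.
have hIc f : @UC n.+1 B f -> continuous ((fun t => integral_rV (slice f t)) : R^o -> R^o).
  move=> hf; apply: UC_continuous1 => e e0.
  have K0 : 0 < (2 * B) ^+ n + 1 by rewrite ltr_wpDl // exprn_ge0 // mulr_ge0.
  have [d d0 hd] := slice_close hf (divr_gt0 e0 K0); exists d => // s t st.
  have -> : integral_rV (slice f s) - integral_rV (slice f t) =
      integral_rV (fun y => slice f s y + -1 * slice f t y).
    by rewrite IL ?mulN1r //; exact: UC_slice.
  apply: (le_trans (IB _ (e / ((2 * B) ^+ n + 1)) _ _)).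
  - by apply: UC_linear; exact: UC_slice.
  - by move=> y; rewrite mulN1r; apply/ltW/hd.
  by rewrite mulrAC ler_pdivrMr // ler_wpM2l ?(ltW e0) // lerDl.
split=> [f g c hf hg|f M hf hM].
  transitivity (int1 (fun t => integral_rV (slice f t) + c * integral_rV (slice g t))).
    congr (Rintegral _ _ _); apply: funext => t; rewrite -IL //; exact: UC_slice.
  by apply: int1_linear (hI0 _ hf) (hI0 _ hg); exact: hIc.
rewrite exprSr mulrA; apply: int1_bound => //; [exact: hIc|exact: hI0|].
by move=> t; apply: IB => [|y]; [exact: UC_slice|exact: hM].
Qed.

Lemma integral_rV_linear n B f g c : 0 <= B -> @UC n B f -> UC B g ->
  integral_rV (fun x => f x + c * g x) = integral_rV f + c * integral_rV g.
Proof. by move=> B0; have [h _] := integral_rV_basic n B0; exact: h. Qed.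

Lemma integral_rV_bound n B f M : 0 <= B -> @UC n B f -> (forall x, `|f x| <= M) ->
  `|integral_rV f| <= M * (2 * B) ^+ n.
Proof. by move=> B0; have [_ h] := integral_rV_basic n B0; exact: h. Qed.

Lemma integral_rV_slices n B (f : 'rV[R]_n.+1 -> R) : 0 <= B -> UC B f ->
  continuous ((fun t => integral_rV (slice f t)) : R^o -> R^o) /\
  vanish1 B (fun t => integral_rV (slice f t)).
Proof.
move=> B0 hf; split.
  apply: UC_continuous1 => e e0.
  have K0 : 0 < (2 * B) ^+ n + 1 by rewrite ltr_wpDl // exprn_ge0 // mulr_ge0.
  have [d d0 hd] := slice_close hf (divr_gt0 e0 K0); exists d => // s t st.
  have -> : integral_rV (slice f s) - integral_rV (slice f t) =
      integral_rV (fun y => slice f s y + -1 * slice f t y).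
    by rewrite (integral_rV_linear _ B0) ?mulN1r //; exact: UC_slice.
  apply: (le_trans (integral_rV_bound (M := e / ((2 * B) ^+ n + 1)) B0 _ _)).
  - by apply: UC_linear; exact: UC_slice.
  - by move=> y; rewrite mulN1r; apply/ltW/hd.
  by rewrite mulrAC ler_pdivrMr // ler_wpM2l ?(ltW e0) // lerDl.
move=> t ht; have := integral_rV_bound (M := 0) B0 (UC_slice t hf); rewrite mul0r => h.
apply/eqP; rewrite -normr_le0; apply: h => y.
by have [_ hv] := hf; rewrite /slice hv ?normr0 //; exists 0; rewrite row_mxE.
Qed.

Lemma integral_rV_ge0 n (f : 'rV[R]_n -> R) : (forall x, 0 <= f x) -> 0 <= integral_rV f.
Proof. by elim: n f => [|n IH] f h //=; apply: int1_ge0 => t; exact: IH. Qed.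

Lemma integral_rV_gt0 n B (f : 'rV[R]_n -> R) x0 : 0 <= B -> UC B f ->
  (forall x, 0 <= f x) -> 0 < f x0 -> 0 < integral_rV f.
Proof.
move=> B0; elim: n f x0 => [|n IH] f x0 hf h h0 /=.
  by rewrite (_ : 0 = x0) //; apply/rowP => -[].
have [hc hv] := integral_rV_slices B0 hf.
pose y0 : 'rV[R]_n := \row_i x0 0 (lift ord0 i).
have e : x0 = row_mx ((x0 0 0)%:M : 'rV[R]_1) y0.
  by apply/rowP => i; have [->|[j ->]] := ord_lift i; rewrite row_mxE // mxE.
apply: (int1_gt0 (B := B) (t0 := x0 0 0) hc hv) => [t|].
  by apply: integral_rV_ge0 => y; exact: h.
by apply: (IH _ y0) => [|y|]; [exact: UC_slice|exact: h|rewrite /slice -e].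
Qed.

(** The first-order expansion is assumed uniformly in [x], so the bound on the integral controls the
    error of the difference quotient. *)
Lemma integral_rV_derive n B (F : R -> 'rV[R]_n -> R) (DF : 'rV[R]_n -> R) t0 : 0 <= B ->
  (exists2 d, 0 < d & forall h, `|h| < d -> UC B (F (t0 + h))) -> UC B DF ->
  (forall e, 0 < e -> exists2 d, 0 < d & forall h, `|h| < d -> forall x,
     `|F (t0 + h) x - F t0 x - h * DF x| <= e * `|h|) ->
  is_derive (t0 : R^o) (1 : R^o) (fun t : R^o => integral_rV (F t) : R^o) (integral_rV DF).
Proof.
move=> B0 [d1 d10 hF] hDF hu.
have hF0 : UC B (F t0) by rewrite -(addr0 t0); apply: hF; rewrite normr0.
have K0 : 0 < (2 * B) ^+ n + 1 by rewrite ltr_wpDl // exprn_ge0 // mulr_ge0.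
have hc : (fun h : R => h^-1 *: ((((fun t : R^o => integral_rV (F t) : R^o) : R^o -> R^o) \o shift (t0 : R^o)) (h *: (1 : R^o)) - integral_rV (F t0)))
    @ (0 : R)^' --> (integral_rV DF : R^o).
  apply/cvgrPdist_le => e e0.
  have [d d0 hd] := hu _ (divr_gt0 e0 K0).
  near=> h; have h0 : h != 0 by near: h; exact: nbhs_dnbhs_neq.
  have hd1 : `|h| < d1 by near: h; apply: dnbhs0_lt.
  have hd2 : `|h| < d by near: h; apply: dnbhs0_lt.
  rewrite /= [h%:A]mulr1 [h + t0]addrC.
  have -> : integral_rV DF - h^-1 *: (integral_rV (F (t0 + h)) - integral_rV (F t0)) =
      - (h^-1 * (integral_rV (F (t0 + h)) - integral_rV (F t0) - h * integral_rV DF)).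
    rewrite -[h^-1 *: _]/(h^-1 * _); move: (integral_rV _) (integral_rV _) (integral_rV _) => x y z.
    by field.
  rewrite normrN normrM normfV ler_pdivrMl ?normr_gt0 //.
  have -> : integral_rV (F (t0 + h)) - integral_rV (F t0) - h * integral_rV DF =
      integral_rV (fun x => (F (t0 + h) x + -1 * F t0 x) + - h * DF x).
    rewrite (integral_rV_linear _ B0) ?(integral_rV_linear _ B0) //; [|exact: hF|].
      by rewrite mulN1r mulNr.
    by apply: UC_linear => //; exact: hF.
  have hU : UC B (fun x => (F (t0 + h) x + -1 * F t0 x) + - h * DF x).
    by apply: UC_linear => //; apply: UC_linear => //; exact: hF.
  apply: (le_trans (integral_rV_bound (M := e / ((2 * B) ^+ n + 1) * `|h|) B0 hU _)) => [x|].
    by rewrite mulN1r mulNr; exact: hd.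
  rewrite mulrAC [X in _ <= X]mulrC ler_wpM2r // mulrAC ler_pdivrMr // ler_wpM2l ?(ltW e0) //.
  by rewrite lerDl.
apply: DeriveDef; first by apply/cvg_ex; exists (integral_rV DF).
exact: cvg_lim hc.
Unshelve. all: by end_near.
Qed.

Lemma mean_value (g dg : R -> R) (h : R) :
  (forall t, `|t| <= `|h| -> is_derive (t : R^o) (1 : R^o) (g : R^o -> R^o) (dg t)) ->
  exists2 c, `|c| <= `|h| & g h - g 0 = h * dg c.
Proof.
move=> hd; have cg t : `|t| <= `|h| -> {for t, continuous (g : R^o -> R^o)}.
  by move=> ht; apply/differentiable_continuous/derivable1_diffP; have [] := hd t ht.
have cw (a b : R) : (forall t, a <= t <= b -> `|t| <= `|h|) -> {within `[a, b], continuous g}.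
  move=> hab; apply: continuous_in_subspaceT => t; rewrite inE /= in_itv /= => ht.
  exact/cg/hab.
have [h0|h0|h0] := ltgtP h 0.
- have hh t : h <= t <= 0 -> `|t| <= `|h|.
    by move=> /andP[h1 h2]; rewrite !ler0_norm // ?(ltW h0) // lerN2.
  have [|c hc e] := @MVT R g dg h 0 h0 _ (cw _ _ hh).
    by move=> t; rewrite in_itv /= => /andP[h1 h2]; apply/hd/hh; rewrite !ltW.
  exists c; first by apply: hh; move: hc; rewrite in_itv /= => /andP[h1 h2]; rewrite !ltW.
  by rewrite -opprB e; ring.
- have hh t : 0 <= t <= h -> `|t| <= `|h|.
    by move=> /andP[h1 h2]; rewrite !ger0_norm // ltW.
  have [|c hc e] := @MVT R g dg 0 h h0 _ (cw _ _ hh).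
    by move=> t; rewrite in_itv /= => /andP[h1 h2]; apply/hd/hh; rewrite !ltW.
  exists c; first by apply: hh; move: hc; rewrite in_itv /= => /andP[h1 h2]; rewrite !ltW.
  by rewrite e; ring.
by exists 0; rewrite ?h0 ?normr0 // subrr mul0r.
Qed.

Lemma row_mx_delta n (t h : R) (y : 'rV[R]_n) :
  (row_mx ((t + h)%:M : 'rV[R]_1) y = row_mx (t%:M : 'rV[R]_1) y + h *: (delta_mx 0 0 : 'rV_n.+1)) *
  (forall j, row_mx (t%:M : 'rV[R]_1) (y + h *: delta_mx 0 j) =
     row_mx (t%:M : 'rV[R]_1) y + h *: (delta_mx 0 (lift ord0 j) : 'rV_n.+1)).
Proof.
split=> [|j]; apply/rowP => i; have [->|[k ->]] := ord_lift i;
  rewrite [RHS]mxE [X in _ = _ + X]mxE [X in _ = _ + _ * X]mxE !row_mxE.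
- by rewrite eqxx mulr1.
- by rewrite mulr0 addr0.
- by rewrite mulr0 addr0.
by rewrite !mxE (inj_eq (@lift_inj _ _)).
Qed.

(** For a later coordinate the slices vanish by induction. For the first one the slice integral is
    differentiated under the sign, and its derivative integrates to zero; the order of integration
    is never exchanged. *)
Lemma integral_rV_partial n B (f df : 'rV[R]_n -> R) i : 0 <= B -> UC B f -> UC B df ->
  (forall x, is_derive (0 : R^o) (1 : R^o) (fun h : R^o => f (x + h *: delta_mx 0 i) : R^o) (df x)) ->
  integral_rV df = 0.
Proof.
move=> B0; elim: n f df i => [|n IH] f df i; first by case: i.
move=> hf hdf hd; have [hc hv] := integral_rV_slices B0 hf; have [hc' hv'] := integral_rV_slices B0 hdf.
have [i0|[j ij]] := ord_lift i; last first.
  have e t : integral_rV (slice df t) = 0.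
    apply: (IH (slice f t) _ j); try exact: UC_slice.
    move=> y; have := hd (row_mx (t%:M : 'rV[R]_1) y).
    have -> // : (fun h : R^o => f (row_mx (t%:M : 'rV[R]_1) y + h *: delta_mx 0 i) : R^o) =
       (fun h : R^o => slice f t (y + h *: delta_mx 0 j) : R^o).
    by apply: funext => h; rewrite ij /slice row_mx_delta.
  transitivity (int1 (fun=> 0 : R)); first by congr (Rintegral _ _ _); apply: funext.
  by rewrite /int1 Rintegral_cst // mul0r.
apply: (int1_derive B0 hc' hv hv') => t.
apply: (integral_rV_derive (F := slice f) B0).
- by exists 1 => // h _; exact: UC_slice.
- exact: UC_slice.
move=> e e0; have [d d0 hs] := slice_close hdf e0; exists d => // h hh y.
have hg s : is_derive (s : R^o) (1 : R^o) ((fun s => slice f (t + s) y) : R^o -> R^o) (slice df (t + s) y).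
  apply/is_derive_line; have := hd (row_mx ((t + s)%:M : 'rV[R]_1) y).
  have -> // : (fun h : R^o => f (row_mx ((t + s)%:M : 'rV[R]_1) y + h *: delta_mx 0 i) : R^o) =
     (fun h : R^o => slice f (t + (h *: (1 : R^o) + s)) y : R^o).
  by apply: funext => k; rewrite i0 /slice [k%:A]mulr1 (addrC k) addrA (row_mx_delta (t + s) k y).1.
have [c hc1 hc2] := @mean_value (fun s => slice f (t + s) y) (fun s => slice df (t + s) y) h (fun s _ => hg s).
move: hc2; rewrite addr0 => ->; rewrite -mulrBr normrM mulrC ler_wpM2r //; apply/ltW/hs.
by rewrite addrAC subrr add0r; exact: le_lt_trans hc1 hh.
Qed.

Lemma UC_continuous n B (f : 'rV[R]_n -> R) : continuous f -> vanish B f -> UC B f.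
Proof.
move=> cf vf; split=> // e e0.
(* The box is enlarged by 1 so that, for increments of at most 1, a point outside it and its
   neighbour both lie where [f] vanishes. *)
pose K := [set x : 'rV[R]_n | forall i, `[- (B + 1), B + 1] (x ord0 i)].
have cK : compact K by apply: (@rV_compact _ _ (fun=> `[- (B + 1), B + 1])) => i; exact: segment_compact.
have /compact_near_coveringP cov := cK.
have := cov R (0 : R)^'+ (fun d x => forall y, ball x d y -> `|f x - f y| < e) _ _.
case=> [x _|d /= d0 hd].
  have /cvgrPdist_lt /(_ _ (divr_gt0 e0 (ltr0Sn _ 1))) := cf x.
  rewrite -nbhs_nearE => /nbhs_ballP[r /= r0 hr].
  exists (ball x (r / 2), [set d | d < r / 2]).
    split; first by apply: nbhsx_ballx; rewrite divr_gt0.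
    by apply: nbhs_right_lt; rewrite divr_gt0.
  move=> [x' d] /= [h1 h2] y hy.
  have b1 : ball x r x' by apply: le_ball h1; lra.
  have b2 : ball x r y.
    by rewrite (splitr r); apply: (ball_triangle h1); apply: le_ball hy; exact: ltW.
  have := hr _ b1; have := hr _ b2 => /= a1 a2.
  have -> : f x' - f y = (f x - f y) - (f x - f x') by ring.
  by apply: (le_lt_trans (ler_normB _ _)); lra.
pose d' := Num.min (d / 2) 1; have d'0 : 0 < d' by rewrite lt_min divr_gt0 //= ltr01.
exists d' => // x y hxy.
have hd' : d' < d by rewrite gt_min; apply/orP; left; lra.
have bxy : ball x d' y by split => // i j; rewrite (ord1 i); exact: hxy.
have [Kx|nKx] := pselect (K x).
  apply: (hd d' _ _ _ Kx) => //.
  by rewrite /= sub0r normrN gtr0_norm.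
have : exists i, B + 1 < `|x 0 i|.
  apply: contrapT => h; apply: nKx => i; rewrite /= in_itv /= -ler_norml leNgt; apply/negP => hi.
  by apply: h; exists i.
move=> [i hi]; rewrite !vf ?subrr ?normr0 //; last by exists i; lra.
exists i; have h1 := hxy i; have : d' <= 1 by rewrite ge_min lexx orbT.
have := ler_normD (x 0 i - y 0 i) (y 0 i); rewrite subrK; lra.
Qed.

End IntegralRV.

Section DeriveRules.
Variables (R : realType) (V : normedModType R) (x v : V).
Implicit Types (f g : V -> R) (l m : R).

Lemma isdM f g l m : is_derive x v f l -> is_derive x v g m ->
  is_derive x v (fun y => f y * g y) (f x * m + g x * l).
Proof. by move=> hf hg; exact: (is_deriveM hf hg). Qed.

Lemma isdD f g l m : is_derive x v f l -> is_derive x v g m ->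
  is_derive x v (fun y => f y + g y) (l + m).
Proof. by move=> hf hg; exact: (is_deriveD hf hg). Qed.

Lemma isdC (c : R) : is_derive x v (fun=> c : R) 0.
Proof. exact: is_derive_cst. Qed.

Lemma isdZ f l (c : R) : is_derive x v f l -> is_derive x v (fun y => c * f y) (c * l).
Proof. by move=> hf; apply: (is_derive_eq (isdM (isdC c) hf)); rewrite mulr0 addr0. Qed.

Lemma isd_sum (I : Type) (r : seq I) (P : pred I) (F : I -> V -> R) (L : I -> R) :
  (forall i, is_derive x v (F i) (L i)) ->
  is_derive x v (fun y => \sum_(i <- r | P i) F i y) (\sum_(i <- r | P i) L i).
Proof.
move=> h; elim: r => [|i r IH].
  rewrite big_nil; have -> : (fun y => \sum_(i <- [::] | P i) F i y) = (fun=> 0 : R).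
    by apply: funext => y; rewrite big_nil.
  exact: isdC.
rewrite big_cons; have -> : (fun y => \sum_(i <- i :: r | P i) F i y) =
    (fun y => if P i then F i y + \sum_(i <- r | P i) F i y else \sum_(i <- r | P i) F i y).
  by apply: funext => y; rewrite big_cons.
by case: (P i) => //; exact: isdD.
Qed.

Lemma isd_unique f l m : is_derive x v f l -> is_derive x v f m -> l = m.
Proof. by move=> [_ <-] [_ <-]. Qed.

Lemma isd_S2 (F : I8 -> I8 -> V -> R) (L : I8 -> I8 -> R) :
  (forall i j, is_derive x v (F i j) (L i j)) ->
  is_derive x v (fun y => S2 (fun i j => F i j y)) (S2 L).
Proof. by move=> h; apply: isd_sum => i; apply: isd_sum. Qed.

Lemma isd_S4 (F : I8 -> I8 -> I8 -> I8 -> V -> R) (L : T4 R) :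
  (forall i j k n, is_derive x v (F i j k n) (L i j k n)) ->
  is_derive x v (fun y => S4 (fun i j k n => F i j k n y)) (S4 L).
Proof. by move=> h; apply: isd_sum => i; apply: isd_sum => j; exact: isd_S2. Qed.

Lemma isd_slots (A B C D : 'M[R]_8) (u : V -> T4 R) (L : T4 R) :
  (forall i j k n, is_derive x v (fun y => u y i j k n) (L i j k n)) ->
  forall a b c d, is_derive x v (fun y => slots A B C D (u y) a b c d) (slots A B C D L a b c d).
Proof. by move=> h a b c d; apply: isd_S4 => p q r s; apply: isdZ. Qed.

Lemma isd_wedge44 (u w : V -> T4 R) (L L' : T4 R) :
  (forall a b c d, is_derive x v (fun y => u y a b c d) (L a b c d)) ->
  (forall a b c d, is_derive x v (fun y => w y a b c d) (L' a b c d)) ->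
  is_derive x v (fun y => wedge44 (u y) (w y)) (wedge44 (u x) L' + wedge44 (w x) L).
Proof.
move=> hu hw; rewrite (wedge44C (w x) L) /wedge44 -mulrDr -big_split /=; apply: isdZ; apply: isd_sum => s.
by rewrite -mulrDr [L _ _ _ _ * _]mulrC; apply: isdZ; apply: isdM.
Qed.

End DeriveRules.

(** * Smooth families of Cayley forms *)

Section CayleyValues.
Variable R : realType.
Local Notation d x y := ((x == y)%:R : R).
Local Notation phi := (Phi0 R).
Local Notation phi_alt := (Phi0_alternating R).
Local Notation phi_Q := (@Phi0_contract1 R).
Implicit Types u : T4 R.

Lemma vol_neq0 u : cayley u -> vol u != 0.
Proof. by move=> [A Au ->]; rewrite vol_pull phi_unitvol mulr1 -unitfE -unitmxE. Qed.

Lemma metric_unit u : cayley u -> metric u \in unitmx.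
Proof. by move=> [A Au ->]; rewrite metric_pull // unitmx_mul unitmx_tr Au. Qed.

Lemma metric_sym u : cayley u -> forall a b, metric u a b = metric u b a.
Proof. by move=> [A Au ->] a b; rewrite metric_pull // gram_sym. Qed.

Lemma cayley_alternating u : cayley u -> alternating4 u.
Proof. by move=> [A Au ->]; exact: u_alternating. Qed.

(** The double contraction written with the form and its metric only, so that it can be
    differentiated along a family for which no smooth frames are known. *)
Lemma contract2_cayley u : cayley u -> forall a b c e,
  S2 (fun p q => up2 u a b p q * u c e p q) =
  6 * (metric u a c * metric u b e - metric u a e * metric u b c) - 4 * u a b c e.
Proof.
move=> [A Au ->] a b c e; rewrite up2_frame // {2}pull4_slots slots_contract2; last first.
  by rewrite -trmx_mul mulmxV // trmx1.
rewrite (eq_slots _ _ _ _ (contract2 phi_alt phi_Q)).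
rewrite metric_pull //.
have e0 : forall i j k l, 6 * (d i k * d j l - d i l * d j k) - 4 * phi i j k l =
    (6 * (d i k * d j l - d i l * d j k)) + - 4 * phi i j k l by move=> *; ring.
rewrite (eq_slots _ _ _ _ e0) slots_lin -(mulNr 4); congr (_ + _).
have hg a' b' : (A^T *m A) a' b' = \sum_p A p a' * A p b'.
  by rewrite mxE; apply: eq_bigr => p _; rewrite mxE.
have s1 i j k l : S2 (fun p q => (A p i * A p j) * (A q k * A q l)) = (A^T *m A) i j * (A^T *m A) k l.
  rewrite !hg mulr_suml; apply: eq_bigr => p _; rewrite mulr_sumr; exact: eq_bigr.
rewrite mulrBr -!s1 -!S2Zl -S2N -S2D slots_S2; apply: eq_S2 => p q.
have -> : S2 (fun r s => A r c * A s e * (6 * (d p r * d q s - d p s * d q r))) =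
   6 * (A p c * A q e) - 6 * (A q c * A p e).
  transitivity (S2 (fun r s => d p r * (d q s * (6 * (A r c * A s e)))) -
     S2 (fun r s => d p s * (d q r * (6 * (A r c * A s e))))).
    by rewrite -S2N -S2D; apply: eq_S2 => r s; ring.
  by rewrite S2_d1 S2_d2 !S1_d.
by ring.
Qed.

End CayleyValues.

Section SmoothCayley.
Variables (R : realType) (V : normedModType R) (U : set V) (oU : open U).
Local Notation phi := (Phi0 R).
Local Notation d x y := ((x == y)%:R : R).

Definition smoothT4 (u : V -> T4 R) := forall a b c e, smooth U (fun y => u y a b c e).

Lemma smooth_wedge44 u w : smoothT4 u -> smoothT4 w -> smooth U (fun y => wedge44 (u y) (w y)).
Proof.
move=> hu hw; apply: smoothM => //; first exact: smooth_cst.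
apply: smooth_sum => // s; apply: smoothM => //; first exact: smooth_cst.
by apply: smoothM.
Qed.

Lemma smooth_S2 (F : I8 -> I8 -> V -> R) : (forall i j, smooth U (F i j)) ->
  smooth U (fun y => S2 (fun i j => F i j y)).
Proof. by move=> h; apply: smooth_sum => // i; apply: smooth_sum. Qed.

Lemma smooth_prod (I : Type) (r : seq I) (F : I -> V -> R) :
  (forall i, smooth U (F i)) -> smooth U (fun x => \prod_(i <- r) F i x).
Proof.
move=> hF; elim: r => [|i r IH].
  by apply: (smooth_eq oU _ (@smooth_cst _ _ U 1)) => x _; rewrite big_nil.
by apply: (smooth_eq oU _ (smoothM oU (hF i) IH)) => x _; rewrite big_cons.
Qed.

Lemma smooth_det n (M : V -> 'M[R]_n) : (forall i j, smooth U (fun y => M y i j)) ->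
  smooth U (fun y => \det (M y)).
Proof.
move=> hM; apply: smooth_sum => // s; apply: smoothM => //; first exact: smooth_cst.
exact: smooth_prod.
Qed.

Lemma smooth_invmx n (M : V -> 'M[R]_n) : (forall y, U y -> M y \in unitmx) ->
  (forall i j, smooth U (fun y => M y i j)) -> forall i j, smooth U (fun y => invmx (M y) i j).
Proof.
move=> hu hM i j; apply: (smooth_eq oU (f := fun y => (\det (M y))^-1 * cofactor (M y) j i)).
  by move=> y Uy; rewrite /invmx hu // !mxE.
apply: smoothM => //.
  apply: smoothV => //; last exact: smooth_det.
  by move=> y Uy; have := hu y Uy; rewrite unitmxE unitfE.
apply: smoothM => //; first exact: smooth_cst.
apply: smooth_det => k l; apply: (smooth_eq oU _ (hM (lift j k) (lift i l))) => y _.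
by rewrite !mxE.
Qed.

Variable u : V -> T4 R.
Hypothesis hs : smoothT4 u.
Hypothesis hc : forall y, U y -> cayley (u y).

Lemma smooth_vol : smooth U (fun y => vol (u y)).
Proof. by apply: smoothM => //; [exact: smooth_wedge44|exact: smooth_cst]. Qed.

Lemma smooth_minors : smoothT4 (fun y => cayley_minors (u y)).
Proof.
move=> a b c e; apply: smoothB => //.
  by apply: smoothM => //; exact: smooth_cst.
apply: smoothM => //; last by apply: smoothV => //; [move=> y /hc; exact: vol_neq0|exact: smooth_vol].
apply: smooth_wedge44 => // i j k l; exact: smoothM.
Qed.

(** The entries are obtained from the form by sums, products, one square root and quotients; the
    strict positivity of [minor_det] keeps the root and the denominator smooth. *)
Lemma smooth_metric a b : smooth U (fun y => metric (u y) a b).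
Proof.
apply: (smooth_eq oU (f := fun y => minor_entry (cayley_minors (u y)) a b)).
  by move=> y Uy; rewrite cayley_metric //; exact: hc.
have hm := smooth_minors; apply: smoothM => //.
  rewrite /minor_num; case: (a == b); apply: smoothB => //; exact: smoothM.
apply: smoothV => //.
  move=> y Uy; rewrite sqrtr_eq0 -ltNge; exact: (cayley_minor_det (hc Uy)).
apply: smooth_sqrt => //; first by move=> y Uy; exact: (cayley_minor_det (hc Uy)).
rewrite /minor_det; apply: smoothD => //; first apply: smoothB => //.
- by apply: smoothM => //; apply: smoothB => //; exact: smoothM.
- by apply: smoothM => //; apply: smoothB => //; exact: smoothM.
by apply: smoothM => //; apply: smoothB => //; exact: smoothM.
Qed.

Lemma smooth_ginv a b : smooth U (fun y => ginv (u y) a b).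
Proof. by apply: smooth_invmx => [y /hc|]; [exact: metric_unit|exact: smooth_metric]. Qed.

(** The sign is v / sqrt(v^2), and the volume v has no zero. *)
Lemma smooth_orient : smooth U (fun y => orient (u y)).
Proof.
apply: (smooth_eq oU (f := fun y => vol (u y) * (Num.sqrt (vol (u y) * vol (u y)))^-1)).
  move=> y Uy; have v0 := vol_neq0 (hc Uy).
  rewrite -expr2 sqrtr_sqr /orient {1}(numEsg (vol (u y))) -mulrA divff ?mulr1 ?normr_eq0 //.
have h2 y : U y -> 0 < vol (u y) * vol (u y).
  by move=> Uy; rewrite -expr2 exprn_even_gt0 //= vol_neq0 //; exact: hc.
have hv := smooth_vol; have hvv := smoothM oU hv hv.
apply: smoothM => //; apply: smoothV => //; last exact: smooth_sqrt.
by move=> y /h2 ?; rewrite sqrtr_eq0 -ltNge.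
Qed.

Lemma orient_near x : U x -> \forall y \near x, orient (u y) = orient (u x).
Proof.
move=> Ux; have v0 := vol_neq0 (hc Ux); have cv := smooth_continuous smooth_vol Ux.
have /cvgrPdist_lt /(_ `|vol (u x)|) := cv; rewrite normr_gt0 => /(_ v0); apply: filterS => y /=.
rewrite /orient => h; have [p|n|e] := ltgtP 0 (vol (u x)); last by rewrite -e eqxx in v0.
  by rewrite (gtr0_sg p) gtr0_sg //; move: h; rewrite (gtr0_norm p) ltr_norml => /andP[]; lra.
by rewrite (ltr0_sg n) ltr0_sg //; move: h; rewrite (ltr0_norm n) ltr_norml => /andP[]; lra.
Qed.

Lemma orient_derive x v : U x -> is_derive x v (fun y => orient (u y)) 0.
Proof.
move=> Ux; apply: (near_eq_is_derive _ (isdC x v (orient (u x)))).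
by have := orient_near Ux; apply: filterS => y ->.
Qed.

Lemma metric_phi : metric phi = 1%:M :> 'M[R]_8.
Proof. by rewrite -(pull4_1 phi) metric_pull ?unitmx1 // trmx1 mulmx1. Qed.

(** Differentiate g^-1 g = 1. *)
Lemma ginv_derive x v (h : I8 -> I8 -> R) : U x ->
  (forall a b, is_derive x v (fun y => metric (u y) a b) (h a b)) ->
  forall p q, is_derive x v (fun y => ginv (u y) p q) (- (ginv (u x) *m mat h *m ginv (u x)) p q).
Proof.
move=> Ux hh p q; pose G := ginv (u x).
pose k : 'M[R]_8 := \matrix_(p, q) 'D_v (fun y => ginv (u y) p q) x.
have hk i j : is_derive x v (fun y => ginv (u y) i j) (k i j).
  by rewrite mxE; exact: (smooth_is_derive _ (smooth_ginv i j) Ux).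
have e : k *m metric (u x) + G *m mat h = 0.
  apply/matrixP => i j; rewrite [RHS]mxE.
  apply: (@isd_unique _ _ x v (fun y => (ginv (u y) *m metric (u y)) i j)); last first.
    apply: (near_eq_is_derive _ (isdC x v ((1%:M : 'M[R]_8) i j))); apply: (near_open oU Ux) => y Uy.
    by rewrite mulVmx //; exact/metric_unit/hc.
  have -> : (fun y => (ginv (u y) *m metric (u y)) i j) = (fun y => \sum_l ginv (u y) i l * metric (u y) l j).
    by apply: funext => y; rewrite mxE.
  have -> : (k *m metric (u x) + G *m mat h) i j = \sum_l (ginv (u x) i l * h l j + metric (u x) l j * k i l).
    rewrite mxE [X in X + _]mxE [X in _ + X]mxE -big_split /=; apply: eq_bigr => l _.
    by rewrite [mat h l j]mxE addrC [k i l * _]mulrC.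
  by apply: isd_sum => l; exact: isdM.
have -> // : - (ginv (u x) *m mat h *m ginv (u x)) p q = k p q.
have {}e : G *m mat h = - (k *m metric (u x)) by apply/eqP; rewrite -addr_eq0 addrC e.
by rewrite -/G e mulNmx -mulmxA mulmxV ?mulmx1 ?mxE ?opprK //; exact/metric_unit/hc.
Qed.

(** Differentiating [contract2_cayley] at a point where the form is the model produces the
    hypothesis of [model_velocity]; each of the two raised indices contributes one term in the
    derivative of the metric. *)
Lemma velocity_std x v : U x -> u x = phi -> exists2 N : I8 -> I8 -> R,
  (forall a b c e, 'D_v (fun y => u y a b c e) x = dot N phi a b c e) &
  (forall a b, N a b + N b a = 'D_v (fun y => metric (u y) a b) x).
Proof.
move=> Ux ux; pose E : T4 R := fun a b c e => 'D_v (fun y => u y a b c e) x.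
pose h a b : R := 'D_v (fun y => metric (u y) a b) x.
have hE a b c e : is_derive x v (fun y => u y a b c e) (E a b c e) by exact: (smooth_is_derive _ (hs a b c e) Ux).
have hh a b : is_derive x v (fun y => metric (u y) a b) (h a b) by exact: (smooth_is_derive _ (smooth_metric a b) Ux).
have gx : metric (u x) = 1%:M by rewrite ux metric_phi.
have Gx : ginv (u x) = 1%:M by rewrite /ginv gx invmx1.
have hG p q : is_derive x v (fun y => ginv (u y) p q) (- h p q).
  by have := ginv_derive Ux hh p q; rewrite Gx mul1mx mulmx1 mxE.
have Ealt : alternating4 E.
  have eN f : (forall y, U y -> f y = 0) -> forall l : R, is_derive x v f l -> l = 0.
    move=> f0 l hf; apply: (isd_unique hf); apply: (near_eq_is_derive _ (isdC x v 0)).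
    by apply: (near_open oU Ux) => y /f0 ->.
  have alt y (Uy : U y) := cayley_alternating (hc Uy).
  move=> a b c e; split; apply/eqP; rewrite -addr_eq0; apply/eqP;
    apply: (eN _ _ _ (isdD (hE _ _ _ _) (hE _ _ _ _))) => y Uy; rewrite (alternating4_perm (alt y Uy) a b c e);
    by rewrite addNr.
have hsym a b : h a b = h b a.
  apply: (isd_unique (hh a b)); apply: (near_eq_is_derive _ (hh b a)).
  by apply: (near_open oU Ux) => y Uy; exact/metric_sym/hc.
suff : exists2 N : I8 -> I8 -> R, E = dot N phi & forall a b, N a b + N b a = h a b.
  by case=> N EN Nh; exists N => // a b c e; rewrite -EN.
apply: model_velocity => // a b c e.
have L1 := isd_S2 (x := x) (v := v) (F := fun p q y => up2 (u y) a b p q * u y c e p q).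
have hup p q : is_derive x v (fun y => up2 (u y) a b p q)
    (E a b p q - (\sum_k h p k * phi a b k q) - (\sum_l h q l * phi a b p l)).
  have : is_derive x v (fun y => up2 (u y) a b p q) (S2 (fun k l => (ginv (u x) p k * ginv (u x) q l) * E a b k l
      + u x a b k l * (ginv (u x) p k * (- h q l) + ginv (u x) q l * (- h p k)))).
    by apply: isd_S2 => k l; do 2 apply: isdM => //.
  rewrite Gx ux => hu; apply: (is_derive_eq hu).
  transitivity (S2 (fun k l => d p k * (d q l * E a b k l)) - S2 (fun k l => d p k * (h q l * phi a b k l))
    - S2 (fun k l => d q l * (h p k * phi a b k l))).
    by rewrite -!S2N -!S2D; apply: eq_S2 => k l; rewrite !mxE; ring.
  rewrite !S2_d1 S2_d2 S1_d; ring.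
have := L1 _ (fun p q => isdM (hup p q) (hE c e p q)) => hL.
have hR : is_derive x v (fun y => 6 * (metric (u y) a c * metric (u y) b e - metric (u y) a e * metric (u y) b c)
    - 4 * u y a b c e) (6 * (h a c * d b e + d a c * h b e - h a e * d b c - d a e * h b c) - 4 * E a b c e).
  have h1 := isdD (isdM (hh a c) (hh b e)) (isdZ (- 1) (isdM (hh a e) (hh b c))).
  have h2 := isdD (isdZ 6 h1) (isdZ (- 4) (hE a b c e)).
  have e1 : (fun y => 6 * (metric (u y) a c * metric (u y) b e - metric (u y) a e * metric (u y) b c) - 4 * u y a b c e)
    = (fun y => 6 * (metric (u y) a c * metric (u y) b e + -1 * (metric (u y) a e * metric (u y) b c)) + -4 * u y a b c e).
    by apply: funext => y; ring.
  by rewrite e1; apply: (is_derive_eq h2); rewrite gx !mxE; ring.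
rewrite -(isd_unique (near_eq_is_derive _ hL) hR); last first.
  by apply: (near_open oU Ux) => y Uy; exact/contract2_cayley/hc.
have upx p q : up2 (u x) a b p q = phi a b p q.
  rewrite /up2 Gx ux; transitivity (S2 (fun k l => d p k * (d q l * phi a b k l))).
    by apply: eq_S2 => k l; rewrite !mxE mulrA.
  by rewrite S2_d1 S1_d.
transitivity (S2 (fun p q => phi c e p q * E a b p q) + S2 (fun p q => phi a b p q * E c e p q)
   - S2 (fun p q => (\sum_k h p k * phi a b k q) * phi c e p q)
   - S2 (fun p q => (\sum_k h q k * phi a b p k) * phi c e p q)); last first.
  by rewrite -!S2N -!S2D; apply: eq_S2 => p q; rewrite upx ux; ring.
rewrite -[S2 (fun p q => phi c e p q * E a b p q)]/(mP phi (E a b) c e).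
rewrite -[S2 (fun p q => phi a b p q * E c e p q)]/(mP phi (E c e) a b) mulr2n mulrDl mul1r opprD addrA.
have -> : S2 (fun p q => (\sum_k h p k * phi a b k q) * phi c e p q) =
    S2 (fun p k => h p k * \sum_q phi a b p q * phi c e k q).
  rewrite [RHS]S2_swap /S2; apply: eq_bigr => p _.
  under eq_bigr => q _ do rewrite mulr_suml.
  rewrite exchange_big /=; apply: eq_bigr => k _; rewrite mulr_sumr; apply: eq_bigr => q _.
  by rewrite (hsym p k) mulrA.
have -> // : S2 (fun p q => (\sum_k h q k * phi a b p k) * phi c e p q) =
    S2 (fun p k => h p k * \sum_q phi a b p q * phi c e k q).
rewrite S2_swap [RHS]S2_swap /S2; apply: eq_bigr => p _.
under eq_bigr => q _ do rewrite mulr_suml.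
rewrite exchange_big /=; apply: eq_bigr => k _; rewrite mulr_sumr; apply: eq_bigr => q _.
rewrite (hsym p k) (alternating4_perm (Phi0_alternating R) a b k q).
by rewrite (alternating4_perm (Phi0_alternating R) c e p q); ring.
Qed.

End SmoothCayley.

Section Velocity.
Variables (R : realType) (V : normedModType R) (U : set V) (oU : open U).
Local Notation phi := (Phi0 R).
Variable u : V -> T4 R.
Hypothesis hs : smoothT4 U u.
Hypothesis hc : forall y, U y -> cayley (u y).

(** Only the frame at the point [x] is used, as a constant matrix: the family pulled back by its
    inverse passes through the model form, where [velocity_std] applies. *)
Lemma velocity x v : U x -> exists N : 'M[R]_8,
  (forall a b c e, 'D_v (fun y => u y a b c e) x = dot N (u x) a b c e) /\
  (forall a b, 'D_v (fun y => metric (u y) a b) x = (N^T *m metric (u x) + metric (u x) *m N) a b) /\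
  (forall a b, is_derive x v (fun y => ginv (u y) a b) (- (N *m ginv (u x) + ginv (u x) *m N^T) a b)).
Proof.
move=> Ux; have [A Au ux] := hc Ux; pose B := invmx A.
pose f y := pull4 B (u y).
have fs : smoothT4 U f.
  move=> a b c e; apply: smooth_sum => // p; apply: smooth_sum => // q; apply: smooth_sum => // r.
  by apply: smooth_sum => // s; apply: smoothM => //; exact: smooth_cst.
have fc y : U y -> cayley (f y).
  move=> /hc[C Cu uC]; exists (C *m B); last by rewrite /f uC pull4_comp.
  by rewrite unitmx_mul Cu unitmx_inv.
have uf y : u y = pull4 A (f y) by rewrite pull4_comp mulVmx // pull4_1.
have fx : f x = phi by rewrite /f ux pull4_comp mulmxV // pull4_1.
have [n hn1 hn2] := velocity_std oU fs fc v Ux fx.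
pose N := B *m mat n *m A.
have gE y : U y -> metric (u y) = A^T *m metric (f y) *m A.
  move=> /fc [C Cu e]; rewrite uf e pull4_comp !metric_pull ?unitmx_mul ?Cu //.
  by rewrite trmx_mul !mulmxA.
have gx : metric (u x) = A^T *m A by rewrite gE // fx metric_phi mulmx1.
have h1 a b c e : is_derive x v (fun y => u y a b c e) (dot N (u x) a b c e).
  rewrite ux -dot_frameV //; have -> : (fun y => u y a b c e) = (fun y => pull4 A (f y) a b c e).
    by apply: funext => y; rewrite uf.
  rewrite pull4_slots; apply: isd_slots => i j k l; rewrite -hn1.
  exact: (smooth_is_derive _ (fs i j k l) Ux).
have h2 a b : is_derive x v (fun y => metric (u y) a b) ((N^T *m metric (u x) + metric (u x) *m N) a b).
  have -> : N^T *m metric (u x) + metric (u x) *m N = A^T *m mat (fun a b => n a b + n b a) *m A.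
    rewrite gx /N !trmx_mul !mulmxA.
    have BA : B^T *m A^T = 1%:M by rewrite -trmx_mul mulmxV // trmx1.
    rewrite -[A^T *m (mat n)^T *m B^T *m A^T]mulmxA BA mulmx1.
    rewrite -[A^T *m A *m B]mulmxA mulmxV // mulmx1 -mulmxDl -mulmxDr; congr (_ *m _ *m _).
    by apply/matrixP => i j; rewrite !mxE addrC.
  rewrite mat_conj; apply: (near_eq_is_derive (f := fun y => S2 (fun i j => A i a * A j b * metric (f y) i j))).
    by apply: (near_open oU Ux) => y Uy; rewrite gE // mx_conj.
  apply: isd_S2 => i j; apply: isdZ; rewrite hn2.
  exact: (smooth_is_derive _ (smooth_metric oU fs fc i j) Ux).
exists N; split; first by move=> a b c e; have [_ ->] := h1 a b c e.
split=> [a b|a b]; first by have [_ ->] := h2 a b.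
apply: (is_derive_eq (ginv_derive oU hs hc Ux h2 a b)); congr (- (fun_of_matrix _ _ _)).
rewrite matE mulmxDr mulmxDl; have mu := metric_unit (hc Ux).
by rewrite !mulmxA mulmxK // mulVmx // mul1mx addrC.
Qed.

End Velocity.

(** * Connections and torsion in a chart *)

Section ChartAlgebra.
Variable R : realType.
Local Notation d x y := ((x == y)%:R : R).
Local Notation phi := (Phi0 R).
Implicit Types (u v : T4 R) (w h : T3 R).

Lemma alt4_dot (M : I8 -> I8 -> R) u : alternating4 u -> forall a b c e,
  4 * alt4 (fun a b c e => \sum_p M p a * u p b c e) a b c e = dot M u a b c e.
Proof.
move=> hu a b c e; pose F x y z t := \sum_p M p x * u p y z t.
have hF x y z t : (F x y t z = - F x y z t) * (F x z y t = - F x y z t) * (F x z t y = F x y z t)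
   * (F x t y z = F x y z t) * (F x t z y = - F x y z t).
  by do !split; rewrite /F -?sumrN; apply: eq_bigr => p _; rewrite (alternating4_perm hu p y z t) ?mulrN.
rewrite -[LHS]/(4 * alt4 F a b c e) alt4E !(hF a b c e) !(hF b a c e) !(hF c a b e) !(hF e a b c).
have -> : dot M u a b c e = F a b c e - F b a c e + F c a b e - F e a b c.
  have q1 : \sum_p M p b * u a p c e = - F b a c e.
    by rewrite /F -sumrN; apply: eq_bigr => p _; rewrite (alternating4_perm hu p a c e) mulrN.
  have q2 : \sum_p M p c * u a b p e = F c a b e.
    by apply: eq_bigr => p _; rewrite (alternating4_perm hu p a b e).
  have q3 : \sum_p M p e * u a b c p = - F e a b c.
    by rewrite /F -sumrN; apply: eq_bigr => p _; rewrite (alternating4_perm hu p a b c) mulrN.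
  by rewrite /dot q1 q2 q3.
by move: (F a b c e) (F b a c e) (F c a b e) (F e a b c) => *; field.
Qed.

(** In the alternating sum the lower indices [i] and [a] of the connection sit in positions 4 and 0;
    transposing them changes the sign but not the term. *)
Lemma dwedge_sym0 (G : I8 -> I8 -> I8 -> R) u h : alternating4 u ->
  (forall i p a, G i p a = G a p i) -> dwedge (fun i => dot (G i) u) h = 0.
Proof.
move=> hu hG; pose D i : T4 R := fun a b c e => \sum_p G i p a * u p b c e.
have e i : wedge44 (dot (G i) u) (fun a b c e => d i a * h b c e) =
    4 * wedge44 (D i) (fun a b c e => d i a * h b c e).
  rewrite wedge44C [in RHS]wedge44C -(wedge44_alt4 _ (D i)).
  have -> : dot (G i) u = fun a b c e => \sum_(k < 1) 4 * alt4 (D i) a b c e.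
    by apply: T4_ext => a b c f; rewrite big_ord1 alt4_dot.
  by rewrite wedge44_sumr big_ord1.
rewrite /dwedge (eq_bigr _ (fun i _ => e i)) -mulr_sumr.
pose F a b c f g k l m : R := (\sum_p G g p a * u p b c f) * h k l m.
have -> : \sum_i wedge44 (D i) (fun a b c e => d i a * h b c e) =
    (4`!%:R * 4`!%:R)^-1 * \sum_(s : 'S_8) (-1) ^+ s * F (s 0) (s 1) (s 2) (s 3) (s 4) (s 5) (s 6) (s 7).
  rewrite /wedge44 -mulr_sumr; congr (_ * _); rewrite exchange_big; apply: eq_bigr => s _.
  rewrite -mulr_sumr; congr (_ * _).
  transitivity (\sum_i d i (s 4) * (D i (s 0) (s 1) (s 2) (s 3) * h (s 5) (s 6) (s 7))).
    by apply: eq_bigr => i _; rewrite mulrCA.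
  by rewrite S1_d'.
rewrite (_ : \sum_(s : 'S_8) _ = 0) ?mulr0 //; apply: oppr_fix0.
apply: (@wedge44_tperm R 0 4 F F) => // s t.
rewrite /t !permM tpermL tpermR !tpermD // /F; congr (_ * _); apply: eq_bigr => p _.
by rewrite hG.
Qed.

Lemma wedge_pair_sym u w h : cayley u -> alternating3 w -> alternating3 h ->
  wedge_pair u w h = wedge_pair u h w.
Proof.
move=> [A Au ->] hw hh; pose w0 := pull3 (invmx A) w; pose h0 := pull3 (invmx A) h.
have hw0 : alternating3 w0 by exact: pull3_alternating.
have hh0 : alternating3 h0 by exact: pull3_alternating.
have -> : w = pull3 A w0 by rewrite pull3_comp mulVmx // pull3_1.
have -> : h = pull3 A h0 by rewrite pull3_comp mulVmx // pull3_1.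
rewrite !wedge_pair_frame // pair3_cycle //; congr (_ * (_ * _)).
rewrite /pair3 S3_swap12 S3_swap23; apply: eq_S3 => p x y.
by rewrite (alternating3_perm hh0 p x y).
Qed.

Lemma unit_frame3 (A : 'M[R]_8) w : A \in unitmx -> w = pull3 A (pull3 (invmx A) w).
Proof. by move=> Au; rewrite pull3_comp mulVmx // pull3_1. Qed.

(* Cramer-free invertibility near the identity: v (1 + s N) = 0 forces |v| <= |s| C |v|. *)
Lemma unitmx_near1 (N : 'M[R]_8) : exists2 e : R, 0 < e & forall s, `|s| < e -> 1%:M + s *: N \in unitmx.
Proof.
pose C := 1 + \sum_i \sum_j `|N i j|; have C0 : 0 < C by rewrite ltr_wpDr // sumr_ge0 // => *; exact: sumr_ge0.
exists C^-1; first by rewrite invr_gt0.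
move=> s hs; rewrite -row_free_unit -kermx_eq0; apply/eqP/row_matrixP => i; rewrite row0.
set v := row i _; have hv : v *m (1%:M + s *: N) = 0 by apply/sub_kermxP; exact: row_sub.
have ev j : v 0 j = - (s * \sum_k v 0 k * N k j).
  move/rowP: hv => /(_ j); rewrite mulmxDr mulmx1 -scalemxAr !mxE => /eqP.
  by rewrite addr_eq0 => /eqP.
pose m := \sum_j `|v 0 j|.
have hm : m <= `|s| * C * m.
  have h1 j : `|v 0 j| <= `|s| * \sum_k `|v 0 k| * `|N k j|.
    rewrite {1}ev normrN normrM ler_wpM2l //; apply: (le_trans (ler_norm_sum _ _ _)).
    by apply: ler_sum => k _; rewrite normrM.
  apply: (le_trans (ler_sum _ (fun j _ => h1 j))); rewrite -mulr_sumr -mulrA ler_wpM2l //.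
  rewrite exchange_big mulrC mulr_suml /=; apply: ler_sum => k _; rewrite -mulr_sumr ler_wpM2l //.
  by rewrite /C ler_wpDl // [X in _ <= X](bigD1 k) //= lerDl sumr_ge0 // => *; exact: sumr_ge0.
have m0 : m = 0.
  apply/eqP; rewrite eq_le; apply/andP; split; last by rewrite sumr_ge0.
  have h1 : `|s| * C < 1 by rewrite -(mulVf (lt0r_neq0 C0)) ltr_pM2r.
  rewrite leNgt; apply/negP => mp; have : `|s| * C * m < m by rewrite gtr_pMl.
  by rewrite ltNge hm.
apply/rowP => j; rewrite [RHS]mxE; apply/eqP; rewrite -normr_eq0; apply/eqP.
exact: (psumr_eq0P (fun k _ => normr_ge0 (v 0 k)) m0 (i := j) isT).
Qed.

Lemma pull4_1N (s : R) (N : 'M[R]_8) u a b c e :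
  pull4 (1%:M + s *: N) u a b c e = S4 (fun p q r t => (d p a + s * N p a) * (d q b + s * N q b)
    * (d r c + s * N r c) * (d t e + s * N t e) * u p q r t).
Proof. by rewrite pull4_slots; apply: eq_S4 => p q r t; rewrite !mxE. Qed.

End ChartAlgebra.

Section ChartGeometry.
Variables (R : realType) (U : set (pt R)) (oU : open U) (Phi : pt R -> T4 R).
Hypothesis hPhi : cayley_on U Phi.
Local Notation d x y := ((x == y)%:R : R).
Let hs : smoothT4 U Phi := hPhi.1.
Let hc := hPhi.2.

Lemma smooth_partial i (f : pt R -> R) : smooth U f -> smooth U (partial i f).
Proof. exact: smooth_derive. Qed.

Lemma partial_near i (f g : pt R -> R) x : U x -> (forall y, U y -> f y = g y) -> partial i f x = partial i g x.
Proof. by move=> Ux fg; apply: near_eq_derive; exact: near_open fg. Qed.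

Lemma partial_metric_sym i a b x : U x ->
  partial i (fun y => metric (Phi y) a b) x = partial i (fun y => metric (Phi y) b a) x.
Proof. by move=> Ux; apply: partial_near => // y Uy; exact/metric_sym/hc. Qed.

Lemma christoffel_sym x k i j : U x -> christoffel Phi x k i j = christoffel Phi x k j i.
Proof.
move=> Ux; rewrite /christoffel; congr (_ * _); apply: eq_bigr => l _; congr (_ * _).
by rewrite (partial_metric_sym l i j Ux) [X in X - _]addrC.
Qed.

Definition chr_mx x i : 'M[R]_8 := mat (fun m a => christoffel Phi x m i a).

Lemma metric_chr x i l a : U x -> (metric (Phi x) *m chr_mx x i) l a =
  2^-1 * (partial i (fun y => metric (Phi y) a l) x + partial a (fun y => metric (Phi y) i l) x
     - partial l (fun y => metric (Phi y) i a) x).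
Proof.
move=> Ux; pose D l := partial i (fun y => metric (Phi y) a l) x + partial a (fun y => metric (Phi y) i l) x
     - partial l (fun y => metric (Phi y) i a) x.
pose c : 'cV[R]_8 := \col_l D l.
transitivity (2^-1 * (metric (Phi x) *m (ginv (Phi x) *m c)) l 0).
  rewrite !mxE mulr_sumr; apply: eq_bigr => m _; rewrite mxE /christoffel mulrCA; congr (_ * (_ * _)).
  by rewrite mxE; apply: eq_bigr => k _; rewrite !mxE.
by rewrite mulmxA mulmxV ?mul1mx ?mxE //; exact/metric_unit/hc.
Qed.

Lemma nabla_Phi_dot x i a b c e : nabla_Phi Phi x i a b c e =
  partial i (fun y => Phi y a b c e) x - dot (chr_mx x i) (Phi x) a b c e.
Proof.
rewrite /nabla_Phi; congr (_ - _); rewrite !big_split /=.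
by rewrite /dot; congr (_ + _ + _ + _); apply: eq_bigr => m _; rewrite !mxE.
Qed.

(** Write the partial derivatives of Phi as N_i.Phi. Then K_i = N_i - Gamma_i is antisymmetric for
    the metric, since both lowered matrices have half the derivative of the metric as symmetric
    part. *)
Lemma nabla_exists x : U x -> exists K : I8 -> 'M[R]_8,
  (forall i, nabla_Phi Phi x i = dot (K i) (Phi x)) /\
  (forall i, (metric (Phi x) *m K i)^T = - (metric (Phi x) *m K i)).
Proof.
move=> Ux; have hv i := velocity oU hs hc (delta_mx 0 i) Ux.
have [N hN] := boolp.choice hv; exists (fun i => N i - chr_mx x i); split=> i.
  apply: T4_ext => a b c e; rewrite nabla_Phi_dot /partial (hN i).1.
  have -> : dot (N i - chr_mx x i) (Phi x) a b c e = dot (fun p q => N i p q + -1 * chr_mx x i p q) (Phi x) a b c e.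
    by congr dot; apply: funext => p; apply: funext => q; rewrite !mxE mulN1r.
  by rewrite dotB mulN1r.
have hg a b := (hN i).2.1 a b.
have z l k : (metric (Phi x) *m (N i - chr_mx x i)) l k =
    (metric (Phi x) *m N i) l k - (metric (Phi x) *m chr_mx x i) l k.
  by rewrite mulmxBr mxE [X in _ + X]mxE.
apply/matrixP => a b; rewrite [LHS]mxE [RHS]mxE !z !metric_chr //.
have := hg a b; rewrite [RHS]mxE.
have -> : ((N i)^T *m metric (Phi x)) a b = (metric (Phi x) *m N i) b a.
  by rewrite [LHS]mxE [RHS]mxE; apply: eq_bigr => k _; rewrite mxE mulrC (metric_sym (hc Ux) k b).
rewrite -/(partial i (fun y => metric (Phi y) a b) x) (partial_metric_sym i b a Ux) => h.
have := partial_metric_sym a i b Ux; have := partial_metric_sym b i a Ux.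
rewrite /partial in h * => h1 h2; lra.
Qed.

Lemma torsion_eqE x T i : U x -> (forall a b c e, nabla_Phi Phi x i a b c e =
    4 * alt4 (fun a' b' c' d' => \sum_p up_last (Phi x) T i a' p * Phi x p b' c' d') a b c e) <->
  nabla_Phi Phi x i = dot (torsion_mx (Phi x) T i) (Phi x).
Proof.
move=> Ux; have hu := cayley_alternating (hc Ux).
have e a b c e : 4 * alt4 (fun a' b' c' d' => \sum_p up_last (Phi x) T i a' p * Phi x p b' c' d') a b c e =
    dot (torsion_mx (Phi x) T i) (Phi x) a b c e.
  rewrite -alt4_dot //; congr (_ * _); apply: eq_alt4 => *; apply: eq_bigr => p _; by rewrite mxE.
split=> [h|h a b c f]; first by apply: T4_ext => a b c f; rewrite h e.
by rewrite e h.
Qed.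

Lemma dwedge_nabla x h : U x ->
  dwedge (fun i a b c e => partial i (fun y => Phi y a b c e) x) h = dwedge (fun i => nabla_Phi Phi x i) h.
Proof.
move=> Ux; have hu := cayley_alternating (hc Ux).
have := dwedge_sym0 (G := fun i => chr_mx x i) h hu _.
move=> /(_ (fun i p a => _)) h0; have {}h0 := h0 _.
rewrite -[LHS]addr0 -(oppr0) -{1}h0.
  rewrite /dwedge -sumrN -big_split /=; apply: eq_bigr => i _.
  rewrite -mulN1r -wedge44_linl; congr wedge44; apply: T4_ext => a b c e.
  by rewrite nabla_Phi_dot mulN1r.
by move=> i p a; rewrite !mxE christoffel_sym.
Qed.

(** The Christoffel terms cancel in pairs by their symmetry. The field equations see the derivatives
    of T through this combination, which is why nabla may be replaced by partial derivatives. *)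
Lemma dform_nabla x C : U x -> alternating3 (C x) -> dform (nabla3 Phi C x) = ext_d C x.
Proof.
move=> Ux hC; apply: T4_ext => a b c e; rewrite /dform /nabla3 /ext_d.
pose S i j k l : R := \sum_m christoffel Phi x m i j * C x m k l.
have e1 i p q r : \sum_m (christoffel Phi x m i p * C x m q r + christoffel Phi x m i q * C x p m r
     + christoffel Phi x m i r * C x p q m) = S i p q r - S i q p r + S i r p q.
  rewrite !big_split /= /S -sumrN; congr (_ + _ + _); apply: eq_bigr => m _.
    by rewrite (alternating3_perm hC m p r) mulrN.
  by rewrite (alternating3_perm hC m p q).
have e2 i j k l : S i j k l = S j i k l by apply: eq_bigr => m _; rewrite christoffel_sym.
rewrite !e1 (e2 b a) (e2 c a) (e2 e a) (e2 c b) (e2 e b) (e2 e c).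
rewrite ?(e2 e c).
have e3 i j k l : S i j l k = - S i j k l.
  by rewrite /S -sumrN; apply: eq_bigr => m _; rewrite (alternating3_perm hC m k l) mulrN.
rewrite /partial; move: ('D_('e_a) _ x) ('D_('e_b) _ x) ('D_('e_c) _ x) ('D_('e_e) _ x) => *.
move: (S a b c e) (S a c b e) (S a e b c) (S b c a e) (S b e a c) (S c e a b) => *; ring.
Qed.

End ChartGeometry.

(** * Variations of the action *)

Section Families.
Variable R : realType.
Notation tx := (R^o * pt R)%type.

Definition tube (e : R) (U : set (pt R)) : set tx := [set z | `|z.1| < e /\ U z.2].

Lemma open_norm_lt (e : R) : open [set t : R^o | `|t| < e].
Proof.
have -> : [set t : R^o | `|t| < e] = (Num.norm : R^o -> R) @^-1` [set y | y < e] by [].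
by apply: open_comp => [t _|]; [exact: norm_continuous|exact: open_lt].
Qed.

Lemma open_tube e U : open U -> open (tube e U).
Proof.
move=> oU; have -> : tube e U = (fst @^-1` [set t : R^o | `|t| < e]) `&` (snd @^-1` U) by [].
apply: openI; apply: open_comp => //; try exact: open_norm_lt.
  by move=> z _; exact: cvg_fst.
by move=> z _; exact: cvg_snd.
Qed.

Lemma slice_t_affine (x : pt R) : continuous ((fun t : R^o => (t, x)) : R^o -> tx) /\
  (forall h (v t : R^o), ((h *: v + t, x) : tx) = h *: ((v, 0) : tx) + (t, x)).
Proof.
split=> [t A [[B C] /= [hB hC] hA]|h v t].
  by apply: filterS hB => s Bs; apply: hA; split=> //=; exact: nbhs_singleton hC.
by congr pair; rewrite /= scaler0 add0r.
Qed.

Lemma slice_x_affine (t : R^o) : continuous ((fun x : pt R => (t, x)) : pt R -> tx) /\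
  (forall h (v x : pt R), ((t, h *: v + x) : tx) = h *: ((0, v) : tx) + (t, x)).
Proof.
split=> [x A [[B C] /= [hB hC] hA]|h v x].
  by apply: filterS hC => s Bs; apply: hA; split=> //=; exact: nbhs_singleton hB.
by congr pair; rewrite /= scaler0 add0r.
Qed.

Lemma smooth_slice_t e U (f : tx -> R) x : U x -> smooth (tube e U) f ->
  smooth [set t : R^o | `|t| < e] (fun t : R^o => f (t, x)).
Proof.
move=> Ux hf; have [h1 h2] := slice_t_affine x.
by apply: (smooth_affine (l := fun v => (v, 0)) h1 h2 _ hf) => t.
Qed.

Lemma smooth_slice_x e U (f : tx -> R) t : `|t| < e -> smooth (tube e U) f ->
  smooth U (fun x => f (t, x)).
Proof.
move=> ht hf; have [h1 h2] := slice_x_affine t.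
by apply: (smooth_affine (l := fun v => (0, v)) h1 h2 _ hf) => x.
Qed.

Lemma derive_slice_t (f : tx -> R) x (t : R^o) :
  'D_(1 : R^o) (fun t : R^o => f (t, x)) t = 'D_((1, 0) : tx) f (t, x).
Proof. by have [_ h2] := slice_t_affine x; exact: (@derive_affine R R^o tx (fun t : R^o => (t, x)) (fun v : R^o => (v, 0)) f 1 t h2). Qed.

Lemma smooth_snd e U (f : pt R -> R) : smooth U f -> smooth (tube e U) (fun z => f z.2).
Proof.
move=> hf; apply: (smooth_affine (g := snd) (l := snd) _ _ _ hf) => //.
- by move=> z; exact: cvg_snd.
- by move=> z [].
Qed.

Lemma smooth_fst (W : set tx) : smooth W (fun z => z.1).
Proof.
have h : smooth [set: R^o] (fun t : R^o => t : R).
  move=> k; case: k => [|k]; first by split=> // x _; exact: cvg_id.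
  split=> [x _|v]; first exact: cvg_id.
  split=> [x _|]; first exact: derivable_id.
  have -> : (fun x : R^o => 'D_v (fun t : R^o => t : R) x) = (fun=> v : R).
    by apply: funext => x; exact: derive_id.
  exact: Ck_cst.
apply: (smooth_affine (g := fst) (l := fst) _ _ _ h) => //.
by move=> z; exact: cvg_fst.
Qed.

Lemma smooth_coord (W : set (pt R)) i : smooth W (fun x : pt R => x 0 i).
Proof.
move=> k; case: k => [|k]; first by split=> // x _; exact: coord_continuous.
have hd (x v : pt R) : is_derive x v (fun x : pt R => x 0 i) (v 0 i).
  apply/is_derive_line.
  have h := isdD (isdM (is_derive_id (0 : R^o) (1 : R^o)) (isdC (0 : R^o) (1 : R^o) (v 0 i))) (isdC (0 : R^o) (1 : R^o) (x 0 i)).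
  have -> : (fun h : R^o => ((h *: v + x : pt R) 0 i) : R^o) = (fun h : R^o => h * v 0 i + x 0 i).
    by apply: funext => h'; rewrite !mxE.
  by apply: (is_derive_eq h); rewrite mulr0 add0r addr0 mulr1.
split=> [x _|v]; first exact: coord_continuous.
split=> [x _|]; first by have [] := hd x v.
have -> : (fun x : pt R => 'D_v (fun x : pt R => x 0 i) x) = (fun=> v 0 i).
  by apply: funext => x; have [_ ->] := hd x v.
exact: Ck_cst.
Qed.

Lemma compact_box (K : set (pt R)) : compact K ->
  exists2 B : R, 0 <= B & forall x, K x -> forall i, `|x 0 i| <= B.
Proof.
move=> /compact_near_coveringP cov.
have := cov R (+oo_R) (fun B x => forall i : 'I_8, `|x 0 i| <= B) _ _.
case=> [x _|M [_ hM]].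
  pose c := \sum_i `|x 0 i| + 1.
  exists (ball x 1, [set B | c <= B]).
    split; first exact: nbhsx_ballx.
    by exists c; split; [exact: num_real|move=> y /= /ltW].
  move=> [y B] /= [[_ hy] hB] i; apply: le_trans hB.
  have := hy 0 i; rewrite /ball /= => h.
  have : `|x 0 i| <= \sum_i `|x 0 i| by rewrite (bigD1 i) //= lerDl sumr_ge0.
  have := ler_distD (x 0 i) 0 (y 0 i); rewrite !sub0r !normrN /c; lra.
exists (`|M| + 1); first by rewrite addr_ge0.
by move=> x Kx i; apply: hM Kx i; rewrite (le_lt_trans (ler_norm M)) // ltrDl.
Qed.

(** The indicator of [K] extends by zero a function known on [U] only. The extension is continuous,
    as it agrees with [f] on [U] and with 0 off the closed set [K]. *)
Lemma UC_ext (U K : set (pt R)) B (f : pt R -> R) : open U -> compact K -> K `<=` U ->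
  (forall x, K x -> forall i, `|x 0 i| <= B) ->
  (forall x, U x -> {for x, continuous f}) -> (forall x, U x -> ~ K x -> f x = 0) ->
  UC B (fun x => \1_K x * f x).
Proof.
move=> oU cK KU hB cf f0; apply: UC_continuous; last first.
  move=> x [i hi]; rewrite indicE memNset ?mul0r // => Kx.
  by have := hB x Kx i; rewrite leNgt hi.
move=> x; have [Ux|nUx] := pselect (U x).
  apply: (continuous_near_eq _ (cf x Ux)); apply: (near_open oU Ux) => y Uy.
  have [Ky|nKy] := pselect (K y); first by rewrite indicE mem_set // mul1r.
  by rewrite indicE memNset // mul0r f0.
have oK : open (~` K) by apply: closed_openC; apply: compact_closed cK; exact: norm_hausdorff.
have nK : (~` K) x by move=> /KU.
apply: (continuous_near_eq _ (smooth_continuous (@smooth_cst R (pt R) setT 0) (I : setT x))).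
by apply: (near_open oK nK) => y Ky; rewrite indicE memNset // mul0r.
Qed.

(** The mean value theorem reduces the uniform first-order expansion to uniform continuity of the
    t-derivative at t = 0 over [K], and this follows from compactness. *)
Lemma action_derive (U K : set (pt R)) (e : R) (G : R -> pt R -> R) : open U -> compact K ->
  K `<=` U -> 0 < e -> smooth (tube e U) (fun z => G z.1 z.2) ->
  (forall t x, `|t| < e -> U x -> ~ K x -> G t x = 0) ->
  is_derive (0 : R^o) (1 : R^o) (fun t : R^o => integral_rV (fun x : pt R => \1_K x * G t x) : R^o)
    (integral_rV (fun x : pt R => \1_K x * 'D_(1 : R^o) (fun t : R^o => G t x) 0)).
Proof.
move=> oU cK KU e0 sG G0; have [B B0 hB] := compact_box cK.
pose DG (z : tx) : R := 'D_((1, 0) : tx) (fun z : tx => G z.1 z.2) z.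
have sDG : smooth (tube e U) DG by exact: smooth_derive.
have eDG t x : 'D_(1 : R^o) (fun t : R^o => G t x) t = DG (t, x).
  by rewrite -[LHS]/('D_(1 : R^o) (fun t : R^o => (fun z : tx => G z.1 z.2) (t, x)) t) derive_slice_t.
have hF t : `|t| < e -> UC B (fun x => \1_K x * G t x).
  move=> ht; apply: (UC_ext oU cK KU hB) => [x Ux|x Ux nK]; last exact: G0.
  exact: (smooth_continuous (smooth_slice_x ht sG) Ux).
have e00 : `|0 : R| < e by rewrite normr0.
apply: (integral_rV_derive (B := B) (F := fun t x => \1_K x * G t x) B0).
- by exists e => // h hh; apply: hF; rewrite add0r.
- apply: (UC_ext oU cK KU hB) => [x Ux|x Ux nK].
    have -> : (fun x => 'D_(1 : R^o) (fun t : R^o => G t x) 0) = (fun x => DG (0, x)) by apply: funext => y.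
    exact: (smooth_continuous (smooth_slice_x e00 sDG) Ux).
  have hn : \forall t \near (0 : R^o), (0 : R) = G t x.
    have h0 : [set t : R^o | `|t| < e] 0 by [].
    by have := open_nbhs_nbhs (conj (@open_norm_lt e) h0); apply: filterS => t ht; rewrite G0.
  by have [_ ->] := near_eq_is_derive hn (isdC (0 : R^o) (1 : R^o) (0 : R)).
move=> eps eps0; have /compact_near_coveringP cov := cK.
have := cov R (0 : R)^'+ (fun d x => forall c : R, `|c| < d -> `|DG (c, x) - DG (0, x)| < eps) _ _.
case=> [x Kx|d /= d0 hd].
  have z0 : tube e U (0, x) by split; [|exact: KU].
  have /cvgrPdist_lt /(_ _ (divr_gt0 eps0 (ltr0Sn _ 1))) := smooth_continuous sDG z0.
  rewrite -nbhs_nearE => /nbhs_ballP[r /= r0 hr].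
  exists (ball x r, [set d | d < r]).
    by split; [exact: nbhsx_ballx|exact: nbhs_right_lt].
  move=> [y d] /= [hy hd] c hc.
  have b1 : ball ((0, x) : tx) r (c, y).
    by split=> //=; rewrite /ball /= sub0r normrN (lt_trans hc).
  have b2 : ball ((0, x) : tx) r (0, y) by split=> //=; exact: ballxx.
  have := hr _ b1; have := hr _ b2; rewrite -/(DG (0, x)) => /= a2 a1.
  have -> : DG (c, y) - DG (0, y) = (DG (0, x) - DG (0, y)) - (DG (0, x) - DG (c, y)) by ring.
  by apply: (le_lt_trans (ler_normB _ _)); rewrite (splitr eps) ltrD.
pose d' := Num.min (d / 2) e; have d'0 : 0 < d' by rewrite lt_min divr_gt0.
exists d' => // h hh x; rewrite add0r indicE.
have [Kx|nKx] := pselect (K x); last by rewrite memNset // !mul0r !subr0 mulr0 subr0 normr0 mulr_ge0 // ltW.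
rewrite mem_set // !mul1r; have Ux := KU x Kx.
have he : `|h| < e by apply: lt_le_trans hh _; rewrite ge_min lexx orbT.
have [t ht|c hc ->] := @mean_value R (fun t => G t x) (fun t => DG (t, x)) h.
  have := smooth_is_derive (1 : R^o) (smooth_slice_t Ux sG) (le_lt_trans ht he : [set t : R^o | `|t| < e] t).
  by rewrite /= eDG.
rewrite eDG -mulrBr normrM mulrC ler_wpM2r //; apply/ltW.
have hd2 : d / 2 < d by lra.
apply: (hd (d / 2) _ _ x Kx); [by rewrite /= sub0r normrN gtr0_norm ?divr_gt0|by rewrite divr_gt0|].
by apply: le_lt_trans hc _; apply: lt_le_trans hh _; rewrite ge_min lexx.
Qed.

Definition bump (x0 : pt R) (r : R) (x : pt R) : R := \prod_(i < 8) flat 0 (r ^+ 2 - (x 0 i - x0 0 i) ^+ 2).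
Definition box (x0 : pt R) (r : R) : set (pt R) := [set x | forall i, `[x0 0 i - r, x0 0 i + r] (x ord0 i)].

Lemma smooth_flat (V : normedModType R) (U : set V) (f : V -> R) : open U -> smooth U f ->
  smooth U (fun x => flat 0 (f x)).
Proof.
move=> oU hf k; apply: (@Ck_family R V setT (@flat R) (fun n => - n%:R) (fun=> 1) U f k oU _ _ (hf k) 0%N) => //.
by move=> n y _; exact: is_derive_flat.
Qed.

Lemma smooth_bump x0 r (U : set (pt R)) : open U -> smooth U (bump x0 r).
Proof.
move=> oU; apply: smooth_prod => // i; apply: smooth_flat => //.
have hc := smooth_coord U i; have h1 := smoothB oU hc (@smooth_cst _ _ U (x0 0 i)).
apply: smoothB => //; first exact: smooth_cst.
by apply: (smooth_eq oU _ (smoothM oU h1 h1)) => x _; rewrite expr2.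
Qed.

Lemma flat_ge0 n (y : R) : 0 <= flat n y.
Proof.
by rewrite /flat; case: ltP => // y0; rewrite mulr_ge0 ?expR_ge0 // exprn_ge0 // invr_ge0 ltW.
Qed.

Lemma bump_ge0 x0 r x : 0 <= bump x0 r x.
Proof. by apply: prodr_ge0 => i _; exact: flat_ge0. Qed.

Lemma bump_gt0 x0 r : 0 < r -> 0 < bump x0 r x0.
Proof.
move=> r0; apply: prodr_gt0 => i _; rewrite subrr expr0n subr0 /flat exprn_gt0 // expr0 mul1r.
exact: expR_gt0.
Qed.

Lemma bump_out x0 r x : 0 < r -> ~ box x0 r x -> bump x0 r x = 0.
Proof.
move=> r0 nb; have [i hi] : exists i, r < `|x 0 i - x0 0 i|.
  apply: contrapT => h; apply: nb => i; rewrite /= in_itv /= -ler_distl leNgt.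
  by apply/negP => hi; apply: h; exists i.
rewrite /bump (bigD1 i) //= /flat ltNge subr_le0 -(real_normK (num_real (x 0 i - x0 0 i))).
by rewrite lerXn2r ?nnegrE ?(ltW r0) ?(ltW hi) //= mul0r.
Qed.

Lemma box_compact x0 r : compact (box x0 r).
Proof. by apply: (@rV_compact _ _ (fun i => `[x0 0 i - r, x0 0 i + r])) => i; exact: segment_compact. Qed.

Lemma box_nbhs (x0 : pt R) (W : set (pt R)) : nbhs x0 W -> exists2 r, 0 < r & box x0 r `<=` W.
Proof.
move=> /nbhs_ballP[e /= e0 he]; exists (e / 2); first by rewrite divr_gt0.
move=> x hx; apply: he; split=> // i j; rewrite (ord1 i) /ball /= distrC.
have := hx j; rewrite /= in_itv /= -ler_distl => h; apply: le_lt_trans h _; lra.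
Qed.

(** Where f does not vanish it keeps its sign on a small box; against the bump of that box, and
    after multiplication by this sign, the integral would be positive. *)
Lemma fundamental_lemma (U : set (pt R)) (f : pt R -> R) : open U ->
  (forall x, U x -> {for x, continuous f}) ->
  (forall x0 r, 0 < r -> box x0 r `<=` U -> integral_rV (fun x => \1_(box x0 r) x * (bump x0 r x * f x)) = 0) ->
  forall x, U x -> f x = 0.
Proof.
move=> oU cf hf x0 Ux0; apply: contrapT => /eqP f0.
have := cf x0 Ux0; move=> /cvgrPdist_lt /(_ `|f x0|); rewrite normr_gt0 => /(_ f0) hn.
pose W := U `&` [set x | `|f x0 - f x| < `|f x0|].
have nW : nbhs x0 W by apply: filterI => //; exact: open_nbhs_nbhs.
have [r r0 hr] := box_nbhs nW.
have rU : box x0 r `<=` U by move=> x /hr [].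
have [B B0 hB] := compact_box (box_compact (x0 := x0) (r := r)).
pose s := Num.sg (f x0).
pose g x := \1_(box x0 r) x * (bump x0 r x * f x).
have ug : UC B g.
  apply: (UC_ext oU (box_compact (x0 := x0) (r := r)) rU hB) => x Ux.
    by apply: continuousM; [exact: (smooth_continuous (smooth_bump x0 r oU) Ux)|exact: cf].
  by move=> nb; rewrite bump_out // mul0r.
have hs : integral_rV (fun x : pt R => 0 + s * g x) = 0.
  have uz : UC B ((fun=> 0) : pt R -> R) by split=> // eps eps0; exists 1 => // *; rewrite subrr normr0.
  rewrite (integral_rV_linear s B0 uz ug) (hf x0 r r0 rU) mulr0 addr0.
  apply/eqP; rewrite -normr_le0; have := integral_rV_bound (M := 0) B0 uz; rewrite mul0r; apply => x.
  by rewrite normr0.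
have ge0 x : 0 <= 0 + s * g x.
  rewrite add0r /g indicE; have [bx|nb] := pselect (box x0 r x); last by rewrite memNset // mul0r mulr0.
  rewrite mem_set // mul1r mulrCA mulr_ge0 ?bump_ge0 //.
  have [_ /=] := hr x bx; rewrite /s; have [p|n|e0] := ltgtP 0 (f x0); last by rewrite -e0 eqxx in f0.
    by rewrite (gtr0_sg p) mul1r (gtr0_norm p) ltr_norml => /andP[]; lra.
  by rewrite (ltr0_sg n) mulN1r (ltr0_norm n) ltr_norml => /andP[]; lra.
have uz : UC B (fun x => 0 + s * g x).
  by apply: UC_linear => //; split=> // eps eps0; exists 1 => // *; rewrite subrr normr0.
have : 0 < integral_rV (fun x : pt R => 0 + s * g x).
  apply: (integral_rV_gt0 (x0 := x0) B0 uz ge0).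
  have bx : box x0 r x0 by move=> i; rewrite /= in_itv /=; apply/andP; split; lra.
  rewrite add0r /g indicE mem_set // mul1r mulrCA mulr_gt0 ?bump_gt0 //.
  by rewrite /s -normrEsg normr_gt0.
by rewrite hs ltxx.
Qed.

End Families.

(** * The Lagrangian and its variation in Phi *)

Section Lagrangian.
Variable R : realType.
Local Notation d x y := ((x == y)%:R : R).
Variable lam : R.
Notation tx := (R^o * pt R)%type.
Implicit Types (u X E : T4 R) (w h : T3 R).

Lemma wedge44Zr (k : R) u X : wedge44 u (fun a b c e => k * X a b c e) = k * wedge44 u X.
Proof.
rewrite /wedge44 [RHS]mulrCA [k * _]mulr_sumr; congr (_ * _).
by apply: eq_bigr => s _; rewrite !(mulrCA k).
Qed.

Lemma wedge44Zl (k : R) u X : wedge44 (fun a b c e => k * X a b c e) u = k * wedge44 X u.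
Proof. by rewrite wedge44C wedge44Zr wedge44C. Qed.

(** The Lagrangian with dC replaced by an independent 4-form [X], which stays fixed when Phi varies;
    it is then an algebraic function at each point. *)
Definition lagr u X w : R :=
  orient u * (wedge44 u (fun a b c e => X a b c e - 6 * wedge_Phi u w a b c e) + lam / 6 * vol u).

Lemma lagrE u X w : lagr u X w = orient u * (wedge44 u X + -6 * wedge_pair u w w + lam / 6 * vol u).
Proof.
rewrite /lagr /wedge_pair -(wedge44_alt4 u (wedge_with2 _ _ _)) -wedge44_linr.
by congr (_ * (wedge44 _ _ + _)); apply: T4_ext => *; rewrite mulNr.
Qed.

Section Smoothness.
Variables (V : normedModType R) (W : set V) (oW : open W).
Variable u : V -> T4 R.
Hypothesis hs : smoothT4 W u.
Hypothesis hc : forall y, W y -> cayley (u y).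
Definition smoothT3 (w : V -> T3 R) := forall a b c, smooth W (fun y => w y a b c).

Lemma smooth_wedge_pair (w h : V -> T3 R) : smoothT3 w -> smoothT3 h ->
  smooth W (fun y => wedge_pair (u y) (w y) (h y)).
Proof.
move=> hw hh; apply: smooth_wedge44 => // a b c e; apply: smooth_S2 => // p q.
by apply: smoothM => //; [exact: smoothM|exact: smooth_ginv].
Qed.

Lemma smooth_lagr (X : V -> T4 R) (w : V -> T3 R) : smoothT4 W X -> smoothT3 w ->
  smooth W (fun y => lagr (u y) (X y) (w y)).
Proof.
move=> hX hw; apply: (smooth_eq oW (f := fun y => orient (u y) *
    (wedge44 (u y) (X y) + -6 * wedge_pair (u y) (w y) (w y) + lam / 6 * vol (u y)))).
  by move=> y _; rewrite lagrE.
apply: smoothM => //; first exact: smooth_orient.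
apply: smoothD => //; last by apply: smoothM => //; [exact: smooth_cst|exact: smooth_vol].
apply: smoothD => //; first exact: smooth_wedge44.
by apply: smoothM => //; [exact: smooth_cst|exact: smooth_wedge_pair].
Qed.

Lemma smooth_S4' (F : I8 -> I8 -> I8 -> I8 -> V -> R) : (forall i j k n, smooth W (F i j k n)) ->
  smooth W (fun y => S4 (fun i j k n => F i j k n y)).
Proof. by move=> h; do 4 (apply: smooth_sum => // ?). Qed.

Lemma smooth_mx_mul (M N : V -> 'M[R]_8) : (forall i j, smooth W (fun y => M y i j)) ->
  (forall i j, smooth W (fun y => N y i j)) -> forall i j, smooth W (fun y => (M y *m N y) i j).
Proof.
move=> hM hN i j; apply: (smooth_eq oW (f := fun y => \sum_k M y i k * N y k j)).
  by move=> y _; rewrite mxE.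
by apply: smooth_sum => // k; exact: smoothM.
Qed.

Lemma smooth_dot (N : V -> 'M[R]_8) (v : V -> T4 R) : (forall i j, smooth W (fun y => N y i j)) ->
  smoothT4 W v -> smoothT4 W (fun y => dot (N y) (v y)).
Proof.
move=> hN hv a b c e; rewrite /dot.
apply: smoothD => //; last by apply: smooth_sum => // p; exact: smoothM.
apply: smoothD => //; last by apply: smooth_sum => // p; exact: smoothM.
by apply: smoothD => //; apply: smooth_sum => // p; exact: smoothM.
Qed.

Lemma smooth_field_form L (X : V -> T4 R) (w : V -> T3 R) : smoothT4 W X -> smoothT3 w ->
  smoothT4 W (fun y => field_form L (u y) (w y) (X y)).
Proof.
move=> hX hw; have hg := smooth_ginv oW hs hc.
have hS i j : smooth W (fun y => (ginv (u y) *m mat (mS (up4 (u y)) (w y))) i j).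
  apply: (smooth_mx_mul hg) => k l.
  apply: (smooth_eq oW (f := fun y => mS (up4 (u y)) (w y) k l)); first by move=> y _; rewrite mxE.
  apply: smooth_S4' => p q r s; apply: smoothM => //; apply: smoothM => //.
  apply: smooth_S4' => p' q' r' s'; apply: smoothM => //; apply: smoothM => //.
  by apply: smoothM => //; exact: smoothM.
have hC i j : smooth W (fun y => correction (u y) (w y) i j).
  apply: (smooth_eq oW (f := fun y => - 8^-1 * (ginv (u y) *m mat (mS (up4 (u y)) (w y))) i j
     + (56^-1 * \sum_k (ginv (u y) *m mat (mS (up4 (u y)) (w y))) k k) * d i j)).
    by move=> y _; rewrite /correction [RHS]mxE [X in _ = X + _]mxE [X in _ = _ + X]mxE mulr_natr.
  apply: smoothD => //; apply: smoothM => //; try exact: smooth_cst.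
  apply: smoothM => //; [exact: smooth_cst|exact: smooth_sum].
move=> a b c e; apply: smoothD => //; last by apply: smoothM => //; exact: smooth_cst.
apply: smoothD => //; last exact: smooth_dot.
apply: smoothB => //; apply: smoothM => //; first exact: smooth_cst.
apply: smoothM => //; first exact: smooth_cst.
apply: smooth_sum => // s; apply: smoothM => //; first exact: smooth_cst.
by apply: smooth_S2 => // p q; apply: smoothM => //; exact: smoothM.
Qed.

(** The orientation is locally constant and the volume contributes lam/6 * 1/7 = lam/42. The
    quadratic term varies through Phi and through the inverse metric; [wedge44_correction] turns the
    latter into a wedge with the same N.Phi. *)
Lemma lagr_derive x v X w : W x -> alternating3 w ->
  is_derive x v (fun y => lagr (u y) X w)
    (orient (u x) * wedge44 (fun a b c e => 'D_v (fun y => u y a b c e) x) (field_form (lam / 2) (u x) w X)).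
Proof.
move=> Wx hw; have [N [h1 [_ h3]]] := velocity oW hs hc v Wx.
have hD a b c e : is_derive x v (fun y => u y a b c e) (dot N (u x) a b c e).
  by rewrite -h1; exact: (smooth_is_derive _ (hs a b c e) Wx).
have -> : (fun a b c e => 'D_v (fun y => u y a b c e) x) = dot N (u x) by apply: T4_ext.
have -> : (fun y => lagr (u y) X w) = (fun y => orient (u y) *
    (wedge44 (u y) X + -6 * wedge_pair (u y) w w + lam / 6 * vol (u y))).
  by apply: funext => y; rewrite lagrE.
have dO := orient_derive oW hs hc v Wx.
have dX := isd_wedge44 hD (fun a b c e => isdC x v (X a b c e)).
have dV : is_derive x v (fun y => vol (u y)) (7^-1 * wedge44 (dot N (u x)) (u x)).
  have := isdM (isd_wedge44 hD hD) (isdC x v (14^-1 : R)) => hv; apply: (is_derive_eq hv).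
  by rewrite (wedge44C (u x)); field.
pose H := N *m ginv (u x) + ginv (u x) *m N^T.
have dW : is_derive x v (fun y => wedge_pair (u y) w w)
   (wedge44 (u x) (fun a b c e => -1 * wedge_with H w a b c e) + wedge44 (wedge_with2 (ginv (u x)) w w) (dot N (u x))).
  apply: isd_wedge44 => // a b c e.
  have hq := isd_S2 (fun p q => isdZ (w a b p * w c e q) (h3 p q)); apply: (is_derive_eq hq).
  by rewrite /wedge_with -S2Zl; apply: eq_S2 => p q; rewrite -/H; ring.
have hF := isdM dO (isdD (isdD dX (isdZ (- 6) dW)) (isdZ (lam / 6) dV)).
apply: (is_derive_eq hF); rewrite mulr0 addr0; congr (_ * _).
have [A Au ux] := hc Wx; pose w0 := pull3 (invmx A) w.
have hw0 : alternating3 w0 by exact: pull3_alternating.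
have wE : w = pull3 A w0 by exact: unit_frame3.
have hcor : 6 * wedge44 (u x) (wedge_with H w) = wedge44 (dot N (u x)) (dot (correction (u x) w) (u x)).
  rewrite -wedge44_alt4 /H ux {1}wE wedge44_correction //.
  by rewrite -wE.
rewrite wedge44Zr (wedge44C (wedge_with2 _ _ _)) -(wedge44_alt4 _ (wedge_with2 _ _ _)).
have z : wedge44 (u x) (fun _ _ _ _ => 0) = 0.
  by rewrite /wedge44 big1 ?mulr0 // => s _; rewrite !mulr0.
have -> : wedge44 (u x) (fun a b c e => 0) = 0 by exact: z.
have -> : field_form (lam / 2) (u x) w X = (fun a b c e => ((X a b c e + -6 * wedge_Phi (u x) w a b c e)
   + 1 * dot (correction (u x) w) (u x) a b c e) + lam / 2 / 21 * u x a b c e).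
  by apply: T4_ext => *; rewrite /field_form; ring.
rewrite !wedge44_linr (wedge44C X) -hcor.
rewrite -[alt4 (wedge_with2 (ginv (u x)) w w)]/(wedge_Phi (u x) w).
move: (wedge44 (dot N (u x)) X) (wedge44 (dot N (u x)) (wedge_Phi (u x) w)) (wedge44 (u x) (wedge_with H w)) (wedge44 (dot N (u x)) (u x)) => *.
by field.
Qed.

End Smoothness.

Section Chart.
Variables (U : set (pt R)) (oU : open U) (Phi : pt R -> T4 R) (hPhi : cayley_on U Phi).
Let hs : smoothT4 U Phi := hPhi.1.
Let hc := hPhi.2.

Lemma integral_rV_0 (f : pt R -> R) : (forall x, f x = 0) -> integral_rV f = 0.
Proof.
move=> f0; have uz : UC 0 f by split=> // eps eps0; exists 1 => // *; rewrite !f0 subrr normr0.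
apply/eqP; rewrite -normr_le0; have := integral_rV_bound (M := 0) (lexx 0) uz; rewrite mul0r; apply => x.
by rewrite f0 normr0.
Qed.

Lemma smooth_ext_d (C : pt R -> T3 R) : smooth3 U C -> smoothT4 U (ext_d C).
Proof.
move=> hC a b c e; apply: smoothB => //; last exact: smooth_partial.
apply: smoothD => //; last exact: smooth_partial.
by apply: smoothB => //; exact: smooth_partial.
Qed.

Lemma partial3_alternating C x i : form3_on U C -> U x -> alternating3 (partial3 C x i).
Proof.
move=> [sC aC] Ux a b c.
have h (f g : pt R -> R) : smooth U g -> (forall y, U y -> f y = - g y) -> partial i f x = - partial i g x.
  move=> sg fg; rewrite (partial_near oU i Ux fg) /partial.
  have hz := isdZ (-1) (smooth_is_derive (delta_mx 0 i) sg Ux).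
  have -> : (fun y => - g y) = (fun y => -1 * g y) by apply: funext => y; rewrite mulN1r.
  by have [_ ->] := hz; rewrite mulN1r.
by split; apply: h => // y Uy; have [h1 h2] := aC y Uy a b c.
Qed.

Lemma ext_d_alternating C x : form3_on U C -> U x -> alternating4 (ext_d C x).
Proof. by move=> hC Ux; apply: (@dform_alternating R (partial3 C x)) => i; exact: partial3_alternating. Qed.

Definition E0 C x : T4 R := field_form (lam / 2) (Phi x) (C x) (ext_d C x).

Lemma form4_E0 C : form3_on U C -> form4_on U (E0 C).
Proof.
move=> hC; split; first by apply: smooth_field_form => //; [exact: smooth_ext_d hC.1|exact: hC.1].
move=> x Ux; have hu := cayley_alternating (hc Ux); have h1 := ext_d_alternating hC Ux.
have h2 := dot_alternating (correction (Phi x) (C x)) hu.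
have h3 : alternating4 (wedge_Phi (Phi x) (C x)) by exact: alt4_alternating.
move=> a b c e; have [p1 p2 p3] := hu a b c e; have [q1 q2 q3] := h1 a b c e.
have [r1 r2 r3] := h2 a b c e; have [t1 t2 t3] := h3 a b c e.
rewrite /E0 /field_form; split.
- by rewrite p1 q1 r1 t1; ring.
- by rewrite p2 q2 r2 t2; ring.
by rewrite p3 q3 r3 t3; ring.
Qed.

Lemma variation_E0 C : form3_on U C -> variation_Phi lam U Phi C (E0 C).
Proof.
move=> hC; split; first exact: form4_E0.
move=> e K h [[e0 [cK KU]] h0 hK hcay hsm].
pose G (t : R) (x : pt R) := lagr (h t x) (ext_d C x) (C x) - lagr (Phi x) (ext_d C x) (C x).
have oT := @open_tube R e U oU.
have sG : smooth (tube e U) (fun z : tx => G z.1 z.2).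
  have sd a b c f : smooth (tube e U) (fun z : tx => ext_d C z.2 a b c f).
    exact: (smooth_snd e (smooth_ext_d hC.1 a b c f)).
  have sc a b c : smooth (tube e U) (fun z : tx => C z.2 a b c).
    exact: (smooth_snd e (hC.1 a b c)).
  have sp a b c f : smooth (tube e U) (fun z : tx => Phi z.2 a b c f).
    exact: (smooth_snd e (hs a b c f)).
  apply: smoothB => //.
    apply: (smooth_lagr oT (u := fun z : tx => h z.1 z.2)) => //.
    by move=> z [z1 z2]; exact: hcay.
  by apply: (smooth_lagr oT (u := fun z : tx => Phi z.2)) => // z [z1 z2]; exact: hc.
have G0 t x : `|t| < e -> U x -> ~ K x -> G t x = 0 by move=> _ _ nK; rewrite /G hK // subrr.
have hact := action_derive oU cK KU e0 sG G0; apply: (is_derive_eq hact).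
congr (integral_rV _); apply: funext => x; rewrite indicE.
have [Kx|nK] := pselect (K x); last by rewrite memNset // !mul0r.
congr (_ * _); have Ux := KU x Kx.
have st a b c f : smooth [set t : R^o | `|t| < e] (fun t : R^o => h t x a b c f).
  exact: (smooth_slice_t (f := fun z : tx => h z.1 z.2 a b c f) Ux (hsm a b c f)).
have z0 : [set t : R^o | `|t| < e] 0 by rewrite /= normr0.
have := lagr_derive (@open_norm_lt R e) (u := fun t : R^o => h t x) st (fun t ht => hcay t x ht Ux) (1 : R^o)
   (ext_d C x) z0 (hC.2 x Ux).
move=> hl; have := isdD hl (isdC (0 : R^o) (1 : R^o) (- lagr (Phi x) (ext_d C x) (C x))) => -[_ hv].
by rewrite -[LHS]/('D_1 (fun t : R^o => lagr (h t x) (ext_d C x) (C x) + - lagr (Phi x) (ext_d C x) (C x)) 0) hv addr0 h0.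
Qed.

End Chart.
End Lagrangian.

Section Velocities.
Variable R : realType.
Local Notation d x y := ((x == y)%:R : R).

Lemma pull4_derive (V : normedModType R) (f : V -> R) (u : V -> T4 R) x v (l : R) (L : T4 R) (N : 'M[R]_8) :
  f x = 0 -> is_derive x v f l -> (forall a b c e, is_derive x v (fun y => u y a b c e) (L a b c e)) ->
  forall a b c e, is_derive x v (fun y => pull4 (1%:M + f y *: N) (u y) a b c e)
    (l * dot N (u x) a b c e + L a b c e).
Proof.
move=> fx hf hu a b c e.
have hm i j : is_derive x v (fun y => d i j + f y * N i j) (l * N i j).
  by have h := isdD (isdC x v (d i j)) (isdM hf (isdC x v (N i j))); apply: (is_derive_eq h); ring.
have -> : (fun y => pull4 (1%:M + f y *: N) (u y) a b c e) = (fun y => S4 (fun p q r t =>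
    (d p a + f y * N p a) * (d q b + f y * N q b) * (d r c + f y * N r c) * (d t e + f y * N t e) * u y p q r t)).
  by apply: funext => y; exact: pull4_1N.
have h := isd_S4 (fun p q r t => isdM (isdM (isdM (isdM (hm p a) (hm q b)) (hm r c)) (hm t e)) (hu p q r t)).
apply: (is_derive_eq h); transitivity (l * dot N (u x) a b c e + pull4 1%:M L a b c e); last by rewrite pull4_1.
rewrite pull4_slots dot_slots /slots -!S4D -S4Zl -S4D.
apply: eq_S4 => p q r t; rewrite !mxE fx.
move: (d p a) (d q b) (d r c) (d t e) (N p a) (N q b) (N r c) (N t e) (u x p q r t) (L p q r t) => *; ring.
Qed.

Lemma smooth_pull4 (V : normedModType R) (W : set V) (oW : open W) (f : V -> R) (u : V -> T4 R) (N : 'M[R]_8) :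
  smooth W f -> smoothT4 W u -> smoothT4 W (fun y => pull4 (1%:M + f y *: N) (u y)).
Proof.
move=> sf su a b c e; apply: (smooth_eq oW (f := fun y => S4 (fun p q r t =>
    (d p a + f y * N p a) * (d q b + f y * N q b) * (d r c + f y * N r c) * (d t e + f y * N t e) * u y p q r t))).
  by move=> y _; rewrite pull4_1N.
have sm i j : smooth W (fun y => d i j + f y * N i j).
  by apply: smoothD => //; [exact: smooth_cst|apply: smoothM => //; exact: smooth_cst].
do 4 (apply: smooth_sum => // ?); apply: smoothM => //; apply: smoothM => //; apply: smoothM => //.
exact: smoothM.
Qed.

Lemma cayley_pull4 (M : 'M[R]_8) u : M \in unitmx -> cayley u -> cayley (pull4 M u).
Proof. by move=> Mu [A Au ->]; exists (A *m M); rewrite ?unitmx_mul ?Au ?pull4_comp. Qed.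

Lemma smooth_id (W : set R^o) : smooth W (fun t : R^o => t : R).
Proof.
have ct x : {for x, continuous (fun t : R^o => t : R)} by exact: cvg_id.
case=> [|k]; first by split.
split=> // v; split; first by move=> x _; exact: derivable_id.
have -> : (fun x : R^o => 'D_v (fun t : R^o => t : R) x) = (fun=> (v : R)) by apply: funext => x; exact: derive_id.
exact: Ck_cst.
Qed.

(** The curve (1 + t N)^* u, invertible for small t, realises the direction N.u; the converse is
    [velocity] for a one-parameter family. *)
Lemma cayley_velocityP (u v : T4 R) : cayley u -> cayley_velocity u v <-> exists N : 'M[R]_8, v = dot N u.
Proof.
move=> hu; split=> [[e [gam [e0 g0 gc gs gd]]]|[N ->]].
  have z0 : [set t : R^o | `|t| < e] 0 by rewrite /= normr0.
  have [N [hN _]] := velocity (@open_norm_lt R e) (u := gam) gs gc (1 : R^o) z0.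
  by exists N; apply: T4_ext => a b c f; rewrite -gd hN g0.
have [e e0 he] := unitmx_near1 N; exists e, (fun t => pull4 (1%:M + t *: N) u); split=> //.
- by rewrite scale0r addr0 pull4_1.
- by move=> t te; apply: cayley_pull4 => //; exact: he.
- move=> a b c f; apply: (smooth_pull4 (@open_norm_lt R e) (f := fun t : R^o => t) (u := fun=> u)).
    exact: smooth_id.
  by move=> *; exact: smooth_cst.
move=> a b c f.
have h := pull4_derive N (f := fun t : R^o => t) (u := fun=> u) (erefl (0 : R)) (is_derive_id (0 : R^o) (1 : R^o))
  (fun a b c e => isdC (0 : R^o) (1 : R^o) (u a b c e)) a b c f.
by have [_ ->] := h; rewrite mul1r addr0.
Qed.

Lemma Lambda4_27_dot (u E : T4 R) : cayley u -> alternating4 E ->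
  Lambda4_27 u E <-> forall N : 'M[R]_8, wedge44 (dot N u) E = 0.
Proof.
case=> A Au -> hE; have h1 := Lambda4_27P Au hE; have h2 := wedge44_dot_eq0 Au hE.
by split=> h; [apply/h2/h1|apply/h1/h2].
Qed.

Lemma bump_le1 x0 (r : R) x : bump x0 r x <= 1.
Proof.
apply: prodr_ile1 => i _; rewrite flat_ge0 /flat; case: ifP => y0; last by rewrite /= ler01.
by rewrite expr0 mul1r expR_le1 oppr_le0 invr_ge0 ltW.
Qed.

End Velocities.

(** * Integration by parts and extremality *)

Section Divergence.
Variable R : realType.

Lemma integral_divergence (U K : set (pt R)) (f : I8 -> pt R -> R) : open U -> compact K -> K `<=` U ->
  (forall i, smooth U (f i)) -> (forall i x, U x -> ~ K x -> f i x = 0) ->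
  integral_rV (fun x => \1_K x * \sum_i partial i (f i) x) = 0.
Proof.
move=> oU cK KU sf f0; have [B B0 hB] := compact_box cK.
have oK : open (~` K) by apply: closed_openC; apply: compact_closed cK; exact: norm_hausdorff.
have df0 i x : ~ K x -> U x -> partial i (f i) x = 0.
  move=> nK Ux; rewrite /partial (near_eq_derive (g := fun=> 0)); first by have [] := isdC x (delta_mx 0 i) (0 : R).
  by apply: (near_open (openI oU oK) (conj Ux nK)) => y [Uy nKy]; exact: f0.
have sd i : smooth U (partial i (f i)) by exact: smooth_partial.
have uf i : UC B (fun x => \1_K x * f i x).
  by apply: (UC_ext oU cK KU hB) => [x Ux|x Ux nK]; [exact: smooth_continuous (sf i) Ux|exact: f0].
have ud i : UC B (fun x => \1_K x * partial i (f i) x).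
  by apply: (UC_ext oU cK KU hB) => [x Ux|x Ux nK]; [exact: smooth_continuous (sd i) Ux|exact: df0].
have ind g : (forall y, U y -> ~ K y -> g y = 0) -> forall y, U y -> \1_K y * g y = g y :> R.
  move=> g0 y Uy; rewrite indicE; have [Ky|nK] := pselect (K y); first by rewrite mem_set // mul1r.
  by rewrite memNset // mul0r g0.
have key i : integral_rV (fun x => \1_K x * partial i (f i) x) = 0.
  apply: (integral_rV_partial B0 (uf i) (ud i) (i := i)) => x.
  suff : is_derive x (delta_mx 0 i) (fun y => \1_K y * f i y) (\1_K x * partial i (f i) x).
    move=> h; have -> : (fun t : R^o => \1_K (x + t *: delta_mx 0 i) * f i (x + t *: delta_mx 0 i)) =
        (fun t : R^o => \1_K (t *: delta_mx 0 i + x) * f i (t *: delta_mx 0 i + x)).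
      by apply: funext => t; rewrite addrC.
    exact: (is_derive_line (fun y => \1_K y * f i y) x _ _).1 h.
  have [Ux|nU] := pselect (U x).
    rewrite (ind _ (fun y Uy nK => df0 i y nK Uy)) //.
    apply: (near_eq_is_derive _ (smooth_is_derive (delta_mx 0 i) (sf i) Ux)).
    by apply: (near_open oU Ux) => y Uy; rewrite (ind _ (f0 i)).
  have nK : ~ K x by move=> Kx; exact/nU/KU.
  rewrite indicE memNset // mul0r; apply: (near_eq_is_derive _ (isdC x (delta_mx 0 i) (0 : R))).
  by apply: (near_open oK nK) => y nKy; rewrite indicE memNset // mul0r.
have main (r : seq I8) : UC B (fun x => \1_K x * \sum_(i <- r) partial i (f i) x) /\
    integral_rV (fun x => \1_K x * \sum_(i <- r) partial i (f i) x) = 0.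
  elim: r => [|i r [IH1 IH2]].
    have -> : (fun x => \1_K x * \sum_(i <- [::]) partial i (f i) x) = (fun=> 0).
      by apply: funext => x; rewrite big_nil mulr0.
    split; last exact: integral_rV_0.
    by split=> // eps e0; exists 1 => // *; rewrite subrr normr0.
  have E : (fun x => \1_K x * \sum_(j <- i :: r) partial j (f j) x) =
     (fun x => \1_K x * partial i (f i) x + 1 * (\1_K x * \sum_(j <- r) partial j (f j) x)).
    by apply: funext => x; rewrite big_cons mulrDr mul1r.
  rewrite E; split; first exact: UC_linear (ud i) IH1.
  by rewrite (integral_rV_linear _ B0 (ud i) IH1) key IH2 mulr0 addr0.
exact: (main _).2.
Qed.

End Divergence.

Section Extremals.
Variables (R : realType) (lam : R) (U : set (pt R)) (oU : open U) (Phi : pt R -> T4 R).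
Hypothesis hPhi : cayley_on U Phi.
Local Notation d x y := ((x == y)%:R : R).
Notation tx := (R^o * pt R)%type.
Let hs : smoothT4 U Phi := hPhi.1.
Let hc := hPhi.2.

Lemma orient_neq0 x : U x -> orient (Phi x) != 0.
Proof. by move=> Ux; rewrite /orient sgr_eq0; exact/vol_neq0/hc. Qed.

(** Bump-localised variations in the direction of a constant matrix [N] show that [E] is annihilated
    by every N.Phi. Conversely each admissible velocity has this form at each point, so the first
    variation vanishes. *)
Lemma extremal_Phi_Lambda4_27 C E : variation_Phi lam U Phi C E ->
  extremal_Phi lam U Phi C <-> forall x, U x -> Lambda4_27 (Phi x) (E x).
Proof.
move=> hE; split=> [hext x Ux|hL e K h hv].
  apply/(Lambda4_27_dot (hc Ux) (hE.1.2 x Ux)) => N.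
  pose f y := orient (Phi y) * wedge44 (dot N (Phi y)) (E y).
  suff f0 : forall y, U y -> f y = 0.
    by have /eqP := f0 x Ux; rewrite mulf_eq0 (negbTE (orient_neq0 Ux)) => /eqP.
  have sf : smooth U f.
    apply: smoothM => //; first exact: smooth_orient; apply: smooth_wedge44 => //; last exact: hE.1.1.
    by apply: smooth_dot => // *; exact: smooth_cst.
  apply: (fundamental_lemma oU) => [y Uy|x0 r r0 bU]; first exact: smooth_continuous sf Uy.
  have [e e0 he] := unitmx_near1 N.
  (* The bump takes values in [0, 1], so the bound on t that keeps 1 + t N invertible is valid at
     all points. *)
  pose h (t : R) (y : pt R) := pull4 (1%:M + (t * bump x0 r y) *: N) (Phi y).
  have hvar : Phi_variation U Phi e (box x0 r) h.
    split.
    - by split=> //; split=> //; exact: box_compact.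
    - by move=> y; rewrite /h mul0r scale0r addr0 pull4_1.
    - by move=> t y nb; rewrite /h bump_out // mulr0 scale0r addr0 pull4_1.
    - move=> t y te Uy; apply: cayley_pull4; last exact: hc.
      apply: he; rewrite normrM; apply: le_lt_trans te.
      by rewrite (ger0_norm (bump_ge0 _ _ _)) ler_piMr // bump_le1.
    have oT := @open_tube R e U oU.
    move=> a b c k; apply: (smooth_pull4 oT (f := fun z : tx => z.1 * bump x0 r z.2) (u := fun z : tx => Phi z.2)).
      apply: smoothM => //; first exact: smooth_fst.
      exact: (smooth_snd e (smooth_bump x0 r oU)).
    by move=> a' b' c' k'; exact: (smooth_snd e (hs a' b' c' k')).
  have d1 := hE.2 _ _ _ hvar; have d2 := hext _ _ _ hvar.
  rewrite [RHS](isd_unique d2 d1); congr integral_rV; apply: funext => y; rewrite indicE.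
  have [Ky|nK] := pselect (box x0 r y); last by rewrite memNset // !mul0r.
  congr (_ * _).
  have -> : (fun a b c k => 'D_(1 : R^o) (fun t : R^o => h t y a b c k) 0) =
      (fun a b c k => bump x0 r y * dot N (Phi y) a b c k).
    apply: T4_ext => a b c k.
    have ht : is_derive (0 : R^o) (1 : R^o) (fun t : R^o => t * bump x0 r y) (bump x0 r y).
      by have q := isdM (is_derive_id (0 : R^o) (1 : R^o)) (isdC (0 : R^o) (1 : R^o) (bump x0 r y)); apply: (is_derive_eq q); rewrite mulr0 add0r mulr1.
    have q := pull4_derive N (f := fun t : R^o => t * bump x0 r y) (u := fun=> Phi y) (mul0r _) ht
      (fun a b c e => isdC (0 : R^o) (1 : R^o) (Phi y a b c e)) a b c k.
    by have [_ ->] := q; rewrite addr0.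
  by rewrite wedge44Zl /f mulrCA.
have hd := hE.2 _ _ _ hv; apply: (is_derive_eq hd); apply: integral_rV_0 => x; rewrite indicE.
have [[e0 [cK KU]] h0 hK hcay hsm] := hv.
have [Kx|nK] := pselect (K x); last by rewrite memNset // mul0r.
have Ux := KU x Kx.
have st a b c f : smooth [set t : R^o | `|t| < e] (fun t : R^o => h t x a b c f).
  exact: (smooth_slice_t (f := fun z : tx => h z.1 z.2 a b c f) Ux (hsm a b c f)).
have z0 : [set t : R^o | `|t| < e] 0 by rewrite /= normr0.
have [N [hN _]] := velocity (@open_norm_lt R e) (u := fun t : R^o => h t x) st (fun t ht => hcay t x ht Ux) (1 : R^o) z0.
have -> : (fun a b c d => 'D_(1 : R^o) (fun t : R^o => h t x a b c d) 0) = dot N (Phi x).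
  by apply: T4_ext => a b c k; rewrite hN h0.
by rewrite ((Lambda4_27_dot (hc Ux) (hE.1.2 x Ux)).1 (hL x Ux) N) !mulr0.
Qed.

Definition dPhi x : I8 -> T4 R := fun i a b c e => partial i (fun y => Phi y a b c e) x.

Lemma torsion_point_wedge x T : U x -> alternating3 T ->
  (forall i a b c e, nabla_Phi Phi x i a b c e = 4 * alt4 (fun a' b' c' d' =>
     \sum_p up_last (Phi x) T i a' p * Phi x p b' c' d') a b c e) <->
  (forall h, alternating3 h -> - 4 * dwedge (dPhi x) h - 12 * wedge_pair (Phi x) T h = 0).
Proof.
move=> Ux hT; have [K [hK aK]] := nabla_exists oU hPhi Ux; have [A Au ux] := hc Ux.
have aK' : forall i, (metric (pull4 A (Phi0 R)) *m K i)^T = - (metric (pull4 A (Phi0 R)) *m K i) by rewrite -ux.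
have hp := torsion_pointP Au aK' hT; rewrite -ux in hp.
have hE h : dwedge (dPhi x) h = dwedge (fun i => dot (K i) (Phi x)) h.
  by rewrite /dPhi (dwedge_nabla oU hPhi h Ux); congr dwedge; apply: funext => i.
split=> [h0 h hh|h0 i].
  rewrite hE; apply: (hp.1 _ h hh) => i; rewrite -hK; apply/(torsion_eqE hPhi T i Ux); exact: h0.
apply/(torsion_eqE hPhi T i Ux); rewrite hK; apply: hp.2 => h hh; rewrite -hE; exact: h0.
Qed.

Lemma wedge44_0 (u : T4 R) : wedge44 u (fun _ _ _ _ => 0) = 0.
Proof. by rewrite /wedge44 big1 ?mulr0 // => s _; rewrite !mulr0. Qed.

Lemma wedge44_delta (u : T4 R) (Y : T4 R) :
  \sum_i wedge44 u (fun a b c e => d i a * Y i b c e) = wedge44 u Y.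
Proof.
transitivity (\sum_i 1 * wedge44 u (fun a b c e => d i a * Y i b c e)).
  by apply: eq_bigr => i _; rewrite mul1r.
rewrite -wedge44_sumr; congr wedge44; apply: T4_ext => a b c e.
rewrite (bigD1 a) //= eqxx !mul1r big1 ?addr0 // => i /negbTE ->.
by rewrite mul0r mulr0.
Qed.

Lemma dwedgeZ (D : I8 -> T4 R) (k : R) (h : T3 R) : dwedge D (fun a b c => k * h a b c) = k * dwedge D h.
Proof.
rewrite /dwedge [RHS]mulr_sumr; apply: eq_bigr => i _; rewrite -wedge44Zr; congr wedge44.
by apply: T4_ext => a b c e; rewrite mulrCA.
Qed.

Lemma wedge_pairZ (u : T4 R) (k : R) (w h : T3 R) : wedge_pair u w (fun a b c => k * h a b c) = k * wedge_pair u w h.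
Proof.
rewrite /wedge_pair -wedge44Zr; congr wedge44.
by apply: T4_ext => a b c e; rewrite /wedge_with2 -S2Zl; apply: eq_S2 => p q; ring.
Qed.

Lemma smooth_dwedge (V : normedModType R) (W : set V) (oW : open W) (D : V -> I8 -> T4 R) (h : V -> T3 R) :
  (forall i, smoothT4 W (fun y => D y i)) -> smoothT3 W h -> smooth W (fun y => dwedge (D y) (h y)).
Proof.
move=> sD sh; apply: smooth_sum => // i; apply: smooth_wedge44 => // a b c e.
by apply: smoothM => //; exact: smooth_cst.
Qed.

Lemma smooth_dPhi i : smoothT4 U (fun x => dPhi x i).
Proof. by move=> a b c e; exact/smooth_partial/hs. Qed.

Section Parts.
Variables (K : set (pt R)) (cK : compact K) (KU : K `<=` U).

Lemma partial_out i (f : pt R -> R) x : (forall x, U x -> ~ K x -> f x = 0) -> U x -> ~ K x -> partial i f x = 0.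
Proof.
move=> f0 Ux nK; rewrite /partial (near_eq_derive (g := fun=> 0)); first by have [] := isdC x (delta_mx 0 i) (0 : R).
have oK : open (~` K) by apply: closed_openC; apply: compact_closed cK; exact: norm_hausdorff.
by apply: (near_open (openI oU oK) (conj Ux nK)) => y [Uy nKy]; exact: f0.
Qed.

(** The divergence of the field with components 4 Phi /\ (dx^i (x) eta), up to orientation: wedging
    with d eta counts the unantisymmetrised derivative four times. *)
Definition parts_integrand (eta : pt R -> T3 R) x : R :=
  orient (Phi x) * (wedge44 (Phi x) (ext_d eta x) + 4 * dwedge (dPhi x) (eta x)).

Lemma integral_by_parts (eta : pt R -> T3 R) : smooth3 U eta ->
  (forall x, U x -> ~ K x -> forall a b c, eta x a b c = 0) ->
  integral_rV (fun x => \1_K x * parts_integrand eta x) = 0.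
Proof.
move=> sh h0.
pose f i x := 4 * (orient (Phi x) * wedge44 (Phi x) (fun a b c e => d i a * eta x b c e)).
have sf i : smooth U (f i).
  apply: smoothM => //; first exact: smooth_cst.
  apply: smoothM => //; first exact: smooth_orient.
  by apply: smooth_wedge44 => // a b c e; apply: smoothM => //; exact: smooth_cst.
have f0 i x : U x -> ~ K x -> f i x = 0.
  move=> Ux nK; rewrite /f.
  have -> : (fun a b c e => d i a * eta x b c e) = (fun _ _ _ _ => 0) by apply: T4_ext => *; rewrite h0 ?mulr0.
  by rewrite wedge44_0 !mulr0.
rewrite -(integral_divergence oU cK KU sf f0); congr integral_rV; apply: funext => x; rewrite indicE.
have [Kx|nK] := pselect (K x); last by rewrite memNset // !mul0r.
congr (_ * _); have Ux := KU Kx.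
have hf i : partial i (f i) x = 4 * (orient (Phi x) *
    (wedge44 (Phi x) (fun a b c e => d i a * partial i (fun y => eta y b c e) x)
     + wedge44 (dPhi x i) (fun a b c e => d i a * eta x b c e))).
  have h1 a b c e : is_derive x (delta_mx 0 i) (fun y => Phi y a b c e) (dPhi x i a b c e).
    exact: (smooth_is_derive _ (hs a b c e) Ux).
  have h2 a b c e := isdZ (d i a) (smooth_is_derive (delta_mx 0 i) (sh b c e) Ux).
  have [_ hq] := isdZ 4 (isdM (orient_derive oU hs hc (delta_mx 0 i) Ux) (isd_wedge44 h1 h2)); apply: (etrans hq).
  by rewrite mulr0 addr0 (wedge44C (dPhi x i)).
rewrite (eq_bigr _ (fun i _ => hf i)) -!mulr_sumr big_split /= wedge44_delta.
rewrite /parts_integrand -[ext_d eta x]/(dform (partial3 eta x)) wedge44_dform.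
rewrite -[wedge44 (Phi x) (partial3 eta x)]/(wedge44 (Phi x) (fun a b c e => partial a (fun y => eta y b c e) x)).
rewrite -[\sum_i wedge44 (dPhi x i) _]/(dwedge (dPhi x) (eta x)).
by ring.
Qed.

Definition reduced_integrand (w' w : T3 R) x : R := orient (Phi x) *
  (-4 * dwedge (dPhi x) (fun a b c => w' a b c - w a b c)
   - 6 * (wedge_pair (Phi x) w' w' - wedge_pair (Phi x) w w)).

(** The action is affine in dC, and C' - C is supported in [K], so its derivatives can be moved to
    Phi; what remains is algebraic in C and C'. *)
Lemma action_diff_C C C' : smooth3 U C -> smooth3 U C' -> (forall x, U x -> ~ K x -> C' x = C x) ->
  action_diff lam K Phi C' Phi C = integral_rV (fun x => \1_K x * reduced_integrand (C' x) (C x) x).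
Proof.
move=> sC sC' CC; pose eta x : T3 R := fun a b c => C' x a b c - C x a b c.
have sh : smooth3 U eta by move=> a b c; exact: smoothB.
have h0 x : U x -> ~ K x -> forall a b c, eta x a b c = 0 by move=> Ux nK a b c; rewrite /eta CC // subrr.
have [B B0 hB] := compact_box cK.
have dw0 x : U x -> ~ K x -> dwedge (dPhi x) (eta x) = 0.
  move=> Ux nK; have -> : eta x = (fun a b c => 0 * eta x a b c) by apply: T3_ext => a b c; rewrite mul0r h0.
  by rewrite dwedgeZ mul0r.
have uR : UC B (fun x => \1_K x * reduced_integrand (C' x) (C x) x).
  apply: (UC_ext oU cK KU hB) => [x Ux|x Ux nK].
    apply: smooth_continuous Ux; apply: smoothM => //; first exact: smooth_orient.
    apply: smoothB => //; apply: smoothM => //; try exact: smooth_cst.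
      by apply: smooth_dwedge => //; exact: smooth_dPhi.
    by apply: smoothB => //; exact: smooth_wedge_pair.
  by rewrite /reduced_integrand -/(eta x) dw0 // CC // subrr !mulr0 subrr mulr0.
have uD : UC B (fun x => \1_K x * parts_integrand eta x).
  apply: (UC_ext oU cK KU hB) => [x Ux|x Ux nK].
    apply: smooth_continuous Ux; apply: smoothM => //; first exact: smooth_orient.
    apply: smoothD => //; first by apply: smooth_wedge44 => //; exact: smooth_ext_d.
    apply: smoothM => //; [exact: smooth_cst|].
    by apply: smooth_dwedge => //; exact: smooth_dPhi.
  rewrite /parts_integrand dw0 //.
  have -> : ext_d eta x = (fun _ _ _ _ => 0).
    by apply: T4_ext => a b c e; rewrite /ext_d !partial_out ?subr0 ?addr0 // => y Uy nKy; exact: h0.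
  by rewrite wedge44_0 mulr0 addr0 mulr0.
have := integral_rV_linear 1 B0 uR uD; rewrite (integral_by_parts sh h0) mulr0 addr0 => <-.
congr integral_rV; apply: funext => x; rewrite indicE.
have [Kx|nK] := pselect (K x); last by rewrite memNset // !mul0r mulr0 addr0.
have Ux := KU Kx; rewrite mem_set // !mul1r.
rewrite -[lagrangian lam Phi C' x]/(lagr lam (Phi x) (ext_d C' x) (C' x)).
rewrite -[lagrangian lam Phi C x]/(lagr lam (Phi x) (ext_d C x) (C x)) !lagrE.
have pE i a b c : partial i (fun y => eta y a b c) x =
    partial i (fun y => C' y a b c) x + -1 * partial i (fun y => C y a b c) x.
  have [_ h] := isdD (smooth_is_derive (delta_mx 0 i) (sC' a b c) Ux)
     (isdZ (-1) (smooth_is_derive (delta_mx 0 i) (sC a b c) Ux)).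
  have -> : (fun y => eta y a b c) = (fun y => C' y a b c + -1 * C y a b c) by apply: funext => y; rewrite mulN1r.
  exact: h.
have eE : ext_d eta x = (fun a b c e => ext_d C' x a b c e + -1 * ext_d C x a b c e).
  apply: T4_ext => a b c e; rewrite /ext_d !pE.
  move: (partial a _ x) (partial b _ x) (partial c _ x) (partial e _ x) => *; ring.
rewrite /parts_integrand eE wedge44_linr /reduced_integrand -/(eta x).
move: (wedge44 _ _) (wedge44 _ _) (dwedge _ _) (wedge_pair _ _ _) (wedge_pair _ _ _) (vol _) (orient _) => *; ring.
Qed.

Lemma action_C_derive C e h : form3_on U C -> C_variation U C e K h ->
  is_derive (0 : R^o) (1 : R^o) (fun t : R^o => action_diff lam K Phi (h t) Phi C : R^o)
   (integral_rV (fun x => \1_K x * (orient (Phi x) *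
     (-4 * dwedge (dPhi x) (fun a b c => 'D_(1 : R^o) (fun t : R^o => h t x a b c) 0)
      - 12 * wedge_pair (Phi x) (C x) (fun a b c => 'D_(1 : R^o) (fun t : R^o => h t x a b c) 0))))).
Proof.
move=> hC [[e0 _] h0 hK halt hsm].
have oT := @open_tube R e U oU.
have sc a b c : smooth (tube e U) (fun z : tx => C z.2 a b c) by exact: (smooth_snd e (hC.1 a b c)).
have sp a b c f : smooth (tube e U) (fun z : tx => Phi z.2 a b c f) by exact: (smooth_snd e (hs a b c f)).
have sdp i a b c f : smooth (tube e U) (fun z : tx => dPhi z.2 i a b c f) by exact: (smooth_snd e (smooth_dPhi i a b c f)).
have cp (z : tx) : tube e U z -> cayley (Phi z.2) by case=> _; exact: hc.
pose G (t : R) x := reduced_integrand (h t x) (C x) x.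
have sG : smooth (tube e U) (fun z : tx => G z.1 z.2).
  apply: smoothM => //; first exact: (smooth_orient oT (u := fun z : tx => Phi z.2)).
  apply: smoothB => //; apply: smoothM => //; try exact: smooth_cst.
    apply: (smooth_dwedge oT (D := fun z : tx => dPhi z.2) (h := fun z : tx => (fun a b c => h z.1 z.2 a b c - C z.2 a b c))) => //.
    by move=> a b c; apply: smoothB => //; exact: hsm.
  by apply: smoothB => //; apply: (smooth_wedge_pair oT (u := fun z : tx => Phi z.2)).
have G0 t x : `|t| < e -> U x -> ~ K x -> G t x = 0.
  move=> _ _ nK; rewrite /G /reduced_integrand hK // subrr !mulr0 subr0.
  have -> : (fun a b c => C x a b c - C x a b c) = (fun a b c => 0 * C x a b c) by apply: T3_ext => *; rewrite subrr mul0r.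
  by rewrite dwedgeZ mul0r !mulr0.
have hact := action_derive oU cK KU e0 sG G0.
have z0 : [set t : R^o | `|t| < e] 0 by rewrite /= normr0.
have hn : \forall t \near (0 : R^o), integral_rV (fun x => \1_K x * G t x) = action_diff lam K Phi (h t) Phi C.
  apply: (near_open (@open_norm_lt R e) z0) => t te; rewrite action_diff_C //; first exact: hC.1.
    by move=> a b c; exact: (smooth_slice_x (f := fun z : tx => h z.1 z.2 a b c) te (hsm a b c)).
  by move=> x _; exact: hK.
apply: (is_derive_eq (near_eq_is_derive hn hact)); congr integral_rV; apply: funext => x; rewrite indicE.
have [Kx|nK] := pselect (K x); last by rewrite memNset // !mul0r.
congr (_ * _); have Ux := KU Kx.
pose eta : T3 R := fun a b c => 'D_(1 : R^o) (fun t : R^o => h t x a b c) 0.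
have he a b c : is_derive (0 : R^o) (1 : R^o) (fun t : R^o => h t x a b c) (eta a b c).
  apply: (smooth_is_derive _ _ z0); exact: (smooth_slice_t (f := fun z : tx => h z.1 z.2 a b c) Ux (hsm a b c)).
have aeta : alternating3 eta.
  have hneg (f g : R^o -> R) l : (forall t, `|t| < e -> f t = - g t) -> is_derive (0 : R^o) (1 : R^o) g l ->
      is_derive (0 : R^o) (1 : R^o) f (- l).
    move=> fg hg; have hz := isdZ (-1) hg; rewrite mulN1r in hz; apply: (near_eq_is_derive _ hz).
    by apply: (near_open (@open_norm_lt R e) z0) => t te; rewrite fg // mulN1r.
  move=> a b c; split; apply: (isd_unique (he _ _ _)); apply: (hneg _ _ _ _ (he a b c)) => t te;
  by have [] := halt t x te Ux a b c.
have dC := isdC (0 : R^o) (1 : R^o).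
have d1 : is_derive (0 : R^o) (1 : R^o) (fun t : R^o => dwedge (dPhi x) (fun a b c => h t x a b c - C x a b c))
    (dwedge (dPhi x) eta).
  have q := isd_sum (index_enum 'I_8) predT (fun i => isd_wedge44 (fun a b c f => dC (dPhi x i a b c f))
     (fun a b c f => isdZ (d i a) (isdD (he b c f) (dC (- C x b c f))))).
  apply: (is_derive_eq q); apply: eq_bigr => i _; rewrite wedge44_0 addr0; congr wedge44.
  by apply: T4_ext => *; rewrite addr0.
have d2 : is_derive (0 : R^o) (1 : R^o) (fun t : R^o => wedge_pair (Phi x) (h t x) (h t x))
    (2 * wedge_pair (Phi x) (C x) eta).
  have q := isd_wedge44 (fun a b c f => dC (Phi x a b c f)) (fun a b c f =>
     isd_S2 (fun p q => isdM (isdM (he a b p) (he c f q)) (dC (ginv (Phi x) p q)))).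
  apply: (is_derive_eq q); rewrite wedge44_0 addr0 h0.
  transitivity (wedge44 (Phi x) (fun a b c f => wedge_with2 (ginv (Phi x)) (C x) eta a b c f +
      1 * wedge_with2 (ginv (Phi x)) eta (C x) a b c f)).
    congr wedge44; apply: T4_ext => a b c f; rewrite /wedge_with2 mul1r -S2D; apply: eq_S2 => p q'; ring.
  rewrite wedge44_linr -!/(wedge_pair _ _ _) (wedge_pair_sym (hc Ux) aeta (hC.2 x Ux)); ring.
have [_ hq] := isdM (dC (orient (Phi x))) (isdD (isdZ (-4) d1) (isdZ (-6) (isdD d2 (dC (- wedge_pair (Phi x) (C x) (C x)))))).
have -> : (fun t : R^o => G t x) = (fun t : R^o => orient (Phi x) * (-4 * dwedge (dPhi x) (fun a b c => h t x a b c - C x a b c) + -6 * (wedge_pair (Phi x) (h t x) (h t x) + - wedge_pair (Phi x) (C x) (C x)))).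
  by apply: funext => t; rewrite /G /reduced_integrand [-6 * _]mulNr.
apply: (etrans hq).
rewrite -/eta; move: (dwedge _ _) (wedge_pair _ _ eta) => *; ring.
Qed.

End Parts.

(** After integration by parts the first variation is pointwise linear in the variation of C, with
    the coefficients of [torsion_pointP]. Localised variations by a constant 3-form test it at each
    point. *)
Lemma extremal_C_torsion C : form3_on U C -> extremal_C lam U Phi C <-> torsion_on U Phi C.
Proof.
move=> hC; split=> [hext|[_ hT] e K h hv]; last first.
  have [[_ [cK KU]] h0 hK halt hsm] := hv.
  apply: (is_derive_eq (action_C_derive cK KU hC hv)); apply: integral_rV_0 => x; rewrite indicE.
  have [Kx|nK] := pselect (K x); last by rewrite memNset // mul0r.
  have Ux := KU x Kx; rewrite ((torsion_point_wedge Ux (hC.2 x Ux)).1 (hT x Ux)) ?mulr0 //.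
  have e0 : 0 < e by have [[]] := hv.
  have z0 : [set t : R^o | `|t| < e] 0 by rewrite /= normr0.
  have he a b c : is_derive (0 : R^o) (1 : R^o) (fun t : R^o => h t x a b c) ('D_(1 : R^o) (fun t : R^o => h t x a b c) 0).
    apply: (smooth_is_derive _ _ z0); exact: (smooth_slice_t (f := fun z : tx => h z.1 z.2 a b c) Ux (hsm a b c)).
  have hneg (f g : R^o -> R) l : (forall t, `|t| < e -> f t = - g t) -> is_derive (0 : R^o) (1 : R^o) g l ->
      is_derive (0 : R^o) (1 : R^o) f (- l).
    move=> fg hg; have hz := isdZ (-1) hg; rewrite mulN1r in hz; apply: (near_eq_is_derive _ hz).
    by apply: (near_open (@open_norm_lt R e) z0) => t te; rewrite fg // mulN1r.
  move=> a b c; split; apply: (isd_unique (he _ _ _)); apply: (hneg _ _ _ _ (he a b c)) => t te;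
  by have [] := halt t x te Ux a b c.
split=> // x Ux; apply/(torsion_point_wedge Ux (hC.2 x Ux)) => w hw.
pose f y := orient (Phi y) * (-4 * dwedge (dPhi y) w - 12 * wedge_pair (Phi y) (C y) w).
suff f0 : forall y, U y -> f y = 0.
  by have /eqP := f0 x Ux; rewrite mulf_eq0 (negbTE (orient_neq0 Ux)) => /eqP.
have sw : smoothT3 U (fun=> w) by move=> *; exact: smooth_cst.
have sf : smooth U f.
  apply: smoothM => //; first exact: smooth_orient.
  apply: smoothB => //; apply: smoothM => //; try exact: smooth_cst.
    by apply: (smooth_dwedge oU (h := fun=> w)) => //; exact: smooth_dPhi.
  by apply: (smooth_wedge_pair oU hs hc (h := fun=> w)) => //; exact: hC.1.
apply: (fundamental_lemma oU) => [y Uy|x0 r r0 bU]; first exact: smooth_continuous sf Uy.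
pose h (t : R) (y : pt R) : T3 R := fun a b c => C y a b c + t * bump x0 r y * w a b c.
have hvar : C_variation U C 1 (box x0 r) h.
  split.
  - by split=> //; split=> //; exact: box_compact.
  - by move=> y; apply: T3_ext => a b c; rewrite /h !mul0r addr0.
  - by move=> t y nb; apply: T3_ext => a b c; rewrite /h bump_out // mulr0 mul0r addr0.
  - move=> t y _ Uy a b c; rewrite /h; have [p1 p2] := hC.2 y Uy a b c; have [q1 q2] := hw a b c.
    by rewrite p1 p2 q1 q2; split; ring.
  have oT := @open_tube R 1 U oU.
  move=> a b c; apply: smoothD => //; first exact: (smooth_snd 1 (hC.1 a b c)).
  apply: smoothM => //; last exact: smooth_cst.
  by apply: smoothM => //; [exact: smooth_fst|exact: (smooth_snd 1 (smooth_bump x0 r oU))].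
have d1 := action_C_derive (@box_compact R x0 r) bU hC hvar; have d2 := hext _ _ _ hvar.
rewrite [RHS](isd_unique d2 d1); congr integral_rV; apply: funext => y; rewrite indicE.
have [Ky|nK] := pselect (box x0 r y); last by rewrite memNset // !mul0r.
congr (_ * _).
have -> : (fun a b c => 'D_(1 : R^o) (fun t : R^o => h t y a b c) 0) = (fun a b c => bump x0 r y * w a b c).
  apply: T3_ext => a b c.
  have [_ ->] := isdD (isdC (0 : R^o) (1 : R^o) (C y a b c))
    (isdM (isdM (is_derive_id (0 : R^o) (1 : R^o)) (isdC (0 : R^o) (1 : R^o) (bump x0 r y))) (isdC (0 : R^o) (1 : R^o) (w a b c))).
  rewrite mulr0 add0r mulr0 !add0r mulr1; ring.
rewrite dwedgeZ wedge_pairZ /f; ring.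
Qed.

End Extremals.

(** * Existence of the torsion *)

Section TorsionFrame.
Variable R : realType.
Local Notation d x y := ((x == y)%:R : R).
Local Notation phi := (Phi0 R).
Local Notation phi_alt := (Phi0_alternating R).
Local Notation phi_Q := (@Phi0_contract1 R).

Lemma S3_rot (f : I8 -> I8 -> I8 -> R) : S3 (fun p q r => f q r p) = S3 f.
Proof. by rewrite /S3 exchange_big; apply: eq_bigr => q _; exact: exchange_big. Qed.

(** Four times the projection of each 2-form T_i on Lambda^2_7. *)
Definition pi7_part (T : T3 R) : T3 R := fun i a b => T i a b - 2^-1 * mP phi (T i) a b.

Lemma torsion_ofK T : alternating3 T -> torsion_of phi (pi7_part T) = T.
Proof.
move=> hT; have hA i a b : T i b a = - T i a b by have [_ ->] := hT i a b.
have hb i a b : pi7_part T i b a = - pi7_part T i a b.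
  by rewrite /pi7_part hA (mP_anti phi_alt _ b a); ring.
have hb7 i a b : mP phi (pi7_part T i) a b = - 6 * pi7_part T i a b.
  exact: (mP_pi7 phi_alt phi_Q (hA i) a b).
have hv := torsion_of_alternating phi_alt hb; have hE := torsion_ofP phi_alt phi_Q hb hb7.
set v := torsion_of phi _ in hv hE *.
have hD : alternating3 (fun a b c => v a b c - T a b c).
  by move=> x y z; split; rewrite (alternating3_perm hv x y z) (alternating3_perm hT x y z); ring.
apply: T3_ext => a b c; apply/eqP; rewrite -subr_eq0; apply/eqP.
apply: (torsion_inj phi_alt phi_Q hD) => {a b c} i a b.
have -> : mP phi (fun a b => v i a b - T i a b) a b = mP phi (v i) a b - mP phi (T i) a b.
  by rewrite -[X in _ - X]mul1r -mulNr -mPB; apply: eq_S2 => x y; ring.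
by have := hE i a b; rewrite /pi7_part; lra.
Qed.

Section Frame.
Variables (A : 'M[R]_8) (Au : A \in unitmx).
Let B := invmx A.
Let u := pull4 A phi.

Lemma up3_pull3 (w : T3 R) e : S3 (fun p q r => up3 u e p q r * pull3 A w p q r) = \sum_v A v e * mV phi w v.
Proof.
(* A dummy first index carrying row 0 of [B] turns the contraction of a 3-form into one of a
   4-tensor; reading row 0 of the result removes it, as (B A)_00 = 1. *)
have h := @con_up3_frame R A Au (fun a p q r => B 0 a * w p q r).
have hp a p q r : pull4 A (fun a p q r => B 0 a * w p q r) a p q r = (B *m A) 0 a * pull3 A w p q r.
  rewrite pull4_slots pull3_S3 /slots /S4 mxE mulr_suml; apply: eq_bigr => i _.
  rewrite -S3Zl; apply: eq_S3 => x y z; ring.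
have := f_equal (fun M : 'M[R]_8 => M 0 e) h; rewrite [LHS]mxE.
have -> : S3 (fun p q r => up3 (pull4 A phi) e p q r * pull4 A (fun a p q r => B 0 a * w p q r) 0 p q r) =
    S3 (fun p q r => up3 u e p q r * pull3 A w p q r).
  by apply: eq_S3 => p q r; rewrite hp mulVmx // mxE eqxx mul1r.
move=> ->; rewrite mat_conj.
transitivity (S2 (fun i j => A i 0 * B 0 i * (A j e * mV phi w j))).
  apply: eq_S2 => i j; rewrite (_ : mX phi _ i j = B 0 i * mV phi w j); first by ring.
  by rewrite /mV -S3Zl; apply: eq_S3 => *; ring.
rewrite /S2; under eq_bigr => i _ do rewrite -mulr_sumr.
rewrite -mulr_suml (_ : \sum_i _ = 1) ?mul1r //.
transitivity ((invmx A *m A) 0 0); last by rewrite mulVmx // mxE eqxx.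
by rewrite [RHS]mxE; apply: eq_bigr => i _; rewrite mulrC.
Qed.

Lemma pull3_contract (y : I8 -> R) i a b :
  pull3 A (fun i a b => \sum_v phi i a b v * y v) i a b = \sum_w u i a b w * \sum_v B w v * y v.
Proof.
transitivity (S4 (fun p q r s => A p i * A q a * A r b * phi p q r s * y s)).
  rewrite pull3_S3 /S4 /S3; do 3 (apply: eq_bigr => ? _); rewrite mulr_sumr.
  by apply: eq_bigr => s _; rewrite mulrA.
have hy s : \sum_w A s w * \sum_v B w v * y v = y s.
  under eq_bigr => w _ do rewrite mulr_sumr.
  rewrite exchange_big /=; transitivity (\sum_v (A *m B) s v * y v).
    by apply: eq_bigr => v _; rewrite mxE mulr_suml; apply: eq_bigr => w _; rewrite mulrA.
  rewrite mulmxV // (bigD1 s) //= big1 ?addr0; first by rewrite mxE eqxx mul1r.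
  by move=> v /negbTE vs; rewrite mxE eq_sym vs mul0r.
transitivity (\sum_w S4 (fun p q r s => (\sum_v B w v * y v) * (A p i * A q a * A r b * A s w * phi p q r s))).
  rewrite -S4_sum; apply: eq_S4 => p q r s; rewrite -{1}(hy s) mulr_sumr.
  by apply: eq_bigr => w _; ring.
by apply: eq_bigr => w _; rewrite S4Zl mulrC /u pull4_slots.
Qed.

Lemma torsion_of_frame (b : T3 R) i a c : pull3 A (torsion_of phi b) i a c =
  2^-1 * (pull3 A b i a c + pull3 A b a c i + pull3 A b c i a)
  + 36^-1 * \sum_w u i a c w * \sum_e ginv u w e * S3 (fun p q r => up3 u e p q r * pull3 A b p q r).
Proof.
have hw w : \sum_e ginv u w e * S3 (fun p q r => up3 u e p q r * pull3 A b p q r) = \sum_v B w v * mV phi b v.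
  under eq_bigr => e _ do rewrite up3_pull3 mulr_sumr.
  rewrite exchange_big /=; apply: eq_bigr => v _.
  transitivity ((\sum_e ginv u w e * A v e) * mV phi b v).
    by rewrite mulr_suml; apply: eq_bigr => e _; rewrite mulrA.
  congr (_ * _); transitivity ((ginv u *m A^T) w v); first by rewrite [RHS]mxE; apply: eq_bigr => e _; rewrite [A^T e v]mxE.
  by rewrite /u ginv_pull // -mulmxA -trmx_mul mulmxV // trmx1 mulmx1.
rewrite (eq_bigr _ (fun w _ => congr1 (fun z => u i a c w * z) (hw w))) -pull3_contract.
rewrite !pull3_S3 -[X in 2^-1 * (_ + X + _)]S3_rot -[X in 2^-1 * (_ + X)]S3_rot -[X in 2^-1 * (_ + X)]S3_rot.
rewrite -!S3D -!S3Zl -S3D; apply: eq_S3 => p q r; rewrite /torsion_of.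
move: (A p i) (A q a) (A r c) (b p q r) (b q r p) (b r p q) (\sum_v _) => *; ring.
Qed.

(** Contracting nabla_i Phi with Phi recovers 24 times the Lambda^2_7 part of the torsion. This
    supplies the data for [torsion_of] without reference to a frame. *)
Lemma con_up3_torsion (T : T3 R) i a b : alternating3 T ->
  con_up3 u (dot (torsion_mx u (pull3 A T) i) u) a b = 24 * pull3 A (pi7_part T) i a b.
Proof.
move=> hT; rewrite /u dot_torsion_mx //.
have hA j x y : T j x y = - T j y x by have [_ ->] := hT j y x.
pose N p q := \sum_j A j i * T j q p.
have -> : (fun a b c e => \sum_j A j i * pull4 A (dot (fun p a => T j a p) phi) a b c e) = pull4 A (dot N phi).
  apply: T4_ext => x y z t; rewrite -pull4_sum; congr (pull4 A _ x y z t).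
  by apply: T4_ext => x' y' z' t'; rewrite -dot_sum.
have hN x y : N y x = - N x y by rewrite /N -sumrN; apply: eq_bigr => j _; rewrite hA mulrN.
have mN x y : mP phi N x y = - \sum_j A j i * mP phi (T j) x y.
  rewrite /mP /S2 -sumrN; under [RHS]eq_bigr => j _ do rewrite mulr_sumr -sumrN.
  rewrite [RHS]exchange_big; apply: eq_bigr => p _ /=.
  under [RHS]eq_bigr => j _ do rewrite mulr_sumr -sumrN.
  rewrite [RHS]exchange_big; apply: eq_bigr => q _ /=; rewrite /N mulr_sumr.
  by apply: eq_bigr => j _; rewrite hA; ring.
rewrite con_up3_frame // mat_conj pull3_S3 -S3Zl -[RHS]S3_rot -[RHS]S3_rot /S3 /S2.
apply: eq_bigr => p _; apply: eq_bigr => q _; rewrite (mX_dot_anti phi_alt phi_Q hN) mN {1}/N.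
have -> : \sum_j A j i * T j q p - 2^-1 * - (\sum_j A j i * mP phi (T j) p q) = - \sum_j A j i * pi7_part T j p q.
  rewrite mulrN opprK [2^-1 * _]mulr_sumr -big_split -sumrN; apply: eq_bigr => j _ /=.
  rewrite /pi7_part (hA j q p); ring.
rewrite (_ : -24 * - _ = 24 * \sum_j A j i * pi7_part T j p q); last by ring.
rewrite !mulr_sumr; apply: eq_bigr => j _; ring.
Qed.

End Frame.
End TorsionFrame.

Section TorsionExists.
Variables (R : realType) (U : set (pt R)) (oU : open U) (Phi : pt R -> T4 R).
Hypothesis hPhi : cayley_on U Phi.
Let hs : smoothT4 U Phi := hPhi.1.
Let hc := hPhi.2.

Lemma smooth_christoffel k i j : smooth U (fun x => christoffel Phi x k i j).
Proof.
apply: smoothM => //; first exact: smooth_cst.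
apply: smooth_sum => // l; apply: smoothM => //; first exact: smooth_ginv.
by apply: smoothB => //; [apply: smoothD => //|]; apply: smooth_partial; exact: smooth_metric.
Qed.

Lemma smooth_chr_mx i a b : smooth U (fun x => chr_mx Phi x i a b).
Proof. by apply: (smooth_eq oU _ (smooth_christoffel a i b)) => x _; rewrite mxE. Qed.

Lemma smooth_nabla i : smoothT4 U (fun x => nabla_Phi Phi x i).
Proof.
move=> a b c e; apply: (smooth_eq oU (f := fun x => partial i (fun y => Phi y a b c e) x - dot (chr_mx Phi x i) (Phi x) a b c e)).
  by move=> x _; rewrite nabla_Phi_dot.
apply: smoothB => //; first by apply: smooth_partial; exact: hs.
by apply: smooth_dot => // x y; exact: smooth_chr_mx.
Qed.

Lemma smooth_up3 : smoothT4 U (fun x => up3 (Phi x)).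
Proof.
move=> a b c e; do 3 (apply: smooth_sum => // ?); apply: smoothM => //.
by apply: smoothM => //; [apply: smoothM => //|]; exact: smooth_ginv.
Qed.

(** T is [torsion_of] applied to the contraction of nabla Phi with Phi and divided by 24. Written
    with the metric in place of a frame it is smooth, and frames are used only to verify it at each
    point. *)
Lemma torsion_exists : exists T, torsion_on U Phi T.
Proof.
pose D x : T3 R := fun i a b => con_up3 (Phi x) (nabla_Phi Phi x i) a b.
pose T x : T3 R := fun i a b => 24^-1 * (2^-1 * (D x i a b + D x a b i + D x b i a)
  + 36^-1 * \sum_w Phi x i a b w * \sum_e ginv (Phi x) w e * S3 (fun p q r => up3 (Phi x) e p q r * D x p q r)).
have sD : smoothT3 U D.
  move=> i a b; apply: (smooth_eq oU (f := fun x => S3 (fun p q r => up3 (Phi x) b p q r * nabla_Phi Phi x i a p q r))).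
    by move=> x _; rewrite /D mxE.
  by do 3 (apply: smooth_sum => // ?); apply: smoothM => //; [exact: smooth_up3|exact: smooth_nabla].
have key x : U x -> exists2 w, alternating3 w /\ T x = w & forall i, nabla_Phi Phi x i = dot (torsion_mx (Phi x) w i) (Phi x).
  move=> Ux; have [K [hK aK]] := nabla_exists oU hPhi Ux; have [A Au ux] := hc Ux.
  have aK' : forall i, (metric (pull4 A (Phi0 R)) *m K i)^T = - (metric (pull4 A (Phi0 R)) *m K i) by rewrite -ux.
  have [T0 [hT [hdot _]]] := torsion_point_exists Au aK'; rewrite -ux in hdot.
  exists (pull3 A T0); last by move=> i; rewrite hK hdot.
  split; first exact: pull3_alternating.
  have DE i a b : D x i a b = 24 * pull3 A (pi7_part T0) i a b.
    by rewrite /D hK hdot ux con_up3_torsion.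
  apply: T3_ext => i a b; rewrite -[in RHS](torsion_ofK hT) torsion_of_frame // -ux /T !DE.
  have -> : \sum_w Phi x i a b w * \sum_e ginv (Phi x) w e * S3 (fun p q r => up3 (Phi x) e p q r * D x p q r) =
      24 * \sum_w Phi x i a b w * \sum_e ginv (Phi x) w e * S3 (fun p q r => up3 (Phi x) e p q r * pull3 A (pi7_part T0) p q r).
    rewrite [RHS]mulr_sumr; apply: eq_bigr => w _; rewrite [RHS]mulrCA; congr (_ * _).
    rewrite [RHS]mulr_sumr; apply: eq_bigr => e _; rewrite [RHS]mulrCA; congr (_ * _).
    by rewrite -S3Zl; apply: eq_S3 => p q r; rewrite DE mulrCA.
  by move: (\sum_w _) (pull3 _ _ i a b) (pull3 _ _ a b i) (pull3 _ _ b i a) => *; field.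
exists T; split; first split.
- move=> i a b; apply: smoothM => //; first exact: smooth_cst.
  apply: smoothD => //; apply: smoothM => //; try exact: smooth_cst.
    by do 2 (apply: smoothD => //).
  apply: smooth_sum => // w; apply: smoothM => //.
  apply: smooth_sum => // e; apply: smoothM => //; first exact: smooth_ginv.
  by do 3 (apply: smooth_sum => // ?); apply: smoothM => //; exact: smooth_up3.
- by move=> x Ux; have [w [hw ->]] := key x Ux.
move=> x Ux i; have [w [hw hT] hn] := key x Ux.
by apply/(torsion_eqE hPhi (T x) i Ux); rewrite hn hT.
Qed.

End TorsionExists.

(** * Prescribing the second jet *)

Section SecondJet.
Variables (R : realType) (W : set (pt R)) (oW : open W) (x0 : pt R) (Wx : W x0) (g : 'M[R]_8).
Hypothesis gsym : forall a b, g a b = g b a.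
Local Notation d x y := ((x == y)%:R : R).

(** The quadratic function with vanishing 1-jet at [x0] and Hessian [g], the metric at that point in
    the application. *)
Definition quad (y : pt R) : R := 2^-1 * S2 (fun i j => g i j * ((y 0 i - x0 0 i) * (y 0 j - x0 0 j))).
Definition dquad i (y : pt R) : R := \sum_j g i j * (y 0 j - x0 0 j).

Lemma coord_derive (y : pt R) k i : is_derive y (delta_mx 0 i) (fun y : pt R => y 0 k) (d i k).
Proof.
apply/is_derive_line.
have -> : (fun h : R^o => (h *: (delta_mx 0 i : pt R) + y) 0 k) = (fun h : R^o => h * d i k + y 0 k).
  by apply: funext => h; rewrite !mxE eqxx /= (eq_sym k).
have h := isdD (isdM (is_derive_id (0 : R^o) (1 : R^o)) (isdC (0 : R^o) (1 : R^o) (d i k))) (isdC (0 : R^o) (1 : R^o) (y 0 k)).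
by apply: (is_derive_eq h); rewrite mulr0 add0r mulr1 addr0.
Qed.

Lemma shift_derive (y : pt R) k i : is_derive y (delta_mx 0 i) (fun y : pt R => y 0 k - x0 0 k) (d i k).
Proof.
by have h := isdD (coord_derive y k i) (isdC y (delta_mx 0 i) (- x0 0 k)); apply: (is_derive_eq h); rewrite addr0.
Qed.

Lemma quad_derive y i : is_derive y (delta_mx 0 i) quad (dquad i y).
Proof.
have h := isdZ 2^-1 (isd_S2 (fun k l => isdZ (g k l) (isdM (shift_derive y k i) (shift_derive y l i)))).
apply: (is_derive_eq h).
have e1 : S2 (fun k l => g k l * ((y 0 k - x0 0 k) * d i l + (y 0 l - x0 0 l) * d i k)) = dquad i y + dquad i y.
  transitivity (S2 (fun k l => d i l * (g k l * (y 0 k - x0 0 k))) + S2 (fun k l => d i k * (g k l * (y 0 l - x0 0 l)))).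
    by rewrite -S2D; apply: eq_S2 => k l; ring.
  congr (_ + _); rewrite /S2 /dquad.
    by apply: eq_bigr => k _; rewrite S1_d gsym.
  by rewrite exchange_big; apply: eq_bigr => l _ /=; rewrite S1_d.
by rewrite e1; field.
Qed.

Lemma dquad_derive y i j : is_derive y (delta_mx 0 j) (dquad i) (g i j).
Proof.
have h := isd_sum (index_enum 'I_8) predT (fun k => isdZ (g i k) (shift_derive y k j)).
apply: (is_derive_eq h); transitivity (\sum_k d j k * g i k); last by rewrite S1_d.
by apply: eq_bigr => k _; rewrite mulrC.
Qed.

Lemma dquad0 i : dquad i x0 = 0.
Proof. by rewrite /dquad big1 // => j _; rewrite subrr mulr0. Qed.

Lemma quad0 : quad x0 = 0.
Proof. by rewrite /quad /S2 big1 ?mulr0 // => i _; rewrite big1 // => j _; rewrite subrr !mul0r mulr0. Qed.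

Lemma smooth_quad (U : set (pt R)) : open U -> smooth U quad.
Proof.
move=> oU; apply: smoothM => //; first exact: smooth_cst.
apply: smooth_S2 => // i j; apply: smoothM => //; first exact: smooth_cst.
by apply: smoothM => //; apply: smoothB => //; [exact: smooth_coord|exact: smooth_cst|exact: smooth_coord|exact: smooth_cst].
Qed.

Section Perturbation.
Variables (F F0 X : pt R -> R).
Hypotheses (sF0 : smooth W F0) (sX : smooth W X) (FE : forall y, W y -> F y = F0 y + quad y * X y).

Lemma perturb_val : F x0 = F0 x0.
Proof. by rewrite FE // quad0 mul0r addr0. Qed.

Lemma perturb_partial_near y i : W y -> partial i F y = partial i F0 y + (quad y * partial i X y + X y * dquad i y).
Proof.
move=> Wy; rewrite (partial_near oW i Wy FE).
have [_ hq] := isdD (smooth_is_derive (delta_mx 0 i) sF0 Wy) (isdM (quad_derive y i) (smooth_is_derive (delta_mx 0 i) sX Wy)).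
exact: hq.
Qed.

Lemma perturb_partial i : partial i F x0 = partial i F0 x0.
Proof. by rewrite perturb_partial_near // quad0 dquad0 mul0r mulr0 !addr0. Qed.

(** Only the Hessian of [quad] survives at [x0], so second derivatives change by g_ij X(x0) whatever
    the derivatives of [X] are. *)
Lemma perturb_partial2 i j : is_derive x0 (delta_mx 0 j) (fun y => partial i F y - partial i F0 y) (g i j * X x0).
Proof.
have h := isdD (isdM (quad_derive x0 j) (smooth_is_derive (delta_mx 0 j) (smooth_partial i sX) Wx))
   (isdM (smooth_is_derive (delta_mx 0 j) sX Wx) (dquad_derive x0 i j)).
apply: (near_eq_is_derive (f := fun y => quad y * partial i X y + X y * dquad i y)); last first.
  apply: (is_derive_eq h); rewrite quad0 !dquad0 mul0r mulr0 mul0r; ring.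
by apply: (near_open oW Wx) => y Wy; rewrite perturb_partial_near // [RHS]addrC addKr.
Qed.

End Perturbation.

Lemma isd_dot (V : normedModType R) (x v : V) (N : V -> I8 -> I8 -> R) (n : I8 -> I8 -> R) (u : V -> T4 R) (L : T4 R) :
  (forall p a, is_derive x v (fun y => N y p a) (n p a)) ->
  (forall a b c e, is_derive x v (fun y => u y a b c e) (L a b c e)) -> forall a b c e,
  is_derive x v (fun y => dot (N y) (u y) a b c e) (dot n (u x) a b c e + dot (N x) L a b c e).
Proof.
move=> hN hu a b c e.
have h := isdD (isdD (isdD (isd_sum (index_enum 'I_8) predT (fun p => isdM (hN p a) (hu p b c e)))
  (isd_sum (index_enum 'I_8) predT (fun p => isdM (hN p b) (hu a p c e))))
  (isd_sum (index_enum 'I_8) predT (fun p => isdM (hN p c) (hu a b p e))))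
  (isd_sum (index_enum 'I_8) predT (fun p => isdM (hN p e) (hu a b c p))).
apply: (is_derive_eq h); rewrite !big_split /= /dot.
have sw (f k : I8 -> R) : \sum_i f i * k i = \sum_i k i * f i by apply: eq_bigr => i _; rewrite mulrC.
rewrite (sw (fun p => u x p b c e)) (sw (fun p => u x a p c e)) (sw (fun p => u x a b p e)) (sw (fun p => u x a b c p)).
move: (\sum_p N x p a * _) (\sum_p N x p b * _) (\sum_p N x p c * _) (\sum_p N x p e * _) => *; ring.
Qed.

Variables (Phi P : pt R -> T4 R) (T t : pt R -> T3 R).
Hypotheses (hPhi : cayley_on W Phi) (hP : cayley_on W P) (hT : torsion_on W Phi T) (ht : torsion_on W P t).
Variables (X : pt R -> T4 R) (H : pt R -> 'M[R]_8).
Hypotheses (sX : smoothT4 W X) (sH : forall a b, smooth W (fun y => H y a b)).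
Hypothesis PE : forall y, W y -> forall a b c e, P y a b c e = Phi y a b c e + quad y * X y a b c e.
Hypothesis gE : forall y, W y -> forall a b, metric (P y) a b = metric (Phi y) a b + quad y * H y a b.
Let u := Phi x0.
Let sPhi := hPhi.1.
Let sg a b : smooth W (fun y => metric (Phi y) a b) := smooth_metric oW hPhi.1 hPhi.2 a b.

Lemma jet_P0 : P x0 = u.
Proof. by apply: T4_ext => a b c e; exact: (perturb_val (fun y Wy => PE Wy a b c e)). Qed.

Lemma jet_P1 i a b c e : partial i (fun y => P y a b c e) x0 = partial i (fun y => Phi y a b c e) x0.
Proof. exact: (perturb_partial (sPhi a b c e) (sX a b c e) (fun y Wy => PE Wy a b c e)). Qed.

Lemma jet_g1 i a b : partial i (fun y => metric (P y) a b) x0 = partial i (fun y => metric (Phi y) a b) x0.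
Proof. exact: (perturb_partial (sg a b) (sH a b) (fun y Wy => gE Wy a b)). Qed.

Lemma jet_chr i : chr_mx P x0 i = chr_mx Phi x0 i.
Proof.
apply/matrixP => k a; rewrite [LHS]mxE [RHS]mxE /christoffel jet_P0; congr (_ * _).
by apply: eq_bigr => l _; rewrite !jet_g1.
Qed.

Lemma jet_nabla i : nabla_Phi P x0 i = nabla_Phi Phi x0 i.
Proof. by apply: T4_ext => a b c e; rewrite !nabla_Phi_dot jet_P1 jet_chr jet_P0. Qed.

(** The covariant derivative at [x0] depends on the 1-jet alone, and it determines the torsion by
    [torsion_unique]. *)
Lemma jet_torsion : t x0 = T x0.
Proof.
have hu := hPhi.2 x0 Wx; have [A Au ux] := hu.
have h1 i : nabla_Phi Phi x0 i = dot (torsion_mx u (T x0) i) u.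
  by apply/(torsion_eqE hPhi (T x0) i Wx); exact: hT.2.
have h2 i : nabla_Phi P x0 i = dot (torsion_mx u (t x0) i) u.
  by rewrite -jet_P0; apply/(torsion_eqE hP (t x0) i Wx); exact: ht.2.
apply: (torsion_unique Au (ht.1.2 x0 Wx) (hT.1.2 x0 Wx)) => i.
by rewrite -ux -/u -h1 -h2 jet_nabla.
Qed.

Definition jet_dchr j i : 'M[R]_8 := \matrix_(k, a)
  ('D_(delta_mx 0 j) (fun y => chr_mx P y i k a) x0 - 'D_(delta_mx 0 j) (fun y => chr_mx Phi y i k a) x0).
Definition jet_dt j : T3 R := fun i a b =>
  'D_(delta_mx 0 j) (fun y => t y i a b) x0 - 'D_(delta_mx 0 j) (fun y => T y i a b) x0.

Let cD (Q : pt R -> T4 R) (hQ : cayley_on W Q) i k a j :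
  is_derive x0 (delta_mx 0 j) (fun y => chr_mx Q y i k a) ('D_(delta_mx 0 j) (fun y => chr_mx Q y i k a) x0).
Proof. exact: (smooth_is_derive _ (smooth_chr_mx oW hQ i k a) Wx). Qed.

(** Differentiate the formula for the lowered Christoffel symbols of both forms and subtract; the
    first jets of the metrics agree, so only their second derivatives contribute. *)
Lemma jet_metric_dchr j i l a : (metric u *m jet_dchr j i) l a =
  2^-1 * (g i j * H x0 a l + g a j * H x0 i l - g l j * H x0 i a).
Proof.
pose Y (Q : pt R -> T4 R) y := \sum_k metric (Q y) l k * chr_mx Q y i k a.
have YE (Q : pt R -> T4 R) (hQ : cayley_on W Q) y : W y -> Y Q y =
    2^-1 * (partial i (fun y => metric (Q y) a l) y + partial a (fun y => metric (Q y) i l) y - partial l (fun y => metric (Q y) i a) y).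
  by move=> Wy; first [rewrite -(metric_chr hQ i l a Wy) | rewrite -(metric_chr oW hQ i l a Wy)]; rewrite mxE.
have d2 a' b' k := perturb_partial2 (sg a' b') (sH a' b') (fun y Wy => gE Wy a' b') k j.
have h1 := isdZ 2^-1 (isdD (isdD (d2 a l i) (d2 i l a)) (isdZ (-1) (d2 i a l))).
have h1' : is_derive x0 (delta_mx 0 j) (fun y => Y P y - Y Phi y)
   (2^-1 * (g i j * H x0 a l + g a j * H x0 i l - g l j * H x0 i a)).
  rewrite -mulN1r; apply: (near_eq_is_derive _ h1).
  apply: (near_open oW Wx) => y Wy; rewrite (YE P hP y Wy) (YE Phi hPhi y Wy); ring.
have gd (Q : pt R -> T4 R) (hQ : cayley_on W Q) k :=
  smooth_is_derive (delta_mx 0 j) (smooth_metric oW hQ.1 hQ.2 l k) Wx.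
have yd (Q : pt R -> T4 R) (hQ : cayley_on W Q) := isd_sum (index_enum 'I_8) predT (fun k => isdM (gd Q hQ k) (cD hQ i k a j)).
have h2 := isdD (yd P hP) (isdZ (-1) (yd Phi hPhi)).
have h2' := near_eq_is_derive (g := fun y => Y P y - Y Phi y) _ h2.
rewrite -(isd_unique (h2' _) h1'); last first.
  by apply: (near_open oW Wx) => y _; rewrite mulN1r.
rewrite mulN1r -sumrB mxE; apply: eq_bigr => k _; rewrite [jet_dchr j i k a]mxE.
have -> : 'D_(delta_mx 0 j) (fun y => metric (P y) l k) x0 = 'D_(delta_mx 0 j) (fun y => metric (Phi y) l k) x0 by exact: jet_g1.
rewrite jet_chr jet_P0.
have alg (m c z z' y : R) : m * (z - z') = m * z + c * y - (m * z' + c * y) by ring.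
exact: alg.
Qed.

(** With the torsion equation the partial derivatives of a Cayley form are the action of this
    matrix, the Christoffel symbols plus the torsion. *)
Definition conn (Q : pt R -> T4 R) (w : pt R -> T3 R) (y : pt R) i p a : R :=
  chr_mx Q y i p a + torsion_mx (Q y) (w y) i p a.

Lemma conn_partial Q w y i a b c e : cayley_on W Q -> torsion_on W Q w -> W y ->
  partial i (fun y => Q y a b c e) y = dot (conn Q w y i) (Q y) a b c e.
Proof.
move=> hQ hw Wy; have h : nabla_Phi Q y i = dot (torsion_mx (Q y) (w y) i) (Q y).
  by apply/(torsion_eqE hQ (w y) i Wy); exact: hw.2.
have := nabla_Phi_dot Q y i a b c e; rewrite h => /eqP; rewrite eq_sym subr_eq => /eqP ->.
rewrite addrC -[X in _ + X]mul1r -dotB; congr (dot _ _ a b c e).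
by apply: funext => p; apply: funext => q; rewrite mul1r.
Qed.

(** Differentiate the equation of [conn_partial] for both forms and subtract. At [x0] forms,
    connections and their first-order data agree, leaving the changes of the derivatives of the
    Christoffel symbols and of the torsion. *)
Lemma jet_conn j i a b c e : g i j * X x0 a b c e =
  dot (fun p q => jet_dchr j i p q + torsion_mx u (jet_dt j) i p q) u a b c e.
Proof.
have d2 := perturb_partial2 (sPhi a b c e) (sX a b c e) (fun y Wy => PE Wy a b c e) i j.
have ginvd (Q : pt R -> T4 R) (hQ : cayley_on W Q) s p :=
  smooth_is_derive (delta_mx 0 j) (smooth_ginv oW hQ.1 hQ.2 s p) Wx.
have wd (Q : pt R -> T4 R) w (hw : torsion_on W Q w) k l s :=
  smooth_is_derive (delta_mx 0 j) (hw.1.1 k l s) Wx.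
have Qd (Q : pt R -> T4 R) (hQ : cayley_on W Q) a b c e := smooth_is_derive (delta_mx 0 j) (hQ.1 a b c e) Wx.
have tE (Q : pt R -> T4 R) (w : pt R -> T3 R) p q : (fun y => conn Q w y i p q) =
    (fun y => chr_mx Q y i p q + \sum_s w y i q s * ginv (Q y) s p).
  by apply: funext => y; rewrite /conn [torsion_mx _ _ _ _ _]mxE.
have cd (Q : pt R -> T4 R) w (hQ : cayley_on W Q) (hw : torsion_on W Q w) p q :=
  isdD (cD hQ i p q j) (isd_sum (index_enum 'I_8) predT (fun s => isdM (wd Q w hw i q s) (ginvd Q hQ s p))).
have cd' (Q : pt R -> T4 R) w (hQ : cayley_on W Q) (hw : torsion_on W Q w) p q :
    is_derive x0 (delta_mx 0 j) (fun y => conn Q w y i p q) ('D_(delta_mx 0 j) (fun y => chr_mx Q y i p q) x0 +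
     \sum_s (w x0 i q s * 'D_(delta_mx 0 j) (fun y => ginv (Q y) s p) x0 + ginv (Q x0) s p * 'D_(delta_mx 0 j) (fun y => w y i q s) x0)).
  by rewrite tE; exact: cd.
have hh := isdD (isd_dot (cd' P t hP ht) (Qd P hP) a b c e) (isdZ (-1) (isd_dot (cd' Phi T hPhi hT) (Qd Phi hPhi) a b c e)).
have d2' : is_derive x0 (delta_mx 0 j) (fun y => dot (conn P t y i) (P y) a b c e + -1 * dot (conn Phi T y i) (Phi y) a b c e) (g i j * X x0 a b c e).
  apply: (near_eq_is_derive _ d2); apply: (near_open oW Wx) => y Wy.
  by rewrite (conn_partial i a b c e hP ht Wy) (conn_partial i a b c e hPhi hT Wy) mulN1r.
rewrite (isd_unique d2' hh) jet_P0.
have -> : (fun a b c e => 'D_(delta_mx 0 j) (fun y => P y a b c e) x0) = (fun a b c e => 'D_(delta_mx 0 j) (fun y => Phi y a b c e) x0).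
  by apply: T4_ext => *; exact: jet_P1.
have -> : conn P t x0 i = conn Phi T x0 i.
  by apply: funext => p; apply: funext => q; rewrite /conn jet_chr jet_P0 jet_torsion.
have gi s p : 'D_(delta_mx 0 j) (fun y => ginv (P y) s p) x0 = 'D_(delta_mx 0 j) (fun y => ginv (Phi y) s p) x0.
  have hm (a' b' : I8) := smooth_is_derive (delta_mx 0 j) (sg a' b') Wx.
  have hm' (a' b' : I8) : is_derive x0 (delta_mx 0 j) (fun y => metric (P y) a' b') ('D_(delta_mx 0 j) (fun y => metric (Phi y) a' b') x0).
    rewrite -[X in is_derive _ _ _ X]jet_g1; exact: (smooth_is_derive _ (smooth_metric oW hP.1 hP.2 a' b') Wx).
  have [_ ->] := ginv_derive oW hP.1 hP.2 Wx hm' s p; have [_ ->] := ginv_derive oW hPhi.1 hPhi.2 Wx hm s p.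
  by rewrite jet_P0.
have -> (z z' y : R) : z + y + -1 * (z' + y) = z + -1 * z' by ring.
rewrite -dotB; congr (dot _ _ a b c e); apply: funext => p; apply: funext => q.
rewrite [jet_dchr j i p q]mxE [torsion_mx _ _ _ _ _]mxE /up_last jet_torsion.
have -> : \sum_k jet_dt j i q k * ginv u k p = \sum_k ginv u k p * 'D_(delta_mx 0 j) (fun y => t y i q k) x0
    - \sum_k ginv u k p * 'D_(delta_mx 0 j) (fun y => T y i q k) x0.
  by rewrite -sumrB; apply: eq_bigr => k _; rewrite /jet_dt; ring.
under eq_bigr => k _ do rewrite gi.
rewrite !big_split /= -/u.
have alg (z y k a1 b1 : R) : z + (k + a1) + -1 * (y + (k + b1)) = z - y + (a1 - b1) by ring.
exact: alg.
Qed.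

Lemma jet_ext_d : ext_d t x0 = (fun a b c e => ext_d T x0 a b c e + 1 * dform jet_dt a b c e).
Proof.
apply: T4_ext => a b c e; rewrite /ext_d /dform /jet_dt /partial.
move: ('D_ _ _ x0) ('D_ _ _ x0) ('D_ _ _ x0) ('D_ _ _ x0) ('D_ _ _ x0) ('D_ _ _ x0) ('D_ _ _ x0) ('D_ _ _ x0) => *; ring.
Qed.

Lemma jet_dt_alternating j : alternating3 (jet_dt j).
Proof.
move=> a b c; have [p1 p2] := partial3_alternating oW j ht.1 Wx a b c.
have [q1 q2] := partial3_alternating oW j hT.1 Wx a b c.
rewrite /partial3 /partial in p1 p2 q1 q2.
by rewrite /jet_dt p1 p2 q1 q2; split; ring.
Qed.

End SecondJet.

(** * Reduction of the second-jet equations to the model *)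

Section JetAlgebra.
Variable R : realType.
Local Notation d x y := ((x == y)%:R : R).
Local Notation phi := (Phi0 R).
Local Notation phi_alt := (Phi0_alternating R).

Lemma mP_sum (I : finType) (k : I -> R) (f : I -> I8 -> I8 -> R) a b :
  mP phi (fun p q => \sum_i k i * f i p q) a b = \sum_i k i * mP phi (f i) a b.
Proof.
rewrite /mP /S2; under [RHS]eq_bigr => i _ do rewrite mulr_sumr.
rewrite [RHS]exchange_big; apply: eq_bigr => p _ /=.
under [RHS]eq_bigr => i _ do rewrite mulr_sumr.
rewrite [RHS]exchange_big; apply: eq_bigr => q _ /=; rewrite mulr_sumr.
by apply: eq_bigr => i _; rewrite mulrCA.
Qed.

Lemma pull3_sum (I : finType) (A : 'M[R]_8) (k : I -> R) (F : I -> T3 R) a b c :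
  pull3 A (fun a b c => \sum_i k i * F i a b c) a b c = \sum_i k i * pull3 A (F i) a b c.
Proof.
rewrite pull3_S3; under [RHS]eq_bigr => i _ do rewrite pull3_S3 -S3Zl.
rewrite /S3; do 3 (rewrite [RHS]exchange_big /=; apply: eq_bigr => ? _).
by rewrite mulr_sumr; apply: eq_bigr => i _; rewrite mulrCA.
Qed.

Lemma S2_prod (f k : I8 -> R) : S2 (fun p q => f p * k q) = (\sum_p f p) * (\sum_q k q).
Proof. by rewrite /S2 mulr_suml; apply: eq_bigr => p _; rewrite mulr_sumr. Qed.

Section Frame.
Variables (A : 'M[R]_8) (Au : A \in unitmx) (al s : I8 -> I8 -> R).
Let B := invmx A.
Let u := pull4 A phi.
Let g : 'M[R]_8 := metric u.
(** The half makes [s] the resulting variation of the metric, whereas [al] rotates the form and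
    leaves the metric unchanged. *)
Let m := B *m mat (fun a b => 2^-1 * s a b + al a b) *m A.
Let h := A^T *m mat s *m A.
Hypotheses (al_anti : forall a b, al b a = - al a b) (al7 : forall a b, mP phi al a b = - 6 * al a b).
Hypothesis s_sym : forall a b, s b a = s a b.

Let gE : g = A^T *m A. Proof. exact: metric_pull. Qed.

Lemma metric_jet_mx : g *m m = A^T *m mat (fun a b => 2^-1 * s a b + al a b) *m A.
Proof. by rewrite gE /m !mulmxA -(mulmxA A^T A) mulmxV // mulmx1. Qed.

Lemma jet_metric_variation : m^T *m g + g *m m = h.
Proof.
have gT : g^T = g by rewrite gE trmx_mul trmxK.
have -> : m^T *m g = (g *m m)^T by rewrite [RHS]trmx_mul gT.
rewrite metric_jet_mx !trmx_mul trmxK mulmxA -mulmxDl -mulmxDr; congr (_ *m _ *m _).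
by apply/matrixP => a b; rewrite [LHS]mxE [X in X + _]mxE ![mat _ _ _]mxE al_anti s_sym; field.
Qed.

Variables (G : I8 -> I8 -> 'M[R]_8) (dt : I8 -> T3 R).
Hypothesis dt_alt : forall j, alternating3 (dt j).
Hypothesis HG : forall j i l a, (g *m G j i) l a = 2^-1 * (g i j * h a l + g a j * h i l - g l j * h i a).
Hypothesis HD : forall j i a b c e, g i j * dot m u a b c e =
  dot (fun p q => G j i p q + torsion_mx u (dt j) i p q) u a b c e.

Let v i l := (A^T *m mat s) i l.
(** The lowered matrix g_ij m - G_ji in mixed components. The symmetric part of the deformation
    cancels against the Christoffel symbols, so the torsion algebra for antisymmetric matrices
    applies. *)
Let kappa i j : 'M[R]_8 := mat (fun l a => g i j * al l a - 2^-1 * (v i l * A a j - A l j * v i a)).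
Let N j i : 'M[R]_8 := g i j *: m - G j i.

Let gN j i : g *m N j i = A^T *m kappa i j *m A.
Proof.
apply/matrixP => l a; rewrite mat_conj /N mulmxBr -scalemxAr metric_jet_mx [LHS]mxE [X in X + _]mxE [X in _ + X]mxE HG mat_conj.
have hv i' l' : h i' l' = \sum_p v i' p * A p l' by rewrite mxE.
have hg x y : g x y = \sum_q A q x * A q y.
  by rewrite gE mxE; apply: eq_bigr => q _; rewrite [A^T x q]mxE.
have e1 : h a l = S2 (fun p q => A p l * A q a * s p q).
  by rewrite /h mat_conj S2_swap; apply: eq_S2 => p q; rewrite s_sym; ring.
have e2 : g a j * h i l = S2 (fun p q => A p l * A q a * (v i p * A q j)).
  by rewrite hg hv mulrC -S2_prod; apply: eq_S2 => p q; ring.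
have e3 : g l j * h i a = S2 (fun p q => A p l * A q a * (A p j * v i q)).
  by rewrite hg hv -S2_prod; apply: eq_S2 => p q; ring.
rewrite e1 e2 e3.
transitivity (g i j * S2 (fun p q => A p l * A q a * al p q) + - 2^-1 * (S2 (fun p q => A p l * A q a * (v i p * A q j))
   + -1 * S2 (fun p q => A p l * A q a * (A p j * v i q)))).
  have -> : S2 (fun p q => A p l * A q a * (2^-1 * s p q + al p q)) =
      2^-1 * S2 (fun p q => A p l * A q a * s p q) + S2 (fun p q => A p l * A q a * al p q).
    by rewrite -S2Zl -S2D; apply: eq_S2 => p q; ring.
  by move: (S2 _) (S2 _) (S2 _) (S2 _) (g i j) => *; field.
rewrite -!S2Zl -!S2D -!S2Zl -!S2D; apply: eq_S2 => p q.
move: (v i p) (v i q) (A p l) (A q a) (A q j) (A p j) (al p q) (g i j) => *; ring.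
Qed.

Let NE j i : N j i = B *m kappa i j *m A.
Proof.
have gu : g \in unitmx by rewrite gE unitmx_mul unitmx_tr Au.
rewrite -[LHS](mulKmx gu) -[RHS](mulKmx gu) gN; congr (_ *m _).
by rewrite gE !mulmxA -(mulmxA A^T A) mulmxV // mulmx1.
Qed.

Let kappa_anti i j : (kappa i j)^T = - kappa i j.
Proof.
apply/matrixP => a b; rewrite mxE [LHS]mxE [RHS]mxE [in RHS]mxE (al_anti a b).
move: (v i a) (v i b) (A a j) (A b j) (al a b) (g i j) => *; ring.
Qed.

Let Nanti j i : (metric (pull4 A phi) *m N j i)^T = - (metric (pull4 A phi) *m N j i).
Proof. by rewrite -/u -/g gN conj_tr kappa_anti mulmxN mulNmx. Qed.

Let n j k : 'M[R]_8 := \sum_i B i k *: (A *m N j i *m B).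

Let nE j k b a : n j k b a = A k j * al b a - 2^-1 * (s k b * A a j - A b j * s k a).
Proof.
have e_g : \sum_i B i k * g i j = A k j.
  transitivity ((B^T *m g) k j); first by rewrite [RHS]mxE; apply: eq_bigr => i _; rewrite [B^T k i]mxE.
  by rewrite gE mulmxA -trmx_mul mulmxV // trmx1 mul1mx.
have e_v x : \sum_i B i k * v i x = s k x.
  transitivity ((B^T *m (A^T *m mat s)) k x); first by rewrite [RHS]mxE; apply: eq_bigr => i _; rewrite [B^T k i]mxE.
  by rewrite mulmxA -trmx_mul mulmxV // trmx1 mul1mx mxE.
transitivity (\sum_i ((B i k * g i j) * al b a + (- 2^-1 * A a j) * (B i k * v i b) + (2^-1 * A b j) * (B i k * v i a))).
  rewrite /n summxE; apply: eq_bigr => i _; rewrite [LHS]mxE NE.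
  have -> : A *m (B *m kappa i j *m A) *m B = kappa i j.
    by rewrite !mulmxA mulmxV // mul1mx -mulmxA mulmxV // mulmx1.
  rewrite [kappa i j b a]mxE.
  move: (v i a) (v i b) (A a j) (A b j) (al b a) (g i j) (B i k) => *; ring.
rewrite !big_split /= -mulr_suml -!mulr_sumr e_g !e_v; ring.
Qed.

Let dotN j i : dot (N j i) (pull4 A phi) = dot (torsion_mx (pull4 A phi) (dt j) i) (pull4 A phi).
Proof.
apply: T4_ext => a b c e; have h1 := HD j i a b c e.
have e1 : dot (N j i) u a b c e = g i j * dot m u a b c e - dot (G j i) u a b c e.
  have -> : dot (N j i) u a b c e = dot (fun p q => g i j * m p q + -1 * G j i p q) u a b c e.
    congr (dot _ u a b c e); apply: funext => p; apply: funext => q.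
    by rewrite /N [LHS]mxE [X in X + _]mxE [X in _ + X]mxE mulN1r.
  rewrite dotB mulN1r; congr (_ - _).
  rewrite /dot !mulrDr; congr (_ + _ + _ + _); rewrite mulr_sumr; by apply: eq_bigr => p _; rewrite mulrA.
rewrite -/u e1 h1.
have -> : dot (fun p q => G j i p q + torsion_mx u (dt j) i p q) u a b c e =
    dot (G j i) u a b c e + 1 * dot (torsion_mx u (dt j) i) u a b c e.
  by rewrite -dotB; congr (dot _ u a b c e); apply: funext => p; apply: funext => q; rewrite mul1r.
by rewrite mul1r addrC addKr.
Qed.

(** The derivatives of the torsion with all indices, that of the derivative included, referred to
    the frame. *)
Let tau J : T3 R := fun k a b => \sum_j B j J * pull3 B (dt j) k a b.

Let tau_alt J : alternating3 (tau J).
Proof.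
move=> a b c; split; rewrite /tau -sumrN; apply: eq_bigr => j _; rewrite -mulrN; congr (_ * _);
by have [] := pull3_alternating B (dt_alt j) a b c.
Qed.

Let tau_pi7 J k a b : tau J k a b - 2^-1 * mP phi (tau J k) a b =
  jet_mx al s J k a b - 2^-1 * mP phi (jet_mx al s J k) a b.
Proof.
have hk j : pull3 B (dt j) k a b - 2^-1 * mP phi (pull3 B (dt j) k) a b = n j k b a - 2^-1 * mP phi (n j k) b a.
  have h1 := (frame_dot_eq Au (N j) (dt_alt j)).1 (dotN j) k.
  exact: (anti_pi7_eq Au (Nanti j) k (pull3_alternating B (dt_alt j))).1 h1 a b.
have hJ x y : \sum_j B j J * n j k y x = jet_mx al s J k x y.
  transitivity (\sum_j ((A k j * B j J) * al y x + (- 2^-1 * s k y) * (A x j * B j J) + (2^-1 * s k x) * (A y j * B j J))).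
    by apply: eq_bigr => j _; rewrite nE; ring.
  have e z : \sum_j A z j * B j J = d J z.
    by transitivity ((A *m B) z J); [rewrite [RHS]mxE|rewrite mulmxV // mxE eq_sym].
  rewrite !big_split /= -mulr_suml -!mulr_sumr !e /jet_mx; ring.
rewrite mP_sum mulr_sumr -sumrB.
transitivity (\sum_j B j J * (n j k b a - 2^-1 * mP phi (n j k) b a)).
  by apply: eq_bigr => j _; rewrite -hk; ring.
transitivity (\sum_j B j J * n j k b a - 2^-1 * \sum_j B j J * mP phi (n j k) b a).
  by rewrite mulr_sumr -sumrB; apply: eq_bigr => j _; ring.
rewrite hJ -mP_sum; congr (_ - _ * _).
have -> : (fun p q => \sum_i B i J * n i k p q) = (fun p q => jet_mx al s J k q p).
  by apply: funext => p; apply: funext => q; exact: hJ.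
by rewrite mP_tr (mP_anti phi_alt) opprK.
Qed.

Let dform_tau : pull4 A (dform tau) = dform dt.
Proof.
have e a b c e : pull4 A (tau : T4 R) a b c e = dt a b c e.
  transitivity (\sum_p A p a * pull3 A (tau p) b c e).
    rewrite pull4_slots /slots /S4; apply: eq_bigr => p _; rewrite pull3_S3 -S3Zl; apply: eq_S3 => q r t; ring.
  transitivity (\sum_p A p a * \sum_j B j p * dt j b c e).
    apply: eq_bigr => p _; congr (_ * _); rewrite pull3_sum; apply: eq_bigr => j _; congr (_ * _).
    by rewrite pull3_comp mulVmx // pull3_1.
  under eq_bigr => p _ do rewrite mulr_sumr.
  rewrite exchange_big /=; transitivity (\sum_j d j a * dt j b c e); last by rewrite S1_d'.
  apply: eq_bigr => j _; transitivity ((B *m A) j a * dt j b c e); last by rewrite mulVmx // [1%:M j a]mxE.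
  by rewrite mxE mulr_suml; apply: eq_bigr => p _; ring.
pose w : T4 R := tau.
have dE : dform tau = (fun a b c e => w a b c e + -1 * sw12 w a b c e + sw23 (sw12 w) a b c e + -1 * sw34 (sw23 (sw12 w)) a b c e).
  by apply: T4_ext => a b c e'; rewrite /dform /sw12 /sw23 /sw34 /w; ring.
apply: T4_ext => a b c f; rewrite dE.
transitivity (pull4 A w a b c f + -1 * pull4 A (sw12 w) a b c f + pull4 A (sw23 (sw12 w)) a b c f
   + -1 * pull4 A (sw34 (sw23 (sw12 w))) a b c f).
  by rewrite !pull4_slots /slots -!S4Zl -!S4D; apply: eq_S4 => *; ring.
have p1 : pull4 A (sw12 w) a b c f = dt b a c f by rewrite (pull4_sw A w).1.1; exact: e.
have p2 : pull4 A (sw23 (sw12 w)) a b c f = dt c a b f.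
  by rewrite (pull4_sw A (sw12 w)).1.2 (pull4_sw A w).1.1; exact: e.
have p3 : pull4 A (sw34 (sw23 (sw12 w))) a b c f = dt f a b c.
  by rewrite (pull4_sw A (sw23 (sw12 w))).2 (pull4_sw A (sw12 w)).1.2 (pull4_sw A w).1.1; exact: e.
rewrite p1 p2 p3 (e a b c f) /dform; move: (dt a b c f) (dt b a c f) (dt c a b f) (dt f a b c) => *; ring.
Qed.

(** In frame components the second-jet equations are exactly the hypotheses of [jet_model]. *)
Lemma jet_con_up3 : con_up3 u (dform dt) =
  A^T *m mat (fun a b => 64 * al a b + 20 * s a b + (\sum_p s p p) * d a b) *m A.
Proof.
rewrite -dform_tau con_up3_frame //; congr (_ *m _ *m _); apply/matrixP => a b.
by rewrite [LHS]mxE [RHS]mxE (jet_model al_anti al7 s_sym tau_alt tau_pi7).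
Qed.

End Frame.
End JetAlgebra.

(** * The field equations in a chart and their independence *)

Section FieldEquations.
Variables (R : realType) (U : set (pt R)) (oU : open U) (Phi : pt R -> T4 R).
Hypothesis hPhi : cayley_on U Phi.

Lemma field_eqE_cayley (L : R) (u : T4 R) (w : T3 R) dw : cayley u -> alternating3 w ->
  field_eq L u w dw = 4^-1 *: con_up3 u (field_form L u w (dform dw)).
Proof.
case=> A Au -> hw; rewrite {1 2}(unit_frame3 w Au); apply: field_eqE => //.
exact: pull3_alternating.
Qed.

Lemma field_eq_nablaE L T x : U x -> alternating3 (T x) ->
  field_eq_nabla L Phi T x = 4^-1 *: con_up3 (Phi x) (field_form L (Phi x) (T x) (ext_d T x)).
Proof.
by move=> Ux hT; rewrite /field_eq_nabla (field_eqE_cayley _ _ (hPhi.2 x Ux) hT) (dform_nabla oU hPhi Ux hT).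
Qed.

Lemma field_eq_partialE L T x : U x -> alternating3 (T x) ->
  field_eq_partial L Phi T x = 4^-1 *: con_up3 (Phi x) (field_form L (Phi x) (T x) (ext_d T x)).
Proof. by move=> Ux hT; rewrite /field_eq_partial (field_eqE_cayley _ _ (hPhi.2 x Ux) hT). Qed.

End FieldEquations.

Section JetRealize.
Variables (R : realType) (U : set (pt R)) (oU : open U) (Phi : pt R -> T4 R).
Hypothesis hPhi : cayley_on U Phi.
Local Notation d x y := ((x == y)%:R : R).

Lemma cayley_on_sub W (P : pt R -> T4 R) : W `<=` U -> cayley_on U P -> cayley_on W P.
Proof. by move=> WU [h1 h2]; split=> [a b c e|x Wx]; [exact: smooth_sub (h1 a b c e)|exact/h2/WU]. Qed.

Lemma torsion_on_sub W (P : pt R -> T4 R) T : W `<=` U -> torsion_on U P T -> torsion_on W P T.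
Proof.
move=> WU [[h1 h2] h3]; split; first split.
- by move=> a b c; exact: smooth_sub (h1 a b c).
- by move=> x Wx; exact/h2/WU.
by move=> x Wx; exact/h3/WU.
Qed.

Lemma metric_pull4 (M : 'M[R]_8) u : M \in unitmx -> cayley u -> metric (pull4 M u) = M^T *m metric u *m M.
Proof.
move=> Mu [A Au ->]; rewrite pull4_comp !metric_pull ?unitmx_mul ?Au //.
by rewrite trmx_mul !mulmxA.
Qed.

Lemma congruence_1Z (k : R) (m G : 'M[R]_8) : (1%:M + k *: m)^T *m G *m (1%:M + k *: m) =
  G + k *: (m^T *m G + G *m m + k *: (m^T *m G *m m)).
Proof.
have -> : (1%:M + k *: m)^T = 1%:M + k *: m^T by apply/matrixP => i j; rewrite !mxE eq_sym.
rewrite mulmxDl mul1mx mulmxDr mulmx1 mulmxDl -!scalemxAl -!scalemxAr !scalerDr.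
by rewrite !addrA.
Qed.

(** The algebraic terms at [x] depend on Phi and T there and do not change, so the difference of the
    equations is a quarter of the contraction of the change of dT. Solving [jet_model] for [s] and
    [al] gives the prescribed value. *)
Lemma jet_realize L T x (Ns Na : 'M[R]_8) : torsion_on U Phi T -> U x -> Ns^T = Ns -> Lambda2_7 (Phi x) Na ->
  exists W P t, [/\ cayley_germ U x W P t, same_1jet x P Phi &
    field_eq_nabla L P t x = field_eq_nabla L Phi T x + (Ns + Na)].
Proof.
move=> hT Ux hNs hNa; have [A Au ux] := hPhi.2 x Ux; pose B := invmx A.
pose ns := B^T *m Ns *m B; pose na := B^T *m Na *m B.
have nsE : A^T *m ns *m A = Ns by exact: conjK.
have naE : A^T *m na *m A = Na by exact: conjK.
have [na_anti na7] : (forall a b, na b a = - na a b) /\ (forall a b, mP (Phi0 R) na a b = - 6 * na a b).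
  by apply/(Lambda2_7_frame Au); rewrite -ux naE.
have nsT : ns^T = ns by rewrite /ns trmx_mul [(B^T *m Ns)^T]trmx_mul trmxK hNs mulmxA.
have ns_sym a b : ns b a = ns a b by rewrite -[in RHS]nsT [RHS]mxE.
(* These invert [jet_model] after division by 4: 64/4 = 16 on Lambda^2_7 and 20/4 = 5 on symmetric
   matrices. The trace of [s] is then 4 c0, and its quarter restores the c0 subtracted in [s]. *)
pose c0 := 28^-1 * \sum_p ns p p.
pose al a b := 16^-1 * na a b; pose s a b := 5^-1 * (ns a b - c0 * d a b).
have al_anti a b : al b a = - al a b by rewrite /al na_anti mulrN.
have al7 a b : mP (Phi0 R) al a b = - 6 * al a b.
  transitivity (16^-1 * mP (Phi0 R) na a b); last by rewrite na7 /al mulrCA.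
  by rewrite /mP -S2Zl; apply: eq_S2 => p q; rewrite /al mulrCA.
have s_sym a b : s b a = s a b by rewrite /s ns_sym eq_sym.
pose m := B *m mat (fun a b => 2^-1 * s a b + al a b) *m A.
pose g := metric (Phi x); pose q := quad x g.
have gsym a b : g a b = g b a by exact/metric_sym/hPhi.2.
have [e e0 he] := unitmx_near1 m.
(* On this neighbourhood 1 + q m is invertible, so the deformed tensor is still a Cayley form. *)
pose W : set (pt R) := [set y | U y /\ `|q y| < e].
have sqT : smooth setT q by apply: smooth_quad; exact: openT.
have oW : open W.
  apply: openI => //; apply: (@open_comp _ _ q [set r | `|r| < e]); last exact: (@open_norm_lt R e).
  by move=> y _; exact: (smooth_continuous sqT).
have WU : W `<=` U by move=> y [].
have q0 : q x = 0 by exact: quad0.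
have Wx : W x by split=> //; rewrite q0 normr0.
have hPhiW := cayley_on_sub WU hPhi; have hTW := torsion_on_sub WU hT.
have sq : smooth W q by apply: smooth_sub sqT.
pose P y := pull4 (1%:M + q y *: m) (Phi y).
have hP : cayley_on W P.
  split; first exact: smooth_pull4 hPhiW.1.
  by move=> y [Uy qy]; apply: cayley_pull4; [exact: he|exact: hPhi.2].
have [t ht] := torsion_exists oW hP.
pose M y := 1%:M + q y *: m.
pose X y : T4 R := fun a b c k => slots m 1%:M 1%:M 1%:M (Phi y) a b c k + slots (M y) m 1%:M 1%:M (Phi y) a b c k
   + slots (M y) (M y) m 1%:M (Phi y) a b c k + slots (M y) (M y) (M y) m (Phi y) a b c k.
pose H y := m^T *m metric (Phi y) + metric (Phi y) *m m + q y *: (m^T *m metric (Phi y) *m m).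
have sc (C : 'M[R]_8) i j : smooth W (fun y => C i j) by exact: smooth_cst.
have sM i j : smooth W (fun y => M y i j).
  apply: (smooth_eq oW (f := fun y => (1%:M : 'M[R]_8) i j + q y * m i j)); first by move=> y _; rewrite [RHS]mxE; congr (_ + _); rewrite [RHS]mxE.
  by apply: smoothD => //; exact: smoothM.
have sS (A1 A2 A3 A4 : pt R -> 'M[R]_8) : (forall i j, smooth W (fun y => A1 y i j)) -> (forall i j, smooth W (fun y => A2 y i j)) ->
   (forall i j, smooth W (fun y => A3 y i j)) -> (forall i j, smooth W (fun y => A4 y i j)) ->
   smoothT4 W (fun y => slots (A1 y) (A2 y) (A3 y) (A4 y) (Phi y)).
  move=> h1 h2 h3 h4 a b c k; do 4 (apply: smooth_sum => // ?); apply: smoothM => //; last exact: hPhiW.1.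
  by do 3 (apply: smoothM => //).
have sX : smoothT4 W X.
  move=> a b c k; apply: smoothD => //; last exact: (sS M M M (fun=> m)).
  apply: smoothD => //; last exact: (sS M M (fun=> m) (fun=> 1%:M)).
  apply: smoothD => //; last exact: (sS M (fun=> m) (fun=> 1%:M) (fun=> 1%:M)).
  exact: (sS (fun=> m) (fun=> 1%:M) (fun=> 1%:M) (fun=> 1%:M)).
have sg i j : smooth W (fun y => metric (Phi y) i j) by exact: (smooth_metric oW hPhiW.1 hPhiW.2 i j).
have sH a b : smooth W (fun y => H y a b).
  apply: (smooth_eq oW (f := fun y => (m^T *m metric (Phi y)) a b + (metric (Phi y) *m m) a b + q y * (m^T *m metric (Phi y) *m m) a b)).
    by move=> y _; rewrite [RHS]mxE; congr (_ + _); rewrite [RHS]mxE.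
  have s1 := smooth_mx_mul oW (sc m^T) sg.
  apply: smoothD => //; last by apply: smoothM => //; exact: (smooth_mx_mul oW s1 (sc m)).
  by apply: smoothD => //; exact: (smooth_mx_mul oW sg (sc m)).
have PE y : W y -> forall a b c k, P y a b c k = Phi y a b c k + q y * X y a b c k.
  move=> _ a b c k; transitivity (pull4 1%:M (Phi y) a b c k + q y * X y a b c k); last by rewrite pull4_1.
  rewrite /P !pull4_slots /X /slots.
  rewrite -!S4D -S4Zl -S4D; apply: eq_S4 => p q' r t'; rewrite /M.
  have mE i j : (1%:M + q y *: m) i j = (1%:M : 'M[R]_8) i j + q y * m i j by rewrite [LHS]mxE [X in _ + X]mxE.
  rewrite !mE.
  move: ((1%:M : 'M[R]_8) p a) ((1%:M : 'M[R]_8) q' b) ((1%:M : 'M[R]_8) r c) ((1%:M : 'M[R]_8) t' k) (m p a) (m q' b) (m r c) (m t' k) (Phi y _ _ _ _) (q y) => *; ring.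
have gE y : W y -> forall a b, metric (P y) a b = metric (Phi y) a b + q y * H y a b.
  move=> [Uy qy] a b; rewrite /P metric_pull4; [|exact: he|exact: hPhi.2].
  suff -> : (1%:M + q y *: m)^T *m metric (Phi y) *m (1%:M + q y *: m) = metric (Phi y) + q y *: H y.
    by rewrite [LHS]mxE [X in _ + X]mxE.
  exact: congruence_1Z.
have Px : P x = Phi x by exact: (jet_P0 Wx PE).
have tx : t x = T x by exact: (jet_torsion oW Wx gsym hPhiW hP hTW ht sX sH PE gE).
have hAT : alternating3 (T x) by exact: hT.1.2.
have Hx : H x = A^T *m mat s *m A.
  rewrite /H q0 scale0r addr0 ux; exact: (jet_metric_variation Au al_anti s_sym).
have Xx a b c k : X x a b c k = dot m (Phi x) a b c k.
  by rewrite /X /M q0 scale0r addr0 dot_slots.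
have hdt := jet_dt_alternating oW Wx hTW ht.
have hG j i l a := jet_metric_dchr oW Wx gsym hPhiW hP sH PE gE j i l a.
have hD j i a b c k := jet_conn oW Wx gsym hPhiW hP hTW ht sX sH PE gE j i a b c k.
have key : con_up3 (Phi x) (dform (jet_dt x T t)) =
    A^T *m mat (fun a b => 64 * al a b + 20 * s a b + (\sum_p s p p) * d a b) *m A.
  rewrite ux; apply: (jet_con_up3 Au al_anti al7 s_sym (G := jet_dchr x Phi P)) => //.
    by move=> j i l a; rewrite -ux hG Hx.
  by move=> j i a b c k; rewrite -ux -hD Xx.
exists W, P, t; split.
- by split.
- move=> a b c k; split; first by rewrite Px.
  by move=> i; exact: (jet_P1 oW Wx gsym hPhiW sX PE).
rewrite (field_eq_nablaE oW hP L Wx (ht.1.2 x Wx)) (field_eq_nablaE oU hPhi L Ux hAT) Px tx.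
have -> : field_form L (Phi x) (T x) (ext_d t x) = (fun a b c k => field_form L (Phi x) (T x) (ext_d T x) a b c k
    + 1 * dform (jet_dt x T t) a b c k).
  apply: T4_ext => a b c k; rewrite (jet_ext_d x T t) /field_form.
  move: (wedge_Phi _ _ _ _ _ _) (dot _ _ _ _ _ _) (ext_d _ _ _ _ _ _) (dform _ _ _ _ _) (Phi x a b c k) => *; ring.
have cD := con_up3D A (field_form L (Phi x) (T x) (ext_d T x)) (dform (jet_dt x T t)) 1; rewrite -ux in cD.
rewrite cD scale1r scalerDr key; congr (_ + _).
rewrite -nsE -naE -mulmxDl -mulmxDr scalemxAl scalemxAr; congr (_ *m _ *m _).
have trs : \sum_p s p p = 4 * c0.
  rewrite /s -mulr_sumr big_split /= sumrN -mulr_sumr.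
  have -> : \sum_(p < 8) d p p = 8 by rewrite (eq_bigr (fun=> 1)) ?sumr_const ?card_ord // => p _; rewrite eqxx.
  have -> : \sum_p ns p p = 28 * c0 by rewrite /c0; field.
  by field.
by apply/matrixP => a b; rewrite [LHS]mxE [mat _ a b]mxE [RHS]mxE trs /al /s; field.
Qed.

End JetRealize.

(** * The equations in a chart *)

Section Projections.
Variable R : realType.
Local Notation phi := (Phi0 R).

Lemma con_up3Z (u E : T4 R) (k : R) : con_up3 u (fun a b c e => k * E a b c e) = k *: con_up3 u E.
Proof. by apply/matrixP => a b; rewrite [LHS]mxE [RHS]mxE [X in k * X]mxE -S3Zl; apply: eq_S3 => *; rewrite mulrCA. Qed.

Lemma Lambda4_27_con_up3 (u E : T4 R) : cayley u -> alternating4 E -> Lambda4_27 u E <-> con_up3 u E = 0.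
Proof. by case=> A Au -> hE; exact: (Lambda4_27P Au hE). Qed.

(** If [E] lies in Lambda^4_27 then so does its projection, and the two summands meet in zero by
    [L1_7_35_27]. *)
Lemma proj_1_7_35_eq0 (u E E' : T4 R) : cayley u -> alternating4 E -> proj_1_7_35 u E E' ->
  Lambda4_27 u E <-> forall a b c d, E' a b c d = 0.
Proof.
move=> hu hE [hE' h27]; split=> [h|h0]; last first.
  by move: h27; congr (Lambda4_27 u _); apply: T4_ext => a b c e; rewrite h0 subr0.
have aD := h27.1.
have aE' : alternating4 E'.
  move=> a b c e; have [p1 p2 p3] := hE a b c e; have [q1 q2 q3] := aD a b c e.
  rewrite p1 in q1; rewrite p2 in q2; rewrite p3 in q3.
  by split; [move: q1|move: q2|move: q3]; move: (E a b c e) (E' a b c e) (E' _ _ _ _) => x y z hx; lra.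
have : Lambda4_27 u E'.
  apply/(Lambda4_27_dot hu aE') => N.
  have -> : E' = (fun a b c e => E a b c e + -1 * (E a b c e - E' a b c e)) by apply: T4_ext => *; ring.
  by rewrite wedge44_linr ((Lambda4_27_dot hu hE).1 h N) ((Lambda4_27_dot hu aD).1 h27 N) mulr0 addr0.
by case: hu hE' => A Au -> hE'; exact: (L1_7_35_27 Au hE').
Qed.

Lemma Lambda2_7_asym (u E : T4 R) (k : R) : cayley u -> alternating4 E -> Lambda2_7 u (asym_part (k *: con_up3 u E)).
Proof.
case=> A Au -> hE; rewrite -con_up3Z; apply: (asym_Lambda2_7 Au) => a b c e.
by have [-> -> ->] := hE a b c e; rewrite !mulrN.
Qed.

Lemma asym_partD (N N' : 'M[R]_8) : asym_part (N + N') = asym_part N + asym_part N'.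
Proof. by apply/matrixP => a b; rewrite !mxE; ring. Qed.

Lemma asym_part_anti (N : 'M[R]_8) : N^T = - N -> asym_part N = N.
Proof. by rewrite /asym_part => ->; apply/matrixP => a b; rewrite !mxE; field. Qed.

Lemma Lambda2_7_neq0 (u : T4 R) : cayley u -> exists2 N, Lambda2_7 u N & N != 0.
Proof.
case=> A Au ->; exists (vpick (pi7_space A)); first by apply/(mem_pi7 Au); exact: memv_pick.
by rewrite vpick0; apply/eqP => h; have := dim_pi7 Au; rewrite h dimv0.
Qed.

Lemma velocity_space (u : T4 R) : cayley u -> exists V : {vspace {ffun 'I_8 * 'I_8 * 'I_8 * 'I_8 -> R^o}},
  \dim V = (36 + 7)%N /\ forall v, v \in V <-> exists2 w, cayley_velocity u w & v = tensor4 w.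
Proof.
move=> hu; have [A Au ux] := hu; have [V [dV hV]] := dim_velocities Au; exists V; split=> // v.
split=> [/hV [N ->]|[w hw ->]].
  by exists (dot N u); [have [_ h] := cayley_velocityP (dot N u) hu; apply: h; exists N|rewrite ux].
by apply/hV; have [N ->] := (cayley_velocityP w hu).1 hw; exists N; rewrite ux.
Qed.

End Projections.

Section ChartEquations.
Variables (R : realType) (lam : R) (U : set (pt R)) (oU : open U) (Phi : pt R -> T4 R) (T : pt R -> T3 R).
Hypotheses (hPhi : cayley_on U Phi) (hT : torsion_on U Phi T).

Lemma proj_exists E : form4_on U E -> exists E', forall x, U x -> proj_1_7_35 (Phi x) (E x) (E' x).
Proof.
move=> hE; have ex x : exists e, U x -> proj_1_7_35 (Phi x) (E x) e; last first.
  by have [E' h] := boolp.choice ex; exists E'.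
have [Ux|nU] := pselect (U x); last by exists (fun _ _ _ _ => 0) => /nU.
have [A Au ux] := hPhi.2 x Ux; have [E' h] := proj_1_7_35_exists Au (hE.2 x Ux).
by exists E' => _; rewrite ux.
Qed.

Lemma Lambda4_27_field_eq x : U x ->
  Lambda4_27 (Phi x) (E0 lam Phi T x) <-> field_eq_nabla (lam / 2) Phi T x = 0.
Proof.
move=> Ux; rewrite (field_eq_nablaE oU hPhi _ Ux (hT.1.2 x Ux)).
have h := Lambda4_27_con_up3 (hPhi.2 x Ux) ((form4_E0 lam oU hPhi hT.1).2 x Ux).
split=> [/h e|/eqP]; first by rewrite -[field_form _ _ _ _]/(E0 lam Phi T x) e scaler0.
by rewrite scaler_eq0 invr_eq0 pnatr_eq0 /= => /eqP e; apply/h.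
Qed.

(** The representative [E] is arbitrary up to Lambda^4_27. It is compared with the explicit one,
    [E0], through extremality, which does not depend on the choice. *)
Lemma extremal_field_eq E : variation_Phi lam U Phi T E ->
  (forall x, U x -> Lambda4_27 (Phi x) (E x)) <-> (forall x, U x -> field_eq_nabla (lam / 2) Phi T x = 0).
Proof.
move=> hE; have h1 := extremal_Phi_Lambda4_27 oU hPhi hE.
have h2 := extremal_Phi_Lambda4_27 oU hPhi (variation_E0 lam oU hPhi hT.1).
split=> h.
  by move=> x Ux; apply/(Lambda4_27_field_eq Ux); apply: h2.1 => //; apply/h1.
by apply/h1/h2 => x Ux; apply/(Lambda4_27_field_eq Ux); exact: h.
Qed.

Lemma asym_field_eq_Lambda2_7 x : U x -> Lambda2_7 (Phi x) (asym_part (field_eq_nabla (lam / 2) Phi T x)).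
Proof.
move=> Ux; rewrite (field_eq_nablaE oU hPhi _ Ux (hT.1.2 x Ux)); apply: Lambda2_7_asym; first exact: hPhi.2.
exact: ((form4_E0 lam oU hPhi hT.1).2 x Ux).
Qed.

(** Either the antisymmetric part is nonzero for Phi itself, or [jet_realize] adds a nonzero element
    of Lambda^2_7 to it on a nearby form. *)
Lemma asym_field_eq_nontrivial (L : R) x : U x ->
  exists W P t, cayley_germ U x W P t /\ asym_part (field_eq_nabla L P t x) != 0.
Proof.
move=> Ux; have [h0|h] := eqVneq (asym_part (field_eq_nabla L Phi T x)) 0; last by exists U, Phi, T; split=> //; split.
have [N hN N0] := Lambda2_7_neq0 (hPhi.2 x Ux).
have [W [P [t [hg _ hf]]]] := jet_realize oU hPhi L hT Ux (trmx0 R 8 8) hN.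
by exists W, P, t; rewrite hf asym_partD h0 !add0r asym_part_anti //; exact: hN.1.
Qed.

Lemma independent_field_eq (L : R) x : U x ->
  exists (S A : {vspace 'M[R]_8}),
    [/\ (forall N, N \in S <-> N^T = N) /\ \dim S = 36%N,
        (forall N, N \in A <-> Lambda2_7 (Phi x) N) /\ \dim A = 7%N,
        \dim (S + A)%VS = (36 + 7)%N
      & forall N, N \in (S + A)%VS -> exists W P t, [/\ cayley_germ U x W P t, same_1jet x P Phi
          & field_eq_nabla L P t x = field_eq_nabla L Phi T x + N]].
Proof.
move=> Ux; have [A Au ux] := hPhi.2 x Ux; exists (symm_space R), (pi7_space A); split.
- by split; [exact: mem_symm|exact: dim_symm].
- by rewrite ux; split; [exact: (mem_pi7 Au)|exact: (dim_pi7 Au)].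
- exact: (dim_symm_pi7 Au).
move=> N /memv_addP [Ns hs [Na ha ->]].
apply: (jet_realize oU hPhi L hT Ux); first exact/mem_symm.
by rewrite ux; apply/(mem_pi7 Au).
Qed.

End ChartEquations.

Theorem proposition1p5 (R : realType) (M : manifold8 R) (lam : R)
    (Phi : atlas M -> 'rV[R]_8 -> T4 R) (hPhi : cayley_form Phi) :
  (* the Euler-Lagrange equation of C says that C is the torsion of Phi *)
  (forall C : atlas M -> 'rV[R]_8 -> T3 R, form3 C ->
     ((forall i, extremal_C lam (img i) (Phi i) (C i)) <-> torsion_form Phi C))
  /\
  (forall T : atlas M -> 'rV[R]_8 -> T3 R, torsion_form Phi T ->
   forall i : atlas M,
   (* the Euler-Lagrange equations of Phi at C = T, their projection, and the
      field equations *)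
   [/\ exists E, variation_Phi lam (img i) (Phi i) (T i) E,
       (forall E, variation_Phi lam (img i) (Phi i) (T i) E ->
          [/\ extremal_Phi lam (img i) (Phi i) (T i) <->
                (forall x, img i x -> Lambda4_27 (Phi i x) (E x)),
              exists E', forall x, img i x ->
                proj_1_7_35 (Phi i x) (E x) (E' x)
            & forall E', (forall x, img i x ->
                            proj_1_7_35 (Phi i x) (E x) (E' x)) ->
                ((forall x, img i x -> Lambda4_27 (Phi i x) (E x)) <->
                 (forall x, img i x -> forall a b c d, E' x a b c d = 0)) /\
                ((forall x, img i x -> forall a b c d, E' x a b c d = 0) <->
                 (forall x, img i x ->
                    field_eq_nabla (lam / 2) (Phi i) (T i) x = 0))]),
       (* nabla may be replaced by the partial derivatives *)
       (forall x, img i x -> field_eq_nabla (lam / 2) (Phi i) (T i) x =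
                             field_eq_partial (lam / 2) (Phi i) (T i) x),
       (* the antisymmetric part lies in Lambda^2_7, and is not identically 0 *)
       (forall x, img i x ->
          Lambda2_7 (Phi i x)
            (asym_part (field_eq_nabla (lam / 2) (Phi i) (T i) x)) /\
          exists W P t, cayley_germ (img i) x W P t /\
            asym_part (field_eq_nabla (lam / 2) P t x) != 0)
     & (* there are 36 + 7 = 43 independent second-order equations, as many as
          the dimension of the space of Cayley forms at a point *)
       (forall x, img i x ->
          exists (S A : {vspace 'M[R]_8})
                 (V : {vspace {ffun 'I_8 * 'I_8 * 'I_8 * 'I_8 -> R^o}}),
          [/\ (forall N, N \in S <-> N^T = N) /\ \dim S = 36%N,
              (forall N, N \in A <-> Lambda2_7 (Phi i x) N) /\ \dim A = 7%N,
              \dim (S + A)%VS = (36 + 7)%N,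
              (forall N, N \in (S + A)%VS ->
                 exists W P t, [/\ cayley_germ (img i) x W P t,
                   same_1jet x P (Phi i)
                 & field_eq_nabla (lam / 2) P t x =
                   field_eq_nabla (lam / 2) (Phi i) (T i) x + N])
            & \dim V = (36 + 7)%N /\
              (forall v, v \in V <->
                 exists2 u, cayley_velocity (Phi i x) u & v = tensor4 u)])]).
Proof.
have oI (i : atlas M) : open (img i) by exact: (@Defs.img_open R M i).
have hP (i : atlas M) : cayley_on (img i) (Phi i) by exact: hPhi.2.
split=> [C hC|T hT i].
  split=> [h|[_ h] i]; last exact/(extremal_C_torsion lam (oI i) (hP i) (hC.1 i)).
  by split=> // i; exact/(extremal_C_torsion lam (oI i) (hP i) (hC.1 i)).
have hTi := hT.2 i; split.
- by exists (E0 lam (Phi i) (T i)); exact: (variation_E0 lam (oI i) (hP i) hTi.1).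
- move=> E hE; split.
  + exact: (extremal_Phi_Lambda4_27 (oI i) (hP i) hE).
  + exact: (proj_exists (hP i) hE.1).
  move=> E' hE'.
  have h1 : (forall x, img i x -> Lambda4_27 (Phi i x) (E x)) <-> (forall x, img i x -> forall a b c d, E' x a b c d = 0).
    by split=> h x Ux; apply/(proj_1_7_35_eq0 ((hP i).2 x Ux) (hE.1.2 x Ux) (hE' x Ux)); exact: h.
  split=> //; apply: iff_trans (iff_sym h1) _; exact: (extremal_field_eq (oI i) (hP i) hTi hE).
- move=> x Ux; have aT := hTi.1.2 x Ux.
  by rewrite (field_eq_nablaE (oI i) (hP i) _ Ux aT) (field_eq_partialE (hP i) _ Ux aT).
- move=> x Ux; split; first exact: (asym_field_eq_Lambda2_7 lam (oI i) (hP i) hTi Ux).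
  exact: (asym_field_eq_nontrivial (oI i) (hP i) hTi (lam / 2) Ux).
move=> x Ux; have [S [A [hS hA hSA hN]]] := independent_field_eq (oI i) (hP i) hTi (lam / 2) Ux.
by have [V hV] := velocity_space ((hP i).2 x Ux); exists S, A, V.
Qed.
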